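(* Let $A\in GL_n(\mathbb{R})$, let $k\in W^{1,1}_{\eta_0}(\mathbb{R},M_n(\mathbb{R}))$ for some $\eta_0>0$ with $k(-x)=k(x)$, and let $f\in C^1(\mathcal{V},\mathbb{R}^n)$ on a neighborhood $\mathcal{V}$ of $0\in\mathbb{R}^n$, with $f(0)=0$, $f'(0)=0$. Put $N(u)(x)=f(u(x))$ and $d(\nu)=\det(-\mathbb{I}_n+\widehat k(\nu)A)$. Assume there is $\omega_*>0$ with $d(i\omega_* )=0$, $d'(i\omega_* )\neq0$, and $d(i\omega)\neq0$ for all $\omega\in\mathbb{R}$ with $|\omega|\neq\omega_*$. Then there exist $\delta>0$, a continuous function $\omega:[0,\delta)\to\mathbb{R}$ with $\omega(0)=\omega_*$, and a continuous map $a\in[0,\delta)\mapsto u_c(\cdot;a)\in C^0(\mathbb{R},\mathbb{R}^n)$ with $u_c(y+2\pi;a)=u_c(y;a)$ and $u_c(y;0)=0$, such that all functions $u_c(\omega(a)(\cdot+\tau);a)$ are periodic solutions of $$0=-u+k*(Au+N(u)),$$ and there exists $\varepsilon>0$ such that all solutions $u\in C^0(\mathbb{R},\mathbb{R}^n)$ of this equation with $\|u\|_{C^0}<\varepsilon$ are periodic and given by this family, i.e. $u=u_c(\omega(a)(\cdot+\tau);a)$ for some $a\in[0,\delta)$ and $\tau\in\mathbb{R}$.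
   Context: $C^0(\mathbb{R},\mathbb{R}^n)$ is the space of bounded continuous functions with the supremum norm. $W^{1,1}_{\eta_0}(\mathbb{R},M_n(\mathbb{R}))$ is the space of $k\in W^{1,1}(\mathbb{R},M_n(\mathbb{R}))$ such that all entries of $k e^{\eta_0|\cdot|}$ and $k'e^{\eta_0|\cdot|}$ are in $L^1$. $\widehat k(\nu)=\int_{\mathbb{R}}k(x)e^{-\nu x}\,dx$; $d$ is analytic in a strip around $i\mathbb{R}$. $\mathbb{I}_n$ is the identity matrix. *)

(* Defs.v *)
From HB Require Import structures.
From mathcomp Require Import all_boot all_order all_algebra.
From mathcomp Require Import complex.
From mathcomp Require Import all_classical all_reals all_analysis.

Set Implicit Arguments.
Unset Strict Implicit.
Unset Printing Implicit Defensive.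

Import Order.TTheory GRing.Theory Num.Theory.
Import numFieldNormedType.Exports.

Local Open Scope classical_set_scope.
Local Open Scope complex_scope.
Local Open Scope ring_scope.

(** Conventions: everything is over an arbitrary [R : realType]; vectors of
    R^n are columns ['cV[R]_n] with the (maximum) norm and topology of the
    library.  Maps that are only meaningful on a subset ([f] on [V], [omega]
    and [uc] on [0, delta)) are total functions whose values elsewhere are
    irrelevant. *)

Definition test_function (R : realType) (phi : R -> R) : Prop :=
  (forall (m : nat) (x : R), derivable (derive1n m phi) x 1) /\
  compact (closure [set x | phi x != 0]).

Definition L1_mx (R : realType) (n : nat) (k : R -> 'M[R]_n) : Prop :=
  forall i j : 'I_n,
    (@lebesgue_measure R).-integrable setT (fun x => (k x i j)%:E).

Definition weak_derivative (R : realType) (n : nat) (k k' : R -> 'M[R]_n)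
    : Prop :=
  forall phi : R -> R, test_function phi -> forall i j : 'I_n,
    (\int[@lebesgue_measure R]_x (k x i j * derive1 phi x))%R =
    - (\int[@lebesgue_measure R]_x (k' x i j * phi x))%R.

(** [k] is a (Borel) representative of its almost-everywhere class. *)
Definition W11_eta (R : realType) (n : nat) (eta : R) (k : R -> 'M[R]_n)
    : Prop :=
  L1_mx k /\
  exists k' : R -> 'M[R]_n,
    [/\ weak_derivative k k', L1_mx k',
        L1_mx (fun x => expR (eta * `|x|) *: k x)
      & L1_mx (fun x => expR (eta * `|x|) *: k' x)].

Definition cexp (R : realType) (z : R[i]) : R[i] :=
  (expR (complex.Re z))%:C *
  (cos (complex.Im z) +i* sin (complex.Im z)).

Definition cintegral (R : realType) (g : R -> R[i]) : R[i] :=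
  (\int[@lebesgue_measure R]_x complex.Re (g x))%R +i*
  (\int[@lebesgue_measure R]_x complex.Im (g x))%R.

Definition khat (R : realType) (n : nat) (k : R -> 'M[R]_n) (nu : R[i])
    : 'M[R[i]]_n :=
  \matrix_(i, j) cintegral (fun x => (k x i j)%:C * cexp (- nu * x%:C)).

(** The codomain and domain are the regular module [R[i]^o], so that
    [derive1 (dchar k A)] is the complex derivative. *)
Definition dchar (R : realType) (n : nat) (k : R -> 'M[R]_n) (A : 'M[R]_n)
    (nu : R[i]^o) : R[i]^o :=
  \det (- 1%:M + khat k nu *m map_mx (real_complex R) A).

Definition jac (R : realType) (n : nat) (f : 'cV[R]_n -> 'cV[R]_n)
    (x : 'cV[R]_n) : 'M[R]_n :=
  \matrix_(i, j) ('d f x (delta_mx j 0 : 'cV[R]_n)) i 0.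

(** Meant for open [V]. *)
Definition C1_on (R : realType) (n : nat) (V : set 'cV[R]_n)
    (f : 'cV[R]_n -> 'cV[R]_n) : Prop :=
  forall x, V x -> differentiable f x /\ {for x, continuous (jac f)}.

Definition C0 (R : realType) (n : nat) (u : R -> 'cV[R]_n) : Prop :=
  continuous u /\ [bounded u x | x in [set: R]].

(** The supremum norm; [sup] is only meaningful for bounded [u]. *)
Definition supnorm (R : realType) (n : nat) (u : R -> 'cV[R]_n) : R :=
  sup (range (fun x => `|u x|)).

(** Continuity on [D] of the curve [a |-> uc a] for the distance induced by
    [supnorm]. *)
Definition C0_continuous_on (R : realType) (n : nat) (D : set R)
    (uc : R -> R -> 'cV[R]_n) : Prop :=
  forall a, D a ->
    supnorm (fun y => uc b y - uc a y) @[b --> within D (nbhs a)] --> (0 : R).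

Definition conv (R : realType) (n : nat) (k : R -> 'M[R]_n)
    (v : R -> 'cV[R]_n) (x : R) : 'cV[R]_n :=
  \col_i (\int[@lebesgue_measure R]_y (k (x - y) *m v y) i 0)%R.

Definition superposition (R : realType) (n : nat) (f : 'cV[R]_n -> 'cV[R]_n)
    (u : R -> 'cV[R]_n) : R -> 'cV[R]_n := fun x => f (u x).

(** Since [f] is only given on [V], a solution has to take its values in [V]
    for [f (u x)] to make sense. *)
Definition solution (R : realType) (n : nat) (V : set 'cV[R]_n)
    (k : R -> 'M[R]_n) (A : 'M[R]_n) (f : 'cV[R]_n -> 'cV[R]_n)
    (u : R -> 'cV[R]_n) : Prop :=
  [/\ C0 u, (forall x, V (u x))
    & forall x,
        0 = - u x + conv k (fun y => A *m u y + superposition f u y) x].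

Definition is_periodic (R : realType) (n : nat) (u : R -> 'cV[R]_n) : Prop :=
  exists2 T : R, 0 < T & periodic u T.

(* Main.v *)
Require Import Defs.
From HB Require Import structures.
From mathcomp Require Import all_boot all_order all_algebra perm.
From mathcomp Require Import complex.
From mathcomp Require Import all_classical all_reals all_analysis.
From mathcomp Require Import measurable_realfun.
From mathcomp Require Import ring lra.

Set Implicit Arguments.
Unset Strict Implicit.
Unset Printing Implicit Defensive.
Import Order.TTheory GRing.Theory Num.Theory.
Import numFieldNormedType.Exports.

Local Open Scope classical_set_scope.
Local Open Scope ring_scope.

(** The proof rests on two features of the kernel: [k exp(eta |.|)] is integrable and [k] is
    even.  Evenness makes the Fourier symbol [M(x) = - I + (int k cos(x .)) A] a real matrix, and
    the hypotheses on the dispersion relation say that [M(x)] is invertible except at [x = +- w],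
    where [det M] has simple zeros.  Choose a kernel vector [e] of [M(w)] and a row [l] with
    [l e = 1].

    Removing the resonance.  For even [m] put
    [q(x) = (2 w)^-1 int m(t) sin_+(w (|t| - |x|)) dt], where [sin_+] vanishes on the negative
    half-line.  Two integrations by parts give [q * (p'' + w^2 p) = m * p - p int m cos(w .)]
    ([osctail_convol]).  With [m = k A e] this shows that subtracting the rank-one kernel
    [(1 + w^2) q l] from [k A] divides the determinant of the symbol by
    [(x^2 - w^2) / (1 + x^2)] ([det_fact]): the simple zeros disappear and the regularised
    symbol is invertible at every frequency ([symbol_regkernel_inv]).  Moreover
    [T Lambda = T_reg], where [Lambda g = g - (1 + w^2) s(l g) e] and [s] solves
    [s'' + w^2 s = .], and every function of mild exponential growth is a [Lambda]-image plus a
    combination of [e cos(w .)] and [e sin(w .)], which [T] annihilates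
    ([resonant_splitting]).

    Inverting the regularised operator.  A convolution operator [T] with uniformly invertible
    symbol satisfies [|T v| >= c |v|] in L2.  The relaxation [S = I - theta T^t T] is
    therefore an L2 contraction; it stays one for the weight [exp(- a |x|)] with small [a],
    because weight and convolution commute up to O(a), and also for a norm that mixes the
    weighted L2 norm with a weighted supremum ([relaxop_mixnorm]).  So [T] is bounded
    below on functions growing slower than [exp(a |x|)] ([linop_inverse]).  The L2 step
    compares norms through Fourier transforms, by the fact that a continuous integrable function
    with nonnegative cosine transform is nonnegative at 0 ([cos_positive_at0]).

    The nonlinear equation.  Clamping the argument of [f] to a small box turns [f] into a
    globally Lipschitz map [F] with a small constant, without changing small solutions
    ([cutoff]).  Every solution [v] with mild growth of the linear equation perturbed by a small
    term follows the element of the kernel that has the same two coordinates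
    [c = l v(0)] and [s = l (v(p) - v(-p)) / 2], [p = pi / (2 w)], up to a small relative error
    ([kernel_tracking]).  Applied to differences of solutions, this says that a solution of the
    equation with [F] is determined by its two coordinates, and depends on them in a Lipschitz
    way.  An iteration produces, for every [alpha], an even solution with coordinates
    [(alpha, 0)] ([even_solution_exists]).

    Reflections do the rest.  Along a solution the coordinates of the translates rotate almost
    like [exp(- i w t)].  At a translation where the second coordinate vanishes the reflected
    solution has the same coordinates, hence is the same: the solution is symmetric about that
    point.  The even solution with [alpha > 0] has another such point [tau] near [pi / w], so it
    has period [2 tau] ([esol_period]), and [omega = pi / tau].  An arbitrary small solution also
    has a point of symmetry with nonnegative first coordinate, hence is a translate of an even one
    ([every_solution_in_family]). *)

(** * Lebesgue integrals on the line *)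

(** Integrability and integral over the whole line, sealed below so that rewriting never
    unfolds the measure-theoretic definitions. *)
Definition itg (R : realType) (f : R -> R) :=
  (@lebesgue_measure R).-integrable setT (EFin \o f).
Definition Int (R : realType) (f : R -> R) : R :=
  (\int[@lebesgue_measure R]_x f x)%R.

Section Integral.
Variable R : realType.
Implicit Types f g : R -> R.
Notation mu := (@lebesgue_measure R).

Lemma itg_meas f : itg f -> measurable_fun setT f.
Proof. by move=> /measurable_int /measurable_EFinP. Qed.

Lemma cont_meas f : continuous f -> measurable_fun setT f.
Proof. exact: continuous_measurable_fun. Qed.

Lemma itg_le f g : measurable_fun setT f -> itg g ->
  (forall x, `|f x| <= g x) -> itg f.
Proof.
move=> mf ig fg; apply: (le_integrable measurableT _ _ ig).
  exact/measurable_EFinP.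
move=> x _ /=; rewrite lee_fin (le_trans (fg x))// ler_norm //.
Qed.

Lemma itgD f g : itg f -> itg g -> itg (fun x => f x + g x).
Proof. by move=> hf hg; have := integrableD measurableT hf hg; apply: eq_integrable. Qed.

Lemma itgZ c f : itg f -> itg (fun x => c * f x).
Proof. by move=> hf; have := integrableZl measurableT c hf; apply: eq_integrable. Qed.

Lemma itgZr c f : itg f -> itg (fun x => f x * c).
Proof. by move=> hf; under eq_fun do rewrite mulrC; exact: itgZ. Qed.

Lemma itgN f : itg f -> itg (fun x => - f x).
Proof. by move=> /(itgZ (-1)); under eq_fun do rewrite mulN1r. Qed.

Lemma itgB f g : itg f -> itg g -> itg (fun x => f x - g x).
Proof. by move=> hf hg; apply: itgD => //; exact: itgN. Qed.

Lemma itg0 : itg (fun _ : R => 0 : R).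
Proof. exact: integrable0. Qed.

Lemma itg_sum (J : Type) (s : seq J) (F : J -> R -> R) :
  (forall j, itg (F j)) -> itg (fun x => \sum_(j <- s) F j x).
Proof.
move=> h; elim: s => [|j s IH].
  by under eq_fun do rewrite big_nil; exact: itg0.
by under eq_fun do rewrite big_cons; exact: itgD.
Qed.

Lemma itg_abs f : itg f -> itg (fun x => `|f x|).
Proof. by move=> hf; have := integrable_abse hf; apply: eq_integrable. Qed.

Lemma Int_D f g : itg f -> itg g -> Int (fun x => f x + g x) = Int f + Int g.
Proof. by move=> hf hg; rewrite /Int RintegralD. Qed.

Lemma Int_Z c f : itg f -> Int (fun x => c * f x) = c * Int f.
Proof. by move=> hf; rewrite /Int RintegralZl. Qed.

Lemma Int_Zr c f : itg f -> Int (fun x => f x * c) = Int f * c.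
Proof. by move=> hf; rewrite /Int RintegralZr. Qed.

Lemma Int_N f : itg f -> Int (fun x => - f x) = - Int f.
Proof. by move=> hf; under eq_fun do rewrite -mulN1r; rewrite Int_Z// mulN1r. Qed.

Lemma Int_B f g : itg f -> itg g -> Int (fun x => f x - g x) = Int f - Int g.
Proof. by move=> hf hg; rewrite Int_D ?Int_N//; exact: itgN. Qed.

Lemma Int_0 : Int (fun _ : R => 0 : R) = 0.
Proof. by rewrite /Int /Rintegral integral0. Qed.

Lemma Int_sum (J : Type) (s : seq J) (F : J -> R -> R) :
  (forall j, itg (F j)) -> Int (fun x => \sum_(j <- s) F j x) = \sum_(j <- s) Int (F j).
Proof.
move=> h; elim: s => [|j s IH].
  by under eq_fun do rewrite big_nil; rewrite big_nil Int_0.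
by under eq_fun do rewrite big_cons; rewrite Int_D ?IH ?big_cons//; exact: itg_sum.
Qed.

Lemma Int_ge0 f : (forall x, 0 <= f x) -> 0 <= Int f.
Proof. by move=> h; apply: Rintegral_ge0. Qed.

Lemma Int_le f g : itg f -> itg g -> (forall x, f x <= g x) -> Int f <= Int g.
Proof. by move=> hf hg h; apply: le_Rintegral. Qed.

Lemma Int_abs f : itg f -> `|Int f| <= Int (fun x => `|f x|).
Proof. by move=> hf; apply: le_normr_Rintegral. Qed.

Lemma Int_abs_le f g : itg f -> itg g -> (forall x, `|f x| <= g x) -> `|Int f| <= Int g.
Proof.
by move=> hf hg h; apply: (le_trans (Int_abs hf)); apply: Int_le => //; exact: itg_abs.
Qed.

Lemma eq_Int f g : f =1 g -> Int f = Int g.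
Proof. by move=> /funext ->. Qed.

Lemma ae_Int f g : measurable_fun setT f -> measurable_fun setT g ->
  {ae mu, forall x, f x = g x} -> Int f = Int g.
Proof.
move=> mf mg h; rewrite /Int /Rintegral; congr fine; apply: ae_eq_integral => //.
- exact/measurable_EFinP.
- exact/measurable_EFinP.
- apply: (@filterS _ _ (ae_filter_ringOfSetsType mu)) h => x h _.
  by rewrite h.
Qed.

Lemma ae_itg f g : measurable_fun setT g -> itg f ->
  {ae mu, forall x, f x = g x} -> itg g.
Proof.
move=> mg hf h; have mf := itg_meas hf.
apply/integrableP; split; first exact/measurable_EFinP.
move/integrableP : hf => [_]; apply: le_lt_trans.
rewrite le_eqVlt; apply/orP; left; apply/eqP/ae_eq_integral => //.
- by apply/measurableT_comp => //; exact/measurable_EFinP.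
- by apply/measurableT_comp => //; exact/measurable_EFinP.
- apply: (@filterS _ _ (ae_filter_ringOfSetsType mu)) h => x h _ /=.
  by rewrite h.
Qed.

(** It suffices to check invariance of the measure on half-open intervals, which determine
    Lebesgue measure. *)
Lemma itg_transfer (p : R -> R) f : continuous p ->
  (forall a b : R, mu (p @^-1` `]a, b]%classic) = mu `]a, b]%classic) ->
  itg f -> itg (fun x => f (p x)) /\ Int (fun x => f (p x)) = Int f.
Proof.
move=> cp hp hf.
have mp : measurable_fun [set: measurableTypeR R] (p : _ -> measurableTypeR R).
  exact: cont_meas.
pose phi : {mfun measurableTypeR R >-> measurableTypeR R} :=
  HB.pack (p : measurableTypeR R -> measurableTypeR R) (isMeasurableFun.Build _ _ _ _ _ mp).
have hphi A : measurable A -> pushforward mu phi A = mu A.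
  move=> mA; apply/esym/lebesgue_measure_unique => //= _ [[a b]] _ <-.
  exact/esym/hp.
have tr (g : R -> \bar R) : measurable_fun [set: measurableTypeR R] g ->
    (forall x, 0 <= g x)%E -> (\int[mu]_x g (p x) = \int[mu]_x g x)%E.
  move=> mg g0.
  have := ge0_integral_pushforward (phi := phi) mp mu measurableT mg (fun x _ => g0 x).
  rewrite preimage_setT => <- //.
  by apply: eq_measure_integral => //= A mA _; exact: hphi.
have mf := itg_meas hf.
have mfp : measurable_fun [set: measurableTypeR R] (fun x => f (p x)).
  exact: measurableT_comp.
have [mf0 hfoo] := integrableP _ _ _ hf.
split.
  apply/integrableP; split; first exact/measurable_EFinP.
  rewrite (tr (fun x => `|(EFin \o f) x|%E)) //.
  by apply/measurableT_comp.
rewrite /Int /Rintegral; congr fine.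
rewrite integralE [RHS]integralE; congr (_ - _)%E.
- have <- := tr _ (measurable_funepos mf0) (funepos_ge0 _).
  by apply: eq_integral => x _; rewrite !funeposE.
- have <- := tr _ (measurable_funeneg mf0) (funeneg_ge0 _).
  by apply: eq_integral => x _; rewrite !funenegE.
Qed.

Lemma shift_itv (a u v : R) :
  mu ((+%R a) @^-1` `]u, v]%classic) = mu `]u, v]%classic.
Proof.
rewrite (_ : _ @^-1` _ = `]u - a, v - a]%classic).
  rewrite !lebesgue_measure_itv/= !lte_fin ltrD2r.
  by case: ifP => // _; rewrite -!EFinB; congr EFin; ring.
apply/seteqP; split => x /=; rewrite !in_itv/=.
  by move=> /andP[? ?]; apply/andP; split; lra.
by move=> /andP[? ?]; apply/andP; split; lra.
Qed.

Lemma cont_shift (a : R) : continuous (+%R a).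
Proof. by move=> x; apply: cvgD; [exact: cvg_cst|exact: cvg_id]. Qed.

Lemma itg_shift a f : itg f -> itg (fun x => f (a + x)).
Proof. by move=> hf; have [] := itg_transfer (@cont_shift a) (@shift_itv a) hf. Qed.
Lemma Int_shift a f : itg f -> Int (fun x => f (a + x)) = Int f.
Proof. by move=> hf; have [] := itg_transfer (@cont_shift a) (@shift_itv a) hf. Qed.

Lemma opp_itv (u v : R) : mu (-%R @^-1` `]u, v]%classic) = mu `]u, v]%classic.
Proof.
rewrite opp_preimage_itvbndbnd/= !lebesgue_measure_itv/=.
by rewrite !lte_fin ltrN2 opprK addrC.
Qed.

Lemma cont_opp : continuous (-%R : R -> R).
Proof. by move=> x; apply: cvgN; exact: cvg_id. Qed.

Lemma itg_opp f : itg f -> itg (fun x => f (- x)).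
Proof. by move=> hf; have [] := itg_transfer cont_opp opp_itv hf. Qed.
Lemma Int_opp f : itg f -> Int (fun x => f (- x)) = Int f.
Proof. by move=> hf; have [] := itg_transfer cont_opp opp_itv hf. Qed.

Lemma itg_refl a f : itg f -> itg (fun x => f (a - x)).
Proof. by move=> /(itg_shift a)/itg_opp. Qed.
Lemma Int_refl a f : itg f -> Int (fun x => f (a - x)) = Int f.
Proof. by move=> hf; rewrite (Int_opp (f := fun x => f (a + x))) ?Int_shift//; exact: itg_shift. Qed.

(** Domination by [h] is the Tonelli half: it makes [F] integrable on the plane. *)
Lemma fubini_Int (F : R -> R -> R) (h : R -> R) :
  measurable_fun setT (fun p : measurableTypeR R * measurableTypeR R => F p.1 p.2) ->
  (forall x, itg (F x)) -> itg h -> (forall x, Int (fun y => `|F x y|) <= h x) ->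
  itg (fun y => Int (F ^~ y)) /\ Int (fun x => Int (F x)) = Int (fun y => Int (F ^~ y)).
Proof.
move=> mF iF ih Fh.
have intF : (mu \x mu)%E.-integrable setT (fun p => (F p.1 p.2)%:E).
  apply/integrable12ltyP; first exact/measurable_EFinP.
  move/integrableP : (ih) => [_]; apply: le_lt_trans.
  apply: ge0_le_integral => //.
  - by move=> x _; apply: integral_ge0.
  - have mm : measurable_fun setT (fun p : measurableTypeR R * measurableTypeR R => `|(F p.1 p.2)%:E|%E).
      by apply/measurableT_comp => //; exact/measurable_EFinP.
    exact: (measurable_fun_fubini_tonelli_F (m2 := mu) _ mm).
  - by apply/measurableT_comp => //; apply/measurable_EFinP; exact: itg_meas.
  move=> x _ /=.
  have := Fh x; rewrite /Int /Rintegral -lee_fin fineK.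
    move=> /le_trans -> //; rewrite lee_fin ler_norm //.
  by apply: integrable_fin_num => //; apply: itg_abs.
split.
  have mG := measurable_fubini_G intF.
  have mF' : measurable_fun setT (fun p : measurableTypeR R * measurableTypeR R => (F p.1 p.2)%:E).
    exact: measurable_int intF.
  apply/integrableP; split.
    by apply: (measurable_EFinP _ (fun y => Int (F ^~ y))).2; rewrite /Int /Rintegral; apply: measurableT_comp.
  have fin := (integrable21ltyP mu mu mF').1 intF.
  apply: (le_lt_trans _ fin).
  apply: ge0_le_integral => //.
  - apply/measurableT_comp => //.
    by apply: (measurable_EFinP _ (fun y => Int (F ^~ y))).2; rewrite /Int /Rintegral; apply: measurableT_comp.
  - have mm : measurable_fun setT (fun p : measurableTypeR R * measurableTypeR R => `|(F p.1 p.2)%:E|%E).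
      by apply/measurableT_comp.
    exact: (measurable_fun_fubini_tonelli_G (m1 := mu) _ mm).
  move=> y _ /=.
  apply: le_trans (le_abse_integral mu measurableT (f := fun x => (F x y)%:E) _).
    rewrite /Int /Rintegral; case: (integral _ _ _) => //=; by rewrite normr0 leey.
  apply: (measurableT_comp (f := fun p : measurableTypeR R * measurableTypeR R => (F p.1 p.2)%:E) (g := fun x => (x, y)) mF').
  exact: measurable_pair2.
have := @Fubini _ _ _ _ _ mu mu _ intF.
rewrite /Int /Rintegral => E.
have E1 : (\int[mu]_x (fine (\int[mu]_y (F x y)%:E))%:E)%E = (\int[mu]_x (\int[mu]_y (F x y)%:E))%E.
  by apply: eq_integral => x _; rewrite fineK//; apply: integrable_fin_num => //; exact: iF.
have E2 : (\int[mu]_y (fine (\int[mu]_x (F x y)%:E))%:E)%E = (\int[mu]_y (\int[mu]_x (F x y)%:E))%E.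
  apply: ae_eq_integral; [exact: measurableT|..].
  - by apply: (measurable_EFinP _ (fun y => Int (F ^~ y))).2; rewrite /Int /Rintegral; apply: measurableT_comp => //; exact: measurable_fubini_G intF.
  - exact: measurable_fubini_G intF.
  - apply: (@filterS _ _ (ae_filter_ringOfSetsType mu)) (ae_integrable2 intF) => y iy _.
    by rewrite fineK//; apply: integrable_fin_num.
by rewrite E1 E2 E.
Qed.

Lemma Int_cont (f : R -> R -> R) (x0 d : R) (g : R -> R) : 0 < d ->
  (forall x, `|x - x0| < d -> itg (f x)) ->
  (forall y, continuous (f ^~ y)) -> itg g ->
  (forall x y, `|x - x0| < d -> `|f x y| <= g y) ->
  {for x0, continuous (fun x => Int (f x))}.
Proof.
move=> d0 hf cf ig fg.
have := @continuity_under_integral R _ _ mu f setT measurableT (x0 - d) (x0 + d) _ _ g ig _ x0.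
have key x : `]x0 - d, x0 + d[%classic x -> `|x - x0| < d.
  by rewrite /= in_itv/= => /andP[? ?]; rewrite ltr_distl; apply/andP; split; lra.
apply.
- by move=> x /key; exact: hf.
- by apply: aeW => y _ x _; exact: cf.
- by move=> x /key hx; apply: aeW => y _; exact: fg.
- by apply/mem_set; rewrite /= in_itv/=; apply/andP; split; lra.
Qed.

Lemma Int_dcvg (f : nat -> R -> R) (f0 g : R -> R) :
  (forall n, measurable_fun setT (f n)) -> measurable_fun setT f0 -> itg g ->
  (forall n x, `|f n x| <= g x) -> (forall x, f n x @[n --> \oo] --> f0 x) ->
  Int (f n) @[n --> \oo] --> Int f0.
Proof.
move=> mf mf0 ig fg cf.
have if0 : itg f0.
  apply: (itg_le mf0 ig) => x.
  have : `|f n x| @[n --> \oo] --> `|f0 x| by apply: cvg_norm; exact: cf.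
  by move=> /cvgr_to_le; apply; near=> n; exact: fg.
apply: fine_cvg; rewrite fineK; last by apply: integrable_fin_num.
have mf' n : measurable_fun [set: measurableTypeR R] (fun x => (f n x)%:E).
  exact: (measurable_EFinP _ (f n)).2.
have mf0' : measurable_fun [set: measurableTypeR R] (EFin \o f0).
  exact/measurable_EFinP.
have H := @dominated_convergence _ _ _ mu setT measurableT (fun n x => (f n x)%:E) (EFin \o f0) (EFin \o g) mf' mf0'.
have [|||_ _ Hc] := H; last exact: Hc.
- by apply: aeW => x _; apply: cvg_EFin; [exact: nearW|exact: cf].
- by [].
- by apply: aeW => x n _ /=; rewrite lee_fin.
Unshelve. all: by end_near. Qed.

Lemma eq_itg f g : f =1 g -> itg f -> itg g.
Proof. by move=> /funext ->. Qed.

Lemma itgE f : itg f = (mu.-integrable setT (EFin \o f)).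
Proof. by []. Qed.

Lemma IntE f : Int f = (\int[mu]_x f x)%R.
Proof. by []. Qed.
End Integral.
Global Opaque itg Int.

(** * The Cauchy-Schwarz and Young inequalities *)

Section Young.
Variable R : realType.
Implicit Types f g K p z : R -> R.
Notation mu := (@lebesgue_measure R).

Lemma measM f g : measurable_fun setT f -> measurable_fun setT g ->
  measurable_fun setT (fun x => f x * g x).
Proof. exact: measurable_funM. Qed.

Lemma meas_sqr f : measurable_fun setT f -> measurable_fun setT (fun x => f x ^+ 2).
Proof. by move=> mf; apply: measM. Qed.

Lemma meas_shiftr f (x : R) : measurable_fun setT f -> measurable_fun setT (fun y : R => f (x - y)).
Proof.
move=> mf; apply: measurableT_comp => //; apply: cont_meas => y.
by apply: cvgB; [exact: cvg_cst|exact: cvg_id].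
Qed.

Lemma itgM_bnd f g (B : R) : itg f -> measurable_fun setT g -> (forall x, `|g x| <= B) ->
  itg (fun x => f x * g x).
Proof.
move=> hf mg hB; apply: (itg_le (g := fun x => B * `|f x|)).
- by apply: measM => //; exact: itg_meas.
- by apply: itgZ; exact: itg_abs.
- by move=> x; rewrite normrM mulrC ler_wpM2r.
Qed.

(** The discriminant argument behind Cauchy-Schwarz. *)
Lemma quad_disc (a b c : R) : 0 <= a -> (forall t : R, 0 <= a * t ^+ 2 - 2 * b * t + c) ->
  b ^+ 2 <= a * c.
Proof.
move=> a0 h; have [a0'|] := ltP 0 a.
  have := h (b / a).
  have -> : a * (b / a) ^+ 2 - 2 * b * (b / a) + c = (a * c - b ^+ 2) / a by field; rewrite gt_eqF.
  by rewrite pmulr_lge0 ?invr_gt0// subr_ge0.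
move=> a1; have {a0 a1}a0 : a = 0 by apply/eqP; rewrite eq_le a0 a1.
rewrite a0 mul0r in h *; have [->|b0] := eqVneq b 0; first by rewrite expr0n.
have := h ((c + 1) / (2 * b)); rewrite mul0r.
have -> : 0 - 2 * b * ((c + 1) / (2 * b)) + c = -1 by field; rewrite b0.
lra.
Qed.

Lemma Int_CS f g : measurable_fun setT f -> measurable_fun setT g ->
  itg (fun x => f x ^+ 2) -> itg (fun x => g x ^+ 2) ->
  itg (fun x => f x * g x) /\
  (Int (fun x => f x * g x)) ^+ 2 <= Int (fun x => f x ^+ 2) * Int (fun x => g x ^+ 2).
Proof.
move=> mf mg if2 ig2.
have ifg : itg (fun x => f x * g x).
  apply: (itg_le (g := fun x => f x ^+ 2 + g x ^+ 2)).
  - exact: measM.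
  - exact: itgD.
  - move=> x; rewrite normrM.
    have := sqr_ge0 (`|f x| - `|g x|); rewrite -(real_normK (num_real (f x))) -(real_normK (num_real (g x))); nra.
split => //.
apply: quad_disc; first by apply: Int_ge0 => x; exact: sqr_ge0.
move=> t.
have := @Int_ge0 R (fun x => (t * f x - g x) ^+ 2) (fun x => sqr_ge0 _).
congr (_ <= _).
rewrite (@eq_Int _ _ (fun x => t ^+ 2 * f x ^+ 2 + (- (2 * t)) * (f x * g x) + g x ^+ 2)); last by move=> x; ring.
rewrite !Int_D ?Int_Z//; first (by ring); try exact: itgZ.
by apply: itgD; exact: itgZ.
Qed.

(** Cauchy-Schwarz for the measure [K dy] gives
    [z(x)^2 <= (int K) (int K(y) p(x - y)^2 dy)]; integrate in [x] by Fubini. *)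
Lemma young_L2 K p z (B : R) : (forall y, 0 <= K y) -> itg K ->
  measurable_fun setT p -> (forall y, 0 <= p y) -> (forall y, p y <= B) ->
  itg (fun y => p y ^+ 2) ->
  measurable_fun setT z -> (forall x, `|z x| <= Int (fun y => K y * p (x - y))) ->
  itg (fun x => z x ^+ 2) /\ Int (fun x => z x ^+ 2) <= Int K ^+ 2 * Int (fun y => p y ^+ 2).
Proof.
move=> K0 iK mp p0 pB ip2 mz hz.
have mK := itg_meas iK.
pose F := fun y x => K y * p (x - y) ^+ 2.
have mF : measurable_fun setT (fun q : measurableTypeR R * measurableTypeR R => F q.1 q.2).
  rewrite /F; apply: measurable_funM; first exact: measurableT_comp.
  apply: measurable_funX; apply: measurableT_comp => //.
  by apply: measurable_funB.
have iF y : itg (F y).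
  by apply: itgZ; under eq_fun do rewrite (addrC _ (- y)); exact: (itg_shift (- y) ip2).
have EF y : Int (F y) = K y * Int (fun x => p x ^+ 2).
  rewrite Int_Z; last by under eq_fun do rewrite (addrC _ (- y)); exact: (itg_shift (- y) ip2).
  congr (_ * _); rewrite -(Int_shift (- y) ip2); apply: eq_Int => x.
  by rewrite addrC.
have aF y : Int (fun x => `|F y x|) <= K y * Int (fun x => p x ^+ 2).
  rewrite -EF; apply: Int_le; [exact: itg_abs|exact: iF|].
  by move=> x; rewrite ger0_norm// mulr_ge0// sqr_ge0.
have [iW IW] := fubini_Int mF iF (itgZr (Int (fun x => p x ^+ 2)) iK) aF.
have zW x : z x ^+ 2 <= Int K * Int (F ^~ x).
  have ms : measurable_fun setT (fun y => Num.sqrt (K y)).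
    by apply: measurableT_comp => //; apply: cont_meas; exact: sqrt_continuous.
  have mp' := meas_shiftr x mp.
  have [|||_ h] := @Int_CS (fun y => Num.sqrt (K y)) (fun y => Num.sqrt (K y) * p (x - y)) ms.
  - exact: measM.
  - by apply: eq_itg iK => y; rewrite sqr_sqrtr.
  - have : itg (fun y => K y * p (x - y) ^+ 2).
      apply: (itgM_bnd (B := B ^+ 2) iK).
        exact: meas_sqr mp'.
      move=> y.
      rewrite ger0_norm ?sqr_ge0//.
      rewrite lerXn2r ?nnegrE//.
      exact: le_trans (pB (x - y)).
    by apply: eq_itg => y; rewrite exprMn sqr_sqrtr.
  have E1 : Int (fun y => K y * p (x - y)) = Int (fun y => Num.sqrt (K y) * (Num.sqrt (K y) * p (x - y))).
    by apply: eq_Int => y; rewrite mulrA -expr2 sqr_sqrtr.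
  have E2 : Int K = Int (fun y => Num.sqrt (K y) ^+ 2) by apply: eq_Int => y; rewrite sqr_sqrtr.
  have E3 : Int (F ^~ x) = Int (fun y => (Num.sqrt (K y) * p (x - y)) ^+ 2).
    by apply: eq_Int => y; rewrite exprMn sqr_sqrtr.
  rewrite -E1 -E2 -E3 in h; apply: le_trans h.
  by rewrite -(real_normK (num_real (z x))) lerXn2r ?nnegrE// (le_trans _ (hz x)).
have iz : itg (fun x => z x ^+ 2).
  apply: (itg_le (g := fun x => Int K * Int (F ^~ x))); first exact: meas_sqr.
  - exact: itgZ.
  - by move=> x; rewrite ger0_norm ?sqr_ge0.
split => //.
have /le_trans := Int_le iz (itgZ (Int K) iW) zW; apply.
rewrite Int_Z; last exact: iW.
rewrite -IW.
rewrite (@eq_Int _ (fun y => Int (F y)) (fun y => K y * Int (fun x => p x ^+ 2)) EF).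
by rewrite Int_Zr; [rewrite mulrA -expr2|exact: iK].
Qed.

Lemma young_sup K p : (forall y, 0 <= K y) -> measurable_fun setT K -> itg (fun y => K y ^+ 2) ->
  measurable_fun setT p -> (forall y, 0 <= p y) -> itg (fun y => p y ^+ 2) -> forall x,
  Int (fun y => K y * p (x - y)) <= Num.sqrt (Int (fun y => K y ^+ 2)) * Num.sqrt (Int (fun y => p y ^+ 2)).
Proof.
move=> K0 mK iK mp p0 ip x.
have [_ h] := Int_CS mK (meas_shiftr x mp) iK (itg_refl x ip).
rewrite (Int_refl x ip) in h.
rewrite -sqrtrM; last by apply: Int_ge0 => y; exact: sqr_ge0.
rewrite -[leLHS]ger0_norm; last by apply: Int_ge0 => y; exact: mulr_ge0.
by rewrite -sqrtr_sqr ler_sqrt// mulr_ge0//; apply: Int_ge0 => y; exact: sqr_ge0.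
Qed.

Lemma itg_exp (c : R) : 0 < c -> itg (fun x : R => expR (- (c * `|x|))).
Proof.
move=> c0.
have ip : itg (exponential_pdf c) by rewrite itgE; exact: integrable_exponential_pdf.
apply: (itg_le (g := fun x => c^-1 * (exponential_pdf c x + exponential_pdf c (- x)))).
- apply: cont_meas => x; apply: (continuous_comp (f := fun x => - (c * `|x|))).
    by apply: cvgN; apply: cvgM; [exact: cvg_cst|exact: norm_continuous].
  exact: continuous_expR.
- by apply: itgZ; apply: itgD => //; exact: (itg_opp (f := exponential_pdf c)).
- move=> x; rewrite ger0_norm ?expR_ge0//.
  have p0 y : 0 <= exponential_pdf c y by apply: exponential_pdf_ge0; exact: ltW.
  have pE (y : R) : 0 <= y -> exponential_pdf c y = c * expR (- (c * y)).
    by move=> y0; rewrite exponential_pdfE// mulNr.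
  rewrite ler_pdivlMl//.
  have [x0|x0] := leP 0 x.
    by rewrite ger0_norm// pE// lerDl.
  by rewrite ltr0_norm// (pE (- x)) ?lerDr// oppr_ge0 ltW.
Qed.
End Young.

(** * Segments and primitives *)

Definition ind (R : realType) (a b x : R) : R := ((a <= x) && (x <= b))%:R.
(** The primitive vanishing at 0; one of the two integrals is zero off the origin. *)
Definition prim (R : realType) (g : R -> R) (x : R) : R :=
  Int (fun y => ind 0 x y * g y) - Int (fun y => ind x 0 y * g y).

(** [f] is the derivative of [F] on the whole line. *)
Definition D1 (R : realType) (F f : R -> R) : Prop := forall x, is_derive x (1:R) F (f x).

Section Calculus.
Variable R : realType.
Implicit Types f g F : R -> R.
Notation mu := (@lebesgue_measure R).

Lemma ind_ge0 (a b x : R) : 0 <= ind a b x.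
Proof. by rewrite /ind ler0n. Qed.
Lemma ind_le1 (a b x : R) : ind a b x <= 1.
Proof. by rewrite /ind; case: (_ && _). Qed.

Lemma ind_restrict f a b : (fun x => ind a b x * f x) = f \_ `[a, b].
Proof.
apply/funext => x; rewrite /ind patchE mem_setE in_itv/=.
by case: ifP => _; rewrite ?mul1r ?mul0r.
Qed.

Lemma Int_seg f a b : Int (fun x => ind a b x * f x) = (\int[mu]_(x in `[a, b]) f x)%R.
Proof. by rewrite ind_restrict IntE -Rintegral_mkcond. Qed.

Lemma itg_segE f a b : itg (fun x => ind a b x * f x) <-> mu.-integrable `[a, b] (EFin \o f).
Proof.
rewrite ind_restrict itgE -restrict_EFin.
have := integrable_restrict mu (measurable_itv `[a, b]) measurableT (EFin \o f).
by rewrite setTI => h; split => [/h|/h].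
Qed.

Lemma itg_seg f a b : continuous f -> itg (fun x => ind a b x * f x).
Proof.
move=> cf; apply/itg_segE; apply: continuous_compact_integrable => //; first exact: segment_compact.
exact: continuous_subspaceT.
Qed.

Lemma is_derive_cont F f : D1 F f -> continuous F.
Proof.
by move=> h x; apply: differentiable_continuous; apply/derivable1_diffP; have := h x => ?; exact: ex_derive.
Qed.

Lemma FTC_seg F f a b : a <= b -> D1 F f -> continuous f ->
  Int (fun x => ind a b x * f x) = F b - F a.
Proof.
move=> ab dF cf; rewrite Int_seg.
move: ab; rewrite le_eqVlt => /predU1P[<-|ab].
  by rewrite subrr set_itv1 Rintegral_set1.
rewrite /Rintegral (@continuous_FTC2 _ f F a b ab) //.
- exact: continuous_subspaceT.
- have cF := is_derive_cont dF; split.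
  + by move=> x _; have := dF x => ?; exact: ex_derive.
  + by apply: cvg_at_right_filter; exact: cF.
  + by apply: cvg_at_left_filter; exact: cF.
- by move=> x _; have := dF x => ?; rewrite derive1E derive_val.
Qed.

Lemma seg_split f a b c : a <= b -> b <= c -> continuous f ->
  Int (fun x => ind a c x * f x) = Int (fun x => ind a b x * f x) + Int (fun x => ind b c x * f x).
Proof.
move=> ab bc cf.
have := @Rintegral_itvB R f (BLeft a) (BRight c) b ((itg_segE f a c).1 (itg_seg a c cf)) ab bc.
rewrite !Int_seg => /eqP; rewrite subr_eq => /eqP ->.
rewrite addrC; congr (_ + _).
rewrite Rintegral_itv_obnd_cbnd //.
have := (itg_segE f b c).1 (itg_seg b c cf).
by apply: integrableS => //; exact: subset_itv_oc_cc.
Qed.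

Lemma seg_point f a : Int (fun x => ind a a x * f x) = 0.
Proof. by rewrite Int_seg set_itv1 Rintegral_set1. Qed.

Lemma seg_empty f a b : b < a -> Int (fun x => ind a b x * f x) = 0.
Proof.
move=> ba; rewrite -[RHS](Int_0 R); apply: eq_Int => x; rewrite /ind.
case: (leP a x) => ax /=; last by rewrite mul0r.
by rewrite leNgt (lt_le_trans ba ax) /= mul0r.
Qed.

Lemma prim0 g : prim g 0 = 0.
Proof. by rewrite /prim seg_point subrr. Qed.

Lemma prim_diff g a x : continuous g -> a <= 0 -> a <= x ->
  prim g x = Int (fun y => ind a x y * g y) - Int (fun y => ind a 0 y * g y).
Proof.
move=> cg a0 ax; rewrite /prim; have [x0|x0] := leP 0 x.
  rewrite (seg_split a0 x0 cg).
  have -> : Int (fun y => ind x 0 y * g y) = 0.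
    by move: x0; rewrite le_eqVlt => /predU1P[<-|/seg_empty->//]; rewrite seg_point.
  ring.
by rewrite (seg_empty _ x0) (seg_split ax (ltW x0) cg); ring.
Qed.

Lemma prim_derive g : continuous g -> D1 (prim g) g.
Proof.
move=> cg x.
pose a := - (`|x| + 1); pose u := `|x| + 1.
have xa : a < x by rewrite /a; have := ler_norm (- x); rewrite normrN; lra.
have xu : x < u by rewrite /u; have := ler_norm x; lra.
have a0 : a < 0 by rewrite /a; have := normr_ge0 x; lra.
have [d1 d2] := continuous_FTC1_closed xu ((itg_segE g a u).1 (itg_seg a u cg)) xa (cg x).
pose F y := (\int[mu]_(t in `[a, y]) g t)%R - Int (fun y => ind a 0 y * g y).
have dF : is_derive x (1:R) F (g x).
  rewrite -[g x]subr0; apply: is_deriveB.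
  by apply: DeriveDef; [exact: d1|rewrite -derive1E d2].
apply: (near_eq_is_derive (f := F)) => //.
near=> y; rewrite /F -Int_seg (prim_diff cg (ltW a0)) //.
by apply: ltW; near: y; exact: lt_nbhsr.
Unshelve. all: by end_near. Qed.

Lemma prim_seg g x y : continuous g -> x <= y -> Int (fun t => ind x y t * g t) = prim g y - prim g x.
Proof. by move=> cg xy; rewrite (FTC_seg xy (prim_derive cg) cg). Qed.

Lemma prim_cont g : continuous g -> continuous (prim g).
Proof. by move=> cg; exact: is_derive_cont (prim_derive cg). Qed.

Lemma ind_opp (a b x : R) : ind a b (- x) = ind (- b) (- a) x.
Proof. by rewrite /ind lerNl lerNr andbC. Qed.

Lemma prim_even g : continuous g -> (forall x, g (- x) = g x) -> forall x, prim g (- x) = - prim g x.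
Proof.
move=> cg eg x; rewrite /prim opprB.
rewrite -(Int_opp (itg_seg 0 (- x) cg)) -(Int_opp (itg_seg (- x) 0 cg)).
by congr (_ - _); apply: eq_Int => y; rewrite eg ind_opp oppr0 opprK.
Qed.

Lemma prim_odd g : continuous g -> (forall x, g (- x) = - g x) -> forall x, prim g (- x) = prim g x.
Proof.
move=> cg eg x; rewrite /prim.
rewrite -(Int_opp (itg_seg 0 (- x) cg)) -(Int_opp (itg_seg (- x) 0 cg)).
have E a b : Int (fun y => ind a b (- y) * g (- y)) = - Int (fun y => ind (- b) (- a) y * g y).
  rewrite -Int_N; last exact: itg_seg.
  by apply: eq_Int => y; rewrite eg ind_opp mulrN.
by rewrite !E oppr0 opprK opprK addrC.
Qed.
End Calculus.

(** * Rules for continuity and differentiation *)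

(** Folded continuity, a form of hypothesis that the tactic [cont] below can recognise. *)
Definition contf (R : realType) (f : R -> R) : Prop := continuous f.

Section Cont.
Variable R : realType.
Implicit Types f g : R -> R.
Lemma cont_cst (c : R) : continuous (fun _ : R => c). Proof. by move=> x; exact: cvg_cst. Qed.
Lemma cont_id : continuous (fun x : R => x). Proof. by move=> x; exact: cvg_id. Qed.
Lemma cont_add f g : continuous f -> continuous g -> continuous (fun x => f x + g x).
Proof. by move=> hf hg x; apply: cvgD; [exact: hf|exact: hg]. Qed.
Lemma cont_neg f : continuous f -> continuous (fun x => - f x).
Proof. by move=> hf x; apply: cvgN; exact: hf. Qed.
Lemma cont_mul f g : continuous f -> continuous g -> continuous (fun x => f x * g x).
Proof. by move=> hf hg x; apply: cvgM; [exact: hf|exact: hg]. Qed.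
Lemma cont_exp_nat f n : continuous f -> continuous (fun x => f x ^+ n).
Proof.
by move=> hf; elim: n => [|n IH]; [exact: cont_cst|under eq_fun do rewrite exprS; exact: cont_mul].
Qed.
Lemma cont_abs f : continuous f -> continuous (fun x => `|f x|).
Proof. by move=> hf x; apply: cvg_norm; exact: hf. Qed.
Lemma cont_cmp f g : continuous f -> continuous g -> continuous (fun x => f (g x)).
Proof. by move=> hf hg x; apply: continuous_comp; [exact: hg|exact: hf]. Qed.
Lemma cont_sinf f : continuous f -> continuous (fun x => sin (f x)).
Proof. by move=> hf; exact: (cont_cmp (@continuous_sin R) hf). Qed.
Lemma cont_cosf f : continuous f -> continuous (fun x => cos (f x)).
Proof. by move=> hf; exact: (cont_cmp (@continuous_cos R) hf). Qed.
Lemma cont_expf f : continuous f -> continuous (fun x => expR (f x)).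
Proof. by move=> hf; exact: (cont_cmp (@continuous_expR R) hf). Qed.
Lemma cont_sum (J : Type) (s : seq J) (F : J -> R -> R) :
  (forall j, continuous (F j)) -> continuous (fun x => \sum_(j <- s) F j x).
Proof.
move=> h; elim: s => [|j s IH].
  by under eq_fun do rewrite big_nil; exact: cont_cst.
by under eq_fun do rewrite big_cons; exact: cont_add.
Qed.
Lemma cont_mulc (c : R) : continuous ( *%R c).
Proof. exact: (cont_mul (@cont_cst c) cont_id). Qed.
Lemma cont_addc (c : R) : continuous (+%R c).
Proof. exact: (cont_add (@cont_cst c) cont_id). Qed.
Lemma contf_eq f g : f =1 g -> contf f -> contf g.
Proof. by move=> /funext ->. Qed.
End Cont.

Ltac cont1 := match goal with
  | |- continuous (fun x => x) => exact: cont_id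
  | |- continuous (fun x => (_ + _)%R) => apply: cont_add
  | |- continuous (fun x => (- _)%R) => apply: cont_neg
  | |- continuous (fun x => (_ * _)%R) => apply: cont_mul
  | |- continuous (fun x => (_ ^+ _)%R) => apply: cont_exp_nat
  | |- continuous (fun x => `|_|%R) => apply: cont_abs
  | |- continuous (fun x => sin _) => apply: cont_sinf
  | |- continuous (fun x => cos _) => apply: cont_cosf
  | |- continuous (fun x => expR _) => apply: cont_expf
  | |- continuous (fun x => \sum_(j <- _) _) => apply: cont_sum => ?
  | |- continuous (fun _ => ?c) => exact: cont_cst
  | |- continuous ( *%R _) => exact: cont_mulc
  | |- continuous (+%R _) => exact: cont_addc
  | |- continuous (-%R) => exact: (cont_neg (@cont_id _))
  | |- continuous (@sin _) => exact: continuous_sin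
  | |- continuous (@cos _) => exact: continuous_cos
  | |- continuous (@expR _) => exact: continuous_expR
  | |- continuous Num.norm => exact: (cont_abs (@cont_id _))
  | h : continuous ?f |- continuous ?f => exact: h
  | |- contf _ => rewrite /contf
  | h : contf ?f |- continuous ?f => exact: h
  | h : contf ?f |- continuous (fun x => ?f _) => apply: (cont_cmp h)
  | h : continuous ?f |- continuous (fun x => ?f _) => apply: (cont_cmp h)
  end.
Ltac cont := repeat cont1.

Section Deriv.
Variable R : realType.
Implicit Types f g a b : R -> R.
Lemma D1_comp f g a b : D1 f a -> D1 g b -> D1 (fun y => f (g y)) (fun x => a (g x) * b x).
Proof. by move=> hf hg x; have := is_derive1_comp (hf (g x)) (hg x). Qed.
Lemma D1_mul f g a b : D1 f a -> D1 g b -> D1 (fun y => f y * g y) (fun x => a x * g x + f x * b x).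
Proof.
move=> hf hg x; apply: (@is_derive_eq _ _ _ _ _ _ _ _ (is_deriveM (hf x) (hg x))).
by rewrite /= /GRing.scale /= addrC (mulrC (g x)).
Qed.
Lemma D1_add f g a b : D1 f a -> D1 g b -> D1 (fun y => f y + g y) (fun x => a x + b x).
Proof. by move=> hf hg x; exact: (is_deriveD (hf x) (hg x)). Qed.
Lemma D1_neg f a : D1 f a -> D1 (fun y => - f y) (fun x => - a x).
Proof. by move=> hf x; exact: (is_deriveN (hf x)). Qed.
Lemma D1_cst (c : R) : D1 (fun _ : R => c) (fun _ => 0).
Proof. by move=> x; exact: is_derive_cst. Qed.
Lemma D1_id : D1 (fun y : R => y) (fun _ => 1).
Proof. by move=> x; exact: is_derive_id. Qed.
Lemma D1_sin f a : D1 f a -> D1 (fun y => sin (f y)) (fun x => cos (f x) * a x).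
Proof. by move=> h; apply: (D1_comp (f := @sin R)) => // x; exact: is_derive_sin. Qed.
Lemma D1_cos f a : D1 f a -> D1 (fun y => cos (f y)) (fun x => - sin (f x) * a x).
Proof. by move=> h; apply: (D1_comp (f := @cos R) (a := fun x => - sin x)) => // x; exact: is_derive_cos. Qed.
Lemma D1_exp f a : D1 f a -> D1 (fun y => expR (f y)) (fun x => expR (f x) * a x).
Proof. by move=> h; apply: (D1_comp (f := @expR R)) => // x; exact: is_derive_expR. Qed.
Lemma D1_eq f a b : D1 f a -> a =1 b -> D1 f b.
Proof. by move=> h /funext <-. Qed.
End Deriv.

Ltac der1 := match goal with
  | |- D1 (fun x => x) _ => apply: D1_id
  | |- D1 (fun x => (_ + _)%R) _ => apply: D1_add
  | |- D1 (fun x => (- _)%R) _ => apply: D1_neg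
  | |- D1 (fun x => (_ * _)%R) _ => apply: D1_mul
  | |- D1 (fun x => sin _) _ => apply: D1_sin
  | |- D1 (fun x => cos _) _ => apply: D1_cos
  | |- D1 (fun x => expR _) _ => apply: D1_exp
  | |- D1 (fun _ => ?c) _ => apply: D1_cst
  | |- D1 ( *%R ?c) _ => apply: (D1_mul (D1_cst c) (@D1_id _))
  | |- D1 (+%R ?c) _ => apply: (D1_add (D1_cst c) (@D1_id _))
  | |- D1 (-%R) _ => apply: (D1_neg (@D1_id _))
  | |- D1 (@sin _) _ => apply: (D1_sin (@D1_id _))
  | |- D1 (@cos _) _ => apply: (D1_cos (@D1_id _))
  | |- D1 (@expR _) _ => apply: (D1_exp (@D1_id _))
  | h : D1 ?f _ |- D1 ?f _ => exact: h
  | h : D1 ?f _ |- D1 (fun x => ?f _) _ => apply: (D1_comp h)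
  end.
Ltac der := repeat der1.

(** * Positivity at the origin from positive cosine transforms *)

Section Fejer.
Variable R : realType.
Notation mu := (@lebesgue_measure R).

(** The Fejer kernel, up to a constant factor: a nonnegative approximate identity of mass
    independent of [N] that is an average of cosines. *)
Definition fejer (N s : R) := Int (fun w => ind 0 N w * ((1 - w / N) * cos (w * s))).

Lemma fejerE (N s : R) : 0 < N -> s != 0 -> fejer N s = (1 - cos (N * s)) / (N * s ^+ 2).
Proof.
move=> N0 s0; have N1 : N != 0 by rewrite gt_eqF.
have dF : D1 (fun w => (1 - w / N) * (sin (w * s) / s) - cos (w * s) / (N * s ^+ 2)) (fun w => (1 - w / N) * cos (w * s)).
  apply: D1_eq; first by der.
  by move=> x /=; field; rewrite ?N1 ?s0.
rewrite /fejer (FTC_seg (ltW N0) dF); last by cont.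
by rewrite !mul0r sin0 cos0 divff//; field; rewrite ?N1 ?s0.
Qed.

Lemma itg_fejer (N s : R) : itg (fun w => ind 0 N w * ((1 - w / N) * cos (w * s))).
Proof. by apply: itg_seg; cont. Qed.

Lemma Int_ind (a b : R) : a <= b -> Int (ind a b) = b - a.
Proof.
move=> ab; rewrite -(FTC_seg ab (@D1_id R)); last exact: cont_cst.
by apply: eq_Int => x; rewrite mulr1.
Qed.

Lemma itg_ind (a b : R) : itg (ind a b).
Proof.
apply: (eq_itg (f := fun x => ind a b x * 1)); first by move=> x; rewrite mulr1.
by apply: itg_seg; exact: cont_cst.
Qed.

Lemma fejer_lower (N s : R) : 0 < N -> `|s| <= N^-1 -> cos 1 * (N / 2) <= fejer N s.
Proof.
move=> N0 hs; have N1 : N != 0 by rewrite gt_eqF.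
have -> : cos 1 * (N / 2) = Int (fun w => ind 0 N w * ((1 - w / N) * cos 1)) :> R.
  have dF : D1 (fun w => (w - w * w / (2 * N)) * cos 1) (fun w => (1 - w / N) * cos 1).
    apply: D1_eq; first by der.
    by move=> x /=; field.
  rewrite (FTC_seg (ltW N0) dF); last by cont.
  by field.
apply: Int_le; [by apply: itg_seg; cont|exact: itg_fejer|].
move=> w; rewrite /ind; have [/andP[w0 wN]|_] := boolP (_ && _); last by rewrite !mul0r.
rewrite !mul1r; apply: ler_wpM2l; first by rewrite subr_ge0 ler_pdivrMr// mul1r.
have ws : `|w * s| <= 1.
  rewrite normrM (ger0_norm w0) -(mulfV N1).
  by apply: ler_pM.
rewrite -(cos_norm (w * s)).
rewrite leNgt ltr_cos ?in_itv/= ?ler01//= -?leNgt//.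
  by apply: (le_trans _ (pi_ge2 R)); rewrite ler1n.
rewrite normr_ge0/=; apply: (le_trans ws).
by apply: (le_trans _ (pi_ge2 R)); rewrite ler1n.
Qed.

Lemma fejer_ge0 (N s : R) : 0 < N -> 0 <= fejer N s.
Proof.
move=> N0; have [->|s0] := eqVneq s 0.
  apply: le_trans (@fejer_lower N 0 N0 _); last by rewrite normr0 invr_ge0 ltW.
  by rewrite mulr_ge0// ?divr_ge0// ?ltW// cos1_gt0.
by rewrite fejerE// divr_ge0 ?subr_ge0 ?cos_le1// mulr_ge0 ?sqr_ge0// ltW.
Qed.

Lemma fejer_upper (N s d : R) : 0 < N -> 0 < d -> d <= `|s| -> fejer N s <= 2 / (N * d ^+ 2).
Proof.
move=> N0 d0 ds; have s0 : s != 0 by rewrite -normr_gt0 (lt_le_trans d0).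
rewrite fejerE//; apply: ler_pM.
- by rewrite subr_ge0 cos_le1.
- by rewrite invr_ge0 mulr_ge0 ?sqr_ge0// ltW.
- by have := cos_geN1 (N * s); lra.
- have s2 : 0 < s ^+ 2 by rewrite exprn_even_gt0.
  have d2 : 0 < d ^+ 2 by rewrite exprn_gt0.
  rewrite lef_pV2; [|by rewrite posrE mulr_gt0|by rewrite posrE mulr_gt0].
  by rewrite ler_pM2l// -(real_normK (num_real s)) lerXn2r ?nnegrE// (ltW d0).
Qed.

(** Integrating [r] against the Fejer kernel averages the cosine transforms of [r], so the
    result is nonnegative.  If [r 0] were negative, the mass of the kernel near 0 would make it
    negative for large [N], since the kernel is O(1/N) away from 0. *)
Lemma cos_positive_at0 (r : R -> R) : itg r -> {for 0, continuous r} ->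
  (forall w, 0 <= Int (fun s => r s * cos (w * s))) -> 0 <= r 0.
Proof.
move=> ir cr hr; rewrite leNgt; apply/negP => r0.
(* By continuity [r < - c] near 0. *)
pose c := - (r 0) / 2; have c0 : 0 < c by rewrite /c; lra.
have [d /= d0 hd] : exists2 d : R, 0 < d & forall s, `|s| < d -> r s < - c.
  have /cvgrPdist_lt /(_ c c0) [d /= d0 hd] := cr.
  exists d => // s sd; have := hd s; rewrite /= sub0r normrN => /(_ sd).
  rewrite ltr_norml => /andP[h _]; rewrite /c in h *; lra.
pose L := Int (fun s => `|r s|).
have L0 : 0 <= L by apply: Int_ge0.
have k0 : 0 < cos 1 :> R by exact: cos1_gt0.
(* The first bound puts the peak [[- 1/N, 1/N]] of the kernel inside [[- d, d]]; the second
   makes the tail, of size [|r|_1 / (N d^2)], smaller than the contribution of the peak. *)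
pose N := Num.max (2 / d) (2 * L / (d ^+ 2 * c * cos 1) + 1).
have Nd : 2 / d <= N by rewrite le_max lexx.
have N0 : 0 < N by apply: lt_le_trans Nd; rewrite divr_gt0.
have NL : 2 * L / (d ^+ 2 * c * cos 1) + 1 <= N by rewrite le_max lexx orbT.
have N1 : N != 0 by rewrite gt_eqF.
have mr := itg_meas ir.
clearbody c N; clear cr r0.
pose F := fun w s => ind 0 N w * (1 - w / N) * (r s * cos (w * s)).
have mcos : measurable_fun setT (fun q : measurableTypeR R * measurableTypeR R => cos (q.1 * q.2)).
  apply: measurableT_comp; first exact: cont_meas (@continuous_cos R).
  by apply: measurable_funM.
have mI : measurable_fun setT (fun w => ind 0 N w * (1 - w / N)).
  by apply: itg_meas; apply: itg_seg; cont.
have mF : measurable_fun setT (fun q : measurableTypeR R * measurableTypeR R => F q.1 q.2).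
  apply: measurable_funM; first exact: (measurableT_comp mI).
  by apply: measurable_funM => //; exact: measurableT_comp.
have irc w : itg (fun s => r s * cos (w * s)).
  have cw : continuous (fun s : R => cos (w * s)).
    by cont.
  by apply: (itgM_bnd (B := 1) ir (cont_meas cw)) => x; exact: cos_max.
have iF w : itg (F w) by apply: itgZ.
have hF w : Int (fun s => `|F w s|) <= ind 0 N w * 1 * L.
  rewrite /L -Int_Z; last exact: itg_abs.
  apply: Int_le; [exact: itg_abs|by apply: itgZ; exact: itg_abs|].
  move=> s; rewrite /F !normrM /ind; have [/andP[w0 wN]|_] := boolP (_ && _); last by rewrite normr0 !mul0r.
  rewrite normr1 !mul1r.
  have a1 : `|1 - w / N| <= 1.
    have : 0 <= w / N by rewrite divr_ge0// ltW.
    have : w / N <= 1 by rewrite ler_pdivrMr// mul1r.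
    by rewrite ler_norml => ? ?; apply/andP; split; lra.
  rewrite -[leRHS]mul1r; apply: ler_pM => //.
  by rewrite -[leRHS]mulr1; apply: ler_pM => //; exact: cos_max.
have ih : itg (fun w => ind 0 N w * 1 * L).
  by apply: itgZr; apply: itg_seg; exact: cont_cst.
have [iG EG] := fubini_Int mF iF ih hF.
have GE s : Int (F ^~ s) = r s * fejer N s.
  rewrite /fejer -Int_Z; last exact: itg_fejer.
  by apply: eq_Int => w; rewrite /F; ring.
have pos : 0 <= Int (fun s => r s * fejer N s).
  rewrite -(@eq_Int _ _ _ GE) -EG; apply: Int_ge0 => w.
  rewrite /F Int_Z//; apply: mulr_ge0 => //.
  rewrite /ind; have [/andP[w0 wN]|_] := boolP (_ && _); last by rewrite mul0r.
  by rewrite mul1r subr_ge0 ler_pdivrMr// mul1r.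
have irf : itg (fun s => r s * fejer N s) by apply: eq_itg iG.
clearbody F; clear mF iF hF ih iG EG GE mcos mI irc.
pose G := fun s => - (c * cos 1 * (N / 2)) * ind (- N^-1) N^-1 s + 2 / (N * d ^+ 2) * `|r s|.
have : Int (fun s => r s * fejer N s) <= Int G.
  apply: Int_le => //.
    by apply: itgD; apply: itgZ; [exact: itg_ind|exact: itg_abs].
  move=> s; rewrite /G; have [ds|sd] := leP d `|s|.
    have -> : ind (- N^-1) N^-1 s = 0.
      rewrite /ind -ler_norml; case: leP => // sN.
      have : N^-1 <= d / 2 by rewrite -[leRHS]invrK lef_pV2 ?posrE ?invr_gt0 ?divr_gt0// invf_div.
      lra.
    rewrite mulr0 add0r mulrC; apply: le_trans (ler_wpM2l (fejer_ge0 s N0) (ler_norm (r s))) _.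
    by apply: ler_wpM2r => //; exact: fejer_upper.
  have rs := hd s sd.
  have f0 := fejer_ge0 s N0.
  have t0 : 0 <= 2 / (N * d ^+ 2) * `|r s| by rewrite mulr_ge0// divr_ge0// mulr_ge0 ?sqr_ge0// ltW.
  rewrite /ind -ler_norml; case: (leP `|s|) => sN; last by rewrite mulr0 add0r; nra.
  have := fejer_lower N0 sN; rewrite mulr1; nra.
apply/negP; rewrite -ltNge.
apply: lt_le_trans pos.
rewrite /G Int_D; [|by apply: itgZ; exact: itg_ind|by apply: itgZ; exact: itg_abs].
rewrite !Int_Z; [|exact: itg_abs|exact: itg_ind].
rewrite Int_ind; last by have h : 0 < N^-1 by [rewrite invr_gt0]; lra.
rewrite -/L.
have -> : - (c * cos 1 * (N / 2)) * (N^-1 - - N^-1) + 2 / (N * d ^+ 2) * L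
  = (2 * L / d ^+ 2 - c * cos 1 * N) / N.
  by field; rewrite N1 gt_eqF.
rewrite pmulr_llt0 ?invr_gt0// subr_lt0.
have q0 : 0 < c * cos 1 by rewrite mulr_gt0.
apply: lt_le_trans (ler_wpM2l (ltW q0) NL).
rewrite mulrDr mulr1.
have -> : c * cos 1 * (2 * L / (d ^+ 2 * c * cos 1)) = 2 * L / d ^+ 2.
  by field; rewrite !gt_eqF.
by rewrite ltrDl.
Qed.
End Fejer.

(** * Comparison of L2 norms through Fourier transforms *)

Section Plancherel.
Variable R : realType.
Implicit Types v : R -> R.
Notation mu := (@lebesgue_measure R).

Definition fc v (w : R) := Int (fun x => v x * cos (w * x)).
Definition fs v (w : R) := Int (fun x => v x * sin (w * x)).
Definition autocorr v (s : R) := Int (fun x => v x * v (x - s)).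

Definition expdecay v := exists C c, 0 < c /\ forall x, `|v x| <= C * expR (- (c * `|x|)).

Lemma expdecay_itg v : continuous v -> expdecay v -> itg v.
Proof.
move=> convol [C [c [c0 h]]]; apply: (itg_le (cont_meas convol) _ h).
by apply: itgZ; exact: itg_exp.
Qed.

Lemma expdecay_bnd v : expdecay v -> exists2 B, 0 <= B & forall x, `|v x| <= B.
Proof.
move=> [C [c [c0 h]]]; exists `|C| => // x; apply: (le_trans (h x)).
apply: (@le_trans _ _ (`|C| * expR (- (c * `|x|)))).
  by apply: ler_wpM2r; rewrite ?expR_ge0// ler_norm.
rewrite -[leRHS]mulr1; apply: ler_wpM2l => //.
by rewrite -expR0 ler_expR oppr_le0 mulr_ge0// ltW.
Qed.

Section One.
Variable v : R -> R.
Hypothesis convol : continuous v.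
Hypothesis dv : expdecay v.

Let iv : itg v. Proof. exact: expdecay_itg. Qed.
Let mv : measurable_fun setT v. Proof. exact: cont_meas. Qed.

Lemma itg_ftc w : itg (fun x => v x * cos (w * x)).
Proof.
have cw : continuous (fun s : R => cos (w * s)) by cont.
by apply: (itgM_bnd (B := 1) iv (cont_meas cw)) => x; exact: cos_max.
Qed.

Lemma itg_fts w : itg (fun x => v x * sin (w * x)).
Proof.
have cw : continuous (fun s : R => sin (w * s)) by cont.
by apply: (itgM_bnd (B := 1) iv (cont_meas cw)) => x; exact: sin_max.
Qed.

Lemma itg_sq : itg (fun x => v x ^+ 2).
Proof.
by have [B B0 hB] := expdecay_bnd dv; exact: (itgM_bnd iv mv hB).
Qed.

(** The transform of [v * v(- .)] is the squared modulus of the transform of [v]; the sine part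
    cancels because [autocorr v] is even. *)
Lemma autocorr_ft w : itg (autocorr v) /\
  Int (fun s => autocorr v s * cos (w * s)) = fc v w ^+ 2 + fs v w ^+ 2.
Proof.
have [B B0 hB] := expdecay_bnd dv.
have key u : itg (fun s => Int (fun x => v x * (v (x - s) * cos (u * s)))) /\
   Int (fun x => Int (fun s => v x * (v (x - s) * cos (u * s)))) =
   Int (fun s => Int (fun x => v x * (v (x - s) * cos (u * s)))).
  apply: (@fubini_Int R (fun x s => v x * (v (x - s) * cos (u * s))) (fun x => `|v x| * Int (fun x => `|v x|))).
  - apply: measurable_funM; first exact: measurableT_comp.
    apply: measurable_funM; first by apply: measurableT_comp => //; exact: measurable_funB.
    apply: (measurableT_comp (f := @cos R)); first exact: cont_meas (@continuous_cos R).
    by apply: measurable_funM.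
  - move=> x; apply: itgZ.
    have cw : continuous (fun s : R => cos (u * s)) by cont.
    by apply: (itgM_bnd (B := 1) (itg_refl x iv) (cont_meas cw)) => y; exact: cos_max.
  - by apply: itgZr; exact: itg_abs.
  - move=> x; rewrite -(Int_refl x (itg_abs iv)) -Int_Z; last exact: itg_refl (itg_abs iv).
    have cw : continuous (fun s : R => cos (u * s)) by cont.
    apply: Int_le.
    + apply: itg_abs; apply: itgZ.
      by apply: (itgM_bnd (B := 1) (itg_refl x iv) (cont_meas cw)) => y; exact: cos_max.
    + by apply: itgZ; exact: itg_refl (itg_abs iv).
    + move=> s; rewrite !normrM; apply: ler_wpM2l => //.
      by rewrite -[leRHS]mulr1; apply: ler_wpM2l => //; exact: cos_max.
split.
  have [h _] := key 0; apply: eq_itg h => s; apply: eq_Int => x.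
  by rewrite mul0r cos0 mulr1.
have [h1 h2] := key w.
rewrite (@eq_Int _ _ (fun s => Int (fun x => v x * (v (x - s) * cos (w * s))))); last first.
  move=> s; rewrite /autocorr -Int_Zr; first by apply: eq_Int => x; rewrite mulrA.
  apply: (itgM_bnd iv (B := B)) => [|x]; last exact: hB.
  have cs : continuous (fun x : R => v (x - s)) by cont.
  exact: cont_meas cs.
rewrite -h2.
rewrite (@eq_Int _ _ (fun x => fc v w * (v x * cos (w * x)) + fs v w * (v x * sin (w * x)))).
  rewrite Int_D; [|exact: itgZ (itg_ftc w)|exact: itgZ (itg_fts w)].
  by rewrite !Int_Z; [rewrite -!expr2|exact: itg_fts|exact: itg_ftc].
move=> x.
have E : Int (fun s => v (x - s) * cos (w * s)) = fc v w * cos (w * x) + fs v w * sin (w * x).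
  have i1 : itg (fun y => v y * cos (w * (x - y))).
    have cw : continuous (fun y : R => cos (w * (x - y))) by cont.
    by apply: (itgM_bnd (B := 1) iv (cont_meas cw)) => y; exact: cos_max.
  rewrite -(@eq_Int _ (fun s => v (x - s) * cos (w * (x - (x - s))))); last first.
    by move=> s; congr (_ * cos (_ * _)); ring.
  rewrite (Int_refl x i1) /fc /fs -!Int_Zr; [|exact: itg_fts|exact: itg_ftc].
  rewrite -Int_D; [|exact: itgZr (itg_ftc w)|exact: itgZr (itg_fts w)].
  by apply: eq_Int => y; rewrite mulrBr cosB; ring.
rewrite Int_Z; first by rewrite E; ring.
have cw : continuous (fun s : R => cos (w * s)) by cont.
by apply: (itgM_bnd (B := 1) (itg_refl x iv) (cont_meas cw)) => y; exact: cos_max.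
Qed.

Lemma autocorr_cont : {for 0, continuous (autocorr v)}.
Proof.
have [B B0 hB] := expdecay_bnd dv.
apply: (@Int_cont R (fun s x => v x * v (x - s)) 0 1 (fun x => `|v x| * B)) => //.
- move=> s _; have cs : continuous (fun x : R => v (x - s)) by cont.
  exact: (itgM_bnd iv (cont_meas cs) (fun x => hB _)).
- by move=> y; cont.
- by apply: itgZr; exact: itg_abs.
- by move=> s x _; rewrite normrM ler_wpM2l.
Qed.
End One.

(** One inequality between squared norms, in place of the Plancherel identity: apply the
    positivity criterion to [Q] times the autocorrelations of [v2] minus those of [v1], whose
    value at 0 is the difference of the two sides. *)
Lemma plancherel_compare (n : nat) (v1 v2 : 'I_n -> R -> R) (Q : R) :
  (forall i, continuous (v1 i)) -> (forall i, continuous (v2 i)) ->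
  (forall i, expdecay (v1 i)) -> (forall i, expdecay (v2 i)) ->
  (forall w, \sum_i (fc (v1 i) w ^+ 2 + fs (v1 i) w ^+ 2) <=
     Q * \sum_i (fc (v2 i) w ^+ 2 + fs (v2 i) w ^+ 2)) ->
  \sum_i Int (fun x => v1 i x ^+ 2) <= Q * \sum_i Int (fun x => v2 i x ^+ 2).
Proof.
move=> c1 c2 d1 d2 h.
(* The positivity criterion is applied to this function at 0. *)
pose r s := Q * \sum_i autocorr (v2 i) s - \sum_i autocorr (v1 i) s.
have ir : itg r.
  apply: itgB; first apply: itgZ; apply: itg_sum => i.
    by have [] := autocorr_ft (c2 i) (d2 i) 0.
  by have [] := autocorr_ft (c1 i) (d1 i) 0.
have a0 v : autocorr v 0 = Int (fun x => v x ^+ 2).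
  by apply: eq_Int => x; rewrite subr0 expr2.
have /(_ ir) := @cos_positive_at0 R r.
rewrite /r; under eq_bigr do rewrite a0; under [X in _ - X]eq_bigr do rewrite a0.
rewrite subr_ge0; apply.
  have cs (v : 'I_n -> R -> R) : (forall i, {for 0, continuous (autocorr (v i))}) ->
      {for 0, continuous (fun s => \sum_i autocorr (v i) s)}.
    move=> hv; rewrite /prop_for /continuous_at.
    elim: (index_enum 'I_n) => [|i s IH].
      by under eq_fun do rewrite big_nil; rewrite big_nil; exact: cvg_cst.
    by under eq_fun do rewrite big_cons; rewrite big_cons; apply: cvgD; [exact: hv|exact: IH].
  apply: cvgB; first apply: cvgM; first exact: cvg_cst.
    by apply: cs => i; exact: autocorr_cont.
  by apply: cs => i; exact: autocorr_cont.
move=> w.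
have ic v : continuous v -> expdecay v -> itg (fun s => autocorr v s * cos (w * s)).
  move=> convol dv; have [ia _] := autocorr_ft convol dv 0.
  have cw : continuous (fun s : R => cos (w * s)) by cont.
  by apply: (itgM_bnd (B := 1) ia (cont_meas cw)) => y; exact: cos_max.
rewrite (@eq_Int _ _ (fun s => Q * (\sum_i autocorr (v2 i) s * cos (w * s)) - \sum_i autocorr (v1 i) s * cos (w * s))); last first.
  by move=> s; rewrite mulrBl -mulrA !mulr_suml.
rewrite Int_B; [|by apply: itgZ; apply: itg_sum => i; exact: ic|by apply: itg_sum => i; exact: ic].
rewrite Int_Z; last by apply: itg_sum => i; exact: ic.
rewrite !Int_sum; [|by move=> i; exact: ic|by move=> i; exact: ic].
rewrite subr_ge0.
under eq_bigr do rewrite (autocorr_ft (c1 _) (d1 _) w).2.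
under [X in _ <= _ * X]eq_bigr do rewrite (autocorr_ft (c2 _) (d2 _) w).2.
exact: h.
Qed.
End Plancherel.

(** * Exponential growth and convolution with even kernels *)

Section Weights.
Variable R : realType.

Lemma wexp_sub (b x y : R) : expR (b * `|x - y|) <= expR (b * `|x|) * expR (`|b| * `|y|).
Proof.
rewrite -expRD ler_expR.
have h1 : `|x| - `|y| <= `|x - y| by exact: lerB_dist.
have h2 : `|x - y| <= `|x| + `|y| by exact: ler_normB.
have y0 := normr_ge0 y.
have [b0|b0] := leP 0 b.
  by rewrite (ger0_norm b0) -mulrDr ler_wpM2l.
by rewrite (ltr0_norm b0); nra.
Qed.

Lemma wexp_sub' (b x y : R) : expR (b * `|x - y|) <= expR (`|b| * `|y|) * expR (b * `|x|).
Proof. by rewrite [leRHS]mulrC wexp_sub. Qed.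

Lemma wexp_mono (a b x : R) : a <= b -> expR (a * `|x|) <= expR (b * `|x|).
Proof. by move=> ab; rewrite ler_expR ler_wpM2r. Qed.

(** From [1 - exp(- y) <= y] and [t <= exp t]. *)
Lemma wexp_lin (a eta x : R) : 0 <= a -> 2 * a <= eta -> 0 < eta ->
  expR (a * `|x|) - 1 <= 2 * a / eta * expR (eta * `|x|).
Proof.
move=> a0 ae e0.
suff key (t : R) : 0 <= t -> expR (a * t) - 1 <= 2 * a / eta * expR (eta * t) by exact: key.
move=> t0.
have h1 : expR (a * t) - 1 <= a * t * expR (a * t).
  have := expR_ge1Dx (- (a * t)); rewrite expRN => h.
  have e1 := expR_gt0 (a * t).
  have := ler_wpM2r (ltW e1) h; rewrite mulVf ?gt_eqF//; lra.
apply: (le_trans h1).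
have h2 : t <= 2 / eta * expR (eta / 2 * t).
  have h := expR_ge1Dx (eta / 2 * t).
  have k0 : 0 <= 2 / eta by rewrite divr_ge0// ltW.
  have := ler_wpM2l k0 h.
  have -> : 2 / eta * (1 + eta / 2 * t) = 2 / eta + t by field; rewrite gt_eqF.
  by apply: le_trans; rewrite lerDr.
have h3 : expR (eta / 2 * t) * expR (a * t) <= expR (eta * t) by rewrite -expRD ler_expR -mulrDl ler_wpM2r//; lra.
have e1 := expR_ge0 (a * t).
have -> : 2 * a / eta = a * (2 / eta) by ring.
rewrite -!mulrA; apply: ler_wpM2l => //.
apply: (@le_trans _ _ (2 / eta * expR (eta / 2 * t) * expR (a * t))).
  exact: ler_wpM2r.
have k0 : 0 <= 2 / eta by rewrite divr_ge0// ltW.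
by rewrite -mulrA [leRHS]mulrA; apply: ler_wpM2l.
Qed.

Lemma cont_wexp (b : R) : continuous (fun x : R => expR (b * `|x|)).
Proof. by cont. Qed.

Lemma quadD (a b t : R) : 0 < t -> (a + b) ^+ 2 <= (1 + t) * a ^+ 2 + (1 + t^-1) * b ^+ 2.
Proof.
move=> t0; rewrite -subr_ge0.
have -> : (1 + t) * a ^+ 2 + (1 + t^-1) * b ^+ 2 - (a + b) ^+ 2 = t^-1 * (t * a - b) ^+ 2.
  by field; rewrite gt_eqF.
by rewrite mulr_ge0 ?sqr_ge0// invr_ge0 ltW.
Qed.

(** Optimising in [t] recovers the triangle inequality; quadratic inequalities with a free
    parameter are easier to integrate than Minkowski inequalities. *)
Lemma sqrt_triangle (Z X Y : R) : 0 <= X -> 0 <= Y ->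
  (forall t, 0 < t -> Z <= (1 + t) * X + (1 + t^-1) * Y) ->
  Num.sqrt Z <= Num.sqrt X + Num.sqrt Y.
Proof.
move=> X0 Y0 h.
suff : Z <= (Num.sqrt X + Num.sqrt Y) ^+ 2.
  move=> /ler_wsqrtr; rewrite sqrtr_sqr ger0_norm// addr_ge0// sqrtr_ge0//.
have [X1|X1] := eqVneq X 0.
  rewrite X1 sqrtr0 add0r sqr_sqrtr//; apply/ler_addgt0Pr => e e0.
  have := h ((Y + 1) / e); rewrite X1 mulr0 add0r => /(_ _)/le_trans; apply; first by rewrite divr_gt0// ltr_wpDl.
  rewrite mulrDl mul1r lerD2l invf_div mulrAC ler_pdivrMr ?ltr_wpDl//.
  by rewrite ler_pM2l// lerDl.
have [Y1|Y1] := eqVneq Y 0.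
  rewrite Y1 sqrtr0 addr0 sqr_sqrtr//; apply/ler_addgt0Pr => e e0.
  have := h (e / (X + 1)); rewrite Y1 mulr0 addr0 => /(_ _)/le_trans; apply; first by rewrite divr_gt0// ltr_wpDl.
  rewrite mulrDl mul1r lerD2l mulrAC ler_pdivrMr ?ltr_wpDl//.
  by rewrite ler_pM2l// lerDl.
have sX : 0 < Num.sqrt X by rewrite sqrtr_gt0 lt_neqAle eq_sym X1.
have sY : 0 < Num.sqrt Y by rewrite sqrtr_gt0 lt_neqAle eq_sym Y1.
apply: (le_trans (h (Num.sqrt Y / Num.sqrt X) (divr_gt0 sY sX))).
move: sX sY; rewrite -[X in _ * X + _](sqr_sqrtr X0) -[X in _ + _ * X](sqr_sqrtr Y0).
move: (Num.sqrt X) (Num.sqrt Y) => p q p0 q0.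
rewrite le_eqVlt; apply/orP; left; apply/eqP.
by field; rewrite !gt_eqF.
Qed.
End Weights.

Definition growth (R : realType) n (b : R) (v : R -> 'cV[R]_n) :=
  (forall i, contf (fun x => v x i 0)) /\
  exists C, forall x i, `|v x i 0| <= C * expR (b * `|x|).
Definition wbound (R : realType) n (b s : R) (v : R -> 'cV[R]_n) :=
  forall x i, `|v x i 0| <= s * expR (b * `|x|).
(** The exponential moment lets convolutions act on growing functions; evenness makes symbols real. *)
Definition ekernel (R : realType) n (eta : R) (K : R -> 'M[R]_n) :=
  (forall i j, itg (fun y => K y i j * expR (eta * `|y|))) /\ forall y, K (- y) = K y.
(** The entrywise l1 norm of the kernel, which dominates every convolution. *)
Definition kabs (R : realType) n (K : R -> 'M[R]_n) (y : R) := \sum_i \sum_j `|K y i j|.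
Definition convol (R : realType) n (K : R -> 'M[R]_n) (v : R -> 'cV[R]_n) (x : R) : 'cV[R]_n :=
  \col_i Int (fun y => (K y *m v (x - y)) i 0).
Definition sqnorm (R : realType) n (v : 'cV[R]_n) : R := \sum_i v i 0 ^+ 2.
(** Squared L2 norm for the weight [exp(- a |x|)]. *)
Definition energy (R : realType) n (a : R) (v : R -> 'cV[R]_n) : R :=
  Int (fun x => sqnorm (expR (- a * `|x|) *: v x)).
Definition kmass (R : realType) n (eta : R) (K : R -> 'M[R]_n) : R :=
  Int (fun y => kabs K y * expR (eta * `|y|)).

Section Conv.
Variables (R : realType) (n : nat) (eta : R).
Hypothesis eta0 : 0 < eta.
Implicit Types (K : R -> 'M[R]_n) (v w : R -> 'cV[R]_n) (a b s : R).

Lemma growth_bd b v : growth b v -> exists2 C, 0 <= C & wbound b C v.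
Proof.
move=> [_ [C h]]; exists `|C| => // x i; apply: (le_trans (h x i)).
by apply: ler_wpM2r; rewrite ?expR_ge0// ler_norm.
Qed.

Lemma growth_mono b b' v : b <= b' -> growth b v -> growth b' v.
Proof.
move=> bb hv; have [C C0 h] := growth_bd hv; split; first by case: hv.
by exists C => x i; apply: (le_trans (h x i)); rewrite ler_wpM2l// wexp_mono.
Qed.

Lemma growth_add b v w : growth b v -> growth b w -> growth b (fun x => v x + w x).
Proof.
move=> [cv' [C h]] [cw' [C' h']]; split.
  move=> i; have ci := cv' i; have ci' := cw' i.
  by apply: (contf_eq (f := fun x => v x i 0 + w x i 0)) => [x|]; [rewrite mxE|cont].
exists (C + C') => x i; rewrite mxE mulrDl.
by apply: (le_trans (ler_normD _ _)); apply: lerD.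
Qed.

Lemma growth_scale b (c : R) v : growth b v -> growth b (fun x => c *: v x).
Proof.
move=> [cv' [C h]]; split.
  move=> i; have ci := cv' i.
  by apply: (contf_eq (f := fun x => c * v x i 0)) => [x|]; [rewrite mxE|cont].
exists (`|c| * C) => x i; rewrite mxE normrM -mulrA.
by apply: ler_wpM2l.
Qed.

Lemma growth_opp b v : growth b v -> growth b (fun x => - v x).
Proof. by move=> /(growth_scale (-1)); under eq_fun do rewrite scaleN1r. Qed.

Lemma growth_sub b v w : growth b v -> growth b w -> growth b (fun x => v x - w x).
Proof. by move=> hv hw; apply: growth_add => //; exact: growth_opp. Qed.

Lemma growth_weight b a v : growth b v -> growth (b - a) (fun x => expR (- a * `|x|) *: v x).
Proof.
move=> [cv' [C h]]; split.
  move=> i; have ci := cv' i.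
  by apply: (contf_eq (f := fun x => expR (- a * `|x|) * v x i 0)) => [x|]; [rewrite mxE|cont].
exists C => x i; rewrite mxE normrM (ger0_norm (expR_ge0 _)) mulrC mulrDl expRD mulrA.
by apply: ler_wpM2r; rewrite ?expR_ge0.
Qed.

Section Kernel.
Variable K : R -> 'M[R]_n.
Hypothesis kK : ekernel eta K.

Lemma ekernel_meas i j : measurable_fun setT (fun y => K y i j).
Proof.
have [h _] := kK; have := itg_meas (h i j).
have mw : measurable_fun setT (fun y : R => expR (- eta * `|y|)).
  by apply: cont_meas; exact: cont_wexp.
move=> /measM => /(_ _ mw); under eq_fun do rewrite -mulrA -expRD mulNr subrr expR0 mulr1.
by [].
Qed.

Lemma ekernel_itgw i j c : c <= eta -> itg (fun y => K y i j * expR (c * `|y|)).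
Proof.
move=> ce; have [h _] := kK; apply: (itg_le _ (itg_abs (h i j))).
  by apply: measM; [exact: ekernel_meas|apply: cont_meas; exact: cont_wexp].
move=> x; rewrite !normrM ler_wpM2l//.
by rewrite !(ger0_norm (expR_ge0 _)) wexp_mono.
Qed.

Lemma kabs_ge0 y : 0 <= kabs K y.
Proof. by apply: sumr_ge0 => i _; apply: sumr_ge0 => j _. Qed.

Lemma kabs_ge y i j : `|K y i j| <= kabs K y.
Proof.
rewrite /kabs (bigD1 i)//= (bigD1 j)//= -addrA lerDl addr_ge0//.
  by apply: sumr_ge0.
by apply: sumr_ge0 => k _; apply: sumr_ge0.
Qed.

Lemma kabs_itgw c : c <= eta -> itg (fun y => kabs K y * expR (c * `|y|)).
Proof.
move=> ce; rewrite /kabs.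
apply: (eq_itg (f := fun y => \sum_i \sum_j `|K y i j * expR (c * `|y|)|)).
  move=> y; rewrite mulr_suml; apply: eq_bigr => i _; rewrite mulr_suml.
  by apply: eq_bigr => j _; rewrite normrM (ger0_norm (expR_ge0 _)).
by apply: itg_sum => i; apply: itg_sum => j; apply: itg_abs; exact: ekernel_itgw.
Qed.

Lemma kabs_itg : itg (kabs K).
Proof.
apply: eq_itg (kabs_itgw (ltW eta0)) => y; by rewrite mul0r expR0 mulr1.
Qed.

Lemma kabs_meas : measurable_fun setT (kabs K).
Proof. exact: itg_meas kabs_itg. Qed.

Lemma kmass_ge0 : 0 <= kmass eta K.
Proof. by apply: Int_ge0 => y; rewrite mulr_ge0 ?kabs_ge0 ?expR_ge0. Qed.

Lemma kmass_mono c : c <= eta -> kmass c K <= kmass eta K.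
Proof.
move=> ce; apply: Int_le; [exact: kabs_itgw|exact: kabs_itgw|].
by move=> y; rewrite ler_wpM2l ?kabs_ge0// wexp_mono.
Qed.

Lemma convol_itg b v x i j : growth b v -> `|b| <= eta ->
  itg (fun y => K y i j * v (x - y) j 0).
Proof.
move=> hv be; have [C C0 h] := growth_bd hv; have [cv' _] := hv.
apply: (itg_le (g := fun y => `|K y i j * expR (`|b| * `|y|)| * (C * expR (b * `|x|)))).
- apply: measM; first exact: ekernel_meas.
  have c1 := cv' j; have c2 : continuous (fun y : R => x - y) by cont.
  exact: cont_meas (cont_cmp c1 c2).
- by apply: itgZr; apply: itg_abs; exact: ekernel_itgw.
- move=> y; rewrite !normrM -mulrA ler_wpM2l// (ger0_norm (expR_ge0 _)).
  by apply: (le_trans (h _ _)); rewrite mulrCA ler_wpM2l// wexp_sub'.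
Qed.

Lemma convol_itg1 b v x i : growth b v -> `|b| <= eta -> itg (fun y => (K y *m v (x - y)) i 0).
Proof.
move=> hv be; apply: (eq_itg (f := fun y => \sum_j K y i j * v (x - y) j 0)).
  by move=> y; rewrite mxE.
by apply: itg_sum => j; exact: convol_itg hv be.
Qed.

Lemma convolE b v x i : growth b v -> `|b| <= eta ->
  convol K v x i 0 = \sum_j Int (fun y => K y i j * v (x - y) j 0).
Proof.
move=> hv be; rewrite mxE -Int_sum; last by move=> j; exact: convol_itg hv be.
by apply: eq_Int => y; rewrite mxE.
Qed.

Lemma convol_dom b v (p : R -> R) x : growth b v -> `|b| <= eta -> (forall y j, `|v y j 0| <= p y) ->
  itg (fun y => kabs K y * p (x - y)) ->
  \sum_i `|convol K v x i 0| <= Int (fun y => kabs K y * p (x - y)).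
Proof.
move=> hv be hp ip.
have ii i j : itg (fun y => `|K y i j * v (x - y) j 0|).
  by apply: itg_abs; exact: convol_itg hv be.
apply: (@le_trans _ _ (Int (fun y => \sum_i \sum_j `|K y i j * v (x - y) j 0|))).
  rewrite Int_sum; last by move=> i; apply: itg_sum.
  apply: ler_sum => i _; rewrite (convolE _ _ hv be) Int_sum//.
  apply: (le_trans (ler_norm_sum _ _ _)); apply: ler_sum => j _.
  by apply: Int_abs; exact: convol_itg hv be.
apply: Int_le => //.
  by apply: itg_sum => i; apply: itg_sum.
move=> y; rewrite /kabs mulr_suml; apply: ler_sum => i _; rewrite mulr_suml.
by apply: ler_sum => j _; rewrite normrM ler_wpM2l.
Qed.

Lemma dom_itg b x c : `|b| <= eta -> itg (fun y => kabs K y * (c * expR (b * `|x - y|))).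
Proof.
move=> be; apply: (itg_le (g := fun y => kabs K y * expR (`|b| * `|y|) * (`|c| * expR (b * `|x|)))).
- apply: measM; first exact: kabs_meas.
  have c2 : continuous (fun y : R => c * expR (b * `|x - y|)) by cont.
  exact: cont_meas c2.
- by apply: itgZr; exact: kabs_itgw.
- move=> y; rewrite normrM (ger0_norm (kabs_ge0 y)) -mulrA ler_wpM2l ?kabs_ge0//.
  by rewrite normrM (ger0_norm (expR_ge0 _)) mulrCA ler_wpM2l// wexp_sub'.
Qed.

Lemma convol_bd b s v : growth b v -> `|b| <= eta -> wbound b s v -> wbound b (kmass eta K * s) (convol K v).
Proof.
move=> hv be hs x i.
have i1 := dom_itg x s be.
have h := convol_dom hv be hs i1.
have h1 : `|convol K v x i 0| <= \sum_i `|convol K v x i 0|.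
  by rewrite (bigD1 i)//= lerDl sumr_ge0.
apply: (le_trans (le_trans h1 h)).
have s0 : 0 <= s.
  have := hs 0 i; rewrite normr0 mulr0 expR0 mulr1; exact: le_trans.
rewrite /kmass -mulrA -Int_Zr; last exact: kabs_itgw.
apply: Int_le => //; first by apply: itgZr; exact: kabs_itgw.
move=> y; rewrite -mulrA ler_wpM2l ?kabs_ge0// mulrCA ler_wpM2l//.
by apply: (le_trans (wexp_sub' _ _ _)); rewrite ler_wpM2r ?expR_ge0// wexp_mono.
Qed.

Lemma convol_growth b v : growth b v -> `|b| <= eta -> growth b (convol K v).
Proof.
move=> hv be; have [C C0 h] := growth_bd hv; split; last first.
  by exists (kmass eta K * C) => x i; exact: convol_bd hv be h x i.
move=> i; rewrite (_ : (fun _ => _) = (fun x => \sum_j Int (fun y => K y i j * v (x - y) j 0))); last first.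
  by apply/funext => x; exact: convolE hv be.
have [cv' _] := hv.
apply: cont_sum => j x0; have cj := cv' j.
apply: (@Int_cont R (fun x y => K y i j * v (x - y) j 0) x0 1
  (fun y => `|K y i j * expR (`|b| * `|y|)| * (C * (expR (b * `|x0|) * expR (`|b| * 1))))) => //.
- by move=> x _; exact: convol_itg hv be.
- move=> y; apply: cont_mul; first exact: cont_cst.
  have c1 := cv' j; have c2 : continuous (fun x : R => x - y) by cont.
  exact: cont_cmp c1 c2.
- by apply: itgZr; apply: itg_abs; exact: ekernel_itgw.
- move=> x y xx; rewrite !normrM -mulrA ler_wpM2l// (ger0_norm (expR_ge0 _)).
  apply: (le_trans (h _ _)); rewrite mulrCA ler_wpM2l//.
  apply: (le_trans (wexp_sub' _ _ _)); rewrite ler_wpM2l ?expR_ge0//.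
  have -> : x = x0 - (x0 - x) by ring.
  apply: (le_trans (wexp_sub _ _ _)); rewrite ler_wpM2l ?expR_ge0// ler_expR ler_wpM2l//.
  by rewrite distrC ltW.
Qed.
End Kernel.
End Conv.

(** * Weighted energies *)

Definition l2 (R : realType) n (v : 'cV[R]_n) : R := Num.sqrt (sqnorm v).

Lemma refl_weight_alg (R : realType) (E p q : R) : 0 <= p -> 0 <= q -> 1 <= E ->
  p <= E * q -> (1 - (E - 1)) * p <= q.
Proof.
move=> p0 q0 E1 h; have [E2|E2] := leP E 2.
  have := ler_wpM2l (_ : 0 <= 2 - E) h; rewrite subr_ge0 => /(_ E2).
  have := mulr_ge0 (sqr_ge0 (E - 1)) q0; lra.
have := mulr_ge0 (_ : 0 <= E - 2) p0; rewrite subr_ge0 => /(_ (ltW E2)); lra.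
Qed.

Section Sqn.
Variables (R : realType) (n : nat).
Implicit Types v w : 'cV[R]_n.

Lemma sqnorm_ge0 v : 0 <= sqnorm v.
Proof. by apply: sumr_ge0 => i _; exact: sqr_ge0. Qed.

Lemma sqnZ c v : sqnorm (c *: v) = c ^+ 2 * sqnorm v.
Proof. by rewrite /sqnorm mulr_sumr; apply: eq_bigr => i _; rewrite mxE exprMn. Qed.

Lemma sqnD v w t : 0 < t -> sqnorm (v + w) <= (1 + t) * sqnorm v + (1 + t^-1) * sqnorm w.
Proof.
move=> t0; rewrite /sqnorm !mulr_sumr -big_split/=; apply: ler_sum => i _.
by rewrite mxE; exact: quadD.
Qed.

Lemma l2_ge0 v : 0 <= l2 v. Proof. exact: sqrtr_ge0. Qed.
Lemma l2sq v : l2 v ^+ 2 = sqnorm v.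
Proof. by rewrite sqr_sqrtr// sqnorm_ge0. Qed.

Lemma l2Z c v : l2 (c *: v) = `|c| * l2 v.
Proof. by rewrite /l2 sqnZ sqrtrM ?sqr_ge0// sqrtr_sqr. Qed.

Lemma l2_coord v i : `|v i 0| <= l2 v.
Proof.
rewrite -sqrtr_sqr; apply: ler_wsqrtr; rewrite /sqnorm (bigD1 i)//= lerDl.
by apply: sumr_ge0 => j _; exact: sqr_ge0.
Qed.

Lemma sqnorm_l1 v : sqnorm v <= (\sum_i `|v i 0|) ^+ 2.
Proof.
rewrite /sqnorm expr2 mulr_suml; apply: ler_sum => i _.
rewrite -(real_normK (num_real (v i 0))) expr2; apply: ler_wpM2l => //.
by rewrite (bigD1 i)//= lerDl sumr_ge0.
Qed.

Lemma l2_l1 v : l2 v <= \sum_i `|v i 0|.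
Proof.
have h : 0 <= \sum_i `|v i 0| by apply: sumr_ge0.
rewrite -[leRHS]ger0_norm// -sqrtr_sqr; apply: ler_wsqrtr; exact: sqnorm_l1.
Qed.

Lemma l1_bnd v (s : R) : (forall i, `|v i 0| <= s) -> \sum_i `|v i 0| <= n%:R * s.
Proof.
move=> h; apply: (@le_trans _ _ (\sum_(i < n) s)); first exact: ler_sum.
by rewrite sumr_const card_ord mulr_natl.
Qed.
End Sqn.

Section L2.
Variables (R : realType) (n : nat) (eta : R).
Hypothesis eta0 : 0 < eta.
Implicit Types (K : R -> 'M[R]_n) (v w z : R -> 'cV[R]_n) (a b s : R).

Definition weighted a v := fun x : R => expR (- a * `|x|) *: v x.

Lemma weighted_growth b a v : growth b v -> growth (b - a) (weighted a v).
Proof. exact: growth_weight. Qed.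

Lemma cont_sqnorm b v : growth b v -> contf (fun x => sqnorm (v x)).
Proof.
by move=> [convol _]; apply: cont_sum => i; have ci := convol i; cont.
Qed.

Lemma cont_l2 b v : growth b v -> contf (fun x => l2 (v x)).
Proof. by move=> /cont_sqnorm h; apply: (cont_cmp (@sqrt_continuous R) h). Qed.

Lemma l2_meas_shift b v x : growth b v -> measurable_fun setT (fun y : R => l2 (v (x - y))).
Proof. by move=> /cont_l2 h; exact: (meas_shiftr x (cont_meas h)). Qed.

Lemma l2_growth b v : growth b v -> exists2 C, 0 <= C & forall x, l2 (v x) <= C * expR (b * `|x|).
Proof.
move=> hv; have [C C0 h] := growth_bd hv; exists (n%:R * C); first by rewrite mulr_ge0.
by move=> x; apply: (le_trans (l2_l1 _)); rewrite -mulrA; apply: l1_bnd => i; exact: h.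
Qed.

Lemma sqnorm_itg0 b v : growth b v -> b < 0 -> itg (fun x => sqnorm (v x)).
Proof.
move=> hv b0; apply: itg_sum => i; have [convol _] := hv; have ci := convol i.
apply: (itg_sq ci); have [C C0 h] := growth_bd hv; exists C, (- b); split; first by rewrite oppr_gt0.
by move=> x; apply: (le_trans (h x i)); rewrite mulNr opprK.
Qed.

Lemma energy_itg b a v : growth b v -> b < a -> itg (fun x => sqnorm (weighted a v x)).
Proof. by move=> hv ba; apply: (sqnorm_itg0 (weighted_growth a hv)); rewrite subr_lt0. Qed.

Lemma energy_ge0 a v : 0 <= energy a v.
Proof. by apply: Int_ge0 => x; exact: sqnorm_ge0. Qed.

Lemma energy_weighted a v : energy a v = energy 0 (weighted a v).
Proof. by apply: eq_Int => x; rewrite oppr0 mul0r expR0 scale1r. Qed.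

Lemma energy0 v : energy 0 v = Int (fun x => sqnorm (v x)).
Proof. by apply: eq_Int => x; rewrite oppr0 mul0r expR0 scale1r. Qed.

Lemma energyZ b a c v : growth b v -> b < a -> energy a (fun x => c *: v x) = c ^+ 2 * energy a v.
Proof.
move=> hv ba; rewrite /energy -Int_Z; last exact: energy_itg hv ba.
by apply: eq_Int => x; rewrite scalerA mulrC -scalerA sqnZ.
Qed.

Lemma energyD b a v w t : growth b v -> growth b w -> b < a -> 0 < t ->
  energy a (fun x => v x + w x) <= (1 + t) * energy a v + (1 + t^-1) * energy a w.
Proof.
move=> hv hw ba t0; have iv := energy_itg hv ba; have iw := energy_itg hw ba.
rewrite /energy -!Int_Z; [|exact: iw|exact: iv].
rewrite -Int_D; [|exact: itgZ iv|exact: itgZ iw].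
apply: Int_le; [exact: energy_itg (growth_add hv hw) ba|by apply: itgD; exact: itgZ|].
by move=> x; rewrite scalerDr; exact: sqnD.
Qed.

Lemma young_vec b a (M0 : R -> R) v z : growth b v -> b < a -> (forall y, 0 <= M0 y) -> itg M0 ->
  (forall i, contf (fun x => z x i 0)) ->
  (forall x, \sum_i `|z x i 0| <= Int (fun y => M0 y * l2 (weighted a v (x - y)))) ->
  Int (fun x => sqnorm (z x)) <= Int M0 ^+ 2 * energy a v.
Proof.
move=> hv ba M00 iM cz hz.
have gw := weighted_growth a hv.
have b0 : b - a < 0 by rewrite subr_lt0.
have [C C0 hC] := l2_growth gw.
have pC y : l2 (weighted a v y) <= C.
  apply: (le_trans (hC y)); rewrite -[leRHS]mulr1 ler_wpM2l// -expR0 ler_expR.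
  by rewrite mulr_le0_ge0// ltW.
have mp : measurable_fun setT (fun y => l2 (weighted a v y)) by apply: cont_meas; exact: cont_l2 gw.
have cs : contf (fun x => \sum_i `|z x i 0|) by apply: cont_sum => i; have ci := cz i; cont.
have ip : itg (fun y => l2 (weighted a v y) ^+ 2).
  by apply: eq_itg (sqnorm_itg0 gw b0) => y; rewrite l2sq.
have hz' x : `| \sum_i `|z x i 0| | <= Int (fun y => M0 y * l2 (weighted a v (x - y))).
  by rewrite ger0_norm// sumr_ge0.
have [iz Iz] := young_L2 M00 iM mp (fun y => l2_ge0 _) pC ip (cont_meas cs) hz'.
have E : Int (fun y => l2 (weighted a v y) ^+ 2) = energy a v by apply: eq_Int => y; rewrite l2sq.
rewrite -E; apply: le_trans Iz.
have csq : contf (fun x => sqnorm (z x)) by apply: cont_sum => i; have ci := cz i; cont.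
apply: Int_le => //; last by move=> x; exact: sqnorm_l1.
apply: (itg_le (cont_meas csq) iz) => x; rewrite ger0_norm ?sqnorm_ge0//; exact: sqnorm_l1.
Qed.

Section K.
Variable K : R -> 'M[R]_n.
Hypothesis kK : ekernel eta K.

Lemma dom_itg2 b (p : R -> R) C x : measurable_fun setT p -> (forall y, 0 <= p y) ->
  (forall y, p y <= C * expR (b * `|y|)) -> `|b| <= eta -> itg (fun y => kabs K y * p (x - y)).
Proof.
move=> mp p0 pC be; apply: (itg_le _ (dom_itg eta0 kK x C be)).
  apply: measM; [exact: kabs_meas eta0 _ kK|exact: meas_shiftr].
by move=> y; rewrite normrM (ger0_norm (kabs_ge0 _ _)) (ger0_norm (p0 _)) ler_wpM2l ?kabs_ge0.
Qed.

Lemma convol_dom2 b v x : growth b v -> `|b| <= eta ->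
  \sum_i `|convol K v x i 0| <= Int (fun y => kabs K y * l2 (v (x - y))).
Proof.
move=> hv be; have [C C0 hC] := l2_growth hv.
apply: (@convol_dom _ _ _ _ kK b v (fun y => l2 (v y)) x hv be (fun y j => l2_coord _ _)).
by apply: (dom_itg2 x _ (fun y => l2_ge0 _) hC be); apply: cont_meas; exact: cont_l2 hv.
Qed.

Lemma l2_weighted_itg b a v x : growth b v -> `|b| <= eta -> 0 <= a -> `|b - a| + a <= eta ->
  itg (fun y => kabs K y * expR (a * `|y|) * l2 (weighted a v (x - y))).
Proof.
move=> hv be a0 bae; have gw := weighted_growth a hv; have [C C0 hC] := l2_growth gw.
apply: (itg_le (g := fun y => kabs K y * expR (eta * `|y|) * (C * expR ((b - a) * `|x|)))).
- apply: measM.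
    apply: measM; first exact: kabs_meas eta0 _ kK.
    by apply: cont_meas; exact: cont_wexp.
  by exact: l2_meas_shift gw.
- by apply: itgZr; exact: kabs_itgw kK _ (lexx _).
- move=> y; rewrite normrM ger0_norm; last by rewrite mulr_ge0 ?kabs_ge0 ?expR_ge0.
  rewrite ger0_norm ?l2_ge0// -!mulrA ler_wpM2l ?kabs_ge0//.
  apply: (@le_trans _ _ (expR (a * `|y|) * (C * (expR (`|b - a| * `|y|) * expR ((b - a) * `|x|))))).
    rewrite ler_wpM2l ?expR_ge0//; apply: (le_trans (hC _)).
    by rewrite ler_wpM2l// wexp_sub'.
  rewrite [leLHS](_ : _ = expR (a * `|y|) * expR (`|b - a| * `|y|) * (C * expR ((b - a) * `|x|))); last by ring.
  rewrite ler_wpM2r ?mulr_ge0 ?expR_ge0// -expRD ler_expR -mulrDl ler_wpM2r//.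
  by rewrite addrC.
Qed.

Lemma weighted_shift a (x y : R) : 0 <= a -> expR (- a * `|x|) <= expR (a * `|y|) * expR (- a * `|x - y|).
Proof.
move=> a0; rewrite -expRD ler_expR; have := ler_wpM2l a0 (ler_normB x y); rewrite !mulNr mulrDr; lra.
Qed.

Lemma l2_wtE a v x : l2 (weighted a v x) = expR (- a * `|x|) * l2 (v x).
Proof. by rewrite l2Z (ger0_norm (expR_ge0 _)). Qed.

Lemma convol_weighted_dom b a v x : growth b v -> `|b| <= eta -> 0 <= a -> `|b - a| + a <= eta ->
  \sum_i `|weighted a (convol K v) x i 0| <= Int (fun y => kabs K y * expR (a * `|y|) * l2 (weighted a v (x - y))).
Proof.
move=> hv be a0 bae.
under eq_bigr do rewrite mxE normrM (ger0_norm (expR_ge0 _)).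
rewrite -mulr_sumr.
have [C C0 hC] := l2_growth hv.
have i1 : itg (fun y => kabs K y * l2 (v (x - y))).
  by apply: (dom_itg2 x _ (fun y => l2_ge0 _) hC be); apply: cont_meas; exact: cont_l2 hv.
apply: (le_trans (ler_wpM2l (expR_ge0 _) (convol_dom2 x hv be))).
rewrite -Int_Z//; apply: Int_le; [exact: itgZ|exact: (l2_weighted_itg x hv be a0 bae)|].
move=> y; rewrite mulrCA -mulrA ler_wpM2l ?kabs_ge0// l2_wtE mulrA ler_wpM2r ?l2_ge0//.
exact: weighted_shift.
Qed.

Lemma convol_energy b a v : growth b v -> `|b| <= eta -> 0 <= a -> b < a -> `|b - a| + a <= eta -> 
  energy a (convol K v) <= kmass eta K ^+ 2 * energy a v.
Proof.
move=> hv be a0 ba bae.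
have ae : a <= eta by apply: le_trans bae; rewrite lerDr.
have gc := weighted_growth a (convol_growth eta0 kK hv be).
have := @young_vec b a (fun y => kabs K y * expR (a * `|y|)) v (weighted a (convol K v)) hv ba.
move=> /(_ _ _ _ _)/le_trans; apply.
- by move=> y; rewrite mulr_ge0 ?kabs_ge0 ?expR_ge0.
- exact: kabs_itgw kK _ ae.
- by case: gc.
- by move=> x; exact: (convol_weighted_dom x hv be a0 bae).
- apply: ler_wpM2r; first exact: energy_ge0.
  rewrite lerXn2r ?nnegrE ?kmass_ge0 ?(kmass_mono kK)//.
Qed.

(** The weight commutes with the convolution up to O(a): on the support of [K(y)] the weights
    at [x] and [x - y] differ by a factor [exp(+- a |y|)]. *)
Definition wcommut a v x := weighted a (convol K v) x - convol K (weighted a v) x.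

Lemma wcommut_growth b a v : growth b v -> `|b| <= eta -> `|b - a| <= eta -> growth (b - a) (wcommut a v).
Proof.
move=> hv be bae; apply: growth_sub.
  exact: (weighted_growth a (convol_growth eta0 kK hv be)).
exact: (convol_growth eta0 kK (weighted_growth a hv) bae).
Qed.

(** The factor [2 a / eta] is [exp(a |y|) - 1] traded against [exp(eta |y|)] by [wexp_lin]. *)
Lemma wcommut_energy b a v : growth b v -> `|b| <= eta -> 0 <= a -> b < a -> 2 * a <= eta -> `|b - a| + a <= eta ->
  energy 0 (wcommut a v) <= (2 * a / eta * kmass eta K) ^+ 2 * energy a v.
Proof.
move=> hv be a0 ba a2e bae; rewrite energy0.
have ae : a <= eta by apply: le_trans bae; rewrite lerDr.
have bae' : `|b - a| <= eta by apply: le_trans bae; rewrite lerDl.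
have gw := weighted_growth a hv.
pose M0 := fun y => kabs K y * (expR (a * `|y|) - 1).
have e1 (y : R) : 0 <= expR (a * `|y|) - 1.
  by rewrite subr_ge0 -[leLHS]expR0 ler_expR mulr_ge0.
have M00 y : 0 <= M0 y by rewrite mulr_ge0 ?kabs_ge0.
have iM0 : itg M0.
  apply: (eq_itg (f := fun y => kabs K y * expR (a * `|y|) - kabs K y)); first by move=> y; rewrite /M0; ring.
  by apply: itgB; [exact: kabs_itgw kK _ ae|exact: kabs_itg eta0 _ kK].
have [cg _] := wcommut_growth hv be bae'.
have := @young_vec b a M0 v (wcommut a v) hv ba M00 iM0 cg.
move=> /(_ _)/le_trans; apply; last first.
  apply: ler_wpM2r; first exact: energy_ge0.
  have h0 : 0 <= Int M0 by exact: Int_ge0.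
  have k0 : 0 <= 2 * a / eta by rewrite divr_ge0 ?mulr_ge0// ltW.
  have k1 : 0 <= 2 * a / eta * kmass eta K by rewrite mulr_ge0// kmass_ge0.
  rewrite lerXn2r ?nnegrE//.
  rewrite -Int_Z; last exact: kabs_itgw kK _ (lexx _).
  apply: Int_le => //; first by apply: itgZ; exact: kabs_itgw kK _ (lexx _).
  by move=> y; rewrite mulrCA ler_wpM2l ?kabs_ge0//; exact: wexp_lin.
move=> x.
have ii i j : itg (fun y => K y i j * v (x - y) j 0) by exact: convol_itg kK _ _ _ _ _ hv be.
have iw i j : itg (fun y => K y i j * weighted a v (x - y) j 0) by exact: convol_itg kK _ _ _ _ _ gw bae'.
have iwl : itg (fun y => M0 y * l2 (weighted a v (x - y))).
  apply: (itg_le _ (l2_weighted_itg x hv be a0 bae)).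
    apply: measM; first exact: itg_meas iM0.
    by exact: l2_meas_shift gw.
  move=> y; rewrite normrM ger0_norm// ger0_norm ?l2_ge0//; apply: ler_wpM2r; rewrite ?l2_ge0//.
  by rewrite /M0 ler_wpM2l ?kabs_ge0// lerBlDr lerDl.
have E i : wcommut a v x i 0 = \sum_j Int (fun y => K y i j * ((expR (- a * `|x|) - expR (- a * `|x - y|)) * v (x - y) j 0)).
  rewrite /wcommut mxE [X in X + _]mxE [X in _ + X]mxE (convolE kK _ _ hv be) (convolE kK _ _ gw bae').
  rewrite mulr_sumr -sumrB; apply: eq_bigr => j _.
  rewrite -Int_Z// -Int_B//; last exact: itgZ.
  by apply: eq_Int => y; rewrite mxE; ring.
have ij i j : itg (fun y => K y i j * ((expR (- a * `|x|) - expR (- a * `|x - y|)) * v (x - y) j 0)).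
  apply: (eq_itg (f := fun y => expR (- a * `|x|) * (K y i j * v (x - y) j 0) - K y i j * weighted a v (x - y) j 0)).
    by move=> y; rewrite mxE; ring.
  by apply: itgB => //; exact: itgZ.
have il i j : itg (fun y => `|K y i j| * ((expR (a * `|y|) - 1) * l2 (weighted a v (x - y)))).
  apply: (itg_le _ iwl).
    apply: measM; first by apply: measurableT_comp => //; exact: ekernel_meas kK _ _.
    apply: measM.
      have c1 : continuous (fun y : R => expR (a * `|y|) - 1) by cont.
      exact: cont_meas c1.
    by exact: l2_meas_shift gw.
  move=> y; rewrite normrM normr_id normrM (ger0_norm (e1 y)) (ger0_norm (l2_ge0 _)) /M0 -mulrA.
  by rewrite ler_wpM2r ?mulr_ge0 ?l2_ge0// kabs_ge.
apply: (@le_trans _ _ (\sum_i \sum_j Int (fun y => `|K y i j| * ((expR (a * `|y|) - 1) * l2 (weighted a v (x - y)))))).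
  apply: ler_sum => i _; rewrite E; apply: (le_trans (ler_norm_sum _ _ _)); apply: ler_sum => j _.
  apply: Int_abs_le => //.
  move=> y; rewrite normrM ler_wpM2l// normrM.
  apply: (@le_trans _ _ ((expR (a * `|y|) - 1) * expR (- a * `|x - y|) * `|v (x - y) j 0|)).
    apply: ler_wpM2r => //; rewrite ler_norml; apply/andP; split.
      rewrite lerNl opprB.
      have := weighted_shift (x - y) (- y) a0; rewrite normrN opprK subrK => h.
      have h2 : expR (- a * `|x|) >= (1 - (expR (a * `|y|) - 1)) * expR (- a * `|x - y|).
        by apply: refl_weight_alg h; rewrite ?expR_ge0// -subr_ge0.
      lra.
    have := weighted_shift x y a0; lra.
  by rewrite -mulrA ler_wpM2l// l2_wtE ler_wpM2l ?expR_ge0// l2_coord.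
under eq_bigr do rewrite -Int_sum//.
rewrite -Int_sum; last by move=> i; exact: itg_sum.
rewrite le_eqVlt; apply/orP; left; apply/eqP; apply: eq_Int => y.
rewrite /M0 /kabs -mulrA mulr_suml; apply: eq_bigr => i _; rewrite mulr_suml.
by apply: eq_bigr.
Qed.
End K.
End L2.

(** * Symbols and the relaxation operator *)

Definition cosft (R : realType) n (K : R -> 'M[R]_n) (w : R) : 'M[R]_n :=
  \matrix_(i, j) Int (fun y => K y i j * cos (w * y)).
(** Cosine transform with a phase: varying [p] gives the real and imaginary parts of the Fourier
    transform without leaving the real numbers. *)
Definition phaseft (R : realType) (v : R -> R) (w p : R) := Int (fun x => v x * cos (w * x - p)).
Definition phaseftv (R : realType) n (v : R -> 'cV[R]_n) (w p : R) : 'cV[R]_n :=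
  \col_i phaseft (fun x => v x i 0) w p.
(** The linear part [v |-> - v + K * v] of the equation. *)
Definition linop (R : realType) n (K : R -> 'M[R]_n) (v : R -> 'cV[R]_n) (x : R) : 'cV[R]_n :=
  - v x + convol K v x.
(** For an even kernel, the kernel of the adjoint convolution operator. *)
Definition trkernel (R : realType) n (K : R -> 'M[R]_n) (y : R) : 'M[R]_n := (K y)^T.
(** Real because the kernels are even. *)
Definition symbol (R : realType) n (K : R -> 'M[R]_n) (w : R) : 'M[R]_n := -1%:M + cosft K w.
(** One gradient step of size [th] for the least-squares problem [linop K v = 0]; it contracts
    as soon as [linop K] is bounded below. *)
Definition relaxop (R : realType) n (K : R -> 'M[R]_n) (th : R) (v : R -> 'cV[R]_n) (x : R) : 'cV[R]_n :=
  v x - th *: linop (trkernel K) (linop K v) x.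

Section Symbol.
Variable R : realType.

Lemma Int_odd (f : R -> R) : itg f -> (forall x, f (- x) = - f x) -> Int f = 0.
Proof.
move=> fi fo; have := Int_opp fi; rewrite (eq_Int (g := fun x => - f x) fo) Int_N//.
lra.
Qed.

Lemma itg_cosp (v : R -> R) w p : itg v -> itg (fun x => v x * cos (w * x - p)).
Proof.
move=> iv; have cw : continuous (fun x : R => cos (w * x - p)) by cont.
by apply: (itgM_bnd (B := 1) iv (cont_meas cw)) => y; exact: cos_max.
Qed.

Lemma itg_sinp (v : R -> R) w p : itg v -> itg (fun x => v x * sin (w * x - p)).
Proof.
move=> iv; have cw : continuous (fun x : R => sin (w * x - p)) by cont.
by apply: (itgM_bnd (B := 1) iv (cont_meas cw)) => y; exact: sin_max.
Qed.

(** Fubini, and evenness of [k] to discard the sine part of its transform. *)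
Lemma conv_phaseft (k v : R -> R) w p : itg k -> (forall y, k (- y) = k y) -> contf v -> itg v ->
  itg (fun x => Int (fun y => k y * v (x - y))) ->
  (forall x, itg (fun y => k y * v (x - y))) ->
  phaseft (fun x => Int (fun y => k y * v (x - y))) w p = Int (fun y => k y * cos (w * y)) * phaseft v w p.
Proof.
move=> ik ek convol iv icv iy.
have mk := itg_meas ik; have mv := itg_meas iv.
have cc : continuous (fun x : R => cos (w * x - p)) by cont.
pose F y x := k y * (v (x - y) * cos (w * x - p)).
have ivs y : itg (fun x => v (x - y)) by apply: eq_itg (itg_shift (- y) iv) => x; rewrite addrC.
have iF y : itg (F y) by apply: itgZ; exact: itg_cosp.
have mF : measurable_fun setT (fun q : measurableTypeR R * measurableTypeR R => F q.1 q.2).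
  apply: measurable_funM; first exact: measurableT_comp.
  apply: measurable_funM; first by apply: measurableT_comp => //; exact: measurable_funB.
  by apply: (measurableT_comp (f := fun x : R => cos (w * x - p))) => //; exact: cont_meas cc.
have hF y : Int (fun x => `|F y x|) <= `|k y| * Int (fun x => `|v x|).
  have e : Int (fun x => `|v x|) = Int (fun x => `|v (x - y)|).
    rewrite -(Int_shift (- y) (itg_abs iv)); apply: eq_Int => x; by rewrite addrC.
  rewrite e -Int_Z; last exact: itg_abs (ivs y).
  apply: Int_le; [exact: itg_abs (iF y)|by apply: itgZ; exact: itg_abs|].
  move=> x; rewrite /F !normrM ler_wpM2l// -[leRHS]mulr1 ler_wpM2l//; exact: cos_max.
have [_ E] := fubini_Int mF iF (itgZr _ (itg_abs ik)) hF.
rewrite /phaseft (@eq_Int _ _ (fun x => Int (F ^~ x))); last first.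
  move=> x; rewrite -Int_Zr//; apply: eq_Int => y; by rewrite /F mulrA.
rewrite -E.
have iks : itg (fun y => k y * sin (w * y)).
  by apply: eq_itg (itg_sinp w 0 ik) => y; rewrite subr0.
have ikc : itg (fun y => k y * cos (w * y)).
  by apply: eq_itg (itg_cosp w 0 ik) => y; rewrite subr0.
have z : Int (fun y => k y * sin (w * y)) = 0.
  by apply: Int_odd => // y; rewrite ek mulrN sinN mulrN.
rewrite (@eq_Int _ _ (fun y => phaseft v w p * (k y * cos (w * y)) - Int (fun x => v x * sin (w * x - p)) * (k y * sin (w * y)))).
  by rewrite Int_B; [rewrite !Int_Z// z mulr0 subr0 mulrC|exact: itgZ|exact: itgZ].
move=> y; rewrite /F Int_Z; last exact: itg_cosp.
have -> : Int (fun x => v (x - y) * cos (w * x - p)) = phaseft v w p * cos (w * y) - Int (fun x => v x * sin (w * x - p)) * sin (w * y).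
  have i1 : itg (fun x => v x * cos (w * x - (p - w * y))) by exact: itg_cosp.
  rewrite (@eq_Int _ _ (fun x => v (- y + x) * cos (w * (- y + x) - (p - w * y)))); last first.
    by move=> x; rewrite addrC; congr (_ * cos _); ring.
  rewrite (Int_shift (- y) i1) /phaseft -!Int_Zr; [|exact: itg_sinp|exact: itg_cosp].
  rewrite -Int_B; [|by apply: itgZr; exact: itg_cosp|by apply: itgZr; exact: itg_sinp].
  apply: eq_Int => x; rewrite (_ : w * x - (p - w * y) = (w * x - p) + w * y); last by ring.
  by rewrite cosD; ring.
by ring.
Qed.
End Symbol.

Section Contraction.
Variables (R : realType) (n : nat) (eta : R).
Hypothesis eta0 : 0 < eta.
Implicit Types (K : R -> 'M[R]_n) (v w z : R -> 'cV[R]_n) (a b s : R).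

Lemma trkernel_ekernel K : ekernel eta K -> ekernel eta (trkernel K).
Proof.
move=> [h e]; split; last by move=> y; rewrite /trkernel e.
by move=> i j; apply: eq_itg (h j i) => y; rewrite mxE.
Qed.

Lemma kabs_trkernel K : kabs (trkernel K) = kabs K.
Proof.
apply/funext => y; rewrite /kabs exchange_big; apply: eq_bigr => i _.
by apply: eq_bigr => j _; rewrite mxE.
Qed.

Lemma kmass_trkernel K : kmass eta (trkernel K) = kmass eta K.
Proof. by rewrite /kmass kabs_trkernel. Qed.

Lemma cosft_trkernel K (w : R) : cosft (trkernel K) w = (cosft K w)^T.
Proof. by apply/matrixP => i j; rewrite !mxE; apply: eq_Int => y; rewrite mxE. Qed.

Lemma symbol_trkernel K (w : R) : symbol (trkernel K) w = (symbol K w)^T.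
Proof. by rewrite /symbol cosft_trkernel linearD/= linearN/= trmx1. Qed.

Section K.
Variable K : R -> 'M[R]_n.
Hypothesis kK : ekernel eta K.

Lemma ekernel_itg i j : itg (fun y => K y i j).
Proof.
by apply: eq_itg (ekernel_itgw kK i j (ltW eta0)) => y; rewrite mul0r expR0 mulr1.
Qed.

Lemma convol_add b v w x : growth b v -> growth b w -> `|b| <= eta ->
  convol K (fun y => v y + w y) x = convol K v x + convol K w x.
Proof.
move=> hv hw be; apply/colP => i; rewrite mxE [RHS]mxE [X in X + _]mxE [X in _ + X]mxE -Int_D.
- by apply: eq_Int => y; rewrite mulmxDr mxE.
- exact: (convol_itg1 kK x i hv be).
- exact: (convol_itg1 kK x i hw be).
Qed.

Lemma convol_scale b c v x : growth b v -> `|b| <= eta -> convol K (fun y => c *: v y) x = c *: convol K v x.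
Proof.
move=> hv be; apply/colP => i; rewrite mxE [RHS]mxE [X in _ * X]mxE -Int_Z.
  by apply: eq_Int => y; rewrite -scalemxAr mxE.
exact: (convol_itg1 kK x i hv be).
Qed.

Lemma convol_opp b v x : growth b v -> `|b| <= eta -> convol K (fun y => - v y) x = - convol K v x.
Proof.
move=> hv be; rewrite -scaleN1r -(convol_scale (-1) x hv be); congr (convol K _ x).
by apply/funext => y; rewrite scaleN1r.
Qed.

Lemma convol_sub b v w x : growth b v -> growth b w -> `|b| <= eta ->
  convol K (fun y => v y - w y) x = convol K v x - convol K w x.
Proof.
by move=> hv hw be; rewrite (convol_add x hv (growth_opp hw) be) (convol_opp x hw be).
Qed.

Lemma linop_growth b v : growth b v -> `|b| <= eta -> growth b (linop K v).
Proof. by move=> hv be; apply: growth_add; [exact: growth_opp|exact: (convol_growth eta0 kK hv be)]. Qed.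

Lemma growth_itg b v i : growth b v -> b < 0 -> itg (fun x => v x i 0).
Proof.
move=> hv b0; have [cv' _] := hv; have [C C0 h] := growth_bd hv.
apply: expdecay_itg; first exact: cv'.
by exists C, (- b); split; [rewrite oppr_gt0|move=> x; rewrite mulNr opprK; exact: h].
Qed.

Lemma convol_phaseftv b v (w p : R) : growth b v -> b < 0 -> `|b| <= eta -> phaseftv (convol K v) w p = cosft K w *m phaseftv v w p.
Proof.
move=> hv b0 be; apply/colP => i; rewrite mxE [RHS]mxE.
have ij j : itg (fun x => Int (fun y => K y i j * v (x - y) j 0)).
  pose vj := fun x => \col_k (if k == j then v x j 0 else 0) : 'cV[R]_n.
  have gj : growth b vj.
    have [cv' [C h]] := hv; split.
      move=> k; have [->|kj] := eqVneq k j.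
        by apply: contf_eq (cv' j) => x; rewrite mxE eqxx.
      by apply: (contf_eq (f := fun=> 0)) => [x|]; [rewrite mxE (negbTE kj)|exact: cont_cst].
    exists C => x k; rewrite mxE; case: eqP => // _; rewrite normr0.
    exact: le_trans (h x j).
  apply: eq_itg (growth_itg i (convol_growth eta0 kK gj be) b0) => x.
  rewrite (convolE kK x i gj be) (bigD1 j)//= big1 ?addr0.
    by apply: eq_Int => y; rewrite mxE eqxx.
  move=> k kj; rewrite -[RHS](Int_0 R); apply: eq_Int => y.
  by rewrite mxE (negbTE kj) mulr0.
transitivity (\sum_j phaseft (fun x => Int (fun y => K y i j * v (x - y) j 0)) w p).
  rewrite /phaseft -Int_sum; last by move=> j; exact: itg_cosp.
  by apply: eq_Int => x; rewrite (convolE kK x i hv be) mulr_suml.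
apply: eq_bigr => j _; rewrite [X in X * _]mxE [X in _ * X]mxE.
have [_ ek] := kK; have [cv' _] := hv.
apply: conv_phaseft.
- exact: ekernel_itg.
- by move=> y; rewrite ek.
- exact: cv'.
- exact: growth_itg hv b0.
- exact: ij.
- by move=> x; exact: (convol_itg kK x i j hv be).
Qed.

Lemma phaseftv_add b v w (x p : R) : growth b v -> growth b w -> b < 0 -> 
  phaseftv (fun y => v y + w y) x p = phaseftv v x p + phaseftv w x p.
Proof.
move=> hv hw b0; apply/colP => i; rewrite mxE [RHS]mxE [X in X + _]mxE [X in _ + X]mxE /phaseft -Int_D.
- by apply: eq_Int => y; rewrite mxE mulrDl.
- by apply: itg_cosp; exact: growth_itg hv b0.
- by apply: itg_cosp; exact: growth_itg hw b0.
Qed.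

Lemma phaseftv_scale b c v (x p : R) : growth b v -> b < 0 -> phaseftv (fun y => c *: v y) x p = c *: phaseftv v x p.
Proof.
move=> hv b0; apply/colP => i; rewrite mxE [RHS]mxE [X in _ * X]mxE /phaseft -Int_Z.
  by apply: eq_Int => y; rewrite mxE mulrA.
by apply: itg_cosp; exact: growth_itg hv b0.
Qed.

Lemma phaseftv_opp b v (x p : R) : growth b v -> b < 0 -> phaseftv (fun y => - v y) x p = - phaseftv v x p.
Proof.
move=> hv b0; rewrite -scaleN1r -(phaseftv_scale (-1) x p hv b0); congr (phaseftv _ x p).
by apply/funext => y; rewrite scaleN1r.
Qed.

Lemma linop_phaseftv b v (w p : R) : growth b v -> b < 0 -> `|b| <= eta -> phaseftv (linop K v) w p = symbol K w *m phaseftv v w p.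
Proof.
move=> hv b0 be; rewrite (phaseftv_add w p (growth_opp hv) (convol_growth eta0 kK hv be) b0).
by rewrite (phaseftv_opp w p hv b0) (convol_phaseftv w p hv b0 be) /symbol mulmxDl mulNmx mul1mx.
Qed.
End K.

Lemma relaxop_phaseftv K th b v (w p : R) : ekernel eta K -> growth b v -> b < 0 -> `|b| <= eta ->
  phaseftv (relaxop K th v) w p = phaseftv v w p - th *: ((symbol K w)^T *m (symbol K w *m phaseftv v w p)).
Proof.
move=> kK hv b0 be; have kT := trkernel_ekernel kK.
have g1 := linop_growth kK hv be; have g2 := linop_growth kT g1 be.
rewrite /relaxop (phaseftv_add w p hv (growth_opp (growth_scale th g2)) b0).
rewrite (phaseftv_opp w p (growth_scale th g2) b0) (phaseftv_scale th w p g2 b0).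
by rewrite (linop_phaseftv kT w p g1 b0 be) (linop_phaseftv kK w p hv b0 be) symbol_trkernel.
Qed.

Lemma sqnorm_dot (x : 'cV[R]_n) : sqnorm x = (x^T *m x) 0 0.
Proof. by rewrite mxE; apply: eq_bigr => i _; rewrite mxE expr2. Qed.

(** Expanding the square: [|x - th M^t M x|^2 = |x|^2 - 2 th |M x|^2 + th^2 |M^t M x|^2]. *)
Lemma sqnorm_grad (M : 'M[R]_n) (x : 'cV[R]_n) th (c L : R) : 0 <= th -> 0 <= c -> 0 <= L ->
  c * sqnorm x <= sqnorm (M *m x) -> sqnorm (M *m x) <= L * sqnorm x -> sqnorm (M^T *m (M *m x)) <= L * sqnorm (M *m x) ->
  sqnorm (x - th *: (M^T *m (M *m x))) <= (1 - 2 * th * c + th ^+ 2 * L ^+ 2) * sqnorm x.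
Proof.
move=> th0 c0 L0 h1 h2 h3.
have -> : sqnorm (x - th *: (M^T *m (M *m x))) = sqnorm x - 2 * th * sqnorm (M *m x) + th ^+ 2 * sqnorm (M^T *m (M *m x)).
  pose y := M^T *m (M *m x).
  have d1 : (x^T *m y) 0 0 = sqnorm (M *m x) by rewrite sqnorm_dot trmx_mul /y !mulmxA.
  have -> : sqnorm (x - th *: y) = sqnorm x - 2 * th * (x^T *m y) 0 0 + th ^+ 2 * sqnorm y.
    rewrite /sqnorm mxE !mulr_sumr -sumrB -big_split/=; apply: eq_bigr => i _.
    by rewrite !mxE; ring.
  by rewrite d1.
have l1 : L * sqnorm (M *m x) <= L * (L * sqnorm x) by rewrite ler_wpM2l.
have l2 : th ^+ 2 * sqnorm (M^T *m (M *m x)) <= th ^+ 2 * (L * (L * sqnorm x)).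
  by rewrite ler_wpM2l ?sqr_ge0// (le_trans h3).
have l3 : 2 * th * (c * sqnorm x) <= 2 * th * sqnorm (M *m x) by rewrite ler_wpM2l// mulr_ge0.
lra.
Qed.

Lemma mulmx_sqnorm_bnd (M : 'M[R]_n) (B : R) (x : 'cV[R]_n) : 0 <= B -> (forall i j, `|M i j| <= B) ->
  sqnorm (M *m x) <= (n%:R * (n%:R * B)) ^+ 2 * sqnorm x.
Proof.
move=> B0 hM; apply: (le_trans (sqnorm_l1 _)).
rewrite -(l2sq x) -exprMn lerXn2r ?nnegrE//.
- by apply: sumr_ge0.
- by rewrite !mulr_ge0// l2_ge0.
rewrite -!mulrA; apply: l1_bnd => i; rewrite mxE.
apply: (le_trans (ler_norm_sum _ _ _)).
apply: (@le_trans _ _ (\sum_(j < n) B * l2 x)); last by rewrite sumr_const card_ord mulr_natl.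
by apply: ler_sum => j _; rewrite normrM; apply: ler_pM => //; exact: l2_coord.
Qed.

Lemma symbol_bnd K (w : R) i j : ekernel eta K -> `|symbol K w i j| <= 1 + kmass eta K.
Proof.
move=> kK; rewrite /symbol mxE; apply: (le_trans (ler_normD _ _)); apply: lerD.
  by rewrite !mxE normrN; case: eqP => _; rewrite ?normr1 ?normr0.
rewrite mxE; apply: Int_abs_le.
- by apply: eq_itg (itg_cosp w 0 (ekernel_itg kK i j)) => y; rewrite subr0.
- exact: (kabs_itgw kK (lexx _)).
- move=> y; rewrite normrM; apply: ler_pM => //; first exact: kabs_ge.
  apply: (le_trans (cos_max _)); rewrite -expR0 ler_expR mulr_ge0//; exact: ltW.
Qed.

(** The phases 0 and [pi / 2] give the cosine and the sine transform; together they
    recover the full transform. *)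
Lemma plancherel_energy b v w Q : growth b v -> growth b w -> b < 0 ->
  (forall x p, sqnorm (phaseftv v x p) <= Q * sqnorm (phaseftv w x p)) -> energy 0 v <= Q * energy 0 w.
Proof.
move=> hv hw b0 h.
have dec u i : growth b u -> expdecay (fun x => u x i 0).
  move=> hu; have [C C0 hC] := growth_bd hu; exists C, (- b); split; first by rewrite oppr_gt0.
  by move=> x; rewrite mulNr opprK; exact: hC.
have [cv' _] := hv; have [cw' _] := hw.
have iu u i : growth b u -> itg (fun x => u x i 0 ^+ 2).
  by move=> hu; have [cu _] := hu; apply: itg_sq; [exact: cu|exact: dec].
rewrite !energy0 /sqnorm !Int_sum; [|by move=> i; exact: iu|by move=> i; exact: iu].
apply: plancherel_compare.
- exact: cv'.
- exact: cw'.
- by move=> i; exact: dec.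
- by move=> i; exact: dec.
move=> x.
have e (u : R -> 'cV[R]_n) : \sum_i (fc (fun x => u x i 0) x ^+ 2 + fs (fun x => u x i 0) x ^+ 2) = sqnorm (phaseftv u x 0) + sqnorm (phaseftv u x (pi / 2)).
  rewrite /sqnorm -big_split/=; apply: eq_bigr => i _; rewrite !mxE; congr (_ ^+ 2 + _ ^+ 2).
    by apply: eq_Int => y; rewrite subr0.
  by apply: eq_Int => y; rewrite cosBpihalf.
by rewrite !e mulrDr lerD.
Qed.
End Contraction.

(** * Contraction of the weighted energy *)

Section Algebra.
Variable R : realType.

Lemma rate_alg (t x : R) : 0 < t -> x <= t / 2 -> (1 + t) * (1 - 2 * t) + x <= 1 - t / 2.
Proof. by move=> t0 h; have := mulr_ge0 (ltW t0) (ltW t0); lra. Qed.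

Lemma frac_alg (D t : R) : 0 <= D -> 0 <= t -> D * (t / 2 / (D + 1)) <= t / 2.
Proof.
move=> D0 t0; have d1 : 0 < D + 1 by lra.
by rewrite mulrA ler_pdivrMr// mulrC ler_wpM2l//; lra.
Qed.

Lemma err_alg (q m E x1 x2 x3 x4 y1 y2 z : R) : 0 <= q -> 0 <= m -> 0 <= E ->
  x1 <= q * E -> x2 <= q * E -> x3 <= q * (m * E) -> x4 <= m * (q * E) ->
  y1 <= (1 + 1) * x3 + (1 + 1) * x4 -> y2 <= (1 + 1) * x1 + (1 + 1) * x2 ->
  z <= (1 + 1) * y2 + (1 + 1) * y1 -> z <= 8 * (1 + m) * q * E.
Proof.
move=> q0 m0 E0 h1 h2 h3 h4 h5 h6 h7.
have e : q * (m * E) = m * (q * E) by ring.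
have -> : 8 * (1 + m) * q * E = 8 * (q * E) + 8 * (m * (q * E)) by ring.
rewrite e in h3; lra.
Qed.
End Algebra.

Section WContraction.
Variables (R : realType) (n : nat) (eta : R).
Hypothesis eta0 : 0 < eta.
Implicit Types (v w z : R -> 'cV[R]_n) (a b s : R).
Variable K : R -> 'M[R]_n.
Hypothesis kK : ekernel eta K.
Let kT := trkernel_ekernel kK.
Notation Mu := (kmass eta K).

Lemma growth_abs b a : 0 <= b -> b < a -> 2 * a <= eta ->
  [/\ `|b| <= eta, `|b - a| <= eta, `|b - a| + a <= eta, 0 <= a & b - a < 0].
Proof.
move=> b0 ba ae; have a0 : 0 <= a by apply: le_trans (ltW ba).
rewrite (ger0_norm b0) ltr0_norm ?subr_lt0// opprB; split => //; lra.
Qed.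

Lemma relaxop_growth b th v : growth b v -> `|b| <= eta -> growth b (relaxop K th v).
Proof.
move=> hv be; apply: growth_sub => //; apply: growth_scale.
exact: (linop_growth eta0 kT (linop_growth eta0 kK hv be) be).
Qed.

Lemma relaxopE b th v x : growth b v -> `|b| <= eta ->
  relaxop K th v x = (1 - th) *: v x + th *: (convol K v x + convol (trkernel K) v x - convol (trkernel K) (convol K v) x).
Proof.
move=> hv be; have g1 := convol_growth eta0 kK hv be.
rewrite /relaxop {1}/linop /linop (convol_add kT x (growth_opp hv) g1 be) (convol_opp kT x hv be).
move: (convol K v x) (convol (trkernel K) v x) (convol (trkernel K) (convol K v) x) => p q r.
by apply/colP => i; rewrite !mxE; ring.
Qed.

(** What remains after moving the weight through the two convolutions of [relaxop]. *)
Definition relax_err (a : R) v x := wcommut K a v x + wcommut (trkernel K) a v x -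
  (wcommut (trkernel K) a (convol K v) x + convol (trkernel K) (wcommut K a v) x).

Lemma relaxop_weighted b a th v x : growth b v -> 0 <= b -> b < a -> 2 * a <= eta ->
  weighted a (relaxop K th v) x = relaxop K th (weighted a v) x + th *: relax_err a v x.
Proof.
move=> hv b0 ba ae; have [be bae baae a0 ba0] := growth_abs b0 ba ae.
have gw := weighted_growth a hv; have gc := convol_growth eta0 kK hv be.
have gcw := convol_growth eta0 kK gw bae; have gwc := weighted_growth a gc.
have gm : growth (b - a) (wcommut K a v) by exact: (wcommut_growth eta0 kK hv be bae).
rewrite (relaxopE th x gw bae) /weighted (relaxopE th x hv be) -/(weighted a v).
rewrite /relax_err /wcommut (convol_sub kT x gwc gcw bae).
have wE u : weighted a u x = expR (- a * `|x|) *: u x by [].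
rewrite !wE.
move: (convol K v x) (convol K (weighted a v) x) (convol (trkernel K) v x) (convol (trkernel K) (weighted a v) x)
  (convol (trkernel K) (convol K v) x) (convol (trkernel K) (weighted a (convol K v)) x) (convol (trkernel K) (convol K (weighted a v)) x) => p1 p2 p3 p4 p5 p6 p7.
apply/colP => i; rewrite !mxE; ring.
Qed.

Lemma relax_err_energy b a v : growth b v -> 0 <= b -> b < a -> 2 * a <= eta ->
  energy 0 (relax_err a v) <= (8 * (1 + Mu ^+ 2) * (2 * a / eta * Mu) ^+ 2) * energy a v.
Proof.
move=> hv b0 ba ae; have [be bae baae a0 ba0] := growth_abs b0 ba ae.
have gw := weighted_growth a hv; have gc := convol_growth eta0 kK hv be.
have g1 : growth (b - a) (wcommut K a v) by exact: (wcommut_growth eta0 kK hv be bae).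
have g2 : growth (b - a) (wcommut (trkernel K) a v) by exact: (wcommut_growth eta0 kT hv be bae).
have g3 : growth (b - a) (wcommut (trkernel K) a (convol K v)) by exact: (wcommut_growth eta0 kT gc be bae).
have g4 := convol_growth eta0 kT g1 bae.
have e1 := wcommut_energy eta0 kK hv be a0 ba ae baae.
have e2 := wcommut_energy eta0 kT hv be a0 ba ae baae.
have e3 := wcommut_energy eta0 kT gc be a0 ba ae baae.
have e4 : energy 0 (convol (trkernel K) (wcommut K a v)) <= kmass eta (trkernel K) ^+ 2 * energy 0 (wcommut K a v).
  by apply: (convol_energy eta0 kT g1 bae) => //; rewrite subr0 addr0.
have e5 := convol_energy eta0 kK hv be a0 ba baae.
rewrite kmass_trkernel in e2 e3 e4.
have := energyD (growth_add g1 g2) (growth_opp (growth_add g3 g4)) ba0 (ltr01).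
have := energyD g1 g2 ba0 ltr01.
have := energyD g3 g4 ba0 ltr01.
have -> : energy 0 (fun x => - (wcommut (trkernel K) a (convol K v) x + convol (trkernel K) (wcommut K a v) x)) =
   energy 0 (fun x => wcommut (trkernel K) a (convol K v) x + convol (trkernel K) (wcommut K a v) x).
  have := energyZ (-1) (growth_add g3 g4) ba0; rewrite sqrrN expr1n mul1r => <-.
  by congr (energy 0 _); apply/funext => x; rewrite scaleN1r.
rewrite invr1 -/(relax_err a v) => h1 h2 h3.
set q := (2 * a / eta * Mu) ^+ 2 in e1 e2 e3 *.
have q0 : 0 <= q by exact: sqr_ge0.
have m0 : 0 <= Mu ^+ 2 by exact: sqr_ge0.
have e3' : energy 0 (wcommut (trkernel K) a (convol K v)) <= q * (Mu ^+ 2 * energy a v) by apply: (le_trans e3); rewrite ler_wpM2l.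
have e4' : energy 0 (convol (trkernel K) (wcommut K a v)) <= Mu ^+ 2 * (q * energy a v).
  by apply: (le_trans e4); exact: (ler_wpM2l m0 e1).
have E0 : 0 <= energy a v by exact: energy_ge0.
clearbody q; exact: (err_alg q0 m0 E0 e1 e2 e3' e4' h1 h2 h3).
Qed.

Variable c : R.
Hypothesis c0 : 0 < c.
Hypothesis hsym : forall (w : R) x, c * sqnorm x <= sqnorm (symbol K w *m x).

Definition Lsym := (n%:R * (n%:R * (1 + Mu))) ^+ 2.
(** Small enough for the quadratic term of [sqnorm_grad] to cost at most half of the gain; the
    extra summands keep it in ]0, 1]. *)
Definition theta := c / (Lsym ^+ 2 + c + 1).
Lemma den0 : 0 < Lsym ^+ 2 + c + 1.
Proof. by have := sqr_ge0 Lsym; move: c0; lra. Qed.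
Lemma theta0 : 0 < theta.
Proof. by rewrite divr_gt0// den0. Qed.
Lemma theta1 : theta <= 1.
Proof. by rewrite ler_pdivrMr ?den0// mul1r; have := sqr_ge0 Lsym; lra. Qed.
Lemma thetaL : theta * Lsym ^+ 2 <= c.
Proof.
rewrite /theta mulrAC ler_pdivrMr ?den0//; have := sqr_ge0 Lsym => h.
by rewrite ler_pM2l//; move: c0; lra.
Qed.

(** Frequency by frequency, [sqnorm_grad] gives the factor [1 - theta c]. *)
Lemma relaxop_En0 b v : growth b v -> b < 0 -> `|b| <= eta ->
  energy 0 (relaxop K theta v) <= (1 - theta * c) * energy 0 v.
Proof.
move=> hv b0 be; apply: (plancherel_energy (relaxop_growth theta hv be) hv b0) => w p.
rewrite (relaxop_phaseftv eta0 theta w p kK hv b0 be).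
have B0 : 0 <= 1 + Mu by rewrite addr_ge0// kmass_ge0.
have L0 : 0 <= Lsym by exact: sqr_ge0.
have hb := @mulmx_sqnorm_bnd R n (symbol K w) (1 + Mu) _ B0 (fun i j => symbol_bnd eta0 w i j kK).
have hbT := @mulmx_sqnorm_bnd R n (symbol K w)^T (1 + Mu) _ B0.
have hbT' x : sqnorm ((symbol K w)^T *m x) <= Lsym * sqnorm x.
  by apply: hbT => i j; rewrite mxE; exact: symbol_bnd.
apply: (le_trans (sqnorm_grad (ltW theta0) (ltW c0) L0 (hsym w _) (hb _) (hbT' _))).
apply: ler_wpM2r; first exact: sqnorm_ge0.
have := thetaL; have t0 := theta0 => h.
have := ler_wpM2l (ltW t0) h; rewrite expr2 => h2; lra.
Qed.

(** Conjugating by the weight changes the relaxation operator by an error of size O(a), which the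
    spectral gap absorbs when [a] is small. *)
Lemma relaxop_energy : exists2 a1 : R, 0 < a1 & exists2 q : R, 0 <= q < 1 & 2 * a1 <= eta /\
  forall a b v, growth b v -> 0 <= b -> b < a -> a <= a1 -> energy a (relaxop K theta v) <= q * energy a v.
Proof.
have t0 := theta0; have t1 := theta1.
have tc0 : 0 < theta * c by rewrite mulr_gt0.
pose t := theta * c / 2; have tp : 0 < t by rewrite /t; lra.
pose D := (1 + t^-1) * (theta ^+ 2 * (8 * (1 + Mu ^+ 2) * (2 / eta * Mu) ^+ 2)).
have D0 : 0 <= D.
  have x1 : 0 <= 1 + t^-1 by rewrite addr_ge0// invr_ge0 ltW.
  have x2 : 0 <= 1 + Mu ^+ 2 by rewrite addr_ge0// sqr_ge0.
  rewrite /D; apply: mulr_ge0 => //; apply: mulr_ge0; first exact: sqr_ge0.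
  by apply: mulr_ge0; [apply: mulr_ge0|exact: sqr_ge0].
have [a1 a10 [a1e a1D]] : exists2 a1 : R, 0 < a1 & 2 * a1 <= eta /\ D * a1 ^+ 2 <= t / 2.
  exists (Num.min (eta / 2) (Num.min 1 (t / 2 / (D + 1)))).
    have d1 : 0 < D + 1 by lra.
    by rewrite !lt_min ltr01 !divr_gt0.
  split.
    have : Num.min (eta / 2) (Num.min 1 (t / 2 / (D + 1))) <= eta / 2 by rewrite ge_min lexx.
    lra.
  set m := Num.min _ _.
  have m1 : m <= 1 by rewrite !ge_min lexx !orbT.
  have m2 : m <= t / 2 / (D + 1) by rewrite !ge_min lexx !orbT.
  have m0 : 0 <= m.
    have d1 : 0 < D + 1 by lra.
    by rewrite !le_min ler01 !divr_ge0// ltW// divr_gt0.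
  have : m ^+ 2 <= m by rewrite expr2 -[leRHS]mulr1 ler_wpM2l.
  move=> h; apply: (@le_trans _ _ (D * (t / 2 / (D + 1)))).
    by rewrite ler_wpM2l// (le_trans h).
  exact: frac_alg (ltW tp).
exists a1 => //.
pose q := Num.max 0 (1 - t / 2).
exists q.
  by rewrite /q le_max lexx/= gt_max ltr01/=; lra.
split => // a b v hv b0 ba aa1.
have ae : 2 * a <= eta by lra.
have [be bae baae a0 ba0] := growth_abs b0 ba ae.
have gw := weighted_growth a hv.
have gS := relaxop_growth theta gw bae.
have gE : growth (b - a) (relax_err a v).
  have gc := convol_growth eta0 kK hv be.
  apply: growth_sub; apply: growth_add.
  - exact: (wcommut_growth eta0 kK hv be bae).
  - exact: (wcommut_growth eta0 kT hv be bae).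
  - exact: (wcommut_growth eta0 kT gc be bae).
  - exact: (convol_growth eta0 kT (wcommut_growth eta0 kK hv be bae) bae).
rewrite energy_weighted.
have -> : weighted a (relaxop K theta v) = (fun x => relaxop K theta (weighted a v) x + theta *: relax_err a v x).
  by apply/funext => x; exact: (relaxop_weighted theta x hv b0 ba ae).
apply: (le_trans (energyD gS (growth_scale theta gE) ba0 tp)).
rewrite (energyZ theta gE ba0).
have e1 := relaxop_En0 gw ba0 bae; rewrite -energy_weighted in e1.
have e2 := relax_err_energy hv b0 ba ae.
have E0 : 0 <= energy a v by exact: energy_ge0.
have h1 : (1 + t) * energy 0 (relaxop K theta (weighted a v)) <= (1 + t) * ((1 - theta * c) * energy a v).
  have tt : 0 <= 1 + t by rewrite addr_ge0// ltW.
  exact: (ler_wpM2l tt e1).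
have ti : 0 <= 1 + t^-1 by rewrite addr_ge0// invr_ge0 ltW.
have h2 : (1 + t^-1) * (theta ^+ 2 * energy 0 (relax_err a v)) <= D * a ^+ 2 * energy a v.
  apply: (@le_trans _ _ ((1 + t^-1) * (theta ^+ 2 * (8 * (1 + Mu ^+ 2) * (2 * a / eta * Mu) ^+ 2 * energy a v)))).
    by rewrite ler_wpM2l// ler_wpM2l// sqr_ge0.
  rewrite le_eqVlt; apply/orP; left; apply/eqP; rewrite /D; ring.
have h3 : D * a ^+ 2 <= t / 2.
  by apply: le_trans a1D; rewrite ler_wpM2l// lerXn2r ?nnegrE// ltW.
apply: (le_trans (lerD h1 h2)); rewrite mulrA -mulrDl ler_wpM2r//.
rewrite /q le_max; apply/orP; right.
have -> : theta * c = 2 * t by rewrite /t; field.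
exact: rate_alg.
Qed.
End WContraction.

(** * Mixing the energy with a weighted supremum *)

(** Weighted supremum norm, meaningful for functions in [growth b] with [b <= a]. *)
Definition wsup (R : realType) n (a : R) (v : R -> 'cV[R]_n) : R :=
  sup [set r | exists x i, r = expR (- a * `|x|) * `|v x i 0|].
(** Growth strictly slower than [exp(a |x|)], so that the energy of weight [a] is finite too. *)
Definition subgrowth (R : realType) n (a : R) (v : R -> 'cV[R]_n) : Prop :=
  exists b, [/\ 0 <= b, b < a & growth b v].
(** Energies alone do not control pointwise Lipschitz nonlinearities, and suprema alone are not
    contracted; a small multiple [sigma] of the supremum keeps both properties. *)
Definition mixnorm (R : realType) n (sigma a : R) (v : R -> 'cV[R]_n) : R :=
  Num.sqrt (energy a v) + sigma * wsup a v.

Section Sup.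
Variables (R : realType) (n : nat).
Implicit Types (v w z : R -> 'cV[R]_n) (a b s : R).

Lemma wsup_ub b a v : growth b v -> b <= a -> wbound a (wsup a v) v.
Proof.
move=> hv ba x i; have [C C0 h] := growth_bd (growth_mono ba hv).
have -> : wsup a v * expR (a * `|x|) = wsup a v / expR (- a * `|x|) by rewrite -expRN mulNr opprK.
rewrite ler_pdivlMr ?expR_gt0// mulrC.
apply: ub_le_sup; last by exists x, i.
exists C => _ [y [j ->]].
have -> : - a * `|y| = - (a * `|y|) by rewrite mulNr.
by rewrite expRN mulrC ler_pdivrMr ?expR_gt0//; exact: h.
Qed.

Lemma wsup_le a s v : 0 <= s -> wbound a s v -> wsup a v <= s.
Proof.
move=> s0 h; rewrite /wsup; set S := [set r | _].
have [->|/set0P S0] := eqVneq S set0; first by rewrite sup0.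
apply: ge_sup => // _ [x [i ->]].
have -> : - a * `|x| = - (a * `|x|) by rewrite mulNr.
by rewrite expRN mulrC ler_pdivrMr ?expR_gt0//; exact: h.
Qed.

Lemma wsup_ge0 a v : 0 <= wsup a v.
Proof.
rewrite /wsup; set S := [set r | _].
have [hs|/sup_out->//] := pselect (has_sup S).
have [[r [x [i hr]]] _] := hs.
apply: (@le_trans _ _ r); first by rewrite hr mulr_ge0 ?expR_ge0.
by apply: (sup_upper_bound hs); exists x, i.
Qed.

Lemma l2_wsup b a v x : growth b v -> b <= a -> l2 (weighted a v x) <= n%:R * wsup a v.
Proof.
move=> hv ba; apply: (le_trans (l2_l1 _)); apply: l1_bnd => i.
rewrite mxE normrM (ger0_norm (expR_ge0 _)).
have := wsup_ub hv ba x i; rewrite -ler_pdivrMr ?expR_gt0// -expRN mulrC mulNr.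
by [].
Qed.

Lemma subgrowth_gr2 a v w : subgrowth a v -> subgrowth a w -> exists b, [/\ 0 <= b, b < a, growth b v & growth b w].
Proof.
move=> [b [b0 ba hv]] [b' [b0' ba' hw]]; exists (Num.max b b'); split.
- by rewrite le_max b0.
- by rewrite gt_max ba.
- by apply: growth_mono hv; rewrite le_max lexx.
- by apply: growth_mono hw; rewrite le_max lexx orbT.
Qed.

Lemma subgrowth_add a v w : subgrowth a v -> subgrowth a w -> subgrowth a (fun x => v x + w x).
Proof.
by move=> hv hw; have [b [b0 ba gv gw]] := subgrowth_gr2 hv hw; exists b; split => //; exact: growth_add.
Qed.

Lemma subgrowth_scale a c v : subgrowth a v -> subgrowth a (fun x => c *: v x).
Proof. by move=> [b [b0 ba gv]]; exists b; split => //; exact: growth_scale. Qed.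

Lemma subgrowth_opp a v : subgrowth a v -> subgrowth a (fun x => - v x).
Proof. by move=> [b [b0 ba gv]]; exists b; split => //; exact: growth_opp. Qed.

Lemma subgrowth_sub a v w : subgrowth a v -> subgrowth a w -> subgrowth a (fun x => v x - w x).
Proof. by move=> hv hw; apply: subgrowth_add => //; exact: subgrowth_opp. Qed.

Variable sigma : R.
Hypothesis sg0 : 0 < sigma.

Lemma mixnorm_ge0 a v : 0 <= mixnorm sigma a v.
Proof. by rewrite addr_ge0 ?sqrtr_ge0// mulr_ge0 ?wsup_ge0// ltW. Qed.

Lemma mixnorm_add a v w : subgrowth a v -> subgrowth a w -> mixnorm sigma a (fun x => v x + w x) <= mixnorm sigma a v + mixnorm sigma a w.
Proof.
move=> hv hw; have [b [b0 ba gv gw]] := subgrowth_gr2 hv hw.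
have h1 : Num.sqrt (energy a (fun x => v x + w x)) <= Num.sqrt (energy a v) + Num.sqrt (energy a w).
  by apply: sqrt_triangle; rewrite ?energy_ge0// => t t0; exact: (energyD gv gw ba t0).
have h2 : wsup a (fun x => v x + w x) <= wsup a v + wsup a w.
  apply: wsup_le; first by rewrite addr_ge0 ?wsup_ge0.
  move=> x i; rewrite mxE mulrDl; apply: (le_trans (ler_normD _ _)); apply: lerD.
    exact: (wsup_ub gv (ltW ba)).
  exact: (wsup_ub gw (ltW ba)).
rewrite /mixnorm; have := ler_wpM2l (ltW sg0) h2; lra.
Qed.

Lemma mixnorm_scale a c v : subgrowth a v -> mixnorm sigma a (fun x => c *: v x) <= `|c| * mixnorm sigma a v.
Proof.
move=> [b [b0 ba gv]]; rewrite /mixnorm (energyZ c gv ba) sqrtrM ?sqr_ge0// sqrtr_sqr mulrDr.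
rewrite lerD2l mulrCA ler_wpM2l ?(ltW sg0)//.
apply: wsup_le; first by rewrite mulr_ge0 ?wsup_ge0.
by move=> x i; rewrite mxE normrM -mulrA ler_wpM2l//; exact: (wsup_ub gv (ltW ba)).
Qed.

Lemma mixnorm_sub a v w : subgrowth a v -> subgrowth a w -> mixnorm sigma a (fun x => v x - w x) <= mixnorm sigma a v + mixnorm sigma a w.
Proof.
move=> hv hw; apply: (le_trans (mixnorm_add hv (subgrowth_opp hw))); rewrite lerD2l.
have := mixnorm_scale (-1) hw; rewrite normrN1 mul1r.
by under eq_fun do rewrite scaleN1r.
Qed.

Lemma mixnorm_bd a v : subgrowth a v -> wbound a (mixnorm sigma a v / sigma) v.
Proof.
move=> [b [b0 ba gv]] x i; apply: (le_trans (wsup_ub gv (ltW ba) x i)).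
rewrite ler_wpM2r ?expR_ge0// ler_pdivlMr// mulrC /mixnorm lerDr; exact: sqrtr_ge0.
Qed.

Lemma mixnorm_dom a d v w : 0 <= d -> subgrowth a v -> subgrowth a w -> (forall x i, `|v x i 0| <= d * l2 (w x)) ->
  mixnorm sigma a v <= d * n%:R * mixnorm sigma a w.
Proof.
move=> d0 hv hw h; have [b [b0 ba gv gw]] := subgrowth_gr2 hv hw.
have k0 : 0 <= d * n%:R by rewrite mulr_ge0.
rewrite /mixnorm mulrDr; apply: lerD.
  rewrite -[X in X * _]ger0_norm// -sqrtr_sqr -sqrtrM ?sqr_ge0//; apply: ler_wsqrtr.
  rewrite /energy -Int_Z; last exact: (energy_itg gw ba).
  apply: Int_le; [exact: (energy_itg gv ba)|by apply: itgZ; exact: (energy_itg gw ba)|].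
  move=> x; rewrite !sqnZ mulrCA ler_wpM2l ?sqr_ge0//.
  apply: (le_trans (sqnorm_l1 _)); rewrite -l2sq -exprMn lerXn2r ?nnegrE//.
  - by apply: sumr_ge0.
  - by rewrite mulr_ge0// l2_ge0.
  - by rewrite mulrC mulrA mulrC; apply: l1_bnd => i; rewrite mulrC.
rewrite mulrCA ler_wpM2l ?(ltW sg0)//.
apply: wsup_le; first by rewrite mulr_ge0 ?wsup_ge0.
move=> x i; apply: (le_trans (h x i)); rewrite -!mulrA ler_wpM2l// mulrA.
have := l2_wsup x gw (ltW ba); rewrite l2_wtE -ler_pdivlMl ?expR_gt0//.
by rewrite -expRN mulNr opprK mulrC.
Qed.

Variable eta : R.
Hypothesis eta0 : 0 < eta.

Lemma subgrowth_convol K a v : ekernel eta K -> subgrowth a v -> 2 * a <= eta -> subgrowth a (convol K v).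
Proof.
move=> kK [b [b0 ba gv]] ae; exists b; split => //.
by have [be _ _ _ _] := growth_abs b0 ba ae; exact: (convol_growth eta0 kK gv be).
Qed.

Lemma subgrowth_linop K a v : ekernel eta K -> subgrowth a v -> 2 * a <= eta -> subgrowth a (linop K v).
Proof. by move=> kK hv ae; apply: subgrowth_add; [exact: subgrowth_opp|exact: subgrowth_convol kK hv ae]. Qed.

Lemma mixnorm_convol K a v : ekernel eta K -> subgrowth a v -> 2 * a <= eta -> mixnorm sigma a (convol K v) <= kmass eta K * mixnorm sigma a v.
Proof.
move=> kK [b [b0 ba gv]] ae; have [be bae baae a0 ba0] := growth_abs b0 ba ae.
have M0 := kmass_ge0 eta K.
rewrite /mixnorm mulrDr; apply: lerD.
  rewrite -[X in X * _]ger0_norm// -sqrtr_sqr -sqrtrM ?sqr_ge0//; apply: ler_wsqrtr.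
  exact: (convol_energy eta0 kK gv be a0 ba baae).
rewrite mulrCA ler_wpM2l ?(ltW sg0)//.
apply: wsup_le; first by rewrite mulr_ge0 ?wsup_ge0.
have aa : `|a| <= eta by rewrite ger0_norm//; lra.
exact: (convol_bd eta0 kK (growth_mono (ltW ba) gv) aa (wsup_ub gv (ltW ba))).
Qed.

Lemma mixnorm_linop K a v : ekernel eta K -> subgrowth a v -> 2 * a <= eta -> mixnorm sigma a (linop K v) <= (1 + kmass eta K) * mixnorm sigma a v.
Proof.
move=> kK hv ae; have hc := subgrowth_convol kK hv ae.
apply: (le_trans (mixnorm_add (subgrowth_opp hv) hc)); rewrite mulrDl mul1r; apply: lerD; last exact: mixnorm_convol.
have := mixnorm_scale (-1) hv; rewrite normrN1 mul1r.
by under eq_fun do rewrite scaleN1r.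
Qed.
End Sup.

Section Smoothing.
Variables (R : realType) (n : nat) (eta : R).
Hypothesis eta0 : 0 < eta.
Variable K : R -> 'M[R]_n.
Hypothesis kK : ekernel eta K.

(** The part of the kernel where it exceeds [m], the complement of a square integrable one. *)
Definition tail (m y : R) := ((m < kabs K y)%R : bool)%:R * (kabs K y * expR (eta * `|y|)).

Lemma tail_meas m : measurable_fun setT (tail m).
Proof.
have mm := kabs_meas eta0 kK.
apply: measM; last first.
  apply: measM => //; apply: cont_meas; exact: cont_wexp.
have mb : measurable_fun [set: measurableTypeR R] (fun y => m < kabs K y).
  by apply: measurable_fun_ltr.
apply: (measurableT_comp (f := fun b : bool => b%:R : R)) => //.
Qed.

Lemma tail_small (e : R) : 0 < e -> exists2 m : R, 0 <= m & Int (tail m) <= e.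
Proof.
move=> e0.
have im := kabs_itgw kK (lexx eta).
have : Int (tail k%:R) @[k --> \oo] --> Int (fun _ : R => 0 : R).
  apply: (Int_dcvg _ _ im).
  - by move=> k; exact: tail_meas.
  - exact: cont_meas (@cont_cst R 0).
  - move=> k y; rewrite /tail ger0_norm; last by rewrite !mulr_ge0 ?kabs_ge0 ?expR_ge0.
    by case: (_ < _); rewrite ?mul1r// mul0r mulr_ge0 ?kabs_ge0 ?expR_ge0.
  - move=> y; apply: cvg_near_cst; near=> k.
    rewrite /tail (_ : (k%:R < kabs K y) = false) ?mul0r//.
    apply/negbTE; rewrite -leNgt; near: k; exact: nbhs_infty_ger.
rewrite Int_0 => /cvgr_le /(_ e e0)[k _ hk].
exists k%:R => //; exact: (hk k (leqnn k)).
Unshelve. all: by end_near. Qed.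

(** A convolution maps weighted L2 to weighted sup up to an arbitrarily small loss: split the
    kernel into a bounded part, handled by Cauchy-Schwarz, and a part of small mass. *)
Lemma smoothing (e : R) : 0 < e -> exists2 C : R, 0 <= C &
  forall a (v : R -> 'cV[R]_n), subgrowth a v -> 2 * a <= eta ->
  wbound a (C * Num.sqrt (energy a v) + e * wsup a v) (convol K v).
Proof.
move=> e0.
have [m m0 hm] := tail_small (divr_gt0 e0 (ltr0Sn R n)).
exists (Num.sqrt (m * kmass eta K)) => // a v [b [b0 ba gv]] ae x i.
have [be bae baae a0 ba0] := growth_abs b0 ba ae.
have h1 := convol_weighted_dom eta0 kK x gv be a0 baae.
have gw := weighted_growth a gv.
(* The bounded part of the kernel: its square is at most [m] times the kernel itself. *)
pose Kb y := ((kabs K y <= m)%R : bool)%:R * (kabs K y * expR (a * `|y|)).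
have Kb0 y : 0 <= Kb y by rewrite !mulr_ge0 ?kabs_ge0 ?expR_ge0.
have mKb : measurable_fun setT Kb.
  have mm := kabs_meas eta0 kK.
  apply: measM; last by apply: measM => //; apply: cont_meas; exact: cont_wexp.
  apply: (measurableT_comp (f := fun b : bool => b%:R : R)) => //.
  by apply: measurable_fun_ler.
have im := kabs_itgw kK (lexx eta).
have sqKb y : Kb y ^+ 2 <= m * (kabs K y * expR (eta * `|y|)).
  rewrite /Kb; case: (leP (kabs K y) m) => hy; last by rewrite mul0r expr0n /= !mulr_ge0 ?kabs_ge0 ?expR_ge0.
  rewrite mul1r exprMn expr2 -mulrA; apply: ler_pM => //; rewrite ?kabs_ge0//.
    by rewrite mulr_ge0 ?kabs_ge0// sqr_ge0.
  by rewrite ler_wpM2l ?kabs_ge0// expr2 -expRD ler_expR -mulrDl ler_wpM2r//; lra.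
have iKb : itg (fun y => Kb y ^+ 2).
  apply: (itg_le (meas_sqr mKb) (itgZ m im)) => y; rewrite ger0_norm ?sqr_ge0//; exact: sqKb.
have mp : measurable_fun setT (fun y => l2 (weighted a v y)) by apply: cont_meas; exact: (cont_l2 gw).
have ip : itg (fun y => l2 (weighted a v y) ^+ 2).
  by apply: eq_itg (sqnorm_itg0 gw ba0) => y; rewrite l2sq.
have y1 := young_sup Kb0 mKb iKb mp (fun y => l2_ge0 _) ip x.
have il := l2_weighted_itg eta0 kK x gv be a0 baae.
have ilb : itg (fun y => Kb y * l2 (weighted a v (x - y))).
  apply: (itg_le _ il).
    by apply: measM => //; exact: (l2_meas_shift x gw).
  move=> y; rewrite ger0_norm; last by rewrite mulr_ge0 ?l2_ge0 ?Kb0.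
  apply: ler_wpM2r; first exact: l2_ge0.
  by rewrite /Kb; case: (leP (kabs K y) m) => _; rewrite ?mul1r// mul0r mulr_ge0 ?kabs_ge0 ?expR_ge0.
have it : itg (fun y => tail m y * (n%:R * wsup a v)).
  apply: itgZr; apply: (itg_le (tail_meas m) im) => y.
  rewrite ger0_norm /tail; last by rewrite !mulr_ge0 ?kabs_ge0 ?expR_ge0.
  by case: (_ < _); rewrite ?mul1r// mul0r mulr_ge0 ?kabs_ge0 ?expR_ge0.
have h2 : Int (fun y => kabs K y * expR (a * `|y|) * l2 (weighted a v (x - y))) <=
    Int (fun y => Kb y * l2 (weighted a v (x - y))) + Int (fun y => tail m y * (n%:R * wsup a v)).
  rewrite -Int_D//; apply: Int_le => //; first exact: itgD.
  move=> y; rewrite /Kb /tail; case: (leP (kabs K y) m) => hy.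
    by rewrite mul1r mul0r mul0r addr0.
  rewrite mul0r mul0r add0r mul1r; apply: ler_pM; rewrite ?mulr_ge0 ?kabs_ge0 ?expR_ge0 ?l2_ge0//.
    by rewrite ler_wpM2l ?kabs_ge0// wexp_mono//; lra.
  exact: (l2_wsup _ gv (ltW ba)).
have iT : itg (tail m).
  apply: (itg_le (tail_meas m) im) => y.
  rewrite ger0_norm /tail; last by rewrite !mulr_ge0 ?kabs_ge0 ?expR_ge0.
  by case: (_ < _); rewrite ?mul1r// mul0r mulr_ge0 ?kabs_ge0 ?expR_ge0.
rewrite Int_Zr// in h2.
have h3 : Int (tail m) * (n%:R * wsup a v) <= e * wsup a v.
  rewrite mulrA ler_wpM2r ?wsup_ge0//.
  apply: (@le_trans _ _ (e / n.+1%:R * n%:R)); first exact: ler_wpM2r.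
  rewrite mulrAC ler_pdivrMr ?ltr0Sn// ler_wpM2l ?(ltW e0)// ler_nat; exact: leqnSn.
have h4 : Int (fun y => Kb y * l2 (weighted a v (x - y))) <= Num.sqrt (m * kmass eta K) * Num.sqrt (energy a v).
  apply: (le_trans y1).
  have -> : Int (fun y => l2 (weighted a v y) ^+ 2) = energy a v by apply: eq_Int => y; rewrite l2sq.
  rewrite ler_wpM2r ?sqrtr_ge0//; apply: ler_wsqrtr; rewrite /kmass -Int_Z//.
  by apply: Int_le => //; exact: itgZ.
have h5 : `|weighted a (convol K v) x i 0| <= \sum_i `|weighted a (convol K v) x i 0|.
  by rewrite (bigD1 i)//= lerDl sumr_ge0.
have := le_trans h5 (le_trans h1 (le_trans h2 (lerD h4 h3))).
rewrite mxE normrM (ger0_norm (expR_ge0 _)) mulNr expRN mulrC.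
by rewrite ler_pdivrMr ?expR_gt0.
Qed.
End Smoothing.

(** * Inverting operators with invertible symbol *)

(** The two rates combine: the weight given to the supremum is small enough for the cross term
    [A E] to be absorbed by the gap [1 - q]. *)
Lemma combined_rate (R : realType) (th q A E S E' S' : R) : 0 < th -> th <= 1 -> 0 <= q -> q < 1 -> 0 <= A ->
  0 <= E -> 0 <= S -> 0 <= S' -> E' <= q * E -> S' <= (1 - th / 2) * S + A * E ->
  E' + (1 - q) / (2 * (A + 1)) * S' <= Num.max ((1 + q) / 2) (1 - th / 2) * (E + (1 - q) / (2 * (A + 1)) * S).
Proof.
move=> th0 th1 q0 q1 A0 E0 S0 S0' h1 h2.
set sigma := (1 - q) / (2 * (A + 1)).
have A1 : 0 < 2 * (A + 1) by lra.
have sg0 : 0 <= sigma by rewrite divr_ge0// ?(ltW A1)//; lra.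
have sgA : sigma * A <= (1 - q) / 2.
  rewrite /sigma mulrAC ler_pdivrMr//.
  have := mulr_ge0 (_ : 0 <= 1 - q) A0; rewrite subr_ge0 => /(_ (ltW q1)); lra.
clearbody sigma; set m := Num.max _ _.
have m1 : (1 + q) / 2 <= m by rewrite le_max lexx.
have m2 : 1 - th / 2 <= m by rewrite le_max lexx orbT.
clearbody m.
have e1 := ler_wpM2l sg0 h2.
have e2 := ler_wpM2r E0 sgA.
have e3 := ler_wpM2r E0 m1.
have e4 := ler_wpM2r (mulr_ge0 sg0 S0) m2.
lra.
Qed.

Lemma absorb (R : realType) (t r M X S Y Z W : R) : r < 1 -> X <= S + Y -> S <= r * X -> Y <= t * Z ->
  t * Z <= t * (M * W) -> X <= t * M / (1 - r) * W.
Proof.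
move=> r1 h1 h2 h3 h4; have r1' : 0 < 1 - r by rewrite subr_gt0.
have -> : t * M / (1 - r) * W = t * (M * W) / (1 - r) by field; rewrite gt_eqF.
rewrite ler_pdivlMr//; lra.
Qed.

Lemma norm3 (R : realType) (x y z : R) : `|x + y| + `|z| <= `|x| + `|y| + `|z|.
Proof. by have := ler_normD x y; lra. Qed.

Section Inverse.
Variables (R : realType) (n : nat) (eta : R).
Hypothesis eta0 : 0 < eta.
Implicit Types (v w z : R -> 'cV[R]_n) (a b s : R).
Variable K : R -> 'M[R]_n.
Hypothesis kK : ekernel eta K.
Let kT := trkernel_ekernel kK.
Variable c : R.
Hypothesis c0 : 0 < c.
Hypothesis hsym : forall (w : R) x, c * sqnorm x <= sqnorm (symbol K w *m x).
Notation th := (theta eta K c).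
Notation Mu := (kmass eta K).

(** In [relaxop] the identity part has coefficient [1 - theta]; by [smoothing] all
    convolutions together add at most [theta / 2] of the supremum and a multiple of the energy. *)
Lemma relaxop_wsup : exists2 A : R, 0 <= A & forall a v, subgrowth a v -> 2 * a <= eta ->
  wsup a (relaxop K th v) <= (1 - th / 2) * wsup a v + A * Num.sqrt (energy a v).
Proof.
have t0 : 0 < th by exact: theta0.
have t1 : th <= 1 by exact: theta1.
have M0 := kmass_ge0 eta K.
have e0 : 0 < 1 / (2 * (2 + Mu)) by rewrite divr_gt0//; lra.
have [C1 C10 h1] := smoothing eta0 kK e0.
have [C2 C20 h2] := smoothing eta0 kT e0.
set e := 1 / (2 * (2 + Mu)) in e0 h1 h2.
have ee : e * (2 + Mu) = 1 / 2 by rewrite /e; field; rewrite gt_eqF//; lra.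
clearbody e.
exists (C1 + C2 * (1 + Mu)); first by rewrite addr_ge0// mulr_ge0//; lra.
move=> a v hv ae; have hc := subgrowth_convol eta0 kK hv ae.
have [b [b0 ba gv]] := hv; have [be bae baae a0 ba0] := growth_abs b0 ba ae.
set E := Num.sqrt (energy a v); have E0 : 0 <= E by exact: sqrtr_ge0.
set S := wsup a v; have S0 : 0 <= S by exact: wsup_ge0.
have Ec : Num.sqrt (energy a (convol K v)) <= Mu * E.
  rewrite -[X in X * _]ger0_norm// -sqrtr_sqr -sqrtrM ?sqr_ge0//; apply: ler_wsqrtr.
  exact: (convol_energy eta0 kK gv be a0 ba baae).
have Sc : wsup a (convol K v) <= Mu * S.
  apply: wsup_le; first by rewrite mulr_ge0.
  have aa : `|a| <= eta by rewrite ger0_norm//; lra.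
  exact: (convol_bd eta0 kK (growth_mono (ltW ba) gv) aa (wsup_ub gv (ltW ba))).
apply: wsup_le.
  by rewrite addr_ge0// mulr_ge0//; [lra|rewrite addr_ge0// mulr_ge0//; lra].
move=> x i; rewrite (relaxopE eta0 kK th x gv be).
have k1 := h1 a v hv ae x i; have k2 := h2 a v hv ae x i; have k3 := h2 a _ hc ae x i.
have k0 := wsup_ub gv (ltW ba) x i.
rewrite -/S -/E in k0 k1 k2 k3.
rewrite !mxE.
have {k3} k3' : `|convol (trkernel K) (convol K v) x i 0| <= (C2 * (Mu * E) + e * (Mu * S)) * expR (a * `|x|).
  apply: (le_trans k3); rewrite ler_wpM2r ?expR_ge0//; apply: lerD; first by rewrite ler_wpM2l.
  by rewrite ler_wpM2l// ltW.
rewrite !mxE in k1 k2 k3'.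
set W := expR (a * `|x|) in k0 k1 k2 k3' *; have W0 : 0 <= W by exact: expR_ge0.
move: k0 k1 k2 k3'; move: (v x i 0) (Int _) (Int _) (Int _) => p1 p2 p3 p4 k0 k1 k2 k3.
clearbody W E S.
apply: (@le_trans _ _ ((1 - th) * `|p1| + th * (`|p4| + `|p3| + `|p2|))).
  apply: (le_trans (ler_normD _ _)); apply: lerD.
    by rewrite normrM ger0_norm// subr_ge0.
  rewrite normrM (ger0_norm (ltW t0)) ler_wpM2l ?(ltW t0)//.
  apply: (le_trans (ler_normB _ _)).
  exact: norm3.
have t1' : 0 <= 1 - th by rewrite subr_ge0.
have l1 := ler_wpM2l t1' k0.
have l2 := ler_wpM2l (ltW t0) (lerD (lerD k1 k2) k3).
apply: (le_trans (lerD l1 l2)).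
have -> : (1 - th) * (S * W) + th * ((C1 * E + e * S) * W + (C2 * E + e * S) * W + (C2 * (Mu * E) + e * (Mu * S)) * W)
  = (1 - th) * (S * W) + th * ((C1 + C2 * (1 + Mu)) * (E * W)) + th * (e * (2 + Mu) * (S * W)) by ring.
rewrite ee.
have A0 : 0 <= (C1 + C2 * (1 + Mu)) * (E * W).
  by rewrite mulr_ge0// ?mulr_ge0// addr_ge0// mulr_ge0//; lra.
have := ler_wpM2r A0 t1; rewrite mul1r.
move: t0 t1 => _ _; lra.
Qed.

Lemma relaxop_mixnorm : exists sigma a1 r : R, [/\ 0 < sigma, 0 < a1, 2 * a1 <= eta, 0 <= r < 1 &
  forall a v, subgrowth a v -> a <= a1 -> mixnorm sigma a (relaxop K th v) <= r * mixnorm sigma a v].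
Proof.
have t0 : 0 < th by exact: theta0.
have t1 : th <= 1 by exact: theta1.
have [a1 a10 [q /andP[q0 q1] [a1e hq]]] := relaxop_energy eta0 kK c0 hsym.
have [A A0 hA] := relaxop_wsup.
have sq1 : Num.sqrt q < 1 by rewrite -[ltRHS]sqrtr1 ltr_sqrt.
have sq0 : 0 <= Num.sqrt q by exact: sqrtr_ge0.
(* [sigma] and the rate are those of [combined_rate], for square roots of energies. *)
exists ((1 - Num.sqrt q) / (2 * (A + 1))), a1, (Num.max ((1 + Num.sqrt q) / 2) (1 - th / 2)).
split => //.
- by rewrite divr_gt0//; lra.
- rewrite le_max gt_max; apply/andP; split; first (apply/orP; left; lra).
  by apply/andP; split; move: t0 t1; lra.
move=> a v hv aa1; have ae : 2 * a <= eta by lra.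
have [b [b0 ba gv]] := hv.
apply: combined_rate => //.
- exact: wsup_ge0.
- exact: wsup_ge0.
- by rewrite -sqrtrM//; apply: ler_wsqrtr; exact: (hq a b).
- exact: hA.
Qed.

(** From [v = S v + theta T^t (T v)] and the contraction of [S]. *)
Lemma linop_inverse : exists sigma a1 r C : R, [/\ 0 < sigma, 0 < a1, 2 * a1 <= eta, 0 <= r < 1 /\ 0 <= C &
  (forall a v, subgrowth a v -> a <= a1 -> mixnorm sigma a (relaxop K th v) <= r * mixnorm sigma a v) /\
  (forall a v, subgrowth a v -> a <= a1 -> mixnorm sigma a v <= C * mixnorm sigma a (linop K v))].
Proof.
have t0 : 0 < th by exact: theta0.
have [sigma [a1 [r [sg0 a10 a1e /andP[r0 r1] hN]]]] := relaxop_mixnorm.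
have M0 := kmass_ge0 eta K.
exists sigma, a1, r, (th * (1 + Mu) / (1 - r)); split => //.
  split; first by rewrite r0.
  apply: divr_ge0; last by rewrite subr_ge0 ltW.
  by apply: mulr_ge0; [exact: ltW|rewrite addr_ge0].
split => // a v hv aa1; have ae : 2 * a <= eta by lra.
have h1 := hN a v hv aa1.
have hT := subgrowth_linop eta0 kK hv ae; have hTT := subgrowth_linop eta0 kT hT ae.
have hS : subgrowth a (relaxop K th v) by apply: subgrowth_sub => //; exact: subgrowth_scale.
have e : v = (fun x => relaxop K th v x + th *: linop (trkernel K) (linop K v) x).
  by apply/funext => x; rewrite /relaxop subrK.
have h2 := mixnorm_add sg0 hS (subgrowth_scale th hTT); rewrite -e in h2.
have h3 := mixnorm_scale sg0 th hTT; rewrite (ger0_norm (ltW t0)) in h3.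
have h4 := mixnorm_linop sg0 eta0 kT hT ae; rewrite kmass_trkernel in h4.
have h5 := ler_wpM2l (ltW t0) h4.
exact: (absorb r1 h2 h1 h3 h5).
Qed.

Lemma linop_inj : exists2 a1 : R, 0 < a1 & forall a v, subgrowth a v -> a <= a1 -> (forall x, linop K v x = 0) ->
  forall x, v x = 0.
Proof.
have [sigma [a1 [r [C [sg0 a10 a1e [_ C0] [_ hI]]]]]] := linop_inverse.
exists a1 => // a v hv aa1 h x.
have := hI a v hv aa1.
have -> : linop K v = (fun=> 0) by apply/funext.
have z : mixnorm sigma a (fun _ : R => 0 : 'cV[R]_n) = 0.
  rewrite /mixnorm /energy (@eq_Int _ _ (fun=> 0)); last first.
    by move=> y; rewrite scaler0 /sqnorm big1// => i _; rewrite mxE expr0n.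
  rewrite Int_0 sqrtr0 add0r.
  have -> : wsup a (fun _ : R => 0 : 'cV[R]_n) = 0.
    apply/eqP; rewrite eq_le wsup_ge0 andbT; apply: wsup_le => // y i.
    by rewrite mxE normr0 mul0r.
  by rewrite mulr0.
rewrite z mulr0 => N0.
have Nv : mixnorm sigma a v = 0 by apply/eqP; rewrite eq_le N0 mixnorm_ge0.
apply/colP => i; rewrite mxE; apply/eqP; rewrite -normr_le0.
by have := mixnorm_bd sg0 hv x i; rewrite Nv mul0r mul0r.
Qed.
End Inverse.

(** * The Riemann-Lebesgue lemma and uniform invertibility *)

Section RiemannLebesgue.
Variable R : realType.
Notation mu := (@lebesgue_measure R).
Implicit Types f p : R -> R.

Lemma seg_bound f (a b : R) : continuous f -> exists2 B : R, 0 <= B & forall x, a <= x <= b -> `|f x| <= B.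
Proof.
move=> cf; case: (leP a b) => ab; last first.
  by exists 0 => // x /andP[ax xb]; have := le_trans ax xb; rewrite leNgt ab.
have cn : continuous (fun x : R => `|f x|) by cont.
have [c _ hc] := EVT_max ab (continuous_subspaceT cn).
by exists `|f c| => // x hx; apply: hc; rewrite in_itv.
Qed.

Definition hat (N x : R) : R := Num.max 0 (Num.min 1 (N + 1 - `|x|)).

Lemma hat_cont N : continuous (hat N).
Proof.
apply: (contf_eq (f := fun x : R => (0 + (1 + (N + 1 - `|x|) - `|1 - (N + 1 - `|x|)|) / 2 +
   `|0 - (1 + (N + 1 - `|x|) - `|1 - (N + 1 - `|x|)|) / 2|) / 2)); last by cont.
by move=> x; rewrite /hat maxr_absE minr_absE.
Qed.

Lemma hat01 N x : 0 <= hat N x <= 1.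
Proof.
rewrite /hat le_max lexx/= ge_max ler01/= ge_min lexx//.
Qed.

Lemma hat_in N x : `|x| <= N -> hat N x = 1.
Proof. by move=> h; rewrite /hat min_l ?max_r//; lra. Qed.

Lemma hat_out N x : N + 1 <= `|x| -> hat N x = 0.
Proof. by move=> h; rewrite /hat min_r ?max_l//; lra. Qed.

Lemma rl_compact p (N : R) : 0 <= N -> continuous p -> (forall x, N <= `|x| -> p x = 0) ->
  Int (fun x => p x * cos (w * x)) @[w --> +oo] --> (0 : R).
Proof.
move=> N0 cp possin.
have [B B0 hB] := seg_bound (- N) N cp.
have bp x : `|p x| <= B.
  case: (leP `|x| N) => h; first by apply: hB; rewrite -ler_norml.
  by rewrite possin ?normr0// ltW.
pose d h := Int (fun x => `|p x - p (x - h)|).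
have ip h : itg (fun x => p (x - h)).
  apply: (@itg_le _ _ (fun x => B * ind (- (N + `|h|)) (N + `|h|) x)).
  - by apply: cont_meas; cont.
  - by apply: itgZ; exact: itg_ind.
  - move=> x; rewrite /ind; case: (leP (`|x - h|) N) => hx.
      have : `|x| <= N + `|h| by rewrite -[x](subrK h); apply: (le_trans (ler_normD _ _)); rewrite lerD2r.
      by rewrite ler_norml => ->; rewrite mulr1.
    by rewrite possin ?normr0 ?mulr_ge0// ltW.
have ip0 : itg p by apply: eq_itg (ip 0) => x; rewrite subr0.
have dc : d h @[h --> (0:R)] --> (0 : R).
  have d0 : (0 : R) = d 0 by rewrite /d -[LHS](Int_0 R); apply: eq_Int => x; rewrite subr0 subrr normr0.
  rewrite [X in _ --> X]d0.
  apply: (@Int_cont _ _ 0 1 (fun x => 2 * B * ind (- (N + 1)) (N + 1) x)) => //.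
  - by move=> h _; apply: itg_abs; exact: itgB.
  - by move=> x; cont.
  - by apply: itgZ; exact: itg_ind.
  move=> h x; rewrite subr0 => h1; rewrite normr_id /ind.
  case: (leP (`|x|) (N + 1)) => hx.
    move: (hx); rewrite ler_norml => ->; rewrite mulr1.
    by apply: (le_trans (ler_normB _ _)); have := bp x; have := bp (x - h); lra.
  have hx' : N <= `|x - h| by have := lerB_normD x (- h); rewrite normrN; lra.
  by rewrite possin ?(possin (x - h)) ?subrr ?normr0 ?mulr_ge0//; lra.
have hpi : pi / w @[w --> +oo] --> (0 : R).
  apply/cvgr0Pnorm_le => e e0; near=> w.
  have w0 : 0 < w by near: w; exact: nbhs_pinfty_gt.
  rewrite ger0_norm ?divr_ge0 ?pi_ge0 ?(ltW w0)// (ler_pdivrMr _ _ w0) mulrC -(ler_pdivrMr _ _ e0).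
  by near: w; apply: nbhs_pinfty_ge; exact: num_real.
have := cvg_comp _ _ hpi dc => {}dc.
apply/cvgr0Pnorm_le => e e0.
have /cvgr0Pnorm_le/(_ _ e0) := dc => {}dc.
near=> w.
have w0 : 0 < w by near: w; exact: nbhs_pinfty_gt.
have ic h : itg (fun x => p (x - h) * cos (w * x)).
  by apply: eq_itg (itg_cosp w 0 (ip h)) => x; rewrite subr0.
have ic0 : itg (fun x => p x * cos (w * x)) by apply: eq_itg (ic 0) => x; rewrite subr0.
have E : Int (fun x => p x * cos (w * x)) = - Int (fun x => p (x - pi / w) * cos (w * x)).
  rewrite -(Int_shift (- (pi / w)) ic0) -Int_N//; apply: eq_Int => x.
  rewrite (addrC _ x) -[RHS]mulrN; congr (_ * _).
  have -> : w * x = w * (x - pi / w) + pi by field; rewrite gt_eqF.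
  by rewrite cosDpi opprK.
have E2 : Int (fun x => p x * cos (w * x)) * 2 = Int (fun x => p x * cos (w * x) - p (x - pi / w) * cos (w * x)).
  by rewrite Int_B// mulr_natr mulr2n {2}E.
have h2 : `|Int (fun x => p x * cos (w * x))| * 2 <= d (pi / w).
  rewrite -[X in _ * X](ger0_norm (_ : 0 <= 2))// -normrM E2.
  apply: Int_abs_le; [exact: itgB|by apply: itg_abs; exact: itgB|] => x.
  by rewrite -mulrBl normrM ler_piMr// cos_max.
have : `|d (pi / w)| <= e by near: w.
have := ler_norm (d (pi / w)).
have := normr_ge0 (Int (fun x => p x * cos (w * x))).
move: `|Int _| h2 => I h2; lra.
Unshelve. all: by end_near. Qed.

(** Approximate on a segment, then multiply by the trapezoidal cut-off [hat]. *)
Lemma L1_approx f (e : R) : itg f -> 0 < e -> exists (p : R -> R) (N : R), [/\ 0 <= N, continuous p,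
  forall x, N <= `|x| -> p x = 0 & itg (fun x => f x - p x) /\ Int (fun x => `|f x - p x|) <= e].
Proof.
move=> jf e0.
have [k hk] : exists k : nat, Int (fun x => `|f x| * (1 - hat k%:R x)) <= e / 2.
  have : Int (fun x => `|f x| * (1 - hat k%:R x)) @[k --> \oo] --> Int (fun _ : R => 0 : R).
    apply: (Int_dcvg _ _ (itg_abs jf)).
    - move=> k; apply: measM; first by apply: itg_meas; exact: itg_abs.
      by apply: cont_meas; have := @hat_cont k%:R => ?; cont.
    - exact: cont_meas (@cont_cst R 0).
    - move=> k y; rewrite normrM normr_id ler_piMr//.
      by have /andP[? ?] := hat01 k%:R y; rewrite ger0_norm; lra.
    - move=> y; apply: cvg_near_cst; near=> k.
      rewrite hat_in ?subrr ?mulr0//; near: k; exact: nbhs_infty_ger.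
  have e2 : 0 < e / 2 by lra.
  by rewrite Int_0 => /cvgr_le /(_ _ e2)[k _ hk]; exists k; exact: (hk k (leqnn k)).
have k0 : (0:R) <= k%:R by [].
set N : R := k%:R in hk k0.
have mE : (mu `[(- (N + 1))%R, (N + 1)%R]%classic < +oo)%E.
  by rewrite lebesgue_measure_itv/=; case: ifP => _; rewrite ?ltry// -EFinD ltry.
have [//|//||g [cg ig hg]] := @approximation_continuous_integrable R `[(- (N + 1)), (N + 1)]%classic f.
  apply/itg_segE; apply: (itg_le _ (itg_abs jf)).
    by apply: measM; [exact: itg_meas (itg_ind _ _)|exact: itg_meas].
  by move=> x; rewrite normrM ler_piMl// ger0_norm ?ind_ge0// ind_le1.
have [m hm] : exists m, Int (fun x => ind (- (N + 1)) (N + 1) x * `|f x - g m x|) <= e / 2.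
  have [_ /cvgr0Pnorm_le/(_ (e / 2))] := (fine_cvgP _ _).1 hg.
  case; first by lra.
  move=> m _ /(_ m (leqnn m)) h; exists m.
  apply: le_trans h; rewrite Int_seg /Rintegral; exact: ler_norm.
exists (fun x => g m x * hat N x), (N + 1); split.
- by lra.
- by have h1 := @hat_cont N; have h2 := cg m; cont.
- by move=> x hx; rewrite hat_out// mulr0.
have h1 := @hat_cont N; have h2 : contf (g m) := cg m.
have j1 : itg (fun x => g m x * hat N x).
  apply: (@itg_le _ _ (fun x => ind (- (N + 1)) (N + 1) x * `|g m x|)).
  - by apply: cont_meas; cont.
  - apply: itg_seg; cont.
  - move=> x; rewrite normrM mulrC; apply: ler_wpM2r => //.
    have /andP[z0 z1] := hat01 N x; rewrite ger0_norm// /ind -ler_norml.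
    by case: (leP `|x| (N + 1)) => // hx; rewrite hat_out// ltW.
split; first exact: itgB.
have j2 : itg (fun x => `|f x| * (1 - hat N x)).
  apply: (@itgM_bnd _ _ _ 1 (itg_abs jf)).
    by apply: cont_meas; cont.
  by move=> x; have /andP[? ?] := hat01 N x; rewrite ger0_norm; lra.
have j3 : itg (fun x => ind (- (N + 1)) (N + 1) x * `|f x - g m x|).
  apply: (@eq_itg _ (fun x => `|ind (- (N + 1)) (N + 1) x * f x - ind (- (N + 1)) (N + 1) x * g m x|)).
    by move=> x; rewrite -mulrBr normrM (ger0_norm (ind_ge0 _ _ _)).
  apply: itg_abs; apply: itgB; last exact: itg_seg.
  apply: (itg_le _ (itg_abs jf)).
    by apply: measM; [exact: itg_meas (itg_ind _ _)|exact: itg_meas].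
  by move=> x; rewrite normrM ler_piMl// ger0_norm ?ind_ge0// ind_le1.
rewrite (splitr e); apply: (le_trans _ (lerD hk hm)); rewrite -Int_D//.
apply: Int_le; [by apply: itg_abs; exact: itgB|exact: itgD|] => x.
have /andP[z0 z1] := hat01 N x.
have -> : f x - g m x * hat N x = f x * (1 - hat N x) + (f x - g m x) * hat N x by ring.
apply: (le_trans (ler_normD _ _)); rewrite !normrM (ger0_norm (_ : 0 <= 1 - _)) ?subr_ge0//.
rewrite lerD2l mulrC; apply: ler_wpM2r => //; rewrite ger0_norm// /ind -ler_norml.
by case: (leP `|x| (N + 1)) => // hx; rewrite hat_out// ltW.
Unshelve. all: by end_near. Qed.

(** Continuous functions of compact support are dense in L1, and for these shifting the
    argument by half a wavelength changes the sign of the cosine. *)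
Lemma riemann_lebesgue f : itg f -> Int (fun x => f x * cos (w * x)) @[w --> +oo] --> (0 : R).
Proof.
move=> jf; apply/cvgr0Pnorm_le => e e0; have e2 : 0 < e / 2 by lra.
have [p [N [N0 cp possin [ifp hfp]]]] := L1_approx jf e2.
have ip : itg p by apply: eq_itg (itgB jf ifp) => x; rewrite opprB addrC subrK.
have /cvgr0Pnorm_le/(_ _ e2) := rl_compact N0 cp possin.
apply: filterS => w hw.
have cc g : itg g -> itg (fun x => g x * cos (w * x)).
  by move=> ig; apply: eq_itg (itg_cosp w 0 ig) => x; rewrite subr0.
have -> : Int (fun x => f x * cos (w * x)) = Int (fun x => (f x - p x) * cos (w * x)) + Int (fun x => p x * cos (w * x)).
  by rewrite -Int_D; [apply: eq_Int => x; ring|exact: cc|exact: cc].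
rewrite [e]splitr; apply: (le_trans (ler_normD _ _)); apply: lerD => //.
apply: le_trans hfp; apply: Int_abs_le; [exact: cc|exact: itg_abs|] => x.
by rewrite normrM ler_piMr// cos_max.
Qed.

End RiemannLebesgue.

Section Det.
Variable R : realType.

Lemma cvg_det n (T : Type) (F : set_system T) (FF : Filter F) (M : T -> 'M[R]_n) (A : 'M[R]_n) :
  (forall i j, M x i j @[x --> F] --> A i j) -> \det (M x) @[x --> F] --> \det A.
Proof.
move=> h; rewrite /determinant; apply: cvg_big => [|s _].
  exact: add_continuous.
apply: cvgMr; apply: cvg_big => [|i _]; last exact: h.
exact: mul_continuous.
Qed.

Lemma det_bnd n (M : 'M[R]_n) (B : R) : 0 <= B -> (forall i j, `|M i j| <= B) ->
  `|\det M| <= (n`!)%:R * B ^+ n.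
Proof.
move=> B0 h; apply: (le_trans (ler_norm_sum _ _ _)).
have -> : (n`!)%:R * B ^+ n = \sum_(s : {perm 'I_n}) B ^+ n.
  by rewrite sumr_const card_Sn mulr_natl.
apply: ler_sum => s _; rewrite normrM normrX normrN1 expr1n mul1r normr_prod.
rewrite -[X in _ ^+ X]card_ord -prodr_const; apply: ler_prod => i _; by rewrite normr_ge0 h.
Qed.

Lemma adj_bnd n (M : 'M[R]_n) (B : R) i j : 0 <= B -> (forall i j, `|M i j| <= B) ->
  `|(\adj M) i j| <= ((n.-1)`!)%:R * B ^+ n.-1.
Proof.
move=> B0 h; rewrite mxE /cofactor normrM normrX normrN1 expr1n mul1r.
by apply: det_bnd => // k l; rewrite !mxE.
Qed.
End Det.

Section Lower.
Variables (R : realType) (n : nat) (eta : R).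
Hypothesis eta0 : 0 < eta.
Variable K : R -> 'M[R]_n.
Hypothesis kK : ekernel eta K.

Lemma symbol_cvg_pinfty i j : symbol K w i j @[w --> +oo] --> (- 1%:M : 'M[R]_n) i j.
Proof.
rewrite -[X in _ --> X]addr0; under eq_fun do rewrite mxE; apply: cvgD; first exact: cvg_cst.
by under eq_fun do rewrite mxE; exact: riemann_lebesgue (ekernel_itg eta0 kK i j).
Qed.

Lemma cosft_cont i j : continuous (fun w => cosft K w i j).
Proof.
apply: (contf_eq (f := fun w => Int (fun y => K y i j * cos (w * y)))); first by move=> w; rewrite mxE.
move=> w; apply: (@Int_cont _ (fun w y => K y i j * cos (w * y)) w 1 (fun y => `|K y i j|)) => //.
- by move=> x _; apply: eq_itg (itg_cosp x 0 (ekernel_itg eta0 kK i j)) => y; rewrite subr0.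
- by move=> y; cont.
- by apply: itg_abs; exact: (ekernel_itg eta0 kK).
- by move=> x y _; rewrite normrM ler_piMr// cos_max.
Qed.

Lemma symbol_cont i j : continuous (fun w => symbol K w i j).
Proof.
apply: (contf_eq (f := fun w => (- 1%:M : 'M[R]_n) i j + cosft K w i j)); first by move=> w; rewrite [in RHS]mxE.
by have h : contf _ := @cosft_cont i j; cont.
Qed.

Lemma symN w : symbol K (- w) = symbol K w.
Proof.
by congr (_ + _); apply/matrixP => i j; rewrite !mxE; apply: eq_Int => y; rewrite mulNr cosN.
Qed.

Hypothesis inv : forall w, \det (symbol K w) != 0.

(** The determinant tends to [+- 1] at infinity and does not vanish on the compact remainder. *)
Lemma det_lower : exists2 m : R, 0 < m & forall w, m <= `|\det (symbol K w)|.
Proof.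
have h1 : \det (symbol K w) @[w --> +oo] --> \det (- 1%:M : 'M[R]_n) by apply: cvg_det; exact: symbol_cvg_pinfty.
have := cvg_norm h1; rewrite -scaleN1r detZ det1 mulr1 normrX normrN1 expr1n => h2.
have [W [_ hW]] : \forall w \near +oo, 1 / 2 <= `|\det (symbol K w)|.
  by have h3 := h2 proper_pinfty_nbhs; have := cvgr_ge _ h3; apply; lra.
pose W1 := Num.max W 0 + 1.
have W10 : 0 <= W1 by rewrite addr_ge0// le_max lexx orbT.
have cD : continuous (fun w => `|\det (symbol K w)|).
  move=> w; apply: cvg_norm; apply: cvg_det => i j; exact: symbol_cont.
have [c _ hc] := EVT_min W10 (continuous_subspaceT cD).
have c0 : 0 < `|\det (symbol K c)| by rewrite normr_gt0.
exists (Num.min (1/2) `|\det (symbol K c)|); first by rewrite lt_min c0 andbT; lra.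
have key w : 0 <= w -> Num.min (1/2) `|\det (symbol K c)| <= `|\det (symbol K w)|.
  move=> w0; rewrite ge_min; case: (leP w W1) => hw; apply/orP; [right|left].
    by apply: hc; rewrite in_itv/= w0.
  apply: hW; apply: le_lt_trans hw; rewrite /W1; have : W <= Num.max W 0 by rewrite le_max lexx.
  lra.
move=> w; case: (leP 0 w) => hw; first exact: key.
by rewrite -(symN w); apply: key; lra.
Qed.

(** The symbol tends to [- I] at infinity, so invertibility at every frequency is uniform; the
    adjugate turns the bound on the determinant into one on [M x]. *)
Lemma symbol_lower : exists2 c : R, 0 < c & forall w x, c * sqnorm x <= sqnorm (symbol K w *m x).
Proof.
have [m m0 hm] := det_lower.
have M0 := kmass_ge0 eta K.
set B := ((n.-1)`!)%:R * (1 + kmass eta K) ^+ n.-1.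
have B0 : 0 <= B by rewrite mulr_ge0// exprn_ge0//; lra.
set C := (n%:R * (n%:R * B)) ^+ 2.
have C0 : 0 <= C by exact: sqr_ge0.
exists (m ^+ 2 / (C + 1)); first by rewrite divr_gt0 ?exprn_gt0//; lra.
move=> w x.
have h : sqnorm (\adj (symbol K w) *m (symbol K w *m x)) <= C * sqnorm (symbol K w *m x).
  apply: mulmx_sqnorm_bnd => // i j; apply: adj_bnd; first lra.
  by move=> k l; exact: symbol_bnd.
rewrite mulmxA mul_adj_mx mul_scalar_mx sqnZ in h.
have h2 : m ^+ 2 * sqnorm x <= \det (symbol K w) ^+ 2 * sqnorm x.
  by apply: ler_wpM2r; rewrite ?sqnorm_ge0// -[leRHS]real_normK ?num_real// lerXn2r ?nnegrE ?(ltW m0).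
have h3 := sqnorm_ge0 (symbol K w *m x).
rewrite mulrAC ler_pdivrMr; last lra.
move: h h2 h3; clearbody C; lra.
Qed.
End Lower.

(** * The scalar equations s'' + w^2 s = g and p'' = p + f *)

Definition sgrowth (R : realType) (b : R) (f : R -> R) :=
  contf f /\ exists2 C, 0 <= C & forall x, `|f x| <= C * expR (b * `|x|).
(** The solution of [s'' + w^2 s = g] with [s(0) = s'(0) = 0], by variation of constants. *)
Definition sineint (R : realType) (w : R) (g : R -> R) (x : R) : R :=
  w^-1 * (sin (w * x) * prim (fun y => cos (w * y) * g y) x - cos (w * x) * prim (fun y => sin (w * y) * g y) x).
Definition sineintD (R : realType) (w : R) (g : R -> R) (x : R) : R :=
  cos (w * x) * prim (fun y => cos (w * y) * g y) x + sin (w * x) * prim (fun y => sin (w * y) * g y) x.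

Section ODE.
Variables (R : realType) (w : R).
Hypothesis w0 : 0 < w.
Implicit Types (f g h : R -> R) (a b : R).

Lemma sgrowth_add b f g : sgrowth b f -> sgrowth b g -> sgrowth b (fun x => f x + g x).
Proof.
move=> [cf [C C0 h]] [cg [C' C0' h']]; split; first by cont.
exists (C + C'); first exact: addr_ge0.
by move=> x; rewrite mulrDl; apply: (le_trans (ler_normD _ _)); exact: lerD.
Qed.

Lemma sgrowth_scale b (c : R) f : sgrowth b f -> sgrowth b (fun x => c * f x).
Proof.
move=> [cf [C C0 h]]; split; first by cont.
exists (`|c| * C); first exact: mulr_ge0.
by move=> x; rewrite normrM -mulrA ler_wpM2l.
Qed.

Lemma sgrowth_bounded b (B : R) f : 0 <= b -> contf f -> (forall x, `|f x| <= B) -> sgrowth b f.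
Proof.
move=> b0 cf h; split => //; exists `|B| => // x; apply: (le_trans (h x)).
apply: (le_trans (ler_norm B)); rewrite ler_peMr//.
by rewrite -expR0 ler_expR mulr_ge0.
Qed.

Lemma prim_FTC F f : D1 F f -> contf f -> forall x, prim f x = F x - F 0.
Proof.
move=> dF cf x; rewrite /prim; case: (leP 0 x) => x0.
  by rewrite (FTC_seg x0 dF cf); move: x0; rewrite le_eqVlt => /predU1P[<-|/seg_empty->]; rewrite ?seg_point ?subr0.
by rewrite (seg_empty _ x0) (FTC_seg (ltW x0) dF cf) sub0r opprB.
Qed.

(** For [t] between 0 and [x] one has [|x| = |t| + |x - t|]: the weight splits, and the primitive
    is dominated by a convolution with [exp(- a |.|)]. *)
Lemma prim_weighted a h (C : R) : 0 < a -> contf h -> (forall y, `|h y| <= C * expR (a * `|y|)) -> forall x,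
  itg (fun y => expR (- (a * `|y|)) * (expR (- a * `|x - y|) * `|h (x - y)|)) /\
  expR (- a * `|x|) * `|prim h x| <= Int (fun y => expR (- (a * `|y|)) * (expR (- a * `|x - y|) * `|h (x - y)|)).
Proof.
move=> a0 ch hC x.
pose P y := expR (- a * `|x - y|) * (expR (- a * `|y|) * `|h y|).
have iP : itg P.
  apply: (@itg_le _ _ (fun y => C * expR (- (a * `|x - y|)))).
  - by apply: cont_meas; rewrite /P; cont.
  - by apply: itgZ; exact: (itg_refl x (itg_exp a0)).
  - move=> y; rewrite /P ger0_norm ?mulr_ge0 ?expR_ge0// mulrC !mulNr ler_wpM2r ?expR_ge0//.
    rewrite expRN ler_pdivrMl ?expR_gt0// mulrC; exact: hC.
have PE y : P (x - y) = expR (- (a * `|y|)) * (expR (- a * `|x - y|) * `|h (x - y)|).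
  by rewrite /P opprB addrCA subrr addr0 mulNr.
have iP2 := itg_refl x iP; have IP := Int_refl x iP.
split; first exact: eq_itg iP2.
rewrite -(eq_Int PE) IP.
have seg u v : u <= v -> (u = 0 /\ v = x \/ u = x /\ v = 0) ->
  expR (- a * `|x|) * `|Int (fun y => ind u v y * h y)| <= Int P.
  move=> uv e; rewrite -[X in X * _]ger0_norm ?expR_ge0// -normrM -Int_Z; last exact: itg_seg.
  apply: Int_abs_le => //; first by apply: itgZ; exact: itg_seg.
  move=> y; rewrite !normrM (ger0_norm (expR_ge0 _)) (ger0_norm (ind_ge0 _ _ _)) /P /ind.
  case: (boolP (u <= y <= v)) => hy; last by rewrite mul0r mulr0 !mulr_ge0 ?expR_ge0.
  rewrite mul1r mulrA -expRD ler_wpM2r// ler_expR -mulrDr.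
  rewrite (_ : `|x| = `|x - y| + `|y|)//.
  move: hy => /andP[h1 h2]; case: e => -[e1 e2]; rewrite e1 e2 in uv h1 h2.
    by rewrite !ger0_norm ?subr_ge0// subrK.
  rewrite !ler0_norm ?subr_le0//; ring.
rewrite /prim; case: (leP 0 x) => x0.
  have -> : Int (fun y => ind x 0 y * h y) = 0.
    by move: x0; rewrite le_eqVlt => /predU1P[<-|/seg_empty->//]; rewrite seg_point.
  by rewrite subr0; apply: seg => //; left.
by rewrite (seg_empty _ x0) sub0r normrN; apply: seg; [exact: ltW|right].
Qed.

Section One.
Variable g : R -> R.
Hypothesis cg : contf g.

Lemma cont_cosg : contf (fun y => cos (w * y) * g y). Proof. by cont. Qed.
Lemma cont_sing : contf (fun y => sin (w * y) * g y). Proof. by cont. Qed.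

Lemma sineint_D1 : D1 (sineint w g) (sineintD w g).
Proof.
have d1 := prim_derive cont_cosg; have d2 := prim_derive cont_sing.
rewrite /sineint; apply: D1_eq; first by der.
by move=> x /=; rewrite /sineintD; field; rewrite gt_eqF.
Qed.

Lemma sineintD_D1 : D1 (sineintD w g) (fun x => g x - w ^+ 2 * sineint w g x).
Proof.
have d1 := prim_derive cont_cosg; have d2 := prim_derive cont_sing.
rewrite /sineintD; apply: D1_eq; first by der.
move=> x /=; rewrite /sineint; have e := cos2Dsin2 (w * x).
transitivity (g x * (cos (w * x) ^+ 2 + sin (w * x) ^+ 2) - w ^+ 2 * (w^-1 *
  (sin (w * x) * prim (fun y : R => cos (w * y) * g y) x - cos (w * x) * prim (fun y : R => sin (w * y) * g y) x))).
  by field; rewrite gt_eqF.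
by rewrite e mulr1.
Qed.

Lemma sineint_cont : contf (sineint w g).
Proof. exact: is_derive_cont sineint_D1. Qed.

Lemma sg0 : sineint w g 0 = 0.
Proof. by rewrite /sineint !prim0 !mulr0 subr0 mulr0. Qed.

Lemma sineint_even : (forall x, g (- x) = g x) -> forall x, sineint w g (- x) = sineint w g x.
Proof.
move=> eg x; rewrite /sineint mulrN sinN cosN.
rewrite (prim_even cont_cosg); last by move=> y; rewrite mulrN cosN eg.
by rewrite (prim_odd cont_sing) ?mulrNN// => y; rewrite mulrN sinN eg mulNr.
Qed.

Lemma sineint_weighted a (C : R) : 0 < a -> (forall y, `|g y| <= C * expR (a * `|y|)) -> forall x,
  expR (- a * `|x|) * `|sineint w g x| <= 2 / w * Int (fun y => expR (- (a * `|y|)) * (expR (- a * `|x - y|) * `|g (x - y)|)).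
Proof.
move=> a0 hC x.
set I := Int _.
have key h : contf h -> (forall y, `|h y| <= `|g y|) -> expR (- a * `|x|) * `|prim h x| <= I.
  move=> ch hg; have hb y : `|h y| <= C * expR (a * `|y|) by exact: le_trans (hg y) _.
  have [i1 b1] := prim_weighted a0 ch hb x; have [i2 _] := prim_weighted a0 cg hC x.
  apply: (le_trans b1); apply: Int_le => // y.
  by rewrite !ler_wpM2l ?expR_ge0.
have k1 : expR (- a * `|x|) * `|prim (fun y => cos (w * y) * g y) x| <= I.
  by apply: key; [exact: cont_cosg|move=> y; rewrite normrM ler_piMl// cos_max].
have k2 : expR (- a * `|x|) * `|prim (fun y => sin (w * y) * g y) x| <= I.
  by apply: key; [exact: cont_sing|move=> y; rewrite normrM ler_piMl// sin_max].
rewrite /sineint; move: k1 k2; move: (prim _ x) (prim _ x) => q p k1 k2.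
rewrite normrM ger0_norm ?invr_ge0 ?(ltW w0)// mulrCA (mulrC 2) -mulrA ler_wpM2l ?invr_ge0 ?(ltW w0)//.
apply: (@le_trans _ _ (expR (- a * `|x|) * (`|p| + `|q|))).
  rewrite ler_wpM2l ?expR_ge0//; apply: (le_trans (ler_normB _ _)); rewrite !normrM; apply: lerD.
    by rewrite ler_piMl// sin_max.
  by rewrite ler_piMl// cos_max.
by rewrite mulrDr; move: k1 k2; lra.
Qed.

Lemma sineint_sup a (C : R) : 0 < a -> (forall y, `|g y| <= C * expR (a * `|y|)) -> forall x,
  `|sineint w g x| <= 2 / w * (Int (fun y => expR (- (a * `|y|))) * C) * expR (a * `|x|).
Proof.
move=> a0 hC x.
rewrite -(ler_pdivrMr _ _ (expR_gt0 _)) -expRN -mulNr mulrC.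
apply: (le_trans (sineint_weighted a0 hC x)).
rewrite ler_wpM2l ?divr_ge0 ?(ltW w0)// -Int_Zr; last exact: itg_exp.
have [i _] := prim_weighted a0 cg hC x.
apply: Int_le => //; first by apply: itgZr; exact: itg_exp.
move=> y; rewrite ler_wpM2l ?expR_ge0// mulNr expRN ler_pdivrMl ?expR_gt0// mulrC; exact: hC.
Qed.
End One.

Lemma sineint_sgrowth b g : 0 < b -> sgrowth b g -> sgrowth b (sineint w g).
Proof.
move=> b0 [cg [C C0 h]]; split; first exact: sineint_cont.
exists (2 / w * (Int (fun y => expR (- (b * `|y|))) * C)); last exact: sineint_sup.
by rewrite !mulr_ge0 ?invr_ge0 ?(ltW w0)//; apply: Int_ge0 => y; exact: expR_ge0.
Qed.

(** Uniqueness of the Cauchy problem: [p] minus its homogeneous part solves it. *)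
Lemma sineint_var p p1 p2 : D1 p p1 -> D1 p1 p2 -> contf p2 -> forall x,
  sineint w (fun y => p2 y + w ^+ 2 * p y) x = p x - p 0 * cos (w * x) - p1 0 / w * sin (w * x).
Proof.
move=> d1 d2 c2 x.
have c0 : contf p := is_derive_cont d1; have c1 : contf p1 := is_derive_cont d2.
have dc : D1 (fun y => cos (w * y) * p1 y + w * sin (w * y) * p y) (fun y => cos (w * y) * (p2 y + w ^+ 2 * p y)).
  by apply: D1_eq; [der|move=> y /=; ring].
have ds : D1 (fun y => sin (w * y) * p1 y - w * cos (w * y) * p y) (fun y => sin (w * y) * (p2 y + w ^+ 2 * p y)).
  by apply: D1_eq; [der|move=> y /=; ring].
rewrite /sineint (prim_FTC dc); last by cont.
rewrite (prim_FTC ds); last by cont.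
rewrite mulr0 cos0 sin0; have e := cos2Dsin2 (w * x).
transitivity (p x * (cos (w * x) ^+ 2 + sin (w * x) ^+ 2) - p 0 * cos (w * x) - p1 0 / w * sin (w * x)).
  by field; rewrite gt_eqF.
by rewrite e mulr1.
Qed.

Lemma half_meas : measurable_fun setT (fun y : R => ((0 <= y)%R : bool)%:R : R).
Proof.
have mb : measurable_fun [set: measurableTypeR R] (fun y : R => (0 <= y)%R).
  by apply: measurable_fun_ler => //; exact: (cont_meas (@cont_id R)).
by apply: (measurableT_comp (f := fun b : bool => b%:R : R)).
Qed.

(** The kink of [exp(- |x - y|)] at [y = x], rewritten with indicator functions; off the segment
    between 0 and [x] the two exponentials separate. *)
Lemma split_pos (x y f : R) : 0 <= x -> let hp : R := ((0 <= y)%R : bool)%:R in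
  expR (- `|x - y|) * f = (expR x * (hp * (expR (- y) * f)) - expR x * (ind 0 x y * (expR (- y) * f))) +
      (expR (- x) * ((1 - hp) * (expR y * f)) + expR (- x) * (ind 0 x y * (expR y * f))).
Proof.
move=> x0 /=; rewrite /ind.
case: (leP 0 y) => y0 /=; rewrite ?mulr1n ?mulr0n; last first.
  by rewrite ger0_norm; [rewrite opprB expRD; ring|lra].
case: (leP y x) => yx /=; rewrite ?mulr1n ?mulr0n.
  by rewrite ger0_norm; [rewrite opprB expRD; ring|lra].
by rewrite ltr0_norm; [rewrite opprK expRD; ring|lra].
Qed.

(** The point 0 belongs to both half-lines, hence the two correction terms supported there. *)
Lemma split_neg (x y f : R) : x < 0 -> let hp : R := ((0 <= y)%R : bool)%:R in
  expR (- `|x - y|) * f = ((expR x * (hp * (expR (- y) * f)) + expR x * (ind x 0 y * (expR (- y) * f))) +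
    (expR (- x) * ((1 - hp) * (expR y * f)) - expR (- x) * (ind x 0 y * (expR y * f)))) -
    (expR x * (ind 0 0 y * (expR (- y) * f)) - expR (- x) * (ind 0 0 y * (expR y * f))).
Proof.
move=> x0 /=; rewrite /ind.
case: (ltrgt0P y) => y0 /=; rewrite ?andbF ?andbT /= ?mulr1n ?mulr0n.
- by rewrite ltr0_norm; [rewrite opprK expRD; ring|lra].
- case: (leP x y) => xy /=; rewrite ?mulr1n ?mulr0n.
    by rewrite ler0_norm; [rewrite opprK expRD; ring|lra].
  by rewrite gtr0_norm; [rewrite opprB expRD; ring|lra].
- by rewrite y0 (ltW x0) subr0 ltr0_norm// opprK oppr0 expR0 ?mulr1n; ring.
Qed.

(** [p = - (1/2) exp(- |.|) * f].  The kernel has a kink, so the convolution is split at [0] and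
    [x] into primitives, which are then differentiated by the product rule. *)
Lemma resolvent b (f : R -> R) : 0 <= b -> b < 1 -> sgrowth b f ->
  exists p p1 : R -> R, [/\ D1 p p1, D1 p1 (fun x => p x + f x) & sgrowth b p].
Proof.
move=> b0 b1 [cf [C C0 hC]].
have c1 : 0 < 1 - b by lra.
pose fm y := expR (- y) * f y; pose phaseft y := expR y * f y.
have cfm : contf fm by rewrite /fm; cont.
have cfp : contf phaseft by rewrite /phaseft; cont.
pose hp (y : R) : R := ((0 <= y)%R : bool)%:R; pose hm (y : R) : R := 1 - hp y.
have ie x : itg (fun y => expR (- `|x - y|) * f y).
  apply: (@itg_le _ _ (fun y => C * expR (b * `|x|) * expR (- ((1 - b) * `|x - y|)))).
  - by apply: cont_meas; cont.
  - by apply: itgZ; exact: (itg_refl x (itg_exp c1)).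
  - move=> y; rewrite normrM ger0_norm ?expR_ge0//.
    apply: (@le_trans _ _ (expR (- `|x - y|) * (C * expR (b * `|y|)))).
      by rewrite ler_wpM2l ?expR_ge0.
    rewrite mulrCA -!mulrA ler_wpM2l// -!expRD ler_expR.
    have := ler_normB x (x - y); rewrite opprB addrCA subrr addr0 => h.
    have := ler_wpM2l b0 h; lra.
have ip : itg (fun y => hp y * fm y).
  apply: (itg_le _ (itg_abs (ie 0))).
    by apply: measM; [exact: half_meas|exact: cont_meas cfm].
  move=> y; rewrite /hp /fm sub0r normrN; case: (leP 0 y) => y0.
    by rewrite mul1r (ger0_norm y0).
  by rewrite mul0r normr0.
have im : itg (fun y => hm y * phaseft y).
  apply: (itg_le _ (itg_abs (ie 0))).
    apply: measM; last exact: cont_meas cfp.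
    by apply: measurable_funB => //; exact: half_meas.
  move=> y; rewrite /hm /hp /phaseft sub0r normrN; case: (leP 0 y) => y0.
    by rewrite subrr mul0r normr0.
  by rewrite subr0 mul1r (ltr0_norm y0) opprK.
pose Ip := Int (fun y => hp y * fm y); pose Im := Int (fun y => hm y * phaseft y).
have E x : Int (fun y => expR (- `|x - y|) * f y) = expR x * (Ip - prim fm x) + expR (- x) * (Im + prim phaseft x).
  have j1 : itg (fun y => expR x * (hp y * fm y)) by exact: itgZ.
  have j2 : itg (fun y => expR (- x) * (hm y * phaseft y)) by exact: itgZ.
  case: (leP 0 x) => x0.
    have s1 := prim_seg cfm x0; have s2 := prim_seg cfp x0; rewrite !(prim0, subr0) in s1 s2.
    have k1 : itg (fun y => expR x * (ind 0 x y * fm y)) by apply: itgZ; exact: itg_seg.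
    have k2 : itg (fun y => expR (- x) * (ind 0 x y * phaseft y)) by apply: itgZ; exact: itg_seg.
    rewrite (@eq_Int _ _ (fun y => (expR x * (hp y * fm y) - expR x * (ind 0 x y * fm y)) +
      (expR (- x) * (hm y * phaseft y) + expR (- x) * (ind 0 x y * phaseft y)))).
      rewrite Int_D; [|exact: itgB|exact: itgD].
      rewrite Int_B// Int_D// !Int_Z//; [|exact: itg_seg|exact: itg_seg].
      by rewrite s1 s2 -/Ip -/Im; ring.
    by move=> y; exact: split_pos.
  have s1 := prim_seg cfm (ltW x0); have s2 := prim_seg cfp (ltW x0); rewrite !(prim0, sub0r) in s1 s2.
  have z1 := seg_point fm 0; have z2 := seg_point phaseft 0.
  have k1 : itg (fun y => expR x * (ind x 0 y * fm y)) by apply: itgZ; exact: itg_seg.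
  have k2 : itg (fun y => expR (- x) * (ind x 0 y * phaseft y)) by apply: itgZ; exact: itg_seg.
  have k3 : itg (fun y => expR x * (ind 0 0 y * fm y)) by apply: itgZ; exact: itg_seg.
  have k4 : itg (fun y => expR (- x) * (ind 0 0 y * phaseft y)) by apply: itgZ; exact: itg_seg.
  rewrite (@eq_Int _ _ (fun y => ((expR x * (hp y * fm y) + expR x * (ind x 0 y * fm y)) +
    (expR (- x) * (hm y * phaseft y) - expR (- x) * (ind x 0 y * phaseft y))) -
    (expR x * (ind 0 0 y * fm y) - expR (- x) * (ind 0 0 y * phaseft y)))).
    rewrite Int_B; [|by apply: itgD; [exact: itgD|exact: itgB]|exact: itgB].
    rewrite Int_D; [|exact: itgD|exact: itgB].
    rewrite Int_D// !Int_B// !Int_Z//; try exact: itg_seg.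
    by rewrite s1 s2 z1 z2 -/Ip -/Im; ring.
  by move=> y; exact: split_neg.
have dm := prim_derive cfm; have dp := prim_derive cfp.
have ee (x : R) : expR x * expR (- x) = 1 by rewrite -expRD subrr expR0.
clearbody Ip Im; clear ip im hp hm.
exists (fun x => - (1/2) * (expR x * (Ip - prim fm x) + expR (- x) * (Im + prim phaseft x))).
exists (fun x => - (1/2) * (expR x * (Ip - prim fm x) - expR (- x) * (Im + prim phaseft x))).
split.
- apply: D1_eq; first by der.
  by move=> x /=; rewrite /fm /phaseft; move: (expR x) (expR (- x)) (prim _ x) (prim _ x) (f x) => *; field.
- apply: D1_eq; first by der.
  move=> x /=; rewrite /fm /phaseft.
  transitivity (- (1/2) * (expR x * (Ip - prim fm x) + expR (- x) * (Im + prim phaseft x)) + (expR x * expR (- x)) * f x).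
    by rewrite /fm /phaseft; move: (expR x) (expR (- x)) (prim _ x) (prim _ x) (f x) => *; field.
  by congr (_ + _); rewrite ee mul1r.
split; first by have h1 : contf _ := prim_cont cfm; have h2 : contf _ := prim_cont cfp; cont.
exists (C * Int (fun y => expR (- ((1 - b) * `|y|)))).
  by rewrite mulr_ge0//; apply: Int_ge0 => y; exact: expR_ge0.
move=> x; rewrite -E normrM normrN (ger0_norm (_ : 0 <= 1 / 2)) ?divr_ge0//.
apply: (@le_trans _ _ (1 * `|Int (fun y : R => expR (- `|x - y|) * f y)|)).
  by rewrite ler_wpM2r//; lra.
rewrite mul1r mulrAC -Int_Z; last exact: itg_exp.
have ir := itg_refl x (itg_exp c1).
rewrite -(Int_refl x (itgZ _ (itg_exp c1))).
apply: Int_abs_le => //; first by apply: itgZ.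
move=> y; rewrite normrM ger0_norm ?expR_ge0//.
apply: (@le_trans _ _ (expR (- `|x - y|) * (C * expR (b * `|y|)))).
  by rewrite ler_wpM2l ?expR_ge0.
rewrite mulrCA -!mulrA ler_wpM2l// -!expRD ler_expR.
have := ler_normB x (x - y); rewrite opprB addrCA subrr addr0 => h.
have := ler_wpM2l b0 h; lra.
Qed.
End ODE.

(** * The oscillating tail of a function *)

(** [sin(w r)] for [r >= 0] and 0 for [r <= 0], without a case distinction. *)
Definition possin (R : realType) (w r : R) : R := sin (w * ((r + `|r|) / 2)).
(** An even, exponentially decaying function with [q'' + w^2 q = m - c delta] and
    [c = int m cos(w .)]: the decaying way of dividing [m] by [d^2 + w^2], at the price of a mass
    at the origin. *)
Definition osctail (R : realType) (w : R) (m : R -> R) (x : R) : R :=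
  (2 * w)^-1 * Int (fun t => m t * possin w (`|t| - `|x|)).

Section Q.
Variables (R : realType) (w eta : R).
Hypotheses (w0 : 0 < w) (eta0 : 0 < eta).

Lemma possin_ge (r : R) : 0 <= r -> possin w r = sin (w * r).
Proof. by move=> r0; rewrite /possin ger0_norm//; congr (sin (_ * _)); field. Qed.
Lemma possin_le (r : R) : r <= 0 -> possin w r = 0.
Proof. by move=> r0; rewrite /possin ler0_norm// subrr mul0r mulr0 sin0. Qed.

Lemma possin_ind (t y : R) : `|possin w (`|t| - `|y|)| <= ind (- `|t|) `|t| y.
Proof.
rewrite /ind -ler_norml; case: (leP `|y| `|t|) => h; first exact: sin_max.
by rewrite possin_le ?normr0// subr_le0 ltW.
Qed.

(** Only [|t| >= |x|] contributes, where the weight at [t] dominates that at [x]. *)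
Lemma possin_weighted (t x : R) : `|possin w (`|t| - `|x|)| <= expR (eta * `|t|) * expR (- (eta * `|x|)).
Proof.
apply: (le_trans (possin_ind t x)); rewrite -expRD /ind -ler_norml.
case: (leP `|x| `|t|) => h; last exact: expR_ge0.
rewrite -[leLHS]expR0 ler_expR; have := ler_wpM2l (ltW eta0) h; lra.
Qed.

Lemma cont_possin (c : R) : contf (fun y => possin w (c - `|y|)).
Proof. by rewrite /possin; cont. Qed.

Variable m : R -> R.
Hypothesis im : itg (fun t => m t * expR (eta * `|t|)).
Hypothesis em : forall t, m (- t) = m t.

Lemma q_meas : measurable_fun setT m.
Proof.
have h : (fun t => m t * expR (eta * `|t|) * expR (- (eta * `|t|))) = m.
  by apply/funext => t; rewrite -mulrA -expRD subrr expR0 mulr1.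
rewrite -h; apply: measM; first exact: itg_meas.
by apply: cont_meas; cont.
Qed.

Lemma q_itgw b : b <= eta -> itg (fun t => m t * expR (b * `|t|)).
Proof.
move=> be; apply: (itg_le _ (itg_abs im)).
  by apply: measM; [exact: q_meas|apply: cont_meas; cont].
by move=> t; rewrite !normrM ler_wpM2l// !(ger0_norm (expR_ge0 _)); exact: wexp_mono.
Qed.

Lemma q_itg : itg m.
Proof. by apply: eq_itg (q_itgw (ltW eta0)) => t; rewrite mul0r expR0 mulr1. Qed.

Lemma q_possin_itg (x : R) : itg (fun t => m t * possin w (`|t| - `|x|)).
Proof.
apply: (itgM_bnd (B := 1) q_itg); last by move=> t; exact: sin_max.
by apply: cont_meas; rewrite /possin; cont.
Qed.

Lemma osctail_even x : osctail w m (- x) = osctail w m x.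
Proof. by rewrite /osctail normrN. Qed.

Lemma osctail_cont : contf (osctail w m).
Proof.
have c : continuous (fun x : R => Int (fun t => m t * possin w (`|t| - `|x|))).
  move=> x; apply: (@Int_cont _ (fun x t => m t * possin w (`|t| - `|x|)) x 1 (fun t => `|m t|)) => //.
  - by move=> y _; exact: q_possin_itg.
  - by move=> t; have h := @cont_possin `|t|; cont.
  - exact: itg_abs q_itg.
  - by move=> y t _; rewrite normrM ler_piMr//; exact: sin_max.
by rewrite /osctail; cont.
Qed.

Definition qB := (2 * w)^-1 * Int (fun t => `|m t * expR (eta * `|t|)|).

Lemma osctail_decay x : `|osctail w m x| <= qB * expR (- (eta * `|x|)).
Proof.
have w2 : 0 <= (2 * w)^-1 by rewrite invr_ge0 mulr_ge0// ltW.
rewrite /osctail normrM ger0_norm// /qB -mulrA ler_wpM2l// -Int_Zr; last exact: itg_abs im.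
apply: Int_abs_le; [exact: q_possin_itg|by apply: itgZr; exact: itg_abs im|] => t.
rewrite !normrM -mulrA ler_wpM2l// (ger0_norm (expR_ge0 _)); exact: possin_weighted.
Qed.

Lemma osctail_itgw c : c < eta -> itg (fun x => osctail w m x * expR (c * `|x|)).
Proof.
move=> ce; have c1 : 0 < eta - c by lra.
apply: (itg_le _ (itgZ qB (itg_exp c1))).
  by apply: cont_meas; have h := osctail_cont; cont.
move=> x; rewrite normrM (ger0_norm (expR_ge0 _)).
apply: (@le_trans _ _ (qB * expR (- (eta * `|x|)) * expR (c * `|x|))).
  by rewrite ler_wpM2r ?expR_ge0//; exact: osctail_decay.
by rewrite -mulrA -expRD (_ : - (eta * `|x|) + c * `|x| = - ((eta - c) * `|x|))//; ring.
Qed.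

Section Star.
Variables p p1 p2 : R -> R.
Hypotheses (d1 : D1 p p1) (d2 : D1 p1 p2) (c2 : contf p2).
Let gam y := p2 y + w ^+ 2 * p y.
Let c0 : contf p := is_derive_cont d1.
Let c1 : contf p1 := is_derive_cont d2.
Let cg : contf gam. Proof. by rewrite /gam; cont. Qed.

(** Integrate by parts twice on each half of [[- |t|, |t|]]; the boundary terms at 0 combine into
    the cosine. *)
Lemma star_inner x t : Int (fun y => possin w (`|t| - `|y|) * gam (x - y)) =
  w * (p (x + t) + p (x - t) - 2 * p x * cos (w * t)).
Proof.
wlog t0 : t / 0 <= t.
  move=> H; case: (leP 0 t) => t0; first exact: H.
  by rewrite -(normrN t) H ?opprK ?mulrN ?cosN; [ring|lra].
rewrite (ger0_norm t0).
have nt0 : - t <= 0 by rewrite oppr_le0.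
have dl : D1 (fun y => sin (w * (t + y)) * (- p1 (x - y)) - w * cos (w * (t + y)) * p (x - y))
  (fun y => sin (w * (t + y)) * gam (x - y)).
  by apply: D1_eq; [der|move=> y /=; rewrite /gam; ring].
have dr : D1 (fun y => sin (w * (t - y)) * (- p1 (x - y)) + w * cos (w * (t - y)) * p (x - y))
  (fun y => sin (w * (t - y)) * gam (x - y)).
  by apply: D1_eq; [der|move=> y /=; rewrite /gam; ring].
have cF : continuous (fun y => possin w (t - `|y|) * gam (x - y)).
  by have h : contf _ := @cont_possin t; cont.
rewrite (@eq_Int _ _ (fun y => ind (- t) t y * (possin w (t - `|y|) * gam (x - y)))); last first.
  move=> y; have := possin_ind t y; rewrite (ger0_norm t0) /ind; case: (_ && _) => h; first by rewrite mul1r.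
  by move: h; rewrite normr_le0 => /eqP ->; rewrite !mul0r.
rewrite (seg_split nt0 t0 cF).
have -> : Int (fun y => ind (- t) 0 y * (possin w (t - `|y|) * gam (x - y))) =
   Int (fun y => ind (- t) 0 y * (sin (w * (t + y)) * gam (x - y))).
  apply: eq_Int => y; rewrite /ind; case: (boolP (- t <= y <= 0)) => [/andP[h1 h2]|_]; last by rewrite !mul0r.
  by rewrite (ler0_norm h2) opprK possin_ge//; lra.
have -> : Int (fun y => ind 0 t y * (possin w (t - `|y|) * gam (x - y))) =
   Int (fun y => ind 0 t y * (sin (w * (t - y)) * gam (x - y))).
  apply: eq_Int => y; rewrite /ind; case: (boolP (0 <= y <= t)) => [/andP[h1 h2]|_]; last by rewrite !mul0r.
  by rewrite (ger0_norm h1) possin_ge//; lra.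
rewrite (FTC_seg nt0 dl); last by cont.
rewrite (FTC_seg t0 dr); last by cont.
by rewrite !addr0 !subr0 !subrr !mulr0 !opprK sin0 cos0; ring.
Qed.

(** Exchange the two integrals and use [star_inner]; evenness of [m] merges the terms
    [p(x + t)] and [p(x - t)]. *)
Lemma osctail_convol b x : 0 <= b -> b < eta -> sgrowth b p -> sgrowth b gam ->
  Int (fun y => osctail w m y * gam (x - y)) = Int (fun t => m t * p (x - t)) - p x * Int (fun t => m t * cos (w * t)).
Proof.
move=> b0 be [_ [Cp Cp0 hp]] [_ [C C0 hC]].
pose F t y := m t * (possin w (`|t| - `|y|) * gam (x - y)).
have mF : measurable_fun setT (fun q : measurableTypeR R * measurableTypeR R => F q.1 q.2).
  apply: measurable_funM; first exact: measurableT_comp q_meas measurable_fst.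
  apply: measurable_funM.
    rewrite /possin; apply: (measurableT_comp (f := @sin R)); first exact: cont_meas (@continuous_sin R).
    apply: measurable_funM => //; apply: measurable_funM => //.
    apply: measurable_funD; [|apply: measurableT_comp => //]; apply: measurable_funB; exact: measurableT_comp.
  apply: (measurableT_comp (f := gam)); first exact: cont_meas cg.
  exact: measurable_funB.
have cgx : contf (fun y => gam (x - y)) by cont.
have csp (t : R) : contf (fun y => possin w (`|t| - `|y|)) by exact: cont_possin.
have wbound (t y : R) : `|possin w (`|t| - `|y|) * gam (x - y)| <= ind (- `|t|) `|t| y * (C * (expR (b * `|x|) * expR (b * `|t|))).
  rewrite normrM; have := possin_ind t y; rewrite /ind -ler_norml; case: (leP `|y| `|t|) => h h1; last first.
    by move: h1; rewrite normr_le0 => /eqP ->; rewrite normr0 !mul0r.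
  rewrite mul1r; apply: (@le_trans _ _ (1 * `|gam (x - y)|)); first by rewrite ler_wpM2r.
  rewrite mul1r; apply: (le_trans (hC _)); rewrite ler_wpM2l// -expRD ler_expR -mulrDr ler_wpM2l//.
  by apply: (le_trans (ler_normB _ _)); rewrite lerD2l.
have isp (t : R) : itg (fun y => possin w (`|t| - `|y|) * gam (x - y)).
  apply: (itg_le _ (itgZr (C * (expR (b * `|x|) * expR (b * `|t|))) (itg_ind (- `|t|) `|t|))); last exact: wbound.
  by apply: cont_meas; have h := csp t; cont.
have iF t : itg (F t) by exact: itgZ.
have eb : 0 < eta - b by lra.
pose D := C * expR (b * `|x|) * (2 / (eta - b)).
have hF t : Int (fun y => `|F t y|) <= `|m t * expR (eta * `|t|)| * D.
  apply: (@le_trans _ _ (`|m t| * (2 * `|t| * (C * (expR (b * `|x|) * expR (b * `|t|)))))).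
    have E2 : Int (ind (- `|t|) `|t|) = 2 * `|t| by rewrite Int_ind; [ring|have := normr_ge0 t; lra].
    rewrite -E2 -Int_Zr; last exact: itg_ind.
    rewrite -Int_Z; last by apply: itgZr; exact: itg_ind.
    apply: Int_le; [exact: itg_abs|by apply: itgZ; apply: itgZr; exact: itg_ind|].
    by move=> y; rewrite /F normrM ler_wpM2l.
  rewrite [in leRHS]normrM -[leRHS]mulrA ler_wpM2l// (ger0_norm (expR_ge0 _)) /D.
  have t1 : `|t| <= expR ((eta - b) * `|t|) / (eta - b).
    rewrite ler_pdivlMr//; have := expR_ge1Dx ((eta - b) * `|t|); lra.
  have e1 : expR (eta * `|t|) = expR ((eta - b) * `|t|) * expR (b * `|t|) by rewrite -expRD; congr expR; ring.
  rewrite e1.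
  have k0 : 0 <= 2 * (C * (expR (b * `|x|) * expR (b * `|t|))) by rewrite !mulr_ge0 ?expR_ge0.
  have := ler_wpM2l k0 t1; congr (_ <= _); first by ring.
  by field; rewrite gt_eqF.
have [_ E] := fubini_Int mF iF (itgZr D (itg_abs im)) hF.
clear mF wbound hF D eb csp.
have -> : Int (fun y => osctail w m y * gam (x - y)) = (2 * w)^-1 * Int (fun t => Int (F t)).
  have iq : itg (fun y => osctail w m y * gam (x - y)).
    have iqb := osctail_itgw be.
    apply: (itg_le _ (itgZ (C * expR (b * `|x|)) (itg_abs iqb))).
      by apply: cont_meas; have h := osctail_cont; cont.
    move=> y; rewrite !normrM (ger0_norm (expR_ge0 _)) mulrCA ler_wpM2l//.
    apply: (le_trans (hC _)); rewrite -mulrA ler_wpM2l// -expRD ler_expR -mulrDr ler_wpM2l//.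
    exact: ler_normB.
  rewrite E -Int_Z.
    apply: eq_Int => y; rewrite /osctail -mulrA; congr (_ * _); rewrite -Int_Zr; last exact: q_possin_itg.
    by apply: eq_Int => t; rewrite /F mulrA.
  have w2 : 2 * w != 0 by rewrite mulf_neq0// gt_eqF.
  apply: eq_itg (itgZ (2 * w) iq) => y; rewrite /osctail !mulrA divff// mul1r -Int_Zr; last exact: q_possin_itg.
  by apply: eq_Int => t; rewrite /F mulrA.
have ipx s : `|s| = 1 -> itg (fun t => m t * p (x + s * t)).
  move=> s1; apply: (itg_le _ (itgZ (Cp * expR (b * `|x|)) (itg_abs (q_itgw (ltW be))))).
    by apply: measM; [exact: q_meas|apply: cont_meas; cont].
  move=> t; rewrite !normrM (ger0_norm (expR_ge0 _)) mulrCA ler_wpM2l//.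
  apply: (le_trans (hp _)); rewrite -mulrA ler_wpM2l// -expRD ler_expR -mulrDr ler_wpM2l//.
  by apply: (le_trans (ler_normD _ _)); rewrite normrM s1 mul1r.
have i1 : itg (fun t => m t * p (x + t)) by apply: eq_itg (ipx 1 (normr1 _)) => t; rewrite mul1r.
have i2 : itg (fun t => m t * p (x - t)) by apply: eq_itg (ipx (-1) (normrN1 _)) => t; rewrite mulN1r.
have i3 : itg (fun t => m t * cos (w * t)).
  by apply: eq_itg (itg_cosp w 0 q_itg) => y; rewrite subr0.
have E1 : Int (fun t => m t * p (x + t)) = Int (fun t => m t * p (x - t)).
  by rewrite -(Int_opp i1); apply: eq_Int => t; rewrite em.
rewrite (@eq_Int _ _ (fun t => w * ((m t * p (x + t) + m t * p (x - t)) - 2 * p x * (m t * cos (w * t))))); last first.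
  by move=> t; rewrite /F Int_Z// star_inner; ring.
rewrite Int_Z; last by apply: itgB; [exact: itgD|exact: itgZ].
rewrite Int_B; [|exact: itgD|exact: itgZ].
rewrite Int_D// Int_Z// E1.
by field; rewrite gt_eqF.
Qed.
End Star.
End Q.

(** * Removing the resonance *)

Definition rowdot (R : realType) n (l : 'rV[R]_n) (v : R -> 'cV[R]_n) (x : R) : R := (l *m v x) 0 0.
Definition osctailv (R : realType) n (w : R) (K : R -> 'M[R]_n) (e : 'cV[R]_n) (x : R) : 'cV[R]_n :=
  \col_i osctail w (fun t => (K t *m e) i 0) x.
(** The regularised kernel.  In Fourier variables [osctail] is [M(x) e / (w^2 - x^2)], so the
    symbol becomes [M(x) (I - (1 + w^2) / (w^2 - x^2) e l)], whose second factor has a pole that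
    cancels the zero of the first. *)
Definition regkernel (R : realType) n (w : R) (K : R -> 'M[R]_n) (e : 'cV[R]_n) (l : 'rV[R]_n) (y : R) : 'M[R]_n :=
  K y - (1 + w ^+ 2) *: (osctailv w K e y *m l).
(** The second factor of the regularised symbol, as an operator: [sineint] divides by
    [w^2 - x^2] without leaving the functions of moderate growth. *)
Definition Lambda (R : realType) n (w : R) (e : 'cV[R]_n) (l : 'rV[R]_n) (g : R -> 'cV[R]_n) (x : R) : 'cV[R]_n :=
  g x - ((1 + w ^+ 2) * sineint w (rowdot l g) x) *: e.

Lemma Lambda_alg (R : realType) (s x1 x2 x3 x4 q1 q2 : R) : 0 < s -> x1 <= q1 * x2 -> x3 <= q2 * x4 ->
  0 <= x4 -> 0 <= x2 -> 0 <= q1 -> 0 <= q2 -> x1 + s * x3 <= (q1 + q2) * (x2 + s * x4).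
Proof.
move=> s0 h1 h2 x40 x20 q10 q20; have := ler_wpM2l (ltW s0) h2.
have := mulr_ge0 q20 x20; have := mulr_ge0 q10 (mulr_ge0 (ltW s0) x40); lra.
Qed.

Section Factor.
Variables (R : realType) (n : nat) (eta w : R).
Hypotheses (eta0 : 0 < eta) (w0 : 0 < w).
Variables (K : R -> 'M[R]_n) (e : 'cV[R]_n) (l : 'rV[R]_n).
Hypothesis kK : ekernel eta K.
Hypothesis hMe : symbol K w *m e = 0.
Hypothesis hle : l *m e = 1%:M.
Notation kreg := (regkernel w K e l).
Notation Lam := (Lambda w e l).
Implicit Types (v g : R -> 'cV[R]_n) (a b : R).

Let m i t := (K t *m e) i 0.

Lemma m_itg i : itg (fun t => m i t * expR (eta * `|t|)).
Proof.
apply: (eq_itg (f := fun t => \sum_j (K t i j * expR (eta * `|t|)) * e j 0)).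
  by move=> t; rewrite /m mxE big_distrl/=; apply: eq_bigr => j _; ring.
by apply: itg_sum => j; apply: itgZr; exact: kK.1.
Qed.

Lemma m_even i t : m i (- t) = m i t.
Proof. by rewrite /m kK.2. Qed.

Lemma m_cos i x : Int (fun t => m i t * cos (x * t)) = (cosft K x *m e) i 0.
Proof.
rewrite mxE (@eq_Int _ _ (fun t => \sum_j (K t i j * cos (x * t)) * e j 0)).
  have ic j : itg (fun t => K t i j * cos (x * t)).
    by apply: eq_itg (itg_cosp x 0 (ekernel_itg eta0 kK i j)) => y; rewrite subr0.
  rewrite Int_sum; last by move=> j; apply: itgZr.
  by apply: eq_bigr => j _; rewrite Int_Zr// mxE.
by move=> t; rewrite /m mxE big_distrl/=; apply: eq_bigr => j _; ring.
Qed.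

Lemma cosft_w : cosft K w *m e = e.
Proof. by move: hMe; rewrite /symbol mulmxDl mulNmx mul1mx => /eqP; rewrite addrC subr_eq0 => /eqP. Qed.

Lemma rowdot_sgrowth b v : growth b v -> sgrowth b (rowdot l v).
Proof.
move=> [convol [C hC]]; split.
  apply: (contf_eq (f := fun x => \sum_j l 0 j * v x j 0)); first by move=> x; rewrite /rowdot mxE.
  by apply: cont_sum => j; have h := convol j; cont.
exists ((\sum_j `|l 0 j|) * `|C|); first by rewrite mulr_ge0// sumr_ge0.
move=> x; rewrite /rowdot mxE; apply: (le_trans (ler_norm_sum _ _ _)).
rewrite -mulrA mulr_suml; apply: ler_sum => j _; rewrite normrM ler_wpM2l//.
by apply: (le_trans (hC x j)); rewrite ler_wpM2r ?expR_ge0// ler_norm.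
Qed.

Lemma sgrowth_vec b (f : R -> R) : sgrowth b f -> growth b (fun x => f x *: e).
Proof.
move=> [cf [C C0 hC]]; split => [i|].
  by apply: (contf_eq (f := fun x => f x * e i 0)) => [x|]; [rewrite mxE|cont].
exists (C * \sum_j `|e j 0|) => x i; rewrite mxE normrM mulrAC.
apply: ler_pM => //; rewrite (bigD1 i)//= lerDl sumr_ge0//.
Qed.

Lemma q_itgf b (f : R -> R) i x : 0 <= b -> b < eta -> sgrowth b f -> itg (fun y => osctail w (m i) y * f (x - y)).
Proof.
move=> b0 be [cf [C C0 hC]].
have cq : contf (osctail w (m i)) := osctail_cont eta0 (m_itg i).
apply: (itg_le _ (itgZ (C * expR (b * `|x|)) (itg_abs (osctail_itgw w0 eta0 (m_itg i) be)))).
  by apply: cont_meas; cont.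
move=> y; rewrite !normrM (ger0_norm (expR_ge0 _)) mulrCA; apply: ler_wpM2l => //.
apply: (le_trans (hC _)); rewrite -mulrA; apply: ler_wpM2l => //.
rewrite -expRD ler_expR -mulrDr; apply: ler_wpM2l => //; exact: ler_normB.
Qed.

(** [osctail_convol] for the columns of [K e]; the term [p(x) int K cos(w .) e] is [p(x) e] because
    [e] is in the kernel of the symbol at [w]. *)
Lemma linop_psi b (p p1 p2 : R -> R) : 0 <= b -> b < eta -> D1 p p1 -> D1 p1 p2 -> contf p2 ->
  sgrowth b p -> sgrowth b (fun y => p2 y + w ^+ 2 * p y) -> forall x,
  linop K (fun y => p y *: e) x = \col_i Int (fun y => osctail w (m i) y * (p2 (x - y) + w ^+ 2 * p (x - y))).
Proof.
move=> b0 be d1 d2 c2 gp gg x; apply/colP => i.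
rewrite [RHS]mxE (osctail_convol w0 eta0 (m_itg i) (m_even i) d1 d2 c2 x b0 be gp gg) m_cos cosft_w.
rewrite !mxE addrC; congr (_ - _); apply: eq_Int => t.
by rewrite -scalemxAr mxE mulrC.
Qed.

Lemma sgrowth_trig (p : R -> R) b : 0 <= b -> contf p -> (forall x, `|p x| <= 1) -> sgrowth b p.
Proof. by move=> *; apply: sgrowth_bounded. Qed.

(** Both functions satisfy [p'' + w^2 p = 0] in [linop_psi]. *)
Lemma linop_kerfun (al be : R) x : linop K (fun y => (al * cos (w * y) + be * sin (w * y)) *: e) x = 0.
Proof.
pose p y := al * cos (w * y) + be * sin (w * y).
pose p1 y := - (w * al) * sin (w * y) + (w * be) * cos (w * y).
have d1 : D1 p p1 by rewrite /p /p1; apply: D1_eq; [der|move=> y /=; ring].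
have d2 : D1 p1 (fun y => - w ^+ 2 * p y) by rewrite /p1 /p; apply: D1_eq; [der|move=> y /=; ring].
have c0 : contf p by rewrite /p; cont.
have gp : sgrowth 0 p.
  rewrite /p; apply: sgrowth_add; apply: sgrowth_scale; apply: sgrowth_trig => //; try by cont.
    by move=> y; exact: cos_max.
  by move=> y; exact: sin_max.
have gg : sgrowth 0 (fun y => - w ^+ 2 * p y + w ^+ 2 * p y) by apply: sgrowth_add; exact: sgrowth_scale.
have c2 : contf (fun y => - w ^+ 2 * p y) by cont.
rewrite (linop_psi (lexx 0) eta0 d1 d2 c2 gp gg); apply/colP => i.
rewrite !mxE -[RHS](Int_0 R); apply: eq_Int => y; ring.
Qed.

Lemma regkernel_ekernel : ekernel (eta / 2) kreg.
Proof.
have h2 : eta / 2 < eta by move: eta0; lra.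
split => [i j|y]; last first.
  have h : osctailv w K e (- y) = osctailv w K e y by apply/colP => i; rewrite [LHS]mxE [RHS]mxE; exact: osctail_even.
  by rewrite /regkernel kK.2 h.
apply: (eq_itg (f := fun y => K y i j * expR (eta / 2 * `|y|) -
  ((1 + w ^+ 2) * l 0 j) * (osctail w (m i) y * expR (eta / 2 * `|y|)))).
  by move=> y; rewrite /regkernel !mxE big_ord1 !mxE; ring.
apply: itgB; first exact: (ekernel_itgw kK i j (ltW h2)).
apply: itgZ; exact: (osctail_itgw w0 eta0 (m_itg i) h2).
Qed.

Lemma linop_regkernel b v x : growth b v -> 0 <= b -> b < eta ->
  linop kreg v x = linop K v x - (1 + w ^+ 2) *: \col_i Int (fun y => osctail w (m i) y * rowdot l v (x - y)).
Proof.
move=> gv b0 be; rewrite /linop -addrA; congr (_ + _); apply/colP => i; rewrite !mxE.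
have babs : `|b| <= eta by rewrite ger0_norm// ltW.
have iq := q_itgf i x b0 be (rowdot_sgrowth gv).
rewrite -Int_Z// -Int_B; [|exact: (convol_itg1 kK x i gv babs)|exact: itgZ].
apply: eq_Int => y; rewrite /regkernel mulmxBl -scalemxAl mxE [X in _ + X]mxE; congr (_ - _).
by rewrite mxE -mulmxA mxE big_ord1 mxE.
Qed.

Lemma sgL_D b g : 0 < b -> growth b g -> sgrowth b (sineint w (rowdot l g)).
Proof. by move=> b0 gg; apply: sineint_sgrowth => //; exact: rowdot_sgrowth. Qed.

Lemma Lambda_growth b g : 0 < b -> growth b g -> growth b (Lam g).
Proof.
move=> b0 gg; apply: growth_sub => //; apply: sgrowth_vec; apply: sgrowth_scale; exact: sgL_D.
Qed.

(** Apply [linop_psi] to [sineint w (l g)], for which [p'' + w^2 p = l g]. *)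
Lemma linop_Lambda b g x : 0 < b -> b < eta -> growth b g -> linop K (Lam g) x = linop kreg g x.
Proof.
move=> b0 be gg; have babs : `|b| <= eta by rewrite ger0_norm ltW.
have gl := rowdot_sgrowth gg; have cl := gl.1; have gs := sgL_D b0 gg.
rewrite (linop_regkernel x gg (ltW b0) be).
have d1 := sineint_D1 w0 cl; have d2 := sineintD_D1 w0 cl.
have c2 : contf (fun x => rowdot l g x - w ^+ 2 * sineint w (rowdot l g) x) by have h := gs.1; cont.
have e2 : (fun y => rowdot l g y - w ^+ 2 * sineint w (rowdot l g) y + w ^+ 2 * sineint w (rowdot l g) y) = rowdot l g.
  by apply/funext => y; rewrite subrK.
have E := linop_psi (ltW b0) be d1 d2 c2 gs; rewrite e2 in E.
have {}E := E gl x.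
have {}E : - (sineint w (rowdot l g) x *: e) + convol K (fun y : R => sineint w (rowdot l g) y *: e) x =
    \col_i Int (fun y : R => osctail w (m i) y * rowdot l g (x - y)).
  rewrite -/(linop K (fun y => sineint w (rowdot l g) y *: e) x) E; apply/colP => i; rewrite [LHS]mxE [RHS]mxE.
  by apply: eq_Int => y; rewrite subrK.
rewrite /linop /Lambda.
have ge : growth b (fun x => (1 + w ^+ 2) *: (sineint w (rowdot l g) x *: e)) by apply: growth_scale; exact: sgrowth_vec.
under [X in convol K X _]funext => y do rewrite -scalerA.
rewrite (convol_sub kK x gg ge babs) (convol_scale kK _ x (sgrowth_vec gs) babs).
rewrite -E -scalerA; move: (convol K _ x) (convol K g x) (sineint w _ x *: e) => p q r.
by apply/colP => i; rewrite !mxE; ring.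
Qed.

(** Take [p'' = p + l v] and [g = v + (1 + w^2) p e].  Then [l g = p'' + w^2 p], so that
    [sineint w (l g)] is [p] up to a combination of cosine and sine, and [Lambda g] is [v] up to
    the corresponding element of the kernel. *)
Lemma resonant_splitting b v : 0 < b -> b < eta -> b < 1 -> growth b v ->
  exists g al be, [/\ growth b g, forall x, v x = Lam g x + (al * cos (w * x) + be * sin (w * x)) *: e &
    forall x, linop kreg g x = linop K v x].
Proof.
move=> b0 be b1 gv; have gf := rowdot_sgrowth gv.
have [p [p1 [d1 d2 gp]]] := resolvent (ltW b0) b1 gf.
have cp : contf p := is_derive_cont d1; have cf := gf.1.
have c2 : contf (fun x => p x + rowdot l v x) by cont.
(* [l g = l v + (1 + w^2) p = p'' + w^2 p]. *)
pose g x := v x + ((1 + w ^+ 2) * p x) *: e.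
have gg : growth b g by apply: growth_add => //; apply: sgrowth_vec; exact: sgrowth_scale.
have lg : rowdot l g = (fun y => (p y + rowdot l v y) + w ^+ 2 * p y).
  apply/funext => y; rewrite /rowdot /g mulmxDr -scalemxAr hle mxE.
  by rewrite [X in _ + X]mxE [X in _ + _ * X]mxE eqxx mulr1; ring.
have E x : v x = Lam g x + (- ((1 + w ^+ 2) * p 0) * cos (w * x) + - ((1 + w ^+ 2) * p1 0 / w) * sin (w * x)) *: e.
  rewrite /Lambda lg (sineint_var w0 d1 d2 c2) /g; apply/colP => i; rewrite !mxE; ring.
exists g, (- ((1 + w ^+ 2) * p 0)), (- ((1 + w ^+ 2) * p1 0 / w)); split => // x.
have babs : `|b| <= eta by rewrite ger0_norm ltW.
have gk : growth b (fun x => (- ((1 + w ^+ 2) * p 0) * cos (w * x) + - ((1 + w ^+ 2) * p1 0 / w) * sin (w * x)) *: e).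
  apply: sgrowth_vec; apply: sgrowth_add; apply: sgrowth_scale; apply: sgrowth_trig; rewrite ?(ltW b0)//; try by cont.
    by move=> y; exact: cos_max.
  by move=> y; exact: sin_max.
have -> : v = (fun x => Lam g x + (- ((1 + w ^+ 2) * p 0) * cos (w * x) + - ((1 + w ^+ 2) * p1 0 / w) * sin (w * x)) *: e).
  exact/funext.
have gL := Lambda_growth b0 gg.
rewrite -(linop_Lambda x b0 be gg) [in RHS]/linop (convol_add kK x gL gk babs) opprD addrACA.
by rewrite -/(linop K _ x) -/(linop K _ x) linop_kerfun addr0.
Qed.

Lemma rowdot_bnd : exists2 L : R, 0 <= L & forall v x, `|rowdot l v x| <= L * l2 (v x).
Proof.
exists (\sum_j `|l 0 j|); first by rewrite sumr_ge0.
move=> v x; rewrite /rowdot mxE; apply: (le_trans (ler_norm_sum _ _ _)).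
by rewrite mulr_suml; apply: ler_sum => j _; rewrite normrM ler_wpM2l//; exact: l2_coord.
Qed.

Lemma Lambda_mixnorm s a : 0 < s -> 0 < a -> exists2 C : R, 0 <= C & forall g, subgrowth a g -> mixnorm s a (Lam g) <= C * mixnorm s a g.
Proof.
move=> s0 a0; have [L L0 hL] := rowdot_bnd.
pose I := Int (fun y : R => expR (- (a * `|y|))).
have I0 : 0 <= I by apply: Int_ge0 => y; exact: expR_ge0.
pose E1 := \sum_j `|e j 0|; have E10 : 0 <= E1 by apply: sumr_ge0.
pose c := 1 + w ^+ 2; have c0 : 0 <= c by rewrite addr_ge0// sqr_ge0.
pose k := c * E1 * (2 / w) * L.
have k0 : 0 <= k by rewrite /k !mulr_ge0 ?invr_ge0 ?(ltW w0).
have [D D0 hD] : exists2 D : R, 0 <= D & forall g, subgrowth a g ->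
    mixnorm s a (fun x => (c * sineint w (rowdot l g) x) *: e) <= D * mixnorm s a g; last first.
  exists (1 + D); first by rewrite addr_ge0.
  move=> g hg; have [b [b0 ba gg]] := hg.
  have hs : subgrowth a (fun x => (c * sineint w (rowdot l g) x) *: e).
    exists ((b + a) / 2); split; [lra|lra|]; apply: sgrowth_vec; apply: sgrowth_scale; apply: sgL_D; first lra.
    by apply: growth_mono gg; lra.
  apply: (le_trans (mixnorm_sub s0 hg hs)); rewrite mulrDl mul1r lerD2l; exact: hD.
have kI0 : 0 <= k * I by exact: mulr_ge0.
exists (k * I + k * I * n%:R); first by rewrite addr_ge0// mulr_ge0.
move=> g hg; have [b [b0 ba gg]] := hg.
have gl := rowdot_sgrowth (growth_mono (ltW ba) gg); have [cl [C C0 hC]] := gl.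
have wtb x : expR (- a * `|x|) * `|sineint w (rowdot l g) x| <=
   2 / w * (L * Int (fun y => expR (- (a * `|y|)) * l2 (weighted a g (x - y)))) /\
   itg (fun y => expR (- (a * `|y|)) * l2 (weighted a g (x - y))).
  have ii : itg (fun y => expR (- (a * `|y|)) * l2 (weighted a g (x - y))).
    have := itg_exp a0 => ie.
    have [C' C'0 hC'] := l2_growth (growth_mono (ltW ba) gg).
    apply: (itg_le _ (itgZ C' ie)).
      apply: measM; first exact: itg_meas.
      exact: (l2_meas_shift x (weighted_growth a gg)).
    move=> y; rewrite normrM (ger0_norm (expR_ge0 _)) (ger0_norm (l2_ge0 _)) mulrC ler_wpM2r ?expR_ge0//.
    by rewrite l2_wtE mulNr expRN ler_pdivrMl ?expR_gt0// mulrC.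
  split => //.
  apply: (le_trans (sineint_weighted w0 cl a0 hC x)).
  rewrite ler_wpM2l ?divr_ge0 ?(ltW w0)// -Int_Z//.
  have [i1 _] := prim_weighted a0 cl hC x.
  apply: Int_le => //; first exact: itgZ.
  move=> y; rewrite [leRHS]mulrCA; apply: ler_wpM2l; first exact: expR_ge0.
  rewrite l2_wtE [leRHS]mulrCA; apply: ler_wpM2l; [exact: expR_ge0|exact: hL].
have gb' : growth ((b + a) / 2) g by apply: growth_mono gg; lra.
have b'0 : 0 < (b + a) / 2 by lra.
have b'a : (b + a) / 2 < a by lra.
have gS : growth ((b + a) / 2) (fun x => (c * sineint w (rowdot l g) x) *: e).
  apply: sgrowth_vec; apply: sgrowth_scale; exact: sgL_D.
have coord x i : `|weighted a (fun x => (c * sineint w (rowdot l g) x) *: e) x i 0| <=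
   c * (expR (- a * `|x|) * `|sineint w (rowdot l g) x|) * `|e i 0|.
  rewrite /weighted 2!mxE 3!normrM (ger0_norm (expR_ge0 _)) (ger0_norm c0).
  by rewrite !mulrA [c * _]mulrC.
have sumb x : \sum_i `|weighted a (fun x => (c * sineint w (rowdot l g) x) *: e) x i 0| <=
   k * Int (fun y => expR (- (a * `|y|)) * l2 (weighted a g (x - y))).
  apply: (@le_trans _ _ (c * (expR (- a * `|x|) * `|sineint w (rowdot l g) x|) * E1)).
    by rewrite /E1 mulr_sumr; apply: ler_sum => i _; exact: coord.
  have [h1 _] := wtb x; have := ler_wpM2l (mulr_ge0 c0 E10) h1; rewrite /k.
  by congr (_ <= _); ring.
have iwt x := (wtb x).2.
clearbody k; clear wtb coord.
have ie := itg_exp a0.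
have iM : itg (fun y => k * expR (- (a * `|y|))) by exact: itgZ.
have IM : Int (fun y => k * expR (- (a * `|y|))) = k * I by rewrite Int_Z.
set F := fun x => (c * sineint w (rowdot l g) x) *: e.
have hEn : Num.sqrt (energy a F) <= k * I * Num.sqrt (energy a g).
  rewrite -[X in X * _]ger0_norm// -sqrtr_sqr -sqrtrM ?sqr_ge0//; apply: ler_wsqrtr.
  rewrite -IM; apply: (young_vec (v := g) (z := weighted a F) gg ba) => //.
  - by move=> y; rewrite mulr_ge0 ?expR_ge0.
  - exact: (weighted_growth a gS).1.
  - move=> x; apply: (le_trans (sumb x)); rewrite -Int_Z; last exact: iwt.
    by rewrite (@eq_Int _ _ (fun y => k * expR (- (a * `|y|)) * l2 (weighted a g (x - y)))) // => y; rewrite mulrA.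
have hns : wsup a F <= k * I * n%:R * wsup a g.
  apply: wsup_le; first by apply: mulr_ge0; [exact: mulr_ge0|exact: wsup_ge0].
  move=> x i; have h : `|weighted a F x i 0| <= k * I * n%:R * wsup a g.
    apply: (@le_trans _ _ (\sum_i `|weighted a F x i 0|)); first by rewrite (bigD1 i)//= lerDl sumr_ge0.
    apply: (le_trans (sumb x)); rewrite -!mulrA; apply: ler_wpM2l => //; rewrite -Int_Zr//.
    apply: Int_le; [exact: iwt|exact: itgZr|].
    by move=> y; rewrite ler_wpM2l ?expR_ge0//; exact: (l2_wsup _ gg (ltW ba)).
  move: h; rewrite /weighted mxE normrM (ger0_norm (expR_ge0 _)) mulNr expRN ler_pdivrMl ?expR_gt0//.
  by rewrite mulrC.
have n0 := wsup_ge0 a g; have q0 := sqrtr_ge0 (energy a g).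
have kn0 : 0 <= k * I * n%:R by rewrite mulr_ge0.
rewrite /mixnorm; move: hEn hns n0 q0 kI0 kn0; move: (Num.sqrt _) (Num.sqrt _) (wsup _ _) (wsup _ _) => x1 x2 x3 x4.
move: (k * I) (k * I * n%:R) => q1 q2; exact: Lambda_alg.
Qed.
End Factor.

(** * The regularised symbol and the dispersion relation *)

Section DetRank1.
Variable R : comPzRingType.
(** Sylvester's identity: two block triangular factorisations of the same matrix. *)
Lemma det_rank1 n (u : 'cV[R]_n) (l : 'rV[R]_n) : \det (1%:M - u *m l) = 1 - (l *m u) 0 0.
Proof.
have E1 : block_mx 1%:M u l 1%:M = block_mx 1%:M 0 l 1%:M *m block_mx 1%:M u 0 (1%:M - l *m u).
  by rewrite mulmx_block !mul1mx !mul0mx !mulmx1 !addr0 addrC subrK.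
have E2 : block_mx 1%:M u l 1%:M = block_mx (1%:M - u *m l) u 0 1%:M *m block_mx 1%:M 0 l 1%:M.
  by rewrite mulmx_block !mul1mx !mul0mx !mulmx1 !mulmx0 !add0r subrK.
have := congr1 determinant E1; rewrite {1}E2 !det_mulmx !det_lblock !det_ublock !det1 !mul1r !mulr1 => ->.
by rewrite det_mx11 !mxE eqxx.
Qed.
End DetRank1.

Section SymKap.
Variables (R : realType) (n : nat) (eta w : R).
Hypotheses (eta0 : 0 < eta) (w0 : 0 < w).
Variables (K : R -> 'M[R]_n) (e : 'cV[R]_n) (l : 'rV[R]_n).
Hypothesis kK : ekernel eta K.
Hypothesis hMe : symbol K w *m e = 0.
Hypothesis hle : l *m e = 1%:M.
Notation kreg := (regkernel w K e l).
Let m i t := (K t *m e) i 0.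
Let kreg_ekernel := regkernel_ekernel eta0 w0 e l kK.
Let eta20 : 0 < eta / 2. Proof. by move: eta0; lra. Qed.

Definition osctail_ft (x : R) : 'cV[R]_n := \col_i Int (fun y => osctail w (m i) y * cos (x * y)).

Lemma osctail_itg i : itg (osctail w (m i)).
Proof.
by apply: eq_itg (osctail_itgw w0 eta0 (m_itg e kK i) eta0) => y; rewrite mul0r expR0 mulr1.
Qed.

(** Apply [linop_psi] to [p = cos(x .)] at the origin. *)
Lemma qhE x : (w ^+ 2 - x ^+ 2) *: osctail_ft x = symbol K x *m e.
Proof.
pose p y := cos (x * y); pose p1 y := - x * sin (x * y); pose p2 y := - x ^+ 2 * cos (x * y).
have d1 : D1 p p1 by rewrite /p /p1; apply: D1_eq; [der|move=> y /=; ring].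
have d2 : D1 p1 p2 by rewrite /p1 /p2; apply: D1_eq; [der|move=> y /=; ring].
have c2 : contf p2 by rewrite /p2; cont.
have gp : sgrowth 0 p by apply: sgrowth_trig => //; [rewrite /p; cont|move=> y; exact: cos_max].
have gg : sgrowth 0 (fun y => p2 y + w ^+ 2 * p y) by apply: sgrowth_add; exact: sgrowth_scale.
have := linop_psi eta0 w0 kK hMe (lexx 0) eta0 d1 d2 c2 gp gg 0.
have -> : linop K (fun y => p y *: e) 0 = symbol K x *m e.
  rewrite /symbol mulmxDl mulNmx mul1mx /linop /p mulr0 cos0 scale1r; congr (_ + _).
  apply/colP => i; rewrite [LHS]mxE -(m_cos eta0 e kK); apply: eq_Int => y.
  by rewrite -scalemxAr mxE mulrC sub0r mulrN cosN.
move=> ->; apply/colP => i; rewrite !mxE -Int_Z; last first.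
  by apply: eq_itg (itg_cosp x 0 (osctail_itg i)) => y; rewrite subr0.
by apply: eq_Int => y; rewrite /p2 /p sub0r mulrN cosN; ring.
Qed.

Lemma symbol_regkernel x : symbol kreg x = symbol K x - (1 + w ^+ 2) *: (osctail_ft x *m l).
Proof.
rewrite /symbol -addrA; congr (_ + _); apply/matrixP => i j; rewrite !mxE big_ord1 !mxE.
have i1 : itg (fun y => K y i j * cos (x * y)).
  by apply: eq_itg (itg_cosp x 0 (ekernel_itg eta0 kK i j)) => y; rewrite subr0.
have i2 : itg (fun y => osctail w (m i) y * cos (x * y)).
  by apply: eq_itg (itg_cosp x 0 (osctail_itg i)) => y; rewrite subr0.
rewrite -Int_Zr// -Int_Z; last exact: itgZr.
rewrite -Int_B//; last by apply: itgZ; exact: itgZr.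
by apply: eq_Int => y; rewrite /regkernel !mxE big_ord1 !mxE; ring.
Qed.

(** This factor is the inverse of the one in [regkernel]; the constant [1 + w^2] is chosen so that
    its denominator is [1 + x^2]. *)
Lemma symbol_fact x : symbol K x = symbol kreg x *m (1%:M - (((1 + w ^+ 2) / (1 + x ^+ 2)) *: e) *m l).
Proof.
have x1 : 1 + x ^+ 2 != 0 by rewrite gt_eqF// ltr_wpDr ?sqr_ge0.
rewrite symbol_regkernel mulmxBr mulmx1 mulmxBl.
rewrite -!scalemxAl -!scalemxAr mulmxA -(qhE x) -[osctail_ft x *m l *m _]mulmxA [l *m (e *m l)]mulmxA hle mul1mx.
rewrite -!scalemxAl !scalerA; move: (osctail_ft x *m l) => Q.
apply/matrixP => i j; rewrite !mxE; field => //.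
Qed.

(** The rank-one factor has determinant [1 - (1 + w^2) / (1 + x^2)] because [l e = 1]. *)
Lemma det_fact x : \det (symbol K x) = \det (symbol kreg x) * ((x ^+ 2 - w ^+ 2) / (1 + x ^+ 2)).
Proof.
have x1 : 1 + x ^+ 2 != 0 by rewrite gt_eqF// ltr_wpDr ?sqr_ge0.
rewrite {1}symbol_fact det_mulmx det_rank1 -scalemxAr hle !mxE eqxx mulr1; congr (_ * _).
by field.
Qed.

Hypothesis hne : forall x, `|x| != w -> \det (symbol K x) != 0.
Hypothesis hsimple : ~ ((fun t => \det (symbol K (w + t)) / t) @ (0 : R)^' --> (0 : R)).

(** Away from [+- w] this is [det_fact].  At [w], a zero of the regularised determinant would make
    [det M(w + t) / t] tend to 0. *)
Lemma symbol_regkernel_inv x : \det (symbol kreg x) != 0.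
Proof.
have [xw|xw] := eqVneq `|x| w; last first.
  by have := hne xw; rewrite det_fact mulf_eq0 negb_or => /andP[].
have -> : symbol kreg x = symbol kreg w.
  have [->|->] : x = w \/ x = - w; [|by []|exact: symN].
  by move: xw; case: (ger0P x) => _ E; [left|right; rewrite -E opprK].
apply/negP => /eqP D0; apply: hsimple.
have c1 : \det (symbol kreg (w + t)) * ((w + t + w) / (1 + (w + t) ^+ 2)) @[t --> (0:R)] --> \det (symbol kreg (w + 0)) * ((w + 0 + w) / (1 + (w + 0) ^+ 2)).
  have cc : continuous (fun t : R => w + t) by cont.
  have cd : continuous (fun t : R => 1 + (w + t) ^+ 2) by cont.
  have cn : continuous (fun t : R => w + t + w) by cont.
  apply: cvgM.
    apply: cvg_det => i j.
    by have h := @symbol_cont _ _ _ eta20 _ kreg_ekernel i j; apply: (cont_cmp h cc).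
  apply: cvgM; first exact: cn.
  apply: cvgV; last exact: cd.
  by rewrite gt_eqF// ltr_wpDr ?sqr_ge0.
rewrite addr0 D0 mul0r in c1.
have : \det (symbol kreg (w + t)) * ((w + t + w) / (1 + (w + t) ^+ 2)) @[t --> (0:R)^'] --> (0:R).
  exact: cvg_within_filter c1.
apply: cvg_trans; apply: near_eq_cvg; near=> t.
have t0 : t != 0 by near: t; exact: nbhs_dnbhs_neq.
have x1 : 1 + (w + t) ^+ 2 != 0 by rewrite gt_eqF// ltr_wpDr ?sqr_ge0.
by rewrite (det_fact (w + t)); field; rewrite t0 x1.
Unshelve. all: by end_near. Qed.
End SymKap.

(** * The characteristic determinant on the imaginary axis *)

Section DChar.
Variables (R : realType) (n : nat).
Variables (k : R -> 'M[R]_n) (A : 'M[R]_n) (eta : R).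
Hypothesis eta0 : 0 < eta.
Hypothesis hk : forall i j, itg (fun x => k x i j * expR (eta * `|x|)).
Hypothesis ek : {ae @lebesgue_measure R, forall x, k (- x) = k x}.

(** An everywhere even representative of [k]. *)
Definition evenk (y : R) : 'M[R]_n := k `|y|.
Definition evenkA (y : R) : 'M[R]_n := evenk y *m A.

Lemma k_meas i j : measurable_fun setT (fun y => k y i j).
Proof.
have h : (fun y => k y i j * expR (eta * `|y|) * expR (- (eta * `|y|))) = (fun y => k y i j).
  by apply/funext => y; rewrite -mulrA -expRD subrr expR0 mulr1.
rewrite -h; apply: measM; first exact: itg_meas.
by apply: cont_meas; cont.
Qed.

Lemma meas_opp (f : R -> R) : measurable_fun setT f -> measurable_fun setT (fun y => - f y).
Proof.
move=> mf; apply: (measurableT_comp (f := fun z : R => - z)) => //.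
exact: cont_meas (cont_neg (@cont_id R)).
Qed.

Lemma evenk_ae i j : {ae @lebesgue_measure R, forall x, k x i j = evenk x i j}.
Proof.
apply: (@filterS _ _ (ae_filter_ringOfSetsType _)) ek => x h; rewrite /evenk.
by case: (ger0P x) => // _; rewrite h.
Qed.

Lemma evenk_meas i j : measurable_fun setT (fun y => evenk y i j).
Proof.
have := k_meas i j => h; apply: (measurableT_comp (f := fun y => k y i j) h).
by apply: cont_meas; cont.
Qed.

Lemma evenk_ekernel : ekernel eta evenk.
Proof.
split; last by move=> y; rewrite /evenk normrN.
move=> i j; apply: ae_itg (hk i j) _.
  by apply: measM; [exact: evenk_meas|apply: cont_meas; cont].
apply: (@filterS _ _ (ae_filter_ringOfSetsType _)) (evenk_ae i j) => x h; by rewrite h.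
Qed.

Lemma evenkA_ekernel : ekernel eta evenkA.
Proof.
have [h e] := evenk_ekernel; split; last by move=> y; rewrite /evenkA e.
move=> i j; apply: (eq_itg (f := fun y => \sum_s (evenk y i s * expR (eta * `|y|)) * A s j)).
  by move=> y; rewrite /evenkA mxE big_distrl/=; apply: eq_bigr => s _; ring.
by apply: itg_sum => s; exact: itgZr.
Qed.

Lemma cosft_evenkA x : cosft evenkA x = cosft evenk x *m A.
Proof.
apply/matrixP => i j; rewrite !mxE.
have ic s : itg (fun y => evenk y i s * cos (x * y)).
  by apply: eq_itg (itg_cosp x 0 (ekernel_itg eta0 evenk_ekernel i s)) => y; rewrite subr0.
under [RHS]eq_bigr => s _ do rewrite mxE -Int_Zr//.
rewrite -Int_sum; last by move=> s; exact: itgZr.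
by apply: eq_Int => y; rewrite /evenkA mxE big_distrl/=; apply: eq_bigr => s _; ring.
Qed.

Local Open Scope complex_scope.

Lemma khat_real x : khat k (0 +i* x) = map_mx (real_complex R) (cosft evenk x).
Proof.
apply/matrixP => i j; rewrite !mxE /cintegral.
have E y : (k y i j)%:C * cexp (- (0 +i* x) * y%:C) = (k y i j * cos (x * y)) +i* (- (k y i j * sin (x * y))).
  have Ez : - (0 +i* x) * y%:C = 0 +i* (- (x * y)) :> R[i] by simpc.
  by rewrite /cexp Ez /= expR0 mul1r cosN sinN; simpc.
have -> : (fun y => complex.Re ((k y i j)%:C * cexp (- (0 +i* x) * y%:C))) = (fun y => k y i j * cos (x * y)).
  by apply/funext => y; rewrite E.
have -> : (fun y => complex.Im ((k y i j)%:C * cexp (- (0 +i* x) * y%:C))) = (fun y => - (k y i j * sin (x * y))).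
  by apply/funext => y; rewrite E.
rewrite -!IntE.
have cc : contf (fun y => cos (x * y)) by cont.
have cs : contf (fun y => sin (x * y)) by cont.
have ak := evenk_ae i j.
have -> : Int (fun y => k y i j * cos (x * y)) = Int (fun y => evenk y i j * cos (x * y)).
  apply: ae_Int.
  - by apply: measM; [exact: k_meas|exact: cont_meas cc].
  - by apply: measM; [exact: evenk_meas|exact: cont_meas cc].
  - by apply: (@filterS _ _ (ae_filter_ringOfSetsType _)) ak => y ->.
have -> : Int (fun y => - (k y i j * sin (x * y))) = Int (fun y => - (evenk y i j * sin (x * y))).
  apply: ae_Int.
  - by apply: meas_opp; apply: measM; [exact: k_meas|exact: cont_meas cs].
  - by apply: meas_opp; apply: measM; [exact: evenk_meas|exact: cont_meas cs].
  - by apply: (@filterS _ _ (ae_filter_ringOfSetsType _)) ak => y ->.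
have is_ : itg (fun y => evenk y i j * sin (x * y)).
  by apply: eq_itg (itg_sinp x 0 (ekernel_itg eta0 evenk_ekernel i j)) => y; rewrite subr0.
rewrite (Int_odd (itgN is_)) //.
by move=> y; rewrite evenk_ekernel.2 mulrN sinN mulrN.
Qed.

Lemma dcharE x : dchar k A (0 +i* x) = (\det (symbol evenkA x))%:C.
Proof.
rewrite /dchar khat_real -map_mxM -cosft_evenkA.
have -> : - 1%:M + map_mx (real_complex R) (cosft evenkA x) = map_mx (real_complex R) (symbol evenkA x).
  by apply/matrixP => i j; rewrite !mxE raddfD/= raddfN/=; case: eqP.
by rewrite det_map_mx.
Qed.

(** The complex difference quotients converge to the nonzero derivative, in particular along the
    imaginary axis, where they are those of the real function [det M] divided by [i]. *)
Lemma dchar_simple w : dchar k A (0 +i* w) = 0 -> derive1 (dchar k A) (0 +i* w) != 0 ->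
  ~ ((fun t => \det (symbol evenkA (w + t)) / t) @ (0 : R)^' --> (0 : R)).
Proof.
move=> h0 h1 hc; move/negP: h1; apply; apply/eqP; rewrite /derive1.
set G := (X in lim X).
have [cF|ncF] := pselect (cvg G); last by rewrite dvgP.
set L := lim G; apply/eqP/negPn/negP => L0.
have LF : G --> L by exact: cF.
pose F (h : R[i]^o) : R[i]^o := h^-1 *: (dchar k A (h + (0 +i* w)) - dchar k A (0 +i* w)).
have e0 : 0 < `|L| / 2 by rewrite divr_gt0// normr_gt0.
have /cvgrPdist_lt/(_ _ e0) := LF.
rewrite near_withinE => /nbhs_ballP[d d0 hd].
have FE (t : R) : t != 0 -> `|F (0 +i* t)| = (`|\det (symbol evenkA (w + t)) / t|)%:C.
  move=> t0; rewrite /F h0 subr0.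
  have -> : (0 +i* t) + (0 +i* w) = 0 +i* (w + t) :> R[i] by simpc; rewrite addrC.
  rewrite dcharE normrM normfV mulrC; rewrite !normc_def /= !expr0n/= ?addr0 ?add0r !sqrtr_sqr.
  by rewrite normrM normfV rmorphM/= fmorphV.
have Ld : `|L| / 2 = (complex.Re `|L| / 2)%:C.
  by rewrite normc_def /= rmorphM/= fmorphV rmorph_nat.
have ld0 : 0 < complex.Re `|L| / 2 by move: e0; rewrite Ld ltcR.
have d0' : 0 < d by exact: d0.
have /andP[/eqP id0 rd0] : (complex.Im d == 0) && (0 < complex.Re d) by have := d0'; rewrite ltcE.
have dd : d = (complex.Re d)%:C by rewrite [LHS]complexE id0 mulr0 addr0.
have near1 : \forall t \near (0:R)^', `|t| < complex.Re d /\ t != 0 /\ `|\det (symbol evenkA (w + t)) / t| < complex.Re `|L| / 2.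
  near=> t; split; last split.
  - near: t; apply: dnbhs0_lt; exact: rd0.
  - near: t; exact: nbhs_dnbhs_neq.
  - by near: t; have /cvgr0Pnorm_lt := hc; apply.
have [t [t1 [t0 t2]]] := filter_ex near1.
have it0 : (0 +i* t : R[i]) != 0 by rewrite eq_complex /= eqxx/=.
have nit : `|(0 +i* t : R[i])| = (`|t|)%:C by rewrite normc_def /= expr0n/= add0r sqrtr_sqr.
have bt : ball (0 : R[i]^o) d (0 +i* t).
  by rewrite -ball_normE /= sub0r normrN nit dd ltcR.
have h := hd _ bt it0.
have := ler_normD (L - F (0 +i* t)) (F (0 +i* t)); rewrite subrK => hh.
have h2 : `|F (0 +i* t)| < `|L| / 2 by rewrite FE// Ld ltcR.
have := lt_le_trans (ltrD h h2) (lexx _).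
rewrite -splitr => h3; have := le_lt_trans hh h3; by rewrite ltxx.
Unshelve. all: by end_near. Qed.
End DChar.

(** * Solutions of the perturbed equation follow the kernel *)

Section Iteration.
Variable R : realType.

(** A telescoping series dominated by a geometric one. *)
Lemma geom_limit_pt (h : nat -> R) (D q : R) : 0 <= D -> 0 <= q -> q < 1 ->
  (forall j, `|h j.+1 - h j| <= D * q ^+ j) ->
  cvgn h /\ forall j, `|limn h - h j| <= D / (1 - q) * q ^+ j.
Proof.
move=> D0 q0 q1 hh; have q1' : 0 < 1 - q by lra.
have tl j m : `|h (j + m)%N - h j| <= D / (1 - q) * q ^+ j * (1 - q ^+ m).
  elim: m => [|m IH]; first by rewrite addn0 subrr normr0 expr0 subrr mulr0.
  rewrite addnS -[h _ - h j](subrKA (h (j + m)%N)); apply: (le_trans (ler_normD _ _)).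
  apply: (le_trans (lerD (hh _) IH)).
  have -> : D * q ^+ (j + m) = D / (1 - q) * q ^+ j * (q ^+ m * (1 - q)).
    by rewrite exprD; field; rewrite gt_eqF.
  by rewrite -mulrDr exprS ler_wpM2l ?mulr_ge0 ?invr_ge0 ?exprn_ge0 ?(ltW q1')//; lra.
have c : cvgn h.
  have : cvgn (series (telescope h)).
    apply: normed_cvg; apply: (@series_le_cvg _ _ (geometric D q)).
    - by move=> m; exact: normr_ge0.
    - by move=> m; rewrite /= mulr_ge0// exprn_ge0.
    - by move=> m; exact: hh.
    - by apply: is_cvg_geometric_series; rewrite ger0_norm.
  move=> ct; have -> : h = (fun m => h 0%N + series (telescope h) m) by apply/funext => m; exact: eq_sum_telescope.
  by apply: is_cvgD => //; exact: is_cvg_cst.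
split => // j.
have cj : `|h m - h j| @[m --> \oo] --> `|limn h - h j|.
  by apply: cvg_norm; apply: cvgB; [exact: c|exact: cvg_cst].
move: cj => /cvgr_to_le; apply; near=> m.
have jm : (j <= m)%N by near: m; exact: nbhs_infty_ge.
rewrite -(subnKC jm); apply: (le_trans (tl _ _)).
rewrite ler_piMr ?mulr_ge0 ?invr_ge0 ?exprn_ge0 ?(ltW q1')//.
by rewrite lerBlDr lerDl exprn_ge0.
Unshelve. all: by end_near. Qed.

(** The convergence is locally uniform, which preserves continuity. *)
Lemma geom_limit (h : nat -> R -> R) (D q a : R) : 0 <= D -> 0 <= q -> q < 1 -> 0 <= a ->
  (forall j, contf (h j)) -> (forall j x, `|h j.+1 x - h j x| <= D * q ^+ j * expR (a * `|x|)) ->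
  exists g : R -> R, contf g /\ forall j x, `|g x - h j x| <= D / (1 - q) * q ^+ j * expR (a * `|x|).
Proof.
move=> D0 q0 q1 a0 ch hh; exists (fun x => limn (h ^~ x)).
have key j x : `|limn (h ^~ x) - h j x| <= D / (1 - q) * q ^+ j * expR (a * `|x|).
  have De : 0 <= D * expR (a * `|x|) by rewrite mulr_ge0 ?expR_ge0.
  have hx i : `|h i.+1 x - h i x| <= D * expR (a * `|x|) * q ^+ i by rewrite mulrAC; exact: hh.
  have [_ H] := geom_limit_pt De q0 q1 hx.
  have -> : D / (1 - q) * q ^+ j * expR (a * `|x|) = D * expR (a * `|x|) / (1 - q) * q ^+ j by ring.
  exact: H.
split => // x0; apply/cvgrPdist_le => ep ep0.
pose W := expR (a * (`|x0| + 1)).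
have W0 : 0 < W by exact: expR_gt0.
have [j hj] : exists j, D / (1 - q) * q ^+ j * W <= ep / 3.
  have : D / (1 - q) * q ^+ j * W @[j --> \oo] --> D / (1 - q) * 0 * W.
    apply: cvgMl; apply: cvgMr; apply: cvg_expr; by rewrite ger0_norm.
  rewrite mulr0 mul0r => /cvgr_le/(_ (ep / 3)) []; first by lra.
  by move=> j _ hj; exists j; exact: (hj j (leqnn j)).
have wbound x : `|x| <= `|x0| + 1 -> `|limn (h ^~ x) - h j x| <= ep / 3.
  move=> hx; apply: (le_trans (key j x)); apply: le_trans hj; apply: ler_wpM2l.
    by rewrite !mulr_ge0 ?invr_ge0 ?exprn_ge0//; lra.
  by rewrite ler_expR ler_wpM2l.
have ep3 : 0 < ep / 3 by lra.
near=> x.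
have h1 : `|x| <= `|x0| + 1.
  have : `|x0 - x| < 1 by near: x; apply: cvgr_dist_lt.
  by have := lerB_normD x (x0 - x); rewrite subrKC; lra.
have h2 : `|h j x0 - h j x| <= ep / 3.
  near: x; move: (ch j x0) => /cvgrPdist_le; apply; exact: ep3.
have b1 := wbound x h1; have b2 : `|limn (h ^~ x0) - h j x0| <= ep / 3 by apply: wbound; lra.
have -> : limn (h ^~ x0) - limn (h ^~ x) = (limn (h ^~ x0) - h j x0) + (h j x0 - h j x) - (limn (h ^~ x) - h j x) by ring.
have := ler_normB (limn (h ^~ x0) - h j x0 + (h j x0 - h j x)) (limn (h ^~ x) - h j x).
have := ler_normD (limn (h ^~ x0) - h j x0) (h j x0 - h j x).
lra.
Unshelve. all: by end_near. Qed.
End Iteration.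

Definition lipF (R : realType) n (d : R) (F : 'cV[R]_n -> 'cV[R]_n) :=
  forall x y i, `|F x i 0 - F y i 0| <= d * l2 (x - y).

Section Lip.
Variables (R : realType) (n : nat).
Implicit Types (u v : R -> 'cV[R]_n).

Lemma growth_cst (c : 'cV[R]_n) b : 0 <= b -> growth b (fun _ : R => c).
Proof.
move=> b0; split; first by move=> i; exact: cont_cst.
exists (\sum_i `|c i 0|) => x i; apply: (@le_trans _ _ (\sum_i `|c i 0|)).
  by rewrite (bigD1 i)//= lerDl sumr_ge0.
by rewrite ler_peMr ?sumr_ge0// -expR0 ler_expR mulr_ge0.
Qed.

Lemma lip_growth d F b u : 0 <= d -> lipF d F -> F 0 = 0 -> 0 <= b -> growth b u -> growth b (fun x => F (u x)).
Proof.
move=> d0 hF F0 b0 gu; split; last first.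
  have [C C0 hC] := l2_growth gu; exists (d * C) => x i.
  have := hF (u x) 0 i; rewrite F0 mxE !subr0 => h; apply: (le_trans h).
  by rewrite -mulrA ler_wpM2l.
move=> i x0; apply/cvgrPdist_le => ep ep0.
have cc : contf (fun x => d * l2 (u x0 - u x)).
  by have h := cont_l2 (growth_sub (growth_cst (u x0) b0) gu); cont.
have := cc x0 => /cvgrPdist_le/(_ _ ep0).
apply: filterS => x; rewrite subrr.
have -> : l2 (0 : 'cV[R]_n) = 0 by rewrite /l2 /sqnorm big1 ?sqrtr0// => j _; rewrite mxE expr0n.
rewrite mulr0 sub0r normrN ger0_norm ?mulr_ge0 ?l2_ge0// => h.
apply: le_trans h; exact: hF.
Qed.

End Lip.

Section Alg.
Variable R : realType.
(** Absorbing [N] into the left-hand side. *)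
Lemma track_alg1 (D C2 C3 del N A0 : R) : 0 <= D -> 0 <= del -> 0 <= C3 -> 0 <= A0 -> 0 <= N -> D * del * C2 <= 1 / 2 ->
  N <= D * del * (C2 * N + C3 * A0) -> N <= 2 * D * C3 * del * A0.
Proof. by move=> D0 d0 C30 A00 N0 h; have := ler_wpM2r N0 h; lra. Qed.

Lemma track_alg2 (al be cos_coord sin_coord k Z del : R) : 0 <= k -> 0 <= del -> k * del <= 1 / 4 ->
  Z <= k * del * (`|al| + `|be|) -> `|cos_coord - al| <= Z -> `|sin_coord - be| <= Z -> `|al| + `|be| <= 2 * (`|cos_coord| + `|sin_coord|).
Proof.
move=> k0 d0 kd hZ h1 h2.
have a1 := lerB_normD al (cos_coord - al); have b1 := lerB_normD be (sin_coord - be).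
rewrite !subrKC in a1 b1.
have := ler_wpM2r (addr_ge0 (normr_ge0 al) (normr_ge0 be)) kd; lra.
Qed.
End Alg.

Lemma small_delta (R : realType) (D C k : R) : 0 <= D -> 0 <= D * C -> 0 <= k ->
  exists2 d : R, 0 < d & D * d * C <= 1 / 2 /\ k * d <= 1 / 4.
Proof.
move=> D0 DC k0; pose d := Num.min (1 / (2 * (D * C + 1))) (1 / (4 * (k + 1))).
have d0 : 0 < d by rewrite lt_min !divr_gt0//; lra.
have h1 : d <= 1 / (2 * (D * C + 1)) by rewrite ge_min lexx.
have h2 : d <= 1 / (4 * (k + 1)) by rewrite ge_min lexx orbT.
clearbody d; exists d => //.
have p1 : 0 < 2 * (D * C + 1) by lra.
have p2 : 0 < 4 * (k + 1) by lra.
rewrite ler_pdivlMr// in h1; rewrite ler_pdivlMr// in h2; split; lra.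
Qed.

Lemma mid_lt (R : realType) (a b : R) : 0 <= b -> b < a -> 0 < (b + a) / 2 /\ (b + a) / 2 < a.
Proof. by move=> b0 ba; split; lra. Qed.

Lemma cst3_alg (R : realType) (N V X1 X2 C2 C3 A0 : R) : V <= X1 + X2 -> X1 <= C2 * N -> X2 <= C3 * A0 ->
  V <= C2 * N + C3 * A0.
Proof. by lra. Qed.

Lemma two_alg (R : realType) (al be n1 n2 : R) : 0 <= al -> 0 <= be -> 0 <= n1 -> 0 <= n2 ->
  al * n1 + be * n2 <= (n1 + n2) * (al + be).
Proof. by move=> a0 b0 n10 n20; have := mulr_ge0 n10 b0; have := mulr_ge0 n20 a0; lra. Qed.

Lemma half_diff (R : realType) (x y B : R) : `|x| <= B -> `|y| <= B -> `|(x - y) / 2| <= B.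
Proof.
move=> hx hy; rewrite normrM (ger0_norm (_ : 0 <= 2^-1)) ?invr_ge0// ler_pdivrMr//.
by apply: (le_trans (ler_normB _ _)); lra.
Qed.

Lemma trig_comb (R : realType) (p q c s Z : R) : `|p| <= Z -> `|q| <= Z -> `|c| <= 1 -> `|s| <= 1 ->
  `|p * c + q * s| <= 2 * Z.
Proof.
move=> hp hq hc hs; apply: (le_trans (ler_normD _ _)); rewrite !normrM.
have h1 := ler_wpM2l (normr_ge0 p) hc; have h2 := ler_wpM2l (normr_ge0 q) hs; lra.
Qed.

Lemma track_alg3 (R : realType) (X1 X2 c1 N W Z e1 M d A0 k Q : R) : X1 <= c1 * N * W -> X2 <= 2 * Z * e1 ->
  0 <= c1 -> 0 <= N -> 0 <= Z -> 0 <= e1 -> 0 <= M -> 0 <= d -> 0 <= k -> 1 <= W -> N <= M * d * A0 -> Z <= k * d * A0 -> A0 <= 2 * Q ->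
  X1 + X2 <= 2 * (c1 * M + 2 * k * e1) * d * Q * W.
Proof.
move=> h1 h2 c10 N0 Z0 e10 M0 d0 k0 W1 hN hZ hA.
have g1 := ler_wpM2l c10 hN.
have g2 := ler_wpM2r e10 hZ.
have ze : 0 <= Z * e1 by exact: mulr_ge0.
have kd : 0 <= (c1 * M + 2 * k * e1) * d.
  by apply: mulr_ge0 => //; apply: addr_ge0; apply: mulr_ge0 => //; apply: mulr_ge0.
have g3 := ler_wpM2l kd hA.
have g4 : c1 * N + 2 * Z * e1 <= 2 * (c1 * M + 2 * k * e1) * d * Q by lra.
have W0 : 0 <= W by lra.
apply: le_trans (ler_wpM2r W0 g4).
have := ler_wpM2l ze W1; lra.
Qed.

Section Track.
Variables (R : realType) (n : nat) (eta w : R).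
Hypotheses (eta0 : 0 < eta) (w0 : 0 < w).
Variables (ke K : R -> 'M[R]_n) (e : 'cV[R]_n) (l : 'rV[R]_n).
Hypothesis kke : ekernel eta ke.
Hypothesis kK : ekernel eta K.
Hypothesis hMe : symbol K w *m e = 0.
Hypothesis hle : l *m e = 1%:M.
Hypothesis hdet : forall x, \det (symbol (regkernel w K e l) x) != 0.
Notation kreg := (regkernel w K e l).
Notation Lam := (Lambda w e l).
Implicit Types (u v g h : R -> 'cV[R]_n).

Let eta20 : 0 < eta / 2. Proof. by move: eta0; lra. Qed.
Let kkp : ekernel (eta / 2) kreg := regkernel_ekernel eta0 w0 e l kK.

(** The two coordinates of the kernel element [e (alpha cos(w .) + beta sin(w .))], read off at
    three points and therefore defined for every function. *)
Definition cos_coord v : R := rowdot l v 0.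
Definition sin_coord v : R := (rowdot l v (pi / (2 * w)) - rowdot l v (- (pi / (2 * w)))) / 2.
Definition kerfun (al be : R) : R -> 'cV[R]_n := fun x => (al * cos (w * x) + be * sin (w * x)) *: e.

Lemma sgrowth_kerfun (al be : R) : sgrowth 0 (fun x => al * cos (w * x) + be * sin (w * x)).
Proof.
apply: sgrowth_add; apply: sgrowth_scale; apply: sgrowth_trig => //; try by cont.
  by move=> y; exact: cos_max.
by move=> y; exact: sin_max.
Qed.

Lemma subgrowth_kerfun a (al be : R) : 0 < a -> subgrowth a (kerfun al be).
Proof. by move=> a0; exists 0; split => //; apply: sgrowth_vec; exact: sgrowth_kerfun. Qed.

Lemma subgrowth_Lambda a g : subgrowth a g -> subgrowth a (Lam g).
Proof.
move=> [b [b0 ba gg]]; exists ((b + a) / 2); split; [lra|lra|].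
have b1 : 0 < (b + a) / 2 by move: b0 ba; lra.
apply: (Lambda_growth w0 _ _ b1).
by apply: growth_mono gg; move: b0 ba; lra.
Qed.

Lemma rowdot_le v x (B W : R) : 0 <= B -> (forall i, `|v x i 0| <= B * W) -> `|rowdot l v x| <= (\sum_j `|l 0 j|) * B * W.
Proof.
move=> B0 h; rewrite /rowdot mxE; apply: (le_trans (ler_norm_sum _ _ _)).
by rewrite -mulrA mulr_suml; apply: ler_sum => j _; rewrite normrM ler_wpM2l.
Qed.

Lemma rowdot_add v1 v2 x : rowdot l (fun y => v1 y + v2 y) x = rowdot l v1 x + rowdot l v2 x.
Proof. by rewrite /rowdot mulmxDr mxE. Qed.

Lemma rowdot_kerfun al be x : rowdot l (kerfun al be) x = al * cos (w * x) + be * sin (w * x).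
Proof. by rewrite /rowdot /kerfun -scalemxAr hle !mxE eqxx mulr1. Qed.

Lemma wp : w * (pi / (2 * w)) = pi / 2.
Proof. by field; rewrite gt_eqF. Qed.

Lemma cos_coord_kerfun al be : cos_coord (kerfun al be) = al.
Proof. by rewrite /cos_coord rowdot_kerfun mulr0 cos0 sin0 mulr1 mulr0 addr0. Qed.

Lemma sin_coord_kerfun al be : sin_coord (kerfun al be) = be.
Proof. by rewrite /sin_coord !rowdot_kerfun mulrN wp cosN sinN cos_pihalf sin_pihalf; field. Qed.

(** Write [v = Lambda g + kernel element] by [resonant_splitting].  Then [T_reg g = T v = - k * h],
    so [g] is bounded by [d] times the norm of [v], which in turn is bounded by [g] and the kernel
    part.  For small [d] this makes [g], hence [Lambda g], a relatively small correction. *)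
Lemma kernel_tracking : exists2 a1 : R, 0 < a1 & forall a, 0 < a -> a <= a1 ->
  exists d0 C : R, [/\ 0 < d0, 0 <= C & forall d v h, 0 <= d -> d <= d0 -> subgrowth a v -> subgrowth a h ->
    (forall x i, `|h x i 0| <= d * l2 (v x)) -> (forall x, linop K v x + convol ke h x = 0) ->
    forall x i, `|v x i 0 - kerfun (cos_coord v) (sin_coord v) x i 0| <= C * d * (`|cos_coord v| + `|sin_coord v|) * expR (a * `|x|)].
Proof.
have [c c0 hc] := symbol_lower eta20 kkp hdet.
have [s [ai [r [C1 [s0 ai0 aie [_ C10] [_ hinv]]]]]] := linop_inverse eta20 kkp c0 hc.
(* Below 1 for [resolvent], and below half of the decay rate [eta / 2] of the regularised
   kernel. *)
pose a1 := Num.min ai (Num.min (1 / 2) (eta / 4)).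
have a1i : a1 <= ai by rewrite ge_min lexx.
have a12 : a1 <= 1 / 2 by rewrite !ge_min lexx orbT.
have a1e : a1 <= eta / 4 by rewrite !ge_min lexx !orbT.
have a10 : 0 < a1 by rewrite !lt_min ai0; move: eta0; lra.
clearbody a1; exists a1 => // a a0 aa1.
have [C2 C20 hL] := Lambda_mixnorm w0 e l s0 a0.
have M0 := kmass_ge0 eta ke.
set Mu := kmass eta ke in M0.
pose D := C1 * Mu * n%:R; have D0 : 0 <= D by rewrite !mulr_ge0.
pose C3 := mixnorm s a (kerfun 1 0) + mixnorm s a (kerfun 0 1).
have C30 : 0 <= C3 by apply: addr_ge0; exact: mixnorm_ge0.
have DE : D = C1 * Mu * n%:R by [].
have C3E : C3 = mixnorm s a (kerfun 1 0) + mixnorm s a (kerfun 0 1) by [].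
pose L : R := \sum_j `|l 0 j|; have L0 : 0 <= L by apply: sumr_ge0.
have LE : L = \sum_j `|l 0 j| by [].
pose E : R := expR (a * `|pi / (2 * w)|).
have EE : E = expR (a * `|pi / (2 * w)|) by [].
have E1 : 1 <= E by rewrite -expR0 ler_expR; apply: mulr_ge0 => //; exact: ltW.
pose c1 := C2 / s; have c10 : 0 <= c1 by apply: divr_ge0 => //; exact: ltW.
have c1E : c1 = C2 / s by [].
pose e1 : R := \sum_j `|e j 0|; have e10 : 0 <= e1 by apply: sumr_ge0.
have e1E : e1 = \sum_j `|e j 0| by [].
clearbody D C3 L E c1 e1.
have E0 : 0 <= E by lra.
have k1 : 0 <= L * c1 * E by apply: mulr_ge0 => //; exact: mulr_ge0.
have DC0 : 0 <= 2 * D * C3 by apply: mulr_ge0 => //; exact: mulr_ge0.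
have [k k0 kE] : exists2 k, 0 <= k & k = L * c1 * E * (2 * D * C3).
  by exists (L * c1 * E * (2 * D * C3)) => //; exact: mulr_ge0.
have Cf1 : 0 <= c1 * (2 * D * C3) + 2 * k * e1.
  by apply: addr_ge0; [exact: mulr_ge0|apply: mulr_ge0 => //; exact: mulr_ge0].
have [Cf Cf0 CfE] : exists2 Cf, 0 <= Cf & Cf = 2 * (c1 * (2 * D * C3) + 2 * k * e1).
  by exists (2 * (c1 * (2 * D * C3) + 2 * k * e1)) => //; exact: mulr_ge0.
have DC2 : 0 <= D * C2 by exact: mulr_ge0.
have [d0 d00 [d01 d02]] : exists2 d0 : R, 0 < d0 & D * d0 * C2 <= 1 / 2 /\ k * d0 <= 1 / 4 by exact: small_delta.
exists d0, Cf; split => // d v h dd0 dd hv hh hhv hE x i.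
have ae : 2 * a <= eta by move: eta0; lra.
have ae2 : 2 * a <= eta / 2 by lra.
have [b [b0 ba gv]] := hv; have [b'0 b'a] := mid_lt b0 ba.
have b'1 : (b + a) / 2 < 1 by apply: (lt_le_trans b'a); apply: (le_trans aa1); apply: (le_trans a12); lra.
have b'e : (b + a) / 2 < eta by apply: (lt_le_trans b'a); apply: (le_trans aa1); apply: (le_trans a1e); move: eta0; lra.
have b'b : b <= (b + a) / 2 by rewrite ler_pdivlMr// mulr_natr mulr2n lerD2l ltW.
have [g [al [be [gg vE gT]]]] : exists g al be, [/\ growth ((b + a) / 2) g,
   forall x, v x = Lam g x + (al * cos (w * x) + be * sin (w * x)) *: e & forall x, linop kreg g x = linop K v x].
  by apply: (resonant_splitting eta0 w0 kK hMe hle) => //; exact: growth_mono gv.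
have hg : subgrowth a g by exists ((b + a) / 2); split => //; exact: ltW.
have hLg := subgrowth_Lambda hg.
set N := mixnorm s a g; have N0 : 0 <= N := mixnorm_ge0 s0 a g.
have hN1 : N <= D * d * (C2 * N + C3 * (`|al| + `|be|)).
  have i1 := hinv a g hg (le_trans aa1 a1i).
  have eT : linop kreg g = (fun x => -1 *: convol ke h x).
    apply/funext => y; rewrite gT scaleN1r; apply/eqP; rewrite -subr_eq0 opprK; apply/eqP; exact: hE.
  have hcv := subgrowth_convol eta0 kke hh ae.
  have i2 := mixnorm_scale s0 (-1) hcv; rewrite normrN1 mul1r in i2.
  have i3 := mixnorm_convol s0 eta0 kke hh ae.
  have i4 := mixnorm_dom s0 dd0 hh hv hhv.
  have i5 := hL g hg.
  have i6 : mixnorm s a v <= mixnorm s a (Lam g) + mixnorm s a (kerfun al be).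
    have -> : v = (fun x => Lam g x + kerfun al be x) by apply/funext.
    exact: mixnorm_add (subgrowth_kerfun al be a0).
  have i7 : mixnorm s a (kerfun al be) <= C3 * (`|al| + `|be|).
    have -> : kerfun al be = (fun x => al *: kerfun 1 0 x + be *: kerfun 0 1 x).
      apply/funext => y; rewrite /kerfun !scalerA -scalerDl; congr (_ *: _); ring.
    apply: (le_trans (mixnorm_add s0 (subgrowth_scale _ (subgrowth_kerfun _ _ a0)) (subgrowth_scale _ (subgrowth_kerfun _ _ a0)))).
    apply: (le_trans (lerD (mixnorm_scale s0 _ (subgrowth_kerfun _ _ a0)) (mixnorm_scale s0 _ (subgrowth_kerfun _ _ a0)))).
    by rewrite C3E; apply: two_alg => //; exact: mixnorm_ge0.
  rewrite eT in i1.
  have i8 : mixnorm s a v <= C2 * N + C3 * (`|al| + `|be|) by exact: cst3_alg i6 i5 i7.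
  apply: (le_trans i1); apply: (le_trans (ler_wpM2l C10 i2)).
  apply: (le_trans (ler_wpM2l C10 i3)); apply: (le_trans (ler_wpM2l C10 (ler_wpM2l M0 i4))).
  have dn : 0 <= C1 * (Mu * (d * n%:R)).
    by apply: mulr_ge0 => //; apply: mulr_ge0 => //; apply: mulr_ge0.
  have := ler_wpM2l dn i8; rewrite DE; congr (_ <= _); ring.
have A0 : 0 <= `|al| + `|be| by apply: addr_ge0.
have Dd : D * d * C2 <= 1 / 2.
  apply: le_trans d01; rewrite -mulrA -[leRHS]mulrA; apply: ler_wpM2l => //; exact: ler_wpM2r.
have kd : k * d <= 1 / 4 by apply: le_trans d02; exact: ler_wpM2l.
have hN := track_alg1 D0 dd0 C30 A0 N0 Dd hN1.
have Lb y j : `|Lam g y j 0| <= c1 * N * expR (a * `|y|).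
  apply: (le_trans (mixnorm_bd s0 hLg y j)); apply: ler_wpM2r; first exact: expR_ge0.
  rewrite c1E ler_pdivrMr//; have := hL g hg; rewrite -/N; congr (_ <= _).
  by field; rewrite gt_eqF.
have cN0 : 0 <= c1 * N by exact: mulr_ge0.
have lb y : `|rowdot l (Lam g) y| <= L * (c1 * N) * expR (a * `|y|) by rewrite LE; apply: rowdot_le.
have vE' : v = (fun y => Lam g y + kerfun al be y) by apply/funext.
pose Z := L * (c1 * N) * E.
have LcN : 0 <= L * (c1 * N) by exact: mulr_ge0.
have q1 : `|cos_coord v - al| <= Z.
  rewrite vE' /cos_coord rowdot_add -/(cos_coord (kerfun al be)) cos_coord_kerfun addrK; apply: (le_trans (lb 0)).
  by rewrite normr0 mulr0 expR0; apply: ler_wpM2l.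
have q2 : `|sin_coord v - be| <= Z.
  rewrite -[X in _ - X](sin_coord_kerfun al) vE' /sin_coord !(rowdot_add (Lam g)).
  have -> : forall p q x y : R, (p + q - (x + y)) / 2 - (q - y) / 2 = (p - x) / 2 by move=> *; field.
  have h1 := lb (pi / (2 * w)); have h2 := lb (- (pi / (2 * w))); rewrite normrN in h2.
  by rewrite -EE in h1 h2; exact: half_diff.
have hZ : Z <= k * d * (`|al| + `|be|).
  have := ler_wpM2l k1 hN; rewrite /Z kE; congr (_ <= _); ring.
have hA := track_alg2 k0 dd0 kd hZ q1 q2.
set Qs := `|cos_coord v| + `|sin_coord v| in hA *.
set W := expR (a * `|x|); have W1 : 1 <= W by rewrite -expR0 ler_expR mulr_ge0// ltW.
have -> : v x i 0 - kerfun (cos_coord v) (sin_coord v) x i 0 =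
   Lam g x i 0 + ((al - cos_coord v) * cos (w * x) + (be - sin_coord v) * sin (w * x)) * e i 0.
  by rewrite {1}vE; rewrite /kerfun [LHS]addrC !mxE; ring.
have h1 := Lb x i; rewrite -/W in h1.
have h2 : `|((al - cos_coord v) * cos (w * x) + (be - sin_coord v) * sin (w * x)) * e i 0| <= 2 * Z * e1.
  rewrite normrM; apply: ler_pM => //; last by rewrite e1E (bigD1 i)//= lerDl sumr_ge0.
  apply: trig_comb; [by rewrite distrC|by rewrite distrC|exact: cos_max|exact: sin_max].
apply: (le_trans (ler_normD _ _)); rewrite CfE.
exact: (track_alg3 h1 h2 c10 N0 (mulr_ge0 LcN E0) e10 DC0 dd0 k0 W1 hN hZ hA).
Qed.
End Track.

(** * Existence of even solutions *)

Section Lin.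
Variables (R : realType) (n : nat).
Implicit Types (f g : R -> R) (u v : R -> 'cV[R]_n).

Lemma prim_sub f g x : contf f -> contf g -> prim (fun y => f y - g y) x = prim f x - prim g x.
Proof.
move=> cf cg; rewrite /prim.
have E a b : Int (fun y => ind a b y * (f y - g y)) = Int (fun y => ind a b y * f y) - Int (fun y => ind a b y * g y).
  by rewrite -Int_B; [apply: eq_Int => y; rewrite mulrBr|exact: itg_seg|exact: itg_seg].
by rewrite !E; ring.
Qed.

Lemma sineint_sub (w : R) f g x : contf f -> contf g -> sineint w (fun y => f y - g y) x = sineint w f x - sineint w g x.
Proof.
move=> cf cg; rewrite /sineint.
have e1 : (fun y => cos (w * y) * (f y - g y)) = (fun y => cos (w * y) * f y - cos (w * y) * g y).
  by apply/funext => y; rewrite mulrBr.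
have e2 : (fun y => sin (w * y) * (f y - g y)) = (fun y => sin (w * y) * f y - sin (w * y) * g y).
  by apply/funext => y; rewrite mulrBr.
rewrite e1 e2 !prim_sub; try (by cont); ring.
Qed.

Lemma linop_sub (eta : R) (K : R -> 'M[R]_n) b u v x : 0 < eta -> ekernel eta K -> `|b| <= eta -> growth b u -> growth b v ->
  linop K (fun y => u y - v y) x = linop K u x - linop K v x.
Proof.
move=> eta0 kK be gu gv; rewrite /linop (convol_sub kK x gu gv be).
by move: (u x) (v x) (convol K u x) (convol K v x) => p q r s; apply/colP => i; rewrite !mxE; ring.
Qed.

Lemma linop_add (eta : R) (K : R -> 'M[R]_n) b u v x : 0 < eta -> ekernel eta K -> `|b| <= eta -> growth b u -> growth b v ->
  linop K (fun y => u y + v y) x = linop K u x + linop K v x.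
Proof. by move=> eta0 kK be gu gv; rewrite /linop (convol_add kK x gu gv be) opprD addrACA. Qed.

Lemma convol_even (K : R -> 'M[R]_n) (eta b : R) v : ekernel eta K -> 0 < eta -> `|b| <= eta -> growth b v ->
  (forall x, v (- x) = v x) -> forall x, convol K v (- x) = convol K v x.
Proof.
move=> kK eta0 be gv ev x; apply/colP => i; rewrite !mxE.
rewrite -(Int_opp (convol_itg1 kK (- x) i gv be)); apply: eq_Int => y.
by rewrite kK.2 (_ : - x - - y = - (x - y)) ?ev//; ring.
Qed.
End Lin.

Lemma phi_alg (R : realType) n (y z p q r s : 'cV[R]_n) (th : R) :
  y - th *: p - th *: r - (z - th *: q - th *: s) = y - z - th *: (p - q) - th *: (r - s).
Proof. by apply/colP => i; rewrite !mxE; ring. Qed.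

Lemma contr_alg (R : realType) (th m1 m2 d nn r Cc q x1 x2 x3 x4 x5 x6 V : R) : 0 <= th -> 0 <= m1 -> 0 <= m2 -> 0 <= d -> 0 <= nn ->
  x1 <= r * V -> x2 <= th * x3 -> x3 <= m1 * x4 -> x4 <= m2 * x5 -> x5 <= d * nn * x6 -> x6 <= Cc * V -> 0 <= V ->
  r + th * (m1 * (m2 * (nn * Cc))) * d <= q -> x1 + x2 <= q * V.
Proof.
move=> th0 m10 m20 d0 nn0 h1 h2 h3 h4 h5 h6 V0 hq.
have g1 := ler_wpM2l (mulr_ge0 d0 nn0) h6.
have g2 := ler_wpM2l m20 (le_trans h5 g1).
have g3 := ler_wpM2l m10 (le_trans h4 g2).
have g4 := ler_wpM2l th0 (le_trans h3 g3).
have := ler_wpM2r V0 hq; lra.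
Qed.

Lemma contr_rate (R : realType) (r C : R) : 0 <= r -> r < 1 -> 0 <= C ->
  exists2 dl : R, 0 < dl & exists q : R, [/\ 0 <= q, q < 1 & forall d, 0 <= d -> d <= dl -> r + C * d <= q].
Proof.
move=> r0 r1 C0; have p : 0 < 2 * (C + 1) by lra.
exists ((1 - r) / (2 * (C + 1))); first by apply: divr_gt0; lra.
exists ((1 + r) / 2); split; [lra|lra|move=> d d0].
rewrite ler_pdivlMr//; lra.
Qed.

Lemma even_alg (R : realType) (x y z E W qj : R) : x <= E * qj * W -> y <= E * qj * W -> z <= x + y ->
  z <= 2 * (E * W) * qj.
Proof. by move=> h1 h2 h3; lra. Qed.

Lemma vec3 (V : zmodType) (p q r : V) : p - r = (q - r) - (q - p).
Proof. by rewrite opprB [RHS]addrC subrKA. Qed.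

Lemma fix_alg (R : realType) (x1 x2 x3 E q qj ka : R) : 0 <= q -> q < 1 -> 0 <= E * qj * ka -> 0 <= x3 ->
  x2 <= q * x3 -> x1 <= E * (q * qj) * ka -> x3 <= E * qj * ka -> x1 + x2 <= 2 * E * ka * qj.
Proof.
move=> q0 q1 P0 x30 h1 h2 h3; have := ler_wpM2l q0 h3; have := ler_wpM2r P0 (ltW q1); lra.
Qed.

Section Exist.
Variables (R : realType) (n : nat) (eta w : R).
Hypotheses (eta0 : 0 < eta) (w0 : 0 < w).
Variables (ke K : R -> 'M[R]_n) (e : 'cV[R]_n) (l : 'rV[R]_n).
Hypothesis kke : ekernel eta ke.
Hypothesis kK : ekernel eta K.
Hypothesis hMe : symbol K w *m e = 0.
Hypothesis hle : l *m e = 1%:M.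
Hypothesis hdet : forall x, \det (symbol (regkernel w K e l) x) != 0.
Notation kreg := (regkernel w K e l).
Notation Lam := (Lambda w e l).
Implicit Types (u v g h : R -> 'cV[R]_n).

Let eta20 : 0 < eta / 2. Proof. by move: eta0; lra. Qed.
Let kkp : ekernel (eta / 2) kreg := regkernel_ekernel eta0 w0 e l kK.
Let kkT := trkernel_ekernel kkp.

(** [Lambda] corrected by an element of the kernel so that [l] vanishes at the origin: adding
    [Lambda0 g] keeps the first coordinate. *)
Definition Lambda0 g x := Lam g x - kerfun w e (rowdot l g 0) 0 x.

Lemma Lambda0_growth b g : 0 < b -> growth b g -> growth b (Lambda0 g).
Proof.
move=> b0 gg; apply: growth_sub; first exact: Lambda_growth.
apply: growth_mono (ltW b0) _; apply: sgrowth_vec; exact: sgrowth_kerfun.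
Qed.

Lemma Lambda0_sub b g g' x : growth b g -> growth b g' -> Lambda0 (fun y => g y - g' y) x = Lambda0 g x - Lambda0 g' x.
Proof.
move=> gg gg'; have cg := (rowdot_sgrowth l gg).1; have cg' := (rowdot_sgrowth l gg').1.
have le : rowdot l (fun y => g y - g' y) = (fun y => rowdot l g y - rowdot l g' y).
  by apply/funext => y; rewrite /rowdot mulmxBr mxE [X in _ + X]mxE.
rewrite /Lambda0 /Lambda le (sineint_sub w x cg cg') /kerfun.
by move: (g x) (g' x) => p q; apply/colP => i; rewrite !mxE; ring.
Qed.

Lemma Lambda0_even g b : growth b g -> (forall x, g (- x) = g x) -> forall x, Lambda0 g (- x) = Lambda0 g x.
Proof.
move=> gg eg x; have cg := (rowdot_sgrowth l gg).1.
have le y : rowdot l g (- y) = rowdot l g y by rewrite /rowdot eg.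
by rewrite /Lambda0 /Lambda /kerfun eg (sineint_even w cg le) mulrN cosN !mul0r.
Qed.

Lemma Lambda0_lv0 g : rowdot l (Lambda0 g) 0 = 0.
Proof.
rewrite /rowdot /Lambda0 /Lambda /kerfun sg0 !mulr0 scale0r subr0 cos0 mul0r addr0 mulr1 mulmxBr -scalemxAr hle.
by rewrite mxE [X in _ + X]mxE [X in _ - X]mxE [X in _ - _ * X]mxE eqxx mulr1 subrr.
Qed.

Lemma linop_Lambda0 b g x : 0 < b -> b < eta -> growth b g -> linop K (Lambda0 g) x = linop kreg g x.
Proof.
move=> b0 be gg; have babs : `|b| <= eta by rewrite ger0_norm ltW.
have gk : growth b (kerfun w e (rowdot l g 0) 0) by apply: growth_mono (ltW b0) _; apply: sgrowth_vec; exact: sgrowth_kerfun.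
rewrite /Lambda0 (linop_sub x eta0 kK babs (Lambda_growth w0 e l b0 gg) gk) (linop_Lambda eta0 w0 l kK hMe x b0 be gg).
by rewrite (linop_kerfun eta0 w0 kK hMe) subr0.
Qed.

Lemma subgrowth_Lambda0 a g : 0 < a -> subgrowth a g -> subgrowth a (Lambda0 g).
Proof. by move=> a0 hg; apply: subgrowth_sub; [exact: subgrowth_Lambda|exact: subgrowth_kerfun]. Qed.

Lemma Lambda0_mixnorm s a : 0 < s -> 0 < a -> exists2 C : R, 0 <= C & forall g, subgrowth a g -> mixnorm s a (Lambda0 g) <= C * mixnorm s a g.
Proof.
move=> s0 a0; have [C C0 hC] := Lambda_mixnorm w0 e l s0 a0.
pose L : R := \sum_j `|l 0 j|; have L0 : 0 <= L by apply: sumr_ge0.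
have k0 := mixnorm_ge0 s0 a (kerfun w e 1 0).
have D0 : 0 <= L / s * mixnorm s a (kerfun w e 1 0) by apply: mulr_ge0 => //; apply: divr_ge0 => //; exact: ltW.
exists (C + L / s * mixnorm s a (kerfun w e 1 0)); first exact: addr_ge0.
move=> g hg; apply: (le_trans (mixnorm_sub s0 (subgrowth_Lambda w0 e l hg) (subgrowth_kerfun w e (rowdot l g 0) 0 a0))).
rewrite mulrDl; apply: lerD; first exact: hC.
have -> : kerfun w e (rowdot l g 0) 0 = (fun x => rowdot l g 0 *: kerfun w e 1 0 x).
  by apply/funext => y; rewrite /kerfun scalerA; congr (_ *: _); ring.
apply: (le_trans (mixnorm_scale s0 _ (subgrowth_kerfun w e 1 0 a0))).
have h : `|rowdot l g 0| <= L * (mixnorm s a g / s) * expR (a * `|0 : R|).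
  by apply: rowdot_le; [apply: divr_ge0; [exact: mixnorm_ge0|exact: ltW]|move=> i; exact: mixnorm_bd].
rewrite normr0 mulr0 expR0 mulr1 in h.
have := ler_wpM2r k0 h; congr (_ <= _); ring.
Qed.

Section Phi.
Variables (F : 'cV[R]_n -> 'cV[R]_n) (d : R) (al : R) (th : R).
Hypotheses (d0 : 0 <= d) (hF : lipF d F) (F0 : F 0 = 0).

(** The ansatz: kernel element with coordinates [(al, 0)] plus a [Lambda0]-image. *)
Definition Ug g x := kerfun w e al 0 x + Lambda0 g x.
Definition FU g x := F (Ug g x).
(** Relaxation step for the equation [T_reg g + F-term = 0] satisfied by the unknown [g]. *)
Definition Phi g x := relaxop kreg th g x - th *: linop (trkernel kreg) (convol ke (FU g)) x.

Lemma Ug_growth b g : 0 < b -> growth b g -> growth b (Ug g).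
Proof.
move=> b0 gg; apply: growth_add; last exact: Lambda0_growth.
apply: growth_mono (ltW b0) _; apply: sgrowth_vec; exact: sgrowth_kerfun.
Qed.

Lemma FU_growth b g : 0 < b -> growth b g -> growth b (FU g).
Proof. by move=> b0 gg; apply: (lip_growth d0 hF F0 (ltW b0)); exact: Ug_growth. Qed.

Lemma Ug_even b g : growth b g -> (forall x, g (- x) = g x) -> forall x, Ug g (- x) = Ug g x.
Proof. by move=> gg eg x; rewrite /Ug (Lambda0_even gg eg) /kerfun mulrN cosN !mul0r. Qed.

Lemma linop_even (J : R -> 'M[R]_n) (et b : R) v : ekernel et J -> 0 < et -> `|b| <= et -> growth b v ->
  (forall x, v (- x) = v x) -> forall x, linop J v (- x) = linop J v x.
Proof. by move=> kJ et0 be gv ev x; rewrite /linop ev (convol_even kJ et0 be gv ev). Qed.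

Section Fix.
Variable b : R.
Hypotheses (b0 : 0 < b) (be : b <= eta / 2).
Let babs2 : `|b| <= eta / 2. Proof. by rewrite ger0_norm// ltW. Qed.
Let beta : b < eta. Proof. by apply: (le_lt_trans be); move: eta0; lra. Qed.
Let babs : `|b| <= eta. Proof. by rewrite ger0_norm ltW. Qed.

Lemma cFU_growth g : growth b g -> growth b (convol ke (FU g)).
Proof. by move=> gg; apply: (convol_growth eta0 kke _ babs); exact: FU_growth. Qed.

Lemma Phi_growth g : growth b g -> growth b (Phi g).
Proof.
move=> gg; apply: growth_sub; first exact: (relaxop_growth eta20 kkp _ gg babs2).
by apply: growth_scale; apply: (linop_growth eta20 kkT _ babs2); exact: cFU_growth.
Qed.

Lemma Phi_even g : growth b g -> (forall x, g (- x) = g x) -> forall x, Phi g (- x) = Phi g x.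
Proof.
move=> gg eg x; rewrite /Phi /relaxop eg.
have gT := linop_growth eta20 kkp gg babs2.
rewrite (linop_even kkT eta20 babs2 gT (linop_even kkp eta20 babs2 gg eg)).
have eF y : FU g (- y) = FU g y by rewrite /FU (Ug_even gg eg).
have eC := convol_even kke eta0 babs (FU_growth b0 gg) eF.
by rewrite (linop_even kkT eta20 babs2 (cFU_growth gg) eC).
Qed.

Lemma Phi_sub g g' x : growth b g -> growth b g' -> Phi g x - Phi g' x =
  relaxop kreg th (fun y => g y - g' y) x - th *: linop (trkernel kreg) (convol ke (fun y => FU g y - FU g' y)) x.
Proof.
move=> gg gg'; rewrite /Phi /relaxop.
have gT := linop_growth eta20 kkp gg babs2; have gT' := linop_growth eta20 kkp gg' babs2.
have E1 : convol ke (fun y => FU g y - FU g' y) = (fun y => convol ke (FU g) y - convol ke (FU g') y).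
  by apply/funext => y; exact: (convol_sub kke y (FU_growth b0 gg) (FU_growth b0 gg') babs).
have E2 : linop kreg (fun y => g y - g' y) = (fun y => linop kreg g y - linop kreg g' y).
  by apply/funext => y; exact: (linop_sub y eta20 kkp babs2 gg gg').
rewrite E1 E2 (linop_sub x eta20 kkT babs2 gT gT') (linop_sub x eta20 kkT babs2 (cFU_growth gg) (cFU_growth gg')).
exact: phi_alg.
Qed.

(** A fixed point satisfies [T_reg^t (T_reg g + F-term) = 0], and [T_reg^t] is injective. *)
Lemma Phi_fix g x : 0 < th -> (forall (a : R) v, subgrowth a v -> a <= 2 * b -> (forall x, linop (trkernel kreg) v x = 0) -> forall x, v x = 0) ->
  growth b g -> (forall x, Phi g x = g x) -> linop K (Ug g) x + convol ke (FU g) x = 0.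
Proof.
move=> th0 inj gg fx.
have gk : growth b (kerfun w e al 0) by apply: growth_mono (ltW b0) _; apply: sgrowth_vec; exact: sgrowth_kerfun.
rewrite /Ug (linop_add x eta0 kK babs gk (Lambda0_growth b0 gg)) (linop_kerfun eta0 w0 kK hMe) add0r (linop_Lambda0 x b0 beta gg).
have gT := linop_growth eta20 kkp gg babs2.
apply: (inj (2 * b) (fun x => linop kreg g x + convol ke (FU g) x)) => //.
  exists b; split; [exact: ltW|by move: b0; lra|]; apply: growth_add => //; exact: cFU_growth.
move=> y; rewrite (linop_add y eta20 kkT babs2 gT (cFU_growth gg)).
have := fx y; rewrite /Phi /relaxop -addrA -opprD -scalerDr => /eqP; rewrite -subr_eq0 addrAC subrr sub0r oppr_eq0.
by rewrite scaler_eq0 gt_eqF//= => /eqP.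
Qed.
End Fix.
End Phi.

Lemma geo_zero (X D q : R) : 0 <= q -> q < 1 -> (forall j, X <= D * q ^+ j) -> X <= 0.
Proof.
move=> q0 q1 h.
have : D * q ^+ j @[j --> \oo] --> D * 0 by apply: cvgMr; apply: cvg_expr; rewrite ger0_norm.
rewrite mulr0 => /cvgr_to_ge; apply; exact: nearW.
Qed.

(** Iterate [Phi] from 0.  It contracts the mixed norm of weight [a], so the iterates converge
    geometrically, but the limit is only O(exp(a |x|)) and falls out of the class of weight [a].
    It lies in the class of weight [2 a], where [Phi] contracts as well, and there it is a fixed
    point. *)
Lemma even_solution_exists : exists2 a1 : R, 0 < a1 & forall a, 0 < a -> a <= a1 -> exists2 dl : R, 0 < dl & forall F d,
  0 <= d -> d <= dl -> lipF d F -> F 0 = 0 -> forall al, exists u,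
  [/\ growth a u, (forall x, u (- x) = u x), rowdot l u 0 = al & forall x, linop K u x + convol ke (fun y => F (u y)) x = 0].
Proof.
have [c c0 hc] := symbol_lower eta20 kkp hdet.
have [s [ai [r [C1 [s0 ai0 aie [/andP[r0 r1] C10] [hS _]]]]]] := linop_inverse eta20 kkp c0 hc.
have hdetT x : \det (symbol (trkernel kreg) x) != 0 by rewrite symbol_trkernel det_tr.
have [cT cT0 hcT] := symbol_lower eta20 kkT hdetT.
have [aj aj0 hinj] := linop_inj eta20 kkT cT0 hcT.
set th := theta (eta / 2) kreg c in hS.
have th0 : 0 < th by exact: theta0.
clearbody th.
(* Halved because the argument also uses the weight [2 a]. *)
pose a1 := Num.min (ai / 2) (Num.min (aj / 2) (eta / 8)).
have a1i : a1 <= ai / 2 by rewrite ge_min lexx.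
have a1j : a1 <= aj / 2 by rewrite !ge_min lexx orbT.
have a1e : a1 <= eta / 8 by rewrite !ge_min lexx !orbT.
have a10 : 0 < a1 by rewrite !lt_min !divr_gt0.
clearbody a1; exists a1 => // a a0 aa1.
have a20 : 0 < 2 * a by lra.
have ai2 : 2 * a <= ai by lra.
have aj2 : 2 * a <= aj by lra.
have ae : 2 * (2 * a) <= eta / 2 by lra.
have a'0 : 0 < a / 2 by lra.
have a'a : a / 2 < a by lra.
have a2a : a < 2 * a by lra.
have aeh : a <= eta / 2 by lra.
have a'e : a / 2 <= eta / 2 by lra.
have [Ca Ca0 hCa] := Lambda0_mixnorm s0 a0.
have [Cb Cb0 hCb] := Lambda0_mixnorm s0 a20.
have M0 := kmass_ge0 (eta / 2) kreg; have M0' := kmass_ge0 eta ke.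
pose Ct : R := th * ((1 + kmass (eta / 2) kreg) * (kmass eta ke * (n%:R * (Ca + Cb)))).
have Ct0 : 0 <= Ct.
  by apply: mulr_ge0; [exact: ltW|apply: mulr_ge0; [exact: addr_ge0|apply: mulr_ge0 => //; apply: mulr_ge0 => //; exact: addr_ge0]].
have [dl dl0 [q [q0 q1 hq]]] := contr_rate r0 r1 Ct0.
exists dl => // F d d0 dd hF F0 al; have rq := hq d d0 dd; clear hq dd.
have {}rq : r + th * ((1 + kmass (eta / 2) kreg) * (kmass eta ke * (n%:R * (Ca + Cb)))) * d <= q by exact: rq.
clearbody Ct.
have contr b b' (C : R) g g' : 0 < b' -> b' < b -> b <= 2 * a -> C <= Ca + Cb ->
    (forall g, subgrowth b g -> mixnorm s b (Lambda0 g) <= C * mixnorm s b g) -> growth b' g -> growth b' g' ->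
    mixnorm s b (fun x => Phi F al th g x - Phi F al th g' x) <= q * mixnorm s b (fun x => g x - g' x).
  move=> b'0 b'b b2a CC hC gg gg'.
  have b0 : 0 < b by exact: lt_trans b'b.
  have be : 2 * b <= eta / 2 by apply: le_trans ae; rewrite ler_wpM2l.
  have be' : 2 * b <= eta by apply: (le_trans be); move: eta0; lra.
  have b'e : b' <= eta / 2 by move: be b'b b0; lra.
  have cgg : subgrowth b (fun x => g x - g' x) by exists b'; split; [exact: ltW|by []|exact: growth_sub].
  have -> : (fun x => Phi F al th g x - Phi F al th g' x) =
     (fun x => relaxop kreg th (fun y => g y - g' y) x - th *: linop (trkernel kreg) (convol ke (fun y => FU F al g y - FU F al g' y)) x).
    by apply/funext => x; exact: (Phi_sub al th d0 hF F0 b'0 b'e).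
  set V := fun x => g x - g' x in cgg *.
  have hUU : subgrowth b (fun y => FU F al g y - FU F al g' y).
    by exists b'; split; [exact: ltW|by []|apply: growth_sub; exact: (FU_growth al d0 hF F0 b'0)].
  have hUV y : Ug al g y - Ug al g' y = Lambda0 V y.
    by rewrite /Ug opprD addrACA subrr add0r (Lambda0_sub _ gg gg').
  have hLV : subgrowth b (Lambda0 V) by exact: subgrowth_Lambda0.
  have hC1 := subgrowth_convol eta0 kke hUU be'.
  have hC2 := subgrowth_linop eta20 kkT hC1 be.
  have hSo : subgrowth b (relaxop kreg th V).
    apply: subgrowth_sub => //; apply: subgrowth_scale; apply: (subgrowth_linop eta20 kkT _ be); exact: (subgrowth_linop eta20 kkp cgg be).
  apply: (le_trans (mixnorm_sub s0 hSo (subgrowth_scale th hC2))).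
  have i1 := hS b V cgg (le_trans b2a ai2).
  have i2 := mixnorm_scale s0 th hC2; rewrite (ger0_norm (ltW th0)) in i2.
  have i3 := mixnorm_linop s0 eta20 kkT hC1 be; rewrite kmass_trkernel in i3.
  have i4 := mixnorm_convol s0 eta0 kke hUU be'.
  have i5 : mixnorm s b (fun y => FU F al g y - FU F al g' y) <= d * n%:R * mixnorm s b (Lambda0 V).
    by apply: mixnorm_dom => // y i; rewrite mxE [X in _ + X]mxE -hUV; exact: hF.
  have N0 := mixnorm_ge0 s0 b V.
  have i6 : mixnorm s b (Lambda0 V) <= (Ca + Cb) * mixnorm s b V.
    by apply: (le_trans (hC _ cgg)); exact: ler_wpM2r.
  exact: (contr_alg (ltW th0) (addr_ge0 ler01 M0) M0' d0 (ler0n R n) i1 i2 i3 i4 i5 i6 N0 rq).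

pose gs j := iter j (Phi F al th) (fun _ => 0 : 'cV[R]_n).
have gsg j : growth (a / 2) (gs j).
  elim: j => [|j IH]; first exact: growth_cst (ltW a'0).
  exact: (Phi_growth al th d0 hF F0 a'0 a'e IH).
have gse j x : gs j (- x) = gs j x.
  elim: j x => [|j IH] x; first by reflexivity.
  exact: (Phi_even al th d0 hF F0 a'0 a'e (gsg j) IH).
pose N0 := mixnorm s a (fun x => gs 1%N x - gs 0%N x).
have N00 : 0 <= N0 by exact: mixnorm_ge0.
have CaC : Ca <= Ca + Cb by rewrite lerDl.
have CbC : Cb <= Ca + Cb by rewrite lerDr.
have Nj j : mixnorm s a (fun x => gs j.+1 x - gs j x) <= q ^+ j * N0.
  elim: j => [|j IH]; first by rewrite expr0 mul1r.
  rewrite exprS -mulrA; apply: le_trans (ler_wpM2l q0 IH).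
  exact: (contr a (a / 2) Ca _ _ a'0 a'a (ltW a2a) CaC hCa (gsg j.+1) (gsg j)).
pose D := N0 / s; have D0 : 0 <= D by apply: divr_ge0 => //; exact: ltW.
have step j x i : `|gs j.+1 x i 0 - gs j x i 0| <= D * q ^+ j * expR (a * `|x|).
  have cl : subgrowth a (fun x => gs j.+1 x - gs j x).
    by exists (a / 2); split; [exact: ltW|by []|apply: growth_sub].
  have := mixnorm_bd s0 cl x i; rewrite mxE [X in _ + X]mxE => h; apply: (le_trans h).
  apply: ler_wpM2r; first exact: expR_ge0.
  rewrite /D mulrAC; apply: ler_wpM2r; first by rewrite invr_ge0 ltW.
  by rewrite mulrC; apply: Nj.
have lim i : exists g : R -> R, contf g /\ forall j x, `|g x - gs j x i 0| <= D / (1 - q) * q ^+ j * expR (a * `|x|).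
  exact: (geom_limit D0 q0 q1 (ltW a0) (fun j => (gsg j).1 i) (fun j x => step j x i)).
have {lim} [G hG] := choice lim.
pose g x : 'cV[R]_n := \col_i G i x.
pose T j := D / (1 - q) * q ^+ j.
have hT j x i : `|gs j x i 0 - g x i 0| <= T j * expR (a * `|x|).
  by rewrite mxE distrC; exact: (hG i).2.
have gg : growth a g.
  split; first by move=> i; apply: contf_eq (hG i).1 => x; rewrite mxE.
  exists (T 0%N) => x i; have := hT 0%N x i; by rewrite mxE sub0r normrN.
have ge x : g (- x) = g x.
  apply/colP => i; apply/eqP; rewrite -subr_eq0 -normr_le0.
  apply: (@geo_zero _ (2 * (D / (1 - q) * expR (a * `|x|))) q q0 q1) => j.
  have h1 := hT j x i; have h2 := hT j (- x) i; rewrite gse normrN in h2.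
  have := ler_normB (gs j x i 0 - g x i 0) (gs j x i 0 - g (- x) i 0).
  have -> : gs j x i 0 - g x i 0 - (gs j x i 0 - g (- x) i 0) = g (- x) i 0 - g x i 0 by ring.
  exact: even_alg.
pose om (x : R) : 'cV[R]_n := expR (a * `|x|) *: e.
have omg : growth a om.
  apply: sgrowth_vec; split; first by cont.
  by exists 1 => // x; rewrite mul1r ger0_norm// expR_ge0.
(* The limit belongs to the class of weight [2 a] only; a pointwise bound by [t exp(a |x|)] is a
   bound of the mixed norm by comparison with [om]. *)
have cl2 v : growth a v -> subgrowth (2 * a) v by move=> gv; exists a; split => //; exact: ltW.
have le0 : 0 < l2 e.
  rewrite lt_neqAle l2_ge0 andbT eq_sym; apply/eqP => l0.
  have e0 : e = 0.
    apply/colP => i; apply/eqP; rewrite mxE -normr_le0; have := l2_coord e i; by rewrite l0.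
  have := congr1 (fun M : 'M[R]_1 => M 0 0) hle; rewrite e0 mulmx0 !mxE eqxx => /eqP.
  by rewrite eq_sym oner_eq0.
pose ka := n%:R / l2 e * mixnorm s (2 * a) om.
have Nom v t : growth a v -> 0 <= t -> (forall x i, `|v x i 0| <= t * expR (a * `|x|)) -> mixnorm s (2 * a) v <= t * ka.
  move=> gv t0 hv.
  have := mixnorm_dom s0 (divr_ge0 t0 (ltW le0)) (cl2 _ gv) (cl2 _ omg); rewrite /ka.
  have -> : t * (n%:R / l2 e * mixnorm s (2 * a) om) = t / l2 e * n%:R * mixnorm s (2 * a) om by ring.
  apply => x i; apply: (le_trans (hv x i)).
  rewrite /om l2Z (ger0_norm (expR_ge0 _)) le_eqVlt; apply/orP; left; apply/eqP.
  by field; rewrite gt_eqF.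
have q1' : 0 < 1 - q by lra.
have T0 j : 0 <= T j by apply: mulr_ge0; [apply: divr_ge0 => //; exact: ltW|exact: exprn_ge0].
have gsa j : growth a (gs j) by apply: growth_mono (gsg j); exact: ltW.
have hNT j : mixnorm s (2 * a) (fun x => gs j x - g x) <= T j * ka.
  apply: Nom => //; first exact: growth_sub.
  by move=> x i; rewrite mxE [X in _ + X]mxE; exact: hT.
have gP := Phi_growth al th d0 hF F0 a0 aeh gg.
have fixN : mixnorm s (2 * a) (fun x => Phi F al th g x - g x) <= 0.
  apply: (@geo_zero _ (2 * (D / (1 - q)) * ka) q q0 q1) => j.
  have -> : (fun x => Phi F al th g x - g x) =
     (fun x => (gs j.+1 x - g x) - (Phi F al th (gs j) x - Phi F al th g x)).
    by apply/funext => x; exact: vec3.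
  have gPj := Phi_growth al th d0 hF F0 a0 aeh (gsa j).
  have c1 : subgrowth (2 * a) (fun x => gs j.+1 x - g x) by apply: cl2; exact: growth_sub.
  have c2 : subgrowth (2 * a) (fun x => Phi F al th (gs j) x - Phi F al th g x) by apply: cl2; exact: growth_sub.
  apply: (le_trans (mixnorm_sub s0 c1 c2)).
  have k1 := contr (2 * a) a Cb _ _ a0 a2a (lexx _) CbC hCb (gsa j) gg.
  have k2 := hNT j.+1; have k3 := hNT j.
  have N3 := mixnorm_ge0 s0 (2 * a) (fun x => gs j x - g x).
  have ka0 : 0 <= ka.
    by apply: mulr_ge0; [apply: divr_ge0 => //; exact: ltW|exact: mixnorm_ge0].
  have TK : 0 <= T j * ka by exact: mulr_ge0.
  rewrite /T exprS in k2; exact: (fix_alg q0 q1 TK N3 k1 k2 k3).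
have fx x : Phi F al th g x = g x.
  have c1 : subgrowth (2 * a) (fun x => Phi F al th g x - g x) by apply: cl2; exact: growth_sub.
  apply/colP => i; apply/eqP; rewrite -subr_eq0 -normr_le0.
  have := mixnorm_bd s0 c1 x i; rewrite mxE [X in _ + X]mxE => h; apply: (le_trans h).
  by rewrite pmulr_lle0 ?expR_gt0// pmulr_lle0 ?invr_gt0.
exists (Ug al g); split.
- exact: Ug_growth.
- exact: Ug_even gg ge.
- by rewrite /Ug rowdot_add rowdot_kerfun// Lambda0_lv0 mulr0 cos0 sin0 mulr0 addr0 mulr1 addr0.
- have inj (b : R) v : subgrowth b v -> b <= 2 * a -> (forall x, linop (trkernel kreg) v x = 0) -> forall x, v x = 0.
    by move=> hv hb; apply: (hinj b v hv); exact: le_trans hb aj2.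
  by move=> x; exact: (Phi_fix d0 hF F0 a0 aeh x th0 inj gg fx).
Qed.
End Exist.

(** * The family of periodic solutions *)

Section Soft.
Variables (R : realType) (n : nat) (eta w : R).
Hypotheses (eta0 : 0 < eta) (w0 : 0 < w).
Variables (ke K : R -> 'M[R]_n) (e : 'cV[R]_n) (l : 'rV[R]_n).
Hypothesis kke : ekernel eta ke.
Hypothesis kK : ekernel eta K.
Hypothesis hle : l *m e = 1%:M.
Variables (F : 'cV[R]_n -> 'cV[R]_n) (a A d C : R).
Hypotheses (a0 : 0 < a) (aA : a < A) (Aeta : 2 * A <= eta) (d0 : 0 <= d) (C0 : 0 <= C).
Hypotheses (hF : lipF d F) (F0 : F 0 = 0).
Notation kerfun := (kerfun w e).
Notation cos_coord := (cos_coord l).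
Notation sin_coord := (sin_coord w l).
Implicit Types (u v h : R -> 'cV[R]_n).
Hypothesis hT : forall (d1 : R) v h, 0 <= d1 -> d1 <= d -> subgrowth A v -> subgrowth A h ->
  (forall x i, `|h x i 0| <= d1 * l2 (v x)) -> (forall x, linop K v x + convol ke h x = 0) ->
  forall x i, `|v x i 0 - kerfun (cos_coord v) (sin_coord v) x i 0| <= C * d1 * (`|cos_coord v| + `|sin_coord v|) * expR (A * `|x|).
(** Solutions of the equation with cut-off nonlinearity, among functions of growth [a]. *)
Definition solves u := growth a u /\ forall x, linop K u x + convol ke (fun y => F (u y)) x = 0.
Hypothesis hE : forall al, exists u, [/\ solves u, (forall x, u (- x) = u x) & rowdot l u 0 = al].
(** The window [|x| <= 4 pi / w] contains all points used to locate half-periods, with a margin of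
    a quarter period for [sin_coord]. *)
Definition window := 4 * (pi / w).
Definition rownorm := \sum_j `|l 0 j|.
Definition window_wt := expR (A * window).
Hypothesis small : rownorm * C * d * window_wt <= 1 / 8.
Hypothesis Fsmall : forall d1 : R, 0 < d1 -> exists2 rho : R, 0 < rho &
  forall x : 'cV[R]_n, (forall i, `|x i 0| <= rho) -> forall i, `|F x i 0| <= d1 * l2 x.

Let A0 : 0 < A. Proof. exact: lt_trans aA. Qed.
Let aeta : `|a| <= eta.
Proof. by rewrite ger0_norm ?(ltW a0)//; move: aA Aeta a0; lra. Qed.
Let p0 : 0 < pi / w. Proof. by rewrite divr_gt0// pi_gt0. Qed.

Lemma rownorm_ge0 : 0 <= rownorm. Proof. by rewrite sumr_ge0. Qed.
Lemma window_wt_ge0 : 0 <= window_wt. Proof. exact: expR_ge0. Qed.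
Lemma wpi : w * (pi / w) = pi.
Proof. by rewrite mulrCA divff ?mulr1// gt_eqF. Qed.

Lemma growth_shift b u t : 0 <= b -> growth b u -> growth b (fun x => u (t + x)).
Proof.
move=> b0 gu; have [C' C'0 hC] := growth_bd gu; split.
  by move=> i; have h := gu.1 i; rewrite /contf; apply: (cont_cmp h); cont.
exists (C' * expR (b * `|t|)) => x i; apply: (le_trans (hC _ _)).
rewrite -mulrA ler_wpM2l// -expRD ler_expR -mulrDr ler_wpM2l//; exact: ler_normD.
Qed.

Lemma growth_refl b u : growth b u -> growth b (fun x => u (- x)).
Proof.
move=> [cu [C' hC]]; split; first by move=> i; have h := cu i; rewrite /contf; apply: (cont_cmp h); cont.
by exists C' => x i; rewrite -[`|x|]normrN.
Qed.

Lemma solves_shift t u : solves u -> solves (fun x => u (t + x)).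
Proof.
move=> [gu hu]; split; first exact: growth_shift (ltW a0) gu.
move=> x; rewrite -[RHS](hu (t + x)) /linop; congr (_ + _ + _); apply/colP => i; rewrite !mxE; apply: eq_Int => y.
  by rewrite addrA.
by rewrite addrA.
Qed.

Lemma solves_refl u : solves u -> solves (fun x => u (- x)).
Proof.
move=> [gu hu]; split; first exact: growth_refl.
have gF := lip_growth d0 hF F0 (ltW a0) gu.
move=> x; rewrite -[RHS](hu (- x)) /linop; congr (_ + _ + _); apply/colP => i; rewrite !mxE.
  rewrite -(Int_opp (convol_itg1 kK (- x) i gu aeta)); apply: eq_Int => y.
  by rewrite kK.2 (_ : - x - - y = - (x - y))//; ring.
rewrite -(Int_opp (convol_itg1 kke (- x) i gF aeta)); apply: eq_Int => y.
by rewrite kke.2 (_ : - x - - y = - (x - y))//; ring.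
Qed.

Lemma convol_cst0 (J : R -> 'M[R]_n) x : convol J (fun _ => 0) x = 0.
Proof.
by apply/colP => i; rewrite !mxE -[RHS](Int_0 R); apply: eq_Int => y; rewrite mulmx0 mxE.
Qed.

Lemma sol0 : solves (fun _ => 0).
Proof.
split; first exact: growth_cst (ltW a0).
by move=> x; rewrite /linop oppr0 add0r F0 !convol_cst0 addr0.
Qed.

Lemma growth_clsA u : growth a u -> subgrowth A u.
Proof. by move=> gu; exists a; split => //; exact: ltW. Qed.

Lemma rowdot_sub u v x : rowdot l (fun y => u y - v y) x = rowdot l u x - rowdot l v x.
Proof. by rewrite /rowdot mulmxBr mxE [X in _ + X]mxE. Qed.

Lemma cos_coord_sub u v : cos_coord (fun y => u y - v y) = cos_coord u - cos_coord v.
Proof. exact: rowdot_sub. Qed.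
Lemma sin_coord_sub u v : sin_coord (fun y => u y - v y) = sin_coord u - sin_coord v.
Proof. by rewrite /sin_coord !rowdot_sub; field. Qed.

(** The difference of two solutions solves the linear equation perturbed by [F u - F v], which is
    bounded by [d] times the difference. *)
Lemma diff_track u v : solves u -> solves v -> forall x i, let q1 := cos_coord u - cos_coord v in let q2 := sin_coord u - sin_coord v in
  `|(u x i 0 - v x i 0) - kerfun q1 q2 x i 0| <= C * d * (`|q1| + `|q2|) * expR (A * `|x|).
Proof.
move=> [gu hu] [gv hv] x i /=.
have gFu := lip_growth d0 hF F0 (ltW a0) gu; have gFv := lip_growth d0 hF F0 (ltW a0) gv.
have := hT d0 (lexx d) (growth_clsA (growth_sub gu gv)) (growth_clsA (growth_sub gFu gFv)).
rewrite cos_coord_sub sin_coord_sub => H; have := H _ _ x i; rewrite [in X in (_ -> _ -> X) -> _]mxE [X in _ + X - _]mxE; apply.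
  by move=> y j; rewrite mxE [X in _ + X]mxE; exact: hF.
move=> y; rewrite (linop_sub y eta0 kK aeta gu gv) (convol_sub kke y gFu gFv aeta).
by rewrite addrACA -opprD hu hv subrr.
Qed.

(** Lipschitz constant of the solution on the window, as a function of its coordinates. *)
Definition ampl := \sum_j `|e j 0| + C * d * window_wt.
Lemma ampl_ge0 : 0 <= ampl.
Proof. by rewrite addr_ge0 ?sumr_ge0// !mulr_ge0// window_wt_ge0. Qed.

Lemma weighted_window (x : R) : `|x| <= window -> expR (A * `|x|) <= window_wt.
Proof. by move=> h; rewrite ler_expR; apply: ler_wpM2l => //; exact: ltW. Qed.

Lemma kerfun_bd al be x i : `|kerfun al be x i 0| <= (`|al| + `|be|) * \sum_j `|e j 0|.
Proof.
rewrite /kerfun mxE normrM; apply: ler_pM => //; last by rewrite (bigD1 i)//= lerDl sumr_ge0.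
apply: (le_trans (ler_normD _ _)); rewrite !normrM; apply: lerD; rewrite ler_piMr//; [exact: cos_max|exact: sin_max].
Qed.

Lemma solution_diff_bd u v x i : solves u -> solves v -> `|x| <= window ->
  `|u x i 0 - v x i 0| <= ampl * (`|cos_coord u - cos_coord v| + `|sin_coord u - sin_coord v|).
Proof.
move=> su sv hx; have := diff_track su sv x i => /=.
set q1 := cos_coord u - cos_coord v; set q2 := sin_coord u - sin_coord v => h.
have hk := kerfun_bd q1 q2 x i.
have q0 : 0 <= C * d * (`|q1| + `|q2|) by apply: mulr_ge0; [exact: mulr_ge0|exact: addr_ge0].
have h2 := ler_wpM2l q0 (weighted_window hx).
have := ler_normD (u x i 0 - v x i 0 - kerfun q1 q2 x i 0) (kerfun q1 q2 x i 0); rewrite subrK /ampl.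
move: h h2 hk; move: (\sum_j `|e j 0|) => s; lra.
Qed.

(** By [diff_track] with both coordinates of the difference equal to zero. *)
Lemma solves_unique u v : solves u -> solves v -> cos_coord u = cos_coord v -> sin_coord u = sin_coord v -> u = v.
Proof.
move=> su sv e1 e2; apply/funext => x; apply/colP => i; apply/eqP; rewrite -subr_eq0 -normr_le0.
have := diff_track su sv x i => /=.
by rewrite e1 e2 !subrr !normr0 addr0 mulr0 mul0r /kerfun !mul0r addr0 scale0r mxE subr0.
Qed.

(** Tracking, applied to [u] and read through [l], where [l e = 1].  The constant [d1 <= d] is free
    because for small solutions the nonlinearity is much smaller than [d]. *)
Lemma rowdot_tracks (d1 : R) u x : 0 <= d1 -> d1 <= d -> solves u -> (forall y i, `|F (u y) i 0| <= d1 * l2 (u y)) -> `|x| <= window ->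
  `|rowdot l u x - (cos_coord u * cos (w * x) + sin_coord u * sin (w * x))| <= rownorm * C * d1 * window_wt * (`|cos_coord u| + `|sin_coord u|).
Proof.
move=> d10 d1d [gu hu] hFu hx.
have gFu := lip_growth d0 hF F0 (ltW a0) gu.
have H := hT d10 d1d (growth_clsA gu) (growth_clsA gFu) hFu hu x.
rewrite -(rowdot_kerfun w hle) -rowdot_sub.
have q0 : 0 <= C * d1 * (`|cos_coord u| + `|sin_coord u|) by apply: mulr_ge0; [exact: mulr_ge0|exact: addr_ge0].
have := @rowdot_le R n l (fun y => u y - kerfun (cos_coord u) (sin_coord u) y) x _ window_wt q0; rewrite -/rownorm.
have -> : rownorm * (C * d1 * (`|cos_coord u| + `|sin_coord u|)) * window_wt = rownorm * C * d1 * window_wt * (`|cos_coord u| + `|sin_coord u|) by ring.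
apply => i; rewrite mxE [X in _ + X]mxE; apply: (le_trans (H i)); apply: ler_wpM2l => //; exact: weighted_window.
Qed.

Lemma rowdot_tracks8 u x : solves u -> `|x| <= window ->
  `|rowdot l u x - (cos_coord u * cos (w * x) + sin_coord u * sin (w * x))| <= 1 / 8 * (`|cos_coord u| + `|sin_coord u|).
Proof.
move=> su hx; apply: (le_trans (rowdot_tracks d0 (lexx d) su _ hx)).
  by move=> y i; have := hF (u y) 0 i; rewrite F0 mxE !subr0.
by apply: ler_wpM2r; first exact: addr_ge0.
Qed.

Definition quarter := pi / (2 * w).
Lemma whp : w * quarter = pi / 2. Proof. exact: wp. Qed.
Lemma hpE : quarter = (pi / w) / 2. Proof. by rewrite /quarter; field; rewrite gt_eqF. Qed.

Definition shiftf t u := fun x => u (t + x).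
Lemma cos_coord_shiftf t u : cos_coord (shiftf t u) = rowdot l u t.
Proof. by rewrite /cos_coord /rowdot /shiftf addr0. Qed.
Lemma sin_coord_shiftf t u : sin_coord (shiftf t u) = (rowdot l u (t + quarter) - rowdot l u (t - quarter)) / 2.
Proof. by []. Qed.

Lemma cont_sin_coord_shift u : solves u -> continuous (fun t => sin_coord (shiftf t u)).
Proof.
move=> [gu _]; have h : contf (rowdot l u) := (rowdot_sgrowth l gu).1.
apply: (contf_eq (f := fun t => (rowdot l u (t + quarter) - rowdot l u (t - quarter)) / 2)) => [t|]; first by rewrite sin_coord_shiftf.
by cont.
Qed.

(** The second coordinate of a translate is read off at [t +- quarter], so it rotates as for the
    pure oscillation. *)
Lemma sin_coord_shift_bd (d1 : R) u t : 0 <= d1 -> d1 <= d -> solves u -> (forall y i, `|F (u y) i 0| <= d1 * l2 (u y)) ->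
  `|t| <= 3 * (pi / w) ->
  `|sin_coord (shiftf t u) - (sin_coord u * cos (w * t) - cos_coord u * sin (w * t))| <= rownorm * C * d1 * window_wt * (`|cos_coord u| + `|sin_coord u|).
Proof.
move=> d10 d1d su hFu ht.
have pp := p0; have hh : `|quarter| <= pi / w by rewrite hpE ger0_norm; lra.
have ht1 : `|t + quarter| <= window by apply: (le_trans (ler_normD _ _)); rewrite /window; lra.
have ht2 : `|t - quarter| <= window by apply: (le_trans (ler_normB _ _)); rewrite /window; lra.
have b1 := rowdot_tracks d10 d1d su hFu ht1; have b2 := rowdot_tracks d10 d1d su hFu ht2.
rewrite mulrDr whp cosDpihalf sinDpihalf in b1.
rewrite mulrBr whp cosBpihalf sinBpihalf in b2.
rewrite sin_coord_shiftf.
have -> : (rowdot l u (t + quarter) - rowdot l u (t - quarter)) / 2 - (sin_coord u * cos (w * t) - cos_coord u * sin (w * t)) =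
  ((rowdot l u (t + quarter) - (cos_coord u * - sin (w * t) + sin_coord u * cos (w * t))) -
   (rowdot l u (t - quarter) - (cos_coord u * sin (w * t) + sin_coord u * - cos (w * t)))) / 2 by field.
exact: half_diff.
Qed.

Lemma sin_coord_shift_bd8 u t : solves u -> `|t| <= 3 * (pi / w) ->
  `|sin_coord (shiftf t u) - (sin_coord u * cos (w * t) - cos_coord u * sin (w * t))| <= 1 / 8 * (`|cos_coord u| + `|sin_coord u|).
Proof.
move=> su hx; apply: (le_trans (sin_coord_shift_bd d0 (lexx d) su _ hx)).
  by move=> y i; have := hF (u y) 0 i; rewrite F0 mxE !subr0.
by apply: ler_wpM2r; first exact: addr_ge0.
Qed.

Lemma even_sin_coord u : (forall x, u (- x) = u x) -> sin_coord u = 0.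
Proof. by move=> eu; rewrite /sin_coord /rowdot eu subrr mul0r. Qed.

(** The translate by [t] and its reflection are solutions with the same coordinates. *)
Lemma refl_at_zero u t : solves u -> sin_coord (shiftf t u) = 0 -> forall x, u (t - x) = u (t + x).
Proof.
move=> su h x.
have s1 := solves_shift t su; have s2 := solves_refl s1.
have E := solves_unique s2 s1 _ _; have := congr1 (fun f => f x) (E _ _) => /= -> //.
- by rewrite /cos_coord /rowdot oppr0.
- rewrite -/(shiftf t u) h; move: h; rewrite /shiftf /sin_coord /rowdot opprK => /eqP; rewrite mulf_eq0 invr_eq0 pnatr_eq0 orbF subr_eq0 => /eqP ->.
  by rewrite subrr mul0r.
Qed.

(** Two reflections compose to a translation. *)
Lemma refl_period u t : solves u -> (forall x, u (- x) = u x) -> sin_coord (shiftf t u) = 0 -> forall x, u (x + 2 * t) = u x.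
Proof.
move=> su eu h x; have := refl_at_zero su h (x + t) => E.
have -> : x + 2 * t = t + (x + t) by ring.
by rewrite -E (_ : t - (x + t) = - x) ?eu//; ring.
Qed.
(** The even solutions, parametrised by their first coordinate. *)
Definition esol (al : R) : R -> 'cV[R]_n := projT1 (cid (hE al)).
Lemma esol_solves al : solves (esol al). Proof. by rewrite /esol; case: cid => u [? ? ?]. Qed.
Lemma esol_even al x : esol al (- x) = esol al x. Proof. by rewrite /esol; case: cid => u [? h ?]; exact: h. Qed.
Lemma esol_cos_coord al : cos_coord (esol al) = al. Proof. by rewrite /esol; case: cid => u [? ? h]; exact: h. Qed.
Lemma esol_sin_coord al : sin_coord (esol al) = 0. Proof. by apply: even_sin_coord; exact: esol_even. Qed.
Lemma esol_0 : esol 0 = fun _ => 0.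
Proof.
apply: (solves_unique (esol_solves 0) sol0); first by rewrite esol_cos_coord /cos_coord /rowdot mulmx0 mxE.
by rewrite esol_sin_coord /sin_coord /rowdot !mulmx0 !mxE subrr mul0r.
Qed.

Lemma esol_diff al be x i : `|x| <= window -> `|esol al x i 0 - esol be x i 0| <= ampl * `|al - be|.
Proof.
by move=> hx; have := solution_diff_bd i (esol_solves al) (esol_solves be) hx; rewrite !esol_cos_coord !esol_sin_coord subrr normr0 addr0.
Qed.

Lemma esol_bd al x i : `|x| <= window -> `|esol al x i 0| <= ampl * `|al|.
Proof. by move=> hx; have := esol_diff al 0 i hx; rewrite esol_0 mxE !subr0. Qed.

(** Second coordinate along the even solution; its zeros are the points of symmetry. *)
Definition sphase al t := sin_coord (shiftf t (esol al)).
Lemma sphase_bd8 al t : `|t| <= 3 * (pi / w) -> `|sphase al t + al * sin (w * t)| <= 1 / 8 * `|al|.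
Proof.
move=> ht; have := sin_coord_shift_bd8 (esol_solves al) ht; rewrite esol_cos_coord esol_sin_coord mul0r sub0r opprK normr0 addr0; exact.
Qed.

Lemma sphase_cont al : continuous (sphase al).
Proof. exact: cont_sin_coord_shift (esol_solves al). Qed.

(** A window of a quarter of [pi / w] on each side of the expected half-period, on which
    [- sin(w t)] changes sign with room for the error [1/8]. *)
Definition tau_lo := pi / w - pi / w / 4.
Definition tau_hi := pi / w + pi / w / 4.
Lemma tlr : 0 < tau_lo /\ tau_lo < tau_hi /\ tau_hi <= 2 * (pi / w).
Proof. by have := p0; rewrite /tau_lo /tau_hi; move: (pi / w) => p pp; split; [lra|split; lra]. Qed.
Lemma win_bd t : tau_lo <= t <= tau_hi -> `|t| <= 3 * (pi / w).
Proof.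
move=> /andP[h1 h2]; have [a1 [a2 a3]] := tlr; have := p0; move: (pi / w) a3 => p a3 pp.
by rewrite ger0_norm; lra.
Qed.

Lemma sin_quarter : 1 / 2 <= sin (pi / 4) :> R.
Proof.
have p40 : 0 <= pi / 4 :> R by rewrite divr_ge0// pi_ge0.
have s0 : 0 <= sin (pi / 4) :> R.
  by apply: sin_ge0_pi; rewrite p40/=; have := @pi_ge0 R; lra.
have e1 : cos (pi / 4) = sin (pi / 4) :> R.
  rewrite -[in RHS](_ : pi / 2 - pi / 4 = pi / 4 :> R); last by field.
  by rewrite sinB sin_pihalf cos_pihalf mul1r mul0r subr0.
have := cos2Dsin2 (pi / 4 : R); rewrite e1 => h.
rewrite leNgt; apply/negP => hlt; nra.
Qed.

Lemma cos_quarter (x : R) : - (pi / 4) <= x -> x <= pi / 4 -> 1 / 2 <= cos x.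
Proof.
move=> h1 h2; have pp := @pi_gt0 R.
have e1 : cos (pi / 4) = sin (pi / 4) :> R.
  rewrite -[in RHS](_ : pi / 2 - pi / 4 = pi / 4 :> R); last by field.
  by rewrite sinB sin_pihalf cos_pihalf mul1r mul0r subr0.
have c4 := sin_quarter; rewrite -e1 in c4.
have key (y : R) : 0 <= y -> y <= pi / 4 -> 1 / 2 <= cos y.
  move=> y0 y1; apply: (le_trans c4).
  move: y1; rewrite le_eqVlt => /predU1P[->//|y1]; apply: ltW.
  have := @ltr_cos R y (pi / 4); rewrite !in_itv/= => ->//; rewrite ?y0/=; lra.
case: (leP 0 x) => x0; first exact: key.
by rewrite -cosN; apply: key; lra.
Qed.

Lemma sin_tau_lo : sin (w * tau_lo) = sin (pi / 4).
Proof.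
rewrite /tau_lo mulrBr wpi (_ : w * (pi / w / 4) = pi / 4); last by field; rewrite gt_eqF.
by rewrite sinB sinpi cospi mul0r sub0r mulN1r opprK.
Qed.
Lemma sin_tau_hi : sin (w * tau_hi) = - sin (pi / 4).
Proof.
rewrite /tau_hi mulrDr wpi (_ : w * (pi / w / 4) = pi / 4); last by field; rewrite gt_eqF.
by rewrite sinD sinpi cospi mul0r add0r mulN1r.
Qed.

Lemma sphase_tau_lo al : 0 < al -> sphase al tau_lo < 0.
Proof.
move=> al0; have [h1 [h2 h3]] := tlr.
have := sphase_bd8 al (win_bd (_ : tau_lo <= tau_lo <= tau_hi)); rewrite lexx (ltW h2) => /(_ isT).
rewrite sin_tau_lo (gtr0_norm al0) ler_norml => /andP[_ h].
have := ler_wpM2l (ltW al0) sin_quarter; lra.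
Qed.
Lemma sphase_tau_hi al : 0 < al -> 0 < sphase al tau_hi.
Proof.
move=> al0; have [h1 [h2 h3]] := tlr.
have := sphase_bd8 al (win_bd (_ : tau_lo <= tau_hi <= tau_hi)); rewrite lexx (ltW h2) => /(_ isT).
rewrite sin_tau_hi (gtr0_norm al0) ler_norml => /andP[h _].
have := ler_wpM2l (ltW al0) sin_quarter; lra.
Qed.

Lemma IVT_inc (f : R -> R) (x y : R) : x <= y -> continuous f -> f x <= 0 -> 0 <= f y ->
  exists2 z, x <= z <= y & f z = 0.
Proof.
move=> xy cf fx fy.
have := @IVT _ f x y 0 xy (continuous_subspaceT cf); rewrite ge_min fx/= le_max fy orbT => /(_ isT).
by move=> [z hz fz]; exists z => //; rewrite in_itv in hz.
Qed.

(** The second coordinate changes sign in the window.  For [al <= 0] any value will do. *)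
Lemma tau_ex al : exists t, tau_lo <= t <= tau_hi /\ (0 < al -> sphase al t = 0).
Proof.
have [h1 [h2 h3]] := tlr.
case: (ltP 0 al) => al0; last by exists tau_lo; split; [rewrite lexx ltW|].
have [t ht g0] := IVT_inc (ltW h2) (@sphase_cont al) (ltW (sphase_tau_lo al0)) (ltW (sphase_tau_hi al0)).
by exists t.
Qed.
Definition tau al := projT1 (cid (tau_ex al)).
Lemma tau_win al : tau_lo <= tau al <= tau_hi. Proof. by rewrite /tau; case: cid => t []. Qed.
Lemma tau_sphase al : 0 < al -> sphase al (tau al) = 0. Proof. by rewrite /tau; case: cid => t []. Qed.
Lemma tau_gt0 al : 0 < tau al.
Proof. by have [h1 _] := tlr; have /andP[h _] := tau_win al; exact: lt_le_trans h. Qed.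

Lemma esol_period al x : 0 <= al -> esol al (x + 2 * tau al) = esol al x.
Proof.
rewrite le_eqVlt => /predU1P[<-|al0]; first by rewrite esol_0.
by apply: (refl_period (esol_solves al) (esol_even al)); exact: tau_sphase.
Qed.

Lemma cos_neg_pi (t : R) : pi / 2 <= t -> t <= pi + pi / 2 -> cos t <= 0.
Proof.
move=> h1 h2; have -> : cos t = - cos (t - pi) by rewrite cosB cospi sinpi; ring.
by rewrite oppr_le0; apply: cos_ge0_pihalf; apply/andP; split; lra.
Qed.

(** A period at most [pi / w] would bring the first coordinate back to [al > 0] at a multiple of it
    where [cos(w t) <= 0], while there it is at most [al / 8]. *)
Lemma no_short_period al P : 0 < al -> 0 < P -> P <= pi / w -> (forall x, esol al (x + P) = esol al x) -> False.
Proof.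
move=> al0 P0 Pp hP.
have itP m x : esol al (x + m%:R * P) = esol al x.
  elim: m => [|m IH]; first by rewrite mul0r addr0.
  by rewrite -natr1 mulrDl mul1r addrA hP.
have h2 : 0 <= quarter / P by rewrite divr_ge0 ?(ltW P0)// hpE; have := p0; lra.
pose m := (Num.truncn (quarter / P)).+1.
have /andP[m1 m2] := truncn_itv h2.
have m3 : quarter < m%:R * P by rewrite -ltr_pdivrMr.
have m4 : m%:R * P <= quarter + pi / w.
  rewrite /m -natr1 mulrDl mul1r; apply: lerD => //; by rewrite -ler_pdivlMr.
have mp : 0 < m%:R * P by rewrite mulr_gt0// ltr0n.
have hX : `|m%:R * P| <= window.
  rewrite ger0_norm ?(ltW mp)// /window; apply: (le_trans m4); rewrite hpE; have := p0; lra.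
have := rowdot_tracks8 (esol_solves al) hX; rewrite esol_cos_coord esol_sin_coord mul0r addr0 normr0 addr0.
have -> : rowdot l (esol al) (m%:R * P) = al by rewrite -[RHS]esol_cos_coord /cos_coord /rowdot -(itP m 0) add0r.
rewrite (gtr0_norm al0) ler_norml => /andP[_].
have c0 : cos (w * (m%:R * P)) <= 0.
  have := ler_wpM2l (ltW w0) (ltW m3); rewrite whp => k1.
  have := ler_wpM2l (ltW w0) m4; rewrite mulrDr whp wpi addrC => k2.
  exact: cos_neg_pi.
have := ler_wpM2l (ltW al0) c0; lra.
Qed.

(** Two zeros in the window would be two centres of symmetry, hence a period of twice their
    distance, which is too short. *)
Lemma tau_unique al t : 0 < al -> tau_lo <= t <= tau_hi -> sphase al t = 0 -> t = tau al.
Proof.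
move=> al0 ht gt; have ht' := tau_win al; have gt' := tau_sphase al0.
have key s1 s2 : tau_lo <= s1 <= tau_hi -> tau_lo <= s2 <= tau_hi -> sphase al s1 = 0 -> sphase al s2 = 0 -> s1 < s2 -> False.
  move=> /andP[a1 a2] /andP[b1 b2] g1 g2 s12.
  apply: (@no_short_period al (2 * (s2 - s1)) al0); first lra.
    by move: a1 b2; rewrite /tau_lo /tau_hi; have := p0; move: (pi / w) => p; lra.
  move=> x; have P1 := refl_period (esol_solves al) (esol_even al) g1; have P2 := refl_period (esol_solves al) (esol_even al) g2.
  rewrite -(P1 (x + 2 * (s2 - s1))) -[RHS]P2; congr (esol al _); ring.
case: (ltgtP t (tau al)) => // h; exfalso; [exact: key h|exact: key h].
Qed.

(** Extended by its value at 0, which makes it continuous on the whole line. *)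
Definition freq al := if 0 < al then pi / tau al else w.
Definition profile al y := esol al (y / freq al).
Lemma freq_gt0 al : 0 < freq al.
Proof. by rewrite /freq; case: ifP => _ //; rewrite divr_gt0 ?pi_gt0// tau_gt0. Qed.

Lemma profile_period al y : 0 <= al -> profile al (y + 2 * pi) = profile al y.
Proof.
rewrite /profile /freq le_eqVlt => /predU1P[<-|al0]; first by rewrite esol_0.
rewrite al0 -[RHS](esol_period _ (ltW al0)); congr (esol al _).
have := @pi_gt0 R; have := tau_gt0 al; move: (pi : R) (tau al) => p t t0 pp.
by field; rewrite !gt_eqF.
Qed.

Lemma tau_window al : `|tau al| <= window.
Proof.
rewrite ger0_norm ?(ltW (tau_gt0 al))//; have /andP[_ h] := tau_win al; have [_ [_ h3]] := tlr.
by rewrite /window; have := p0; move: (pi / w) h3 => p h3 pp; lra.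
Qed.

(** A whole number of periods brings every point into one period around 0. *)
Lemma mod_period (P x : R) : 0 < P -> exists k : int, `|x + k%:~R * (2 * P)| <= P.
Proof.
move=> P0; pose m := Num.floor ((x + P) / (2 * P)).
have P2 : 0 < 2 * P by lra.
have h1 : m%:~R * (2 * P) <= x + P by rewrite -ler_pdivlMr// floor_le.
have h2 : x + P < (m%:~R + 1) * (2 * P) by rewrite -ltr_pdivrMr// -intrD1 floorD1_gt.
exists (- m); rewrite ler_norml rmorphN/= mulNr; apply/andP; split; lra.
Qed.

Lemma periodZ (f : R -> 'cV[R]_n) T : (forall x, f (x + T) = f x) -> forall (k : int) x, f (x + k%:~R * T) = f x.
Proof.
move=> hper; have pos m x : f (x + m%:R * T) = f x.
  elim: m => [|m IH]; first by rewrite mul0r addr0.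
  by rewrite -natr1 mulrDl mul1r addrA hper.
move=> [m|m] x; first exact: pos.
by rewrite NegzE rmorphN/= mulNr -(pos m.+1) subrK.
Qed.

Lemma esol_bd_all al x i : 0 <= al -> `|esol al x i 0| <= ampl * al.
Proof.
move=> al0; have [k hk] := mod_period x (tau_gt0 al).
have P := periodZ (fun x => esol_period x al0).
rewrite -(P k x) -[in leRHS](ger0_norm al0); apply: esol_bd.
by apply: (le_trans hk); have := tau_window al; rewrite ger0_norm ?(ltW (tau_gt0 al)).
Qed.
Lemma rowdot_esol_lip al be x : `|x| <= window -> `|rowdot l (esol al) x - rowdot l (esol be) x| <= rownorm * ampl * `|al - be|.
Proof.
move=> hx; rewrite -rowdot_sub.
have Bp : 0 <= ampl * `|al - be| by apply: mulr_ge0 => //; exact: ampl_ge0.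
have -> : rownorm * ampl * `|al - be| = rownorm * (ampl * `|al - be|) * 1 by ring.
apply: rowdot_le => // i; rewrite mulr1 mxE [X in _ + X]mxE; exact: esol_diff.
Qed.

Lemma quarter_bd t : `|t| <= 3 * (pi / w) -> `|t + quarter| <= window /\ `|t - quarter| <= window.
Proof.
move=> ht; have pp := p0; have hh : `|quarter| <= pi / w by rewrite hpE ger0_norm; lra.
split; [apply: (le_trans (ler_normD _ _))|apply: (le_trans (ler_normB _ _))]; rewrite /window; lra.
Qed.

Lemma sphase_lip al be t : `|t| <= 3 * (pi / w) -> `|sphase al t - sphase be t| <= rownorm * ampl * `|al - be|.
Proof.
move=> /quarter_bd[h1 h2]; rewrite /sphase !sin_coord_shiftf.
have -> : (rowdot l (esol al) (t + quarter) - rowdot l (esol al) (t - quarter)) / 2 - (rowdot l (esol be) (t + quarter) - rowdot l (esol be) (t - quarter)) / 2 =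
  ((rowdot l (esol al) (t + quarter) - rowdot l (esol be) (t + quarter)) - (rowdot l (esol al) (t - quarter) - rowdot l (esol be) (t - quarter))) / 2 by field.
by apply: half_diff; exact: rowdot_esol_lip.
Qed.

Lemma sphase_neg al t : 0 < al -> tau_lo <= t -> t < tau al -> sphase al t < 0.
Proof.
move=> al0 h1 h2; rewrite ltNge; apply/negP => h.
have [z /andP[z1 z2] gz] := IVT_inc h1 (@sphase_cont al) (ltW (sphase_tau_lo al0)) h.
have /andP[_ tr1] := tau_win al.
have := tau_unique al0 (_ : tau_lo <= z <= tau_hi) gz; rewrite z1 (le_trans z2 (ltW (lt_le_trans h2 tr1))) => /(_ isT) E.
by move: h2; rewrite -E ltNge z2.
Qed.

Lemma sphase_pos al t : 0 < al -> t <= tau_hi -> tau al < t -> 0 < sphase al t.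
Proof.
move=> al0 h1 h2; rewrite ltNge; apply/negP => h.
have [z /andP[z1 z2] gz] := IVT_inc h1 (@sphase_cont al) h (ltW (sphase_tau_hi al0)).
have /andP[tl1 _] := tau_win al.
have := tau_unique al0 (_ : tau_lo <= z <= tau_hi) gz; rewrite z2 andbT (le_trans tl1 (ltW (lt_le_trans h2 z1))) => /(_ isT) E.
by move: h2; rewrite -E ltNge z1.
Qed.

Lemma tau_between al s1 s2 : 0 < al -> tau_lo <= s1 -> s1 <= s2 -> s2 <= tau_hi -> sphase al s1 <= 0 -> 0 <= sphase al s2 ->
  s1 <= tau al <= s2.
Proof.
move=> al0 h1 h2 h3 g1 g2; have [z /andP[z1 z2] gz] := IVT_inc h2 (@sphase_cont al) g1 g2.
have := tau_unique al0 (_ : tau_lo <= z <= tau_hi) gz; rewrite (le_trans h1 z1) (le_trans z2 h3) => /(_ isT) <-.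
by rewrite z1 z2.
Qed.

(** The sign of the second coordinate on both sides of [tau al] is stable under small changes
    of [al]. *)
Lemma tau_cont al ep : 0 < al -> 0 < ep -> exists2 dl : R, 0 < dl & forall be, `|be - al| < dl -> 0 < be /\ `|tau be - tau al| <= ep.
Proof.
move=> al0 ep0; have /andP[t1 t2] := tau_win al.
have t1' : tau_lo < tau al.
  by rewrite lt_neqAle t1 andbT; apply/eqP => E; have := sphase_tau_lo al0; rewrite E tau_sphase// ltxx.
have t2' : tau al < tau_hi.
  by rewrite lt_neqAle t2 andbT; apply/eqP => E; have := sphase_tau_hi al0; rewrite -E tau_sphase// ltxx.
pose s1 := Num.max tau_lo (tau al - ep); pose s2 := Num.min tau_hi (tau al + ep).
have s1l : tau_lo <= s1 by rewrite le_max lexx.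
have s1e : tau al - ep <= s1 by rewrite le_max lexx orbT.
have s1t : s1 < tau al by rewrite gt_max t1'/=; lra.
have s2l : s2 <= tau_hi by rewrite ge_min lexx.
have s2e : s2 <= tau al + ep by rewrite ge_min lexx orbT.
have s2t : tau al < s2 by rewrite lt_min t2'/=; lra.
clearbody s1 s2.
have g1 := sphase_neg al0 s1l s1t; have g2 := sphase_pos al0 s2l s2t.
pose m := Num.min (- sphase al s1) (sphase al s2).
have m0 : 0 < m by rewrite lt_min g2 oppr_gt0 g1.
have m1 : m <= - sphase al s1 by rewrite ge_min lexx.
have m2 : m <= sphase al s2 by rewrite ge_min lexx orbT.
clearbody m.
have LB0 : 0 <= rownorm * ampl by apply: mulr_ge0; [exact: rownorm_ge0|exact: ampl_ge0].
have LB1 : 0 < rownorm * ampl + 1 by lra.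
exists (Num.min al (m / (rownorm * ampl + 1))); first by rewrite lt_min al0 divr_gt0.
move=> be; rewrite lt_min => /andP[hb1 hb2].
have be0 : 0 < be by move: hb1; rewrite ltr_norml => /andP[h _]; lra.
split => //.
have hm : rownorm * ampl * `|be - al| <= m.
  move: hb2; rewrite ltr_pdivlMr// => h; have := normr_ge0 (be - al); lra.
have w1 : `|s1| <= 3 * (pi / w) by apply: win_bd; rewrite s1l/=; lra.
have w2 : `|s2| <= 3 * (pi / w) by apply: win_bd; rewrite s2l andbT; lra.
have k1 := le_trans (sphase_lip be al w1) hm; have k2 := le_trans (sphase_lip be al w2) hm.
move: k1 k2; rewrite !ler_norml => /andP[_ k1] /andP[k2 _].
have := tau_between be0 s1l (_ : s1 <= s2) s2l (_ : sphase be s1 <= 0) (_ : 0 <= sphase be s2).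
move=> /(_ ltac:(lra) ltac:(lra) ltac:(lra))/andP[h1 h2].
by apply/andP; split; lra.
Qed.

(** By smallness of [F] near 0 the relative error of the phase tends to 0 with the amplitude,
    although it is only bounded by [1/8] in general. *)
Lemma sphase_small (s : R) : 0 < s -> exists2 dl : R, 0 < dl & forall be t, 0 <= be -> be < dl -> `|t| <= 3 * (pi / w) ->
  `|sphase be t + be * sin (w * t)| <= s * be.
Proof.
move=> s0.
have LCE : 0 <= rownorm * C * window_wt by apply: mulr_ge0; [apply: mulr_ge0; [exact: rownorm_ge0|by []]|exact: window_wt_ge0].
have LCE1 : 0 < rownorm * C * window_wt + 1 by lra.
pose d2 := s / (rownorm * C * window_wt + 1); have d20 : 0 < d2 by apply: divr_gt0.
have d2s : rownorm * C * d2 * window_wt <= s.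
  have e1 : s = d2 * (rownorm * C * window_wt + 1) by rewrite /d2 mulfVK// gt_eqF.
  rewrite [leRHS]e1; move: d20; clearbody d2; lra.
have fin be t d1 : 0 <= be -> 0 <= d1 -> d1 <= d -> d1 <= d2 -> (forall y i, `|F (esol be y) i 0| <= d1 * l2 (esol be y)) ->
    `|t| <= 3 * (pi / w) -> `|sphase be t + be * sin (w * t)| <= s * be.
  move=> be0 d10 d1d d12 hFU ht; have := sin_coord_shift_bd d10 d1d (esol_solves be) hFU ht.
  rewrite esol_cos_coord esol_sin_coord mul0r sub0r opprK normr0 addr0 (ger0_norm be0) => h; apply: (le_trans h).
  apply: ler_wpM2r => //; apply: le_trans d2s.
  have := ler_wpM2l LCE d12; lra.
case: (leP d2 d) => dd.
  have [rho rho0 hr] := Fsmall d20.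
  have B1 : 0 < ampl + 1 by have := ampl_ge0; lra.
  exists (rho / (ampl + 1)); first exact: divr_gt0.
  move=> be t be0 bed ht; apply: (fin be t d2) => //; first exact: ltW.
  move=> y i; apply: hr => j; apply: (le_trans (esol_bd_all y j be0)).
  move: bed; rewrite ltr_pdivlMr// => h; lra.
exists 1 => // be t be0 _ ht; apply: (fin be t d) => //; first exact: ltW.
by move=> y i; have := hF (esol be y) 0 i; rewrite F0 mxE !subr0.
Qed.

(** The zero of [- sin(w t)] at [pi / w] is simple, so a relatively small error moves it little. *)
Lemma tau_lim0 ep : 0 < ep -> exists2 dl : R, 0 < dl & forall be, 0 < be -> be < dl -> `|tau be - pi / w| <= ep.
Proof.
move=> ep0; have pp := p0.
pose e1 := Num.min ep (pi / w / 4).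
have e11 : e1 <= ep by rewrite ge_min lexx.
have e12 : e1 <= pi / w / 4 by rewrite ge_min lexx orbT.
have e10 : 0 < e1 by rewrite lt_min ep0; lra.
clearbody e1.
have sn : 0 < sin (w * e1).
  have k1 : 0 < w * e1 by exact: mulr_gt0.
  have := ler_wpM2l (ltW w0) e12; rewrite (_ : w * (pi / w / 4) = pi / 4); last by field; rewrite gt_eqF.
  by have := @pi_gt0 R => q1 q2; apply: sin_gt0_pi; rewrite k1/=; lra.
have [dl dl0 hd] := sphase_small sn.
exists dl => // be be0 bed.
have s1l : tau_lo <= pi / w - e1 by rewrite /tau_lo; lra.
have s2l : pi / w + e1 <= tau_hi by rewrite /tau_hi; lra.
have w1 : `|pi / w - e1| <= 3 * (pi / w) by rewrite ger0_norm; lra.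
have w2 : `|pi / w + e1| <= 3 * (pi / w) by rewrite ger0_norm; lra.
have k1 := hd be _ (ltW be0) bed w1; have k2 := hd be _ (ltW be0) bed w2.
have sn1 : sin (w * (pi / w - e1)) = sin (w * e1).
  by rewrite mulrBr wpi sinB sinpi cospi mul0r sub0r mulN1r opprK.
have sn2 : sin (w * (pi / w + e1)) = - sin (w * e1).
  by rewrite mulrDr wpi sinD sinpi cospi mul0r add0r mulN1r.
rewrite sn1 ler_norml in k1; rewrite sn2 ler_norml in k2.
move: k1 k2 => /andP[_ k1] /andP[k2 _].
have := tau_between be0 s1l (_ : _ <= _) s2l (_ : _ <= 0) (_ : 0 <= _).
move=> /(_ ltac:(lra) ltac:(lra) ltac:(lra))/andP[h1 h2].
by rewrite ler_norml; apply/andP; split; lra.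
Qed.

(** Half of the period, also at the parameter 0. *)
Definition halfper al := pi / freq al.
Lemma halfper_tau al : 0 < al -> halfper al = tau al.
Proof. by move=> al0; rewrite /halfper /freq al0 invf_div mulrCA divff ?mulr1// gt_eqF// pi_gt0. Qed.
Lemma halfper_0 al : al <= 0 -> halfper al = pi / w.
Proof. by move=> al0; rewrite /halfper /freq ltNge al0. Qed.

Lemma halfper_cont al ep : 0 < ep -> exists2 dl : R, 0 < dl & forall be, `|be - al| < dl -> `|halfper be - halfper al| <= ep.
Proof.
move=> ep0; case: (ltrgt0P al) => al0.
- have [dl dl0 hd] := tau_cont al0 ep0; exists dl => // be hb.
  by have [be0 h] := hd be hb; rewrite !halfper_tau.
- exists (- al); first by rewrite oppr_gt0.
  move=> be; rewrite ltr_norml => /andP[_ h]; rewrite !halfper_0 ?subrr ?normr0 ?(ltW ep0)//; [exact: ltW|lra].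
- have [dl dl0 hd] := tau_lim0 ep0; exists dl => // be; rewrite al0 subr0 => hb.
  rewrite (halfper_0 (lexx 0)); case: (leP be 0) => be0; first by rewrite halfper_0// subrr normr0 ltW.
  by rewrite halfper_tau//; apply: hd => //; rewrite -(gtr0_norm be0).
Qed.

Lemma halfper_gt0 al : 0 < halfper al.
Proof. by rewrite divr_gt0 ?pi_gt0// freq_gt0. Qed.

Lemma halfper_bd al : halfper al <= 2 * (pi / w).
Proof.
case: (leP al 0) => h; first by rewrite halfper_0//; have := p0; lra.
by rewrite halfper_tau//; have /andP[_ k] := tau_win al; apply: (le_trans k); exact: tlr.2.2.
Qed.

Lemma freq_cont : continuous freq.
Proof.
have hc : continuous halfper.
  move=> al; apply/cvgrPdist_le => ep ep0; have [dl dl0 hd] := halfper_cont al ep0.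
  near=> be; rewrite distrC; apply: hd; rewrite distrC; near: be; exact: cvgr_dist_lt.
have E : freq = (fun al => pi / halfper al).
  by apply/funext => al; rewrite /halfper invf_div mulrCA divff ?mulr1// gt_eqF// pi_gt0.
rewrite E => al; apply: cvgMr; apply: cvgV; [by rewrite gt_eqF// halfper_gt0|exact: hc].
Unshelve. all: by end_near. Qed.

Lemma freq_0 : freq 0 = w. Proof. by rewrite /freq ltxx. Qed.

(** In this form both dependences on the parameter are continuous on the window. *)
Lemma profileE al y : profile al y = esol al (y / pi * halfper al).
Proof.
rewrite /profile /halfper; congr (esol al _); have := freq_gt0 al; have := @pi_gt0 R.
by move: (pi : R) (freq al) => p o pp oo; field; rewrite !gt_eqF.
Qed.

Lemma esol_unif al ep : 0 < ep -> exists2 dl : R, 0 < dl & forall h : R, `|h| < dl -> forall (x : R) i, `|x| <= window ->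
  `|esol al (h + x) i 0 - esol al x i 0| <= ep.
Proof.
move=> ep0.
pose mu (h : R) := ampl * (`|rowdot l (esol al) h - rowdot l (esol al) 0| + `|sphase al h - sphase al 0|).
have cmu : continuous mu.
  have h1 : contf (rowdot l (esol al)) := (rowdot_sgrowth l (esol_solves al).1).1.
  have h2 : contf (sphase al) := @sphase_cont al.
  by rewrite /mu; cont.
have : mu h @[h --> (0:R)] --> mu 0 by exact: cmu.
rewrite {2}/mu !subrr normr0 addr0 mulr0 => /cvgr0Pnorm_le/(_ _ ep0)/nbhs_ballP[dl dl0 hd].
exists dl => // h hh x i hx.
have := solution_diff_bd i (solves_shift h (esol_solves al)) (esol_solves al) hx.
rewrite -/(shiftf h (esol al)) cos_coord_shiftf => k; apply: (le_trans k).
have := hd h; rewrite -ball_normE /= sub0r normrN => /(_ hh); apply: le_trans.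
apply: le_trans (ler_norm _).
rewrite /mu /sphase le_eqVlt; apply/orP; left; apply/eqP; congr (ampl * (`|_ - _| + `|_ - _|)).
by congr (sin_coord _); apply/funext => y; rewrite /shiftf add0r.
Qed.

Lemma profile_cont al ep : 0 <= al -> 0 < ep -> exists2 dl : R, 0 < dl & forall be, 0 <= be -> `|be - al| < dl ->
  forall y i, `|profile be y i 0 - profile al y i 0| <= ep.
Proof.
move=> al0 ep0; have e2 : 0 < ep / 2 by lra.
have [dh dh0 hU] := esol_unif al e2.
have dh2 : 0 < dh / 2 by lra.
have [dt dt0 hh] := halfper_cont al dh2.
have B1 : 0 < ampl + 1 by have := ampl_ge0; lra.
exists (Num.min dt (ep / 2 / (ampl + 1))); first by rewrite lt_min dt0 divr_gt0.
move=> be be0; rewrite lt_min => /andP[b1 b2] y i.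
have [k hk] := mod_period y (@pi_gt0 R).
have P1 := periodZ (fun x => profile_period x al0) k y; have P2 := periodZ (fun x => profile_period x be0) k y.
rewrite -P1 -P2; move: (y + _) hk => z hz.
rewrite !profileE.
have zpi : `|z / pi| <= 1.
  by rewrite normrM normfV (gtr0_norm (pi_gt0 R)) ler_pdivrMr ?pi_gt0// mul1r.
have xb c : `|z / pi * halfper c| <= window.
  rewrite normrM (gtr0_norm (halfper_gt0 c)); apply: (@le_trans _ _ (1 * halfper c)).
    by apply: ler_wpM2r => //; exact: ltW (halfper_gt0 c).
  by rewrite mul1r /window; have := halfper_bd c; have := p0; lra.
have t1 : `|esol be (z / pi * halfper be) i 0 - esol al (z / pi * halfper be) i 0| <= ep / 2.
  apply: (le_trans (esol_diff be al i (xb be))).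
  move: b2; rewrite ltr_pdivlMr// => h; have := normr_ge0 (be - al); lra.
have t2 : `|esol al (z / pi * halfper be) i 0 - esol al (z / pi * halfper al) i 0| <= ep / 2.
  have -> : z / pi * halfper be = z / pi * (halfper be - halfper al) + z / pi * halfper al by ring.
  apply: hU; last exact: xb.
  rewrite normrM; apply: (@le_lt_trans _ _ (1 * `|halfper be - halfper al|)); first exact: ler_wpM2r.
  by rewrite mul1r; have := hh be b1; lra.
rewrite (splitr ep); apply: le_trans (lerD t1 t2).
have -> : esol be (z / pi * halfper be) i 0 - esol al (z / pi * halfper al) i 0 =
  (esol be (z / pi * halfper be) i 0 - esol al (z / pi * halfper be) i 0) + (esol al (z / pi * halfper be) i 0 - esol al (z / pi * halfper al) i 0) by ring.
exact: ler_normD.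
Qed.

(** The function [t |-> c sin(w t) - s cos(w t)] has a zero [t0] in one period at which the rotated
    first coordinate is positive; near [t0] the true second coordinate changes sign.  At its zero
    the translate has coordinates [(alpha, 0)] with [alpha > 0], as the even solution does, and
    the two agree by uniqueness. *)
Lemma every_solution_in_family u : solves u -> exists al t, [/\ 0 <= al, u = (fun x => esol al (x + t)) & al = rowdot l u (- t)].
Proof.
move=> su; have pp := p0.
have [q0|qn] := pselect (cos_coord u = 0 /\ sin_coord u = 0).
  exists 0, 0; have E : u = (fun _ => 0).
    apply: (solves_unique su sol0); [rewrite q0.1|rewrite q0.2]; first by rewrite /cos_coord /rowdot mulmx0 mxE.
    by rewrite /sin_coord /rowdot !mulmx0 !mxE subrr mul0r.
  split => //; first by rewrite esol_0.
  by rewrite E /rowdot mulmx0 mxE.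
set q1 := cos_coord u in qn; set q2 := sin_coord u in qn.
have [t0 [ht0 ht0' ct0]] : exists t0, [/\ 0 <= t0 <= 2 * (pi / w), q2 * cos (w * t0) = q1 * sin (w * t0) &
   0 < q1 * cos (w * t0) + q2 * sin (w * t0)].
  pose f t := q2 * cos (w * t) - q1 * sin (w * t).
  have cf : continuous f by rewrite /f; cont.
  have fpi : f (pi / w) = - f 0 by rewrite /f wpi mulr0 cospi sinpi cos0 sin0; ring.
  have [z /andP[z1 z2] fz] : exists2 z, 0 <= z <= pi / w & f z = 0.
    case: (leP (f 0) 0) => h.
      by apply: IVT_inc => //; [exact: ltW|rewrite fpi; lra].
    have cf' : continuous (fun t => - f t) by cont.
    have g1 : - f 0 <= 0 by lra.
    have g2 : 0 <= - f (pi / w) by rewrite fpi; lra.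
    have [z hz fz] := IVT_inc (ltW pp) cf' g1 g2.
    by exists z => //; apply/eqP; rewrite -oppr_eq0 fz.
  have e1 : q2 * cos (w * z) = q1 * sin (w * z) by apply/eqP; rewrite -subr_eq0; apply/eqP.
  have cs := cos2Dsin2 (w * z).
  pose c := q1 * cos (w * z) + q2 * sin (w * z).
  have c1 : q1 = c * cos (w * z).
    transitivity (q1 * (cos (w * z) ^+ 2 + sin (w * z) ^+ 2)); first by rewrite cs mulr1.
    have -> : q1 * (cos (w * z) ^+ 2 + sin (w * z) ^+ 2) = q1 * cos (w * z) ^+ 2 + (q1 * sin (w * z)) * sin (w * z) by ring.
    by rewrite -e1 /c; ring.
  have c2 : q2 = c * sin (w * z).
    transitivity (q2 * (cos (w * z) ^+ 2 + sin (w * z) ^+ 2)); first by rewrite cs mulr1.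
    have -> : q2 * (cos (w * z) ^+ 2 + sin (w * z) ^+ 2) = (q2 * cos (w * z)) * cos (w * z) + q2 * sin (w * z) ^+ 2 by ring.
    by rewrite e1 /c; ring.
  have cn : c != 0 by apply/eqP => c0; apply: qn; rewrite c1 c2 c0 !mul0r.
  case: (ltrgt0P c) cn => // c0 _.
    by exists z; split => //; rewrite z1/=; lra.
  have cz : cos (w * (z + pi / w)) = - cos (w * z).
    by rewrite mulrDr wpi cosD cospi sinpi; ring.
  have sz : sin (w * (z + pi / w)) = - sin (w * z).
    by rewrite mulrDr wpi sinD cospi sinpi; ring.
  exists (z + pi / w); split; first (by apply/andP; split; lra).
    by rewrite cz sz; lra.
  by rewrite cz sz; move: c0; rewrite /c; lra.
move: ht0 => /andP[t00 t02].
set c := q1 * cos (w * t0) + q2 * sin (w * t0) in ct0.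
have cs := cos2Dsin2 (w * t0).
have c1 : q1 = c * cos (w * t0).
  transitivity (q1 * (cos (w * t0) ^+ 2 + sin (w * t0) ^+ 2)); first by rewrite cs mulr1.
  have -> : q1 * (cos (w * t0) ^+ 2 + sin (w * t0) ^+ 2) = q1 * cos (w * t0) ^+ 2 + (q1 * sin (w * t0)) * sin (w * t0) by ring.
  by rewrite -ht0' /c; ring.
have c2 : q2 = c * sin (w * t0).
  transitivity (q2 * (cos (w * t0) ^+ 2 + sin (w * t0) ^+ 2)); first by rewrite cs mulr1.
  have -> : q2 * (cos (w * t0) ^+ 2 + sin (w * t0) ^+ 2) = (q2 * cos (w * t0)) * cos (w * t0) + q2 * sin (w * t0) ^+ 2 by ring.
  by rewrite ht0' /c; ring.
clearbody c.
have qc : `|q1| + `|q2| <= 2 * c.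
  rewrite c1 c2 !normrM (gtr0_norm ct0).
  have := ler_wpM2l (ltW ct0) (cos_max (w * t0)); have := ler_wpM2l (ltW ct0) (sin_max (w * t0)); lra.
(* A quarter of [pi / w] on each side the sine has size [1 / sqrt 2], above the error [1/4]. *)
pose s1 := t0 - pi / w / 4; pose s2 := t0 + pi / w / 4.
have sq := sin_quarter.
have w4 : w * (pi / w / 4) = pi / 4 by field; rewrite gt_eqF.
have Q2E t : q2 * cos (w * t) - q1 * sin (w * t) = c * sin (w * (t0 - t)).
  by rewrite c1 c2 mulrBr sinB; ring.
have wbound t : `|t| <= 3 * (pi / w) -> `|sin_coord (shiftf t u) - c * sin (w * (t0 - t))| <= c / 4.
  by move=> ht; have := sin_coord_shift_bd8 su ht; rewrite -/q1 -/q2 Q2E => h; apply: (le_trans h); lra.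
have b1 : `|s1| <= 3 * (pi / w) by rewrite ler_norml /s1; apply/andP; split; lra.
have b2 : `|s2| <= 3 * (pi / w) by rewrite ler_norml /s2; apply/andP; split; lra.
have k1 := wbound s1 b1; have k2 := wbound s2 b2.
have e1 : t0 - s1 = pi / w / 4 by rewrite /s1; ring.
have e2 : t0 - s2 = - (pi / w / 4) by rewrite /s2; ring.
rewrite e1 w4 ler_norml in k1; rewrite e2 mulrN w4 sinN ler_norml in k2.
move: k1 k2 => /andP[k1 _] /andP[_ k2].
have cq := ler_wpM2l (ltW ct0) sq.
have cQ : continuous (fun t => - sin_coord (shiftf t u)).
  by have h : contf (fun t => sin_coord (shiftf t u)) := cont_sin_coord_shift su; apply: cont_neg.
have s12 : s1 <= s2 by rewrite /s1 /s2; lra.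
have [t /andP[t1 t2] zt] := IVT_inc s12 cQ (ltac:(lra) : - sin_coord (shiftf s1 u) <= 0) (ltac:(lra) : 0 <= - sin_coord (shiftf s2 u)).
have zt' : sin_coord (shiftf t u) = 0 by apply/eqP; rewrite -oppr_eq0 zt.
have ht : `|t| <= window by rewrite /window ler_norml; move: t1 t2; rewrite /s1 /s2 => t1 t2; apply/andP; split; lra.
have lvp : 0 < rowdot l u t.
  have := rowdot_tracks8 su ht; rewrite -/q1 -/q2.
  have -> : q1 * cos (w * t) + q2 * sin (w * t) = c * cos (w * (t - t0)).
    by rewrite c1 c2 mulrBr cosB; ring.
  rewrite ler_norml => /andP[h _].
  have cosb : 1 / 2 <= cos (w * (t - t0)).
    have h1 := ler_wpM2l (ltW w0) (_ : t - t0 <= pi / w / 4); have h2 := ler_wpM2l (ltW w0) (_ : - (pi / w / 4) <= t - t0).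
    have {}h1 : w * (t - t0) <= pi / 4 by rewrite -w4; apply: h1; move: t2; rewrite /s2; lra.
    have {}h2 : - (pi / 4) <= w * (t - t0) by rewrite -w4 -mulrN; apply: h2; move: t1; rewrite /s1; lra.
    exact: cos_quarter.
  have := ler_wpM2l (ltW ct0) cosb; lra.
exists (rowdot l u t), (- t); split; [exact: ltW| |by rewrite opprK].
have E : shiftf t u = esol (rowdot l u t).
  apply: (solves_unique (solves_shift t su) (esol_solves _)); first by rewrite esol_cos_coord -/(shiftf t u) cos_coord_shiftf.
  by rewrite esol_sin_coord.
by apply/funext => x; rewrite -E /shiftf addrC subrK.
Qed.

(** The interface to the original equation: [W al] is the profile normalised to period [2 pi] and
    [omg al] its wave number. *)
Theorem periodic_family : exists (omg : R -> R) (W : R -> R -> 'cV[R]_n),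
  [/\ continuous omg, omg 0 = w, forall al, 0 < omg al & forall y, W 0 y = 0] /\
  [/\ forall al t, solves (fun x => W al (omg al * (x + t))),
      forall al y, 0 <= al -> W al (y + 2 * pi) = W al y,
      forall al y i, 0 <= al -> `|W al y i 0| <= ampl * al,
      forall al ep, 0 <= al -> 0 < ep -> exists2 dl : R, 0 < dl &
        forall be, 0 <= be -> `|be - al| < dl -> forall y i, `|W be y i 0 - W al y i 0| <= ep
    & forall u, solves u -> exists al t,
        [/\ 0 <= al, u = (fun x => W al (omg al * (x + t))) & al = rowdot l u (- t)]].
Proof.
have ucU al x : profile al (freq al * x) = esol al x.
  by rewrite /profile mulrAC mulfV ?mul1r// gt_eqF// freq_gt0.
exists freq, profile; split.
  by split; [exact: freq_cont|exact: freq_0|exact: freq_gt0|move=> y; rewrite /profile esol_0].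
split.
- move=> al t; have -> : (fun x => profile al (freq al * (x + t))) = shiftf t (esol al).
    by apply/funext => x; rewrite ucU /shiftf addrC.
  exact: solves_shift (esol_solves al).
- by move=> al y; exact: profile_period.
- by move=> al y i; exact: esol_bd_all.
- by move=> al ep; exact: profile_cont.
- move=> u /every_solution_in_family[al [t [al0 ut alE]]]; exists al, t; split=> //.
  by rewrite ut; apply/funext => x; rewrite ucU.
Qed.
End Soft.

(** * Cutting off the nonlinearity *)

Lemma mx_coord_le (R : realType) m n (M : 'M[R]_(m, n)) i j : `|M i j| <= `|M|.
Proof.
by rewrite [leRHS]mx_normrE; apply: (le_bigmax _ (fun ij : 'I_m * 'I_n => `|M ij.1 ij.2|) (i, j)).
Qed.

Lemma mx_norm_le (R : realType) m n (M : 'M[R]_(m, n)) (c : R) :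
  0 <= c -> (forall i j, `|M i j| <= c) -> `|M| <= c.
Proof.
by move=> c0 h; rewrite [leLHS]mx_normrE; apply/bigmax_leP; split => // -[i j] _ /=; exact: h.
Qed.

Lemma diff_coord_le (R : realType) n (f : 'cV[R]_n -> 'cV[R]_n) z (v : 'cV[R]_n) (c : R) i :
  (forall j, `|jac f z i j| <= c) -> `|('d f z v) i 0| <= c * n%:R * l2 v.
Proof.
move=> hc.
have -> : ('d f z v) i 0 = \sum_j v j 0 * jac f z i j.
  rewrite {1}[v]matrix_sum_delta linear_sum summxE.
  by apply: eq_bigr => j _; rewrite big_ord1 linearZ /= !mxE.
apply: (le_trans (ler_norm_sum _ _ _)).
apply: (@le_trans _ _ (\sum_(j < n) l2 v * c)).
  apply: ler_sum => j _; rewrite normrM; apply: ler_pM => //; exact: l2_coord.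
by rewrite sumr_const card_ord -mulr_natl; lra.
Qed.

(** The mean value theorem on the segment, applied to one coordinate. *)
Lemma MVT_coord (R : realType) n (f : 'cV[R]_n -> 'cV[R]_n) (x y : 'cV[R]_n) i (c : R) :
  (forall t : R, 0 <= t <= 1 -> differentiable f (y + t *: (x - y))) ->
  (forall t : R, 0 <= t <= 1 -> `|('d f (y + t *: (x - y)) (x - y)) i 0| <= c) ->
  `|f x i 0 - f y i 0| <= c.
Proof.
move=> hd hc; pose g (t : R) := f (y + t *: (x - y)) i 0.
have gd (t : R) : 0 <= t <= 1 -> is_derive t (1 : R) g (('d f (y + t *: (x - y)) (x - y)) i 0).
  move=> ht.
  have [dv De] : derivable f (y + t *: (x - y)) (x - y) /\
      'D_(x - y) f (y + t *: (x - y)) = 'd f (y + t *: (x - y)) (x - y).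
    by split; [exact: diff_derivable (hd _ ht)|exact: deriveE (hd _ ht)].
  have lim : h^-1 *: (g (h + t) - g t) @[h --> (0 : R)^'] -->
      ('d f (y + t *: (x - y)) (x - y)) i 0.
    rewrite -De.
    have co : {for 'D_(x - y) f (y + t *: (x - y)), continuous (fun N : 'cV[R]_n => N i 0)}.
      exact: differentiable_continuous (differentiable_coord _ _ _).
    apply: cvg_trans (continuous_cvg _ co dv).
    apply: near_eq_cvg; near=> h.
    rewrite /g /= !mxE /=; congr (_ * (f _ i 0 - _)).
    by apply/matrixP => p q; rewrite !mxE; ring.
  split.
    apply: cvgP; apply: cvg_trans lim; apply: near_eq_cvg; near=> h.
    by rewrite /= [_ *: 1]mulr1.
  apply: cvg_lim => //; apply: cvg_trans lim; apply: near_eq_cvg; near=> h.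
  by rewrite /= [_ *: 1]mulr1.
have [||t] := @MVT_segment R g (fun t => ('d f (y + t *: (x - y)) (x - y)) i 0) 0 1 ler01.
- by move=> t; rewrite in_itv/= => /andP[t0 t1]; apply: gd; rewrite !ltW.
- apply: derivable_within_continuous => t; rewrite in_itv/= => ht.
  by have [] := gd t ht.
rewrite in_itv/= => ht.
have -> : g 1 = f x i 0 by rewrite /g scale1r addrC subrK.
have -> : g 0 = f y i 0 by rewrite /g scale0r addr0.
by rewrite subr0 mulr1 => ->; exact: hc.
Unshelve. all: by end_near.
Qed.

(** The differential is small near 0 since it is continuous and vanishes at 0. *)
Lemma C1_lip (R : realType) n (V : set 'cV[R]_n) (f : 'cV[R]_n -> 'cV[R]_n) :
  open V -> V 0 -> C1_on V f -> jac f 0 = 0 -> forall ep : R, 0 < ep ->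
  exists2 r : R, 0 < r & (forall x : 'cV[R]_n, (forall i, `|x i 0| <= r) -> V x) /\
    forall x y : 'cV[R]_n, (forall i, `|x i 0| <= r) -> (forall i, `|y i 0| <= r) ->
    forall i, `|f x i 0 - f y i 0| <= ep * l2 (x - y).
Proof.
move=> hV V0 hf hj ep ep0.
have [_ cj] := hf 0 V0.
have n0 : 0 < n%:R + 1 :> R by rewrite ltr_wpDl.
have ep1 : 0 < ep / (n%:R + 1) by rewrite divr_gt0.
have nV : \forall x \near (0 : 'cV[R]_n), V x by move: hV; rewrite openE; apply.
have /nbhs_ballP[r0 r00 hr] : \forall x \near (0 : 'cV[R]_n),
    V x /\ `|jac f 0 - jac f x| <= ep / (n%:R + 1).
  by near=> x; split; near: x; [exact: nV|exact: cvgr_dist_le cj _ ep1].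
have box (x : 'cV[R]_n) : (forall i, `|x i 0| <= r0 / 2) ->
    V x /\ `|jac f 0 - jac f x| <= ep / (n%:R + 1).
  move=> hx; apply: hr; rewrite -ball_normE /= sub0r normrN.
  apply: (@le_lt_trans _ _ (r0 / 2)); last by rewrite ltr_pdivrMr // ltr_pMr// ltr1n.
  by apply: mx_norm_le => [|i j]; [rewrite divr_ge0// ltW|rewrite ord1].
exists (r0 / 2); first by rewrite divr_gt0.
split=> [x /box[]//|x y hx hy i].
have hz (t : R) : 0 <= t <= 1 -> forall i, `|(y + t *: (x - y)) i 0| <= r0 / 2.
  move=> /andP[t0 t1] k; rewrite !mxE.
  have -> : y k 0 + t * (x k 0 - y k 0) = t * x k 0 + (1 - t) * y k 0 by ring.
  have t1' : 0 <= 1 - t by rewrite subr_ge0.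
  apply: (le_trans (ler_normD _ _)); rewrite !normrM (ger0_norm t0) (ger0_norm t1').
  have := ler_wpM2l t0 (hx k); have := ler_wpM2l t1' (hy k); lra.
apply: MVT_coord => t ht.
  by have [/hf[]] := box _ (hz t ht).
have [_ hJ] := box _ (hz t ht); rewrite hj sub0r normrN in hJ.
have := @diff_coord_le _ _ f (y + t *: (x - y)) (x - y) _ i (fun j => le_trans (mx_coord_le _ _ _) hJ).
move=> h; apply: (le_trans h); apply: ler_wpM2r; first exact: l2_ge0.
by rewrite mulrAC ler_pdivrMr// ler_pM2l// lerDl.
Unshelve. all: by end_near.
Qed.

Definition clamp (R : realType) (r t : R) : R := Num.max (- r) (Num.min r t).

Definition clampv (R : realType) n (r : R) (x : 'cV[R]_n) : 'cV[R]_n :=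
  \col_i clamp r (x i 0).

Lemma clamp_bd (R : realType) (r t : R) : 0 <= r -> `|clamp r t| <= r.
Proof.
move=> r0; rewrite ler_norml /clamp le_max lexx ge_max ge_min lexx /=.
by rewrite (le_trans _ r0) // oppr_le0.
Qed.

Lemma clamp_id (R : realType) (r t : R) : `|t| <= r -> clamp r t = t.
Proof.
by rewrite ler_norml => /andP[h1 h2]; rewrite /clamp (min_idPr h2) (max_idPr h1).
Qed.

Lemma clamp_lip (R : realType) (r s t : R) : `|clamp r s - clamp r t| <= `|s - t|.
Proof.
have mx (c a b : R) : `|Num.max c a - Num.max c b| <= `|a - b|.
  rewrite /Num.max; case: (ltP c a) => h1; case: (ltP c b) => h2; rewrite ler_norml;
  by case: (ger0P (a - b)) => h; apply/andP; split; lra.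
have mn (c a b : R) : `|Num.min c a - Num.min c b| <= `|a - b|.
  rewrite /Num.min; case: (ltP c a) => h1; case: (ltP c b) => h2; rewrite ler_norml;
  by case: (ger0P (a - b)) => h; apply/andP; split; lra.
exact: le_trans (mx _ _ _) (mn _ _ _).
Qed.

Lemma sqnorm_mono (R : realType) n (x y : 'cV[R]_n) : (forall i, `|x i 0| <= `|y i 0|) -> l2 x <= l2 y.
Proof.
move=> h; rewrite /l2; apply: ler_wsqrtr; apply: ler_sum => i _.
by rewrite -(real_normK (num_real (x i 0))) -(real_normK (num_real (y i 0))) ler_pXn2r// ?nnegrE.
Qed.

Lemma clampv_lip (R : realType) n (r : R) (x y : 'cV[R]_n) :
  l2 (clampv r x - clampv r y) <= l2 (x - y).
Proof. by apply: sqnorm_mono => i; rewrite !mxE; apply: clamp_lip. Qed.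

Lemma clampv_id (R : realType) n (r : R) (x : 'cV[R]_n) :
  (forall i, `|x i 0| <= r) -> clampv r x = x.
Proof.
by move=> h; apply/matrixP => i j; rewrite ord1 mxE clamp_id.
Qed.

(** Compose [f] with the projection onto a box, which is 1-Lipschitz; the box is convex, so that the
    mean value theorem applies in it. *)
Lemma cutoff (R : realType) n (V : set 'cV[R]_n) (f : 'cV[R]_n -> 'cV[R]_n) (d : R) :
  open V -> V 0 -> C1_on V f -> f 0 = 0 -> jac f 0 = 0 -> 0 < d ->
  exists (r : R) (F : 'cV[R]_n -> 'cV[R]_n),
  [/\ 0 < r, forall x : 'cV[R]_n, (forall i, `|x i 0| <= r) -> V x /\ F x = f x,
      lipF d F, F 0 = 0
    & forall d1 : R, 0 < d1 -> exists2 rho : R, 0 < rho & forall x : 'cV[R]_n,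
      (forall i, `|x i 0| <= rho) -> forall i, `|F x i 0| <= d1 * l2 x].
Proof.
move=> hV V0 hf f0 j0 d0; have C := C1_lip hV V0 hf j0.
have [r r0 [hrV hr]] := C d d0.
have FE (x : 'cV[R]_n) : (forall i, `|x i 0| <= r) -> f (clampv r x) = f x.
  by move=> h; rewrite clampv_id.
have z0 (rho : R) : 0 < rho -> forall i, `|(0 : 'cV[R]_n) i 0| <= rho.
  by move=> h i; rewrite mxE normr0 ltW.
have F0 : f (clampv r 0) = 0 by rewrite FE //; exact: z0.
exists r, (fun x => f (clampv r x)); split=> //.
- by move=> x hx; split; [exact: hrV|exact: FE].
- move=> x y i.
  have b (z : 'cV[R]_n) j : `|clampv r z j 0| <= r by rewrite mxE clamp_bd // ltW.
  apply: (le_trans (hr _ _ (b x) (b y) i)); apply: ler_wpM2l; first exact: ltW.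
  exact: clampv_lip.
- move=> d1 /C[r1 r10 [_ hr1]]; exists (Num.min r r1); first by rewrite lt_min r0.
  move=> x hx i.
  have hx1 j : `|x j 0| <= r by apply: le_trans (hx j) _; rewrite ge_min lexx.
  have hx2 j : `|x j 0| <= r1 by apply: le_trans (hx j) _; rewrite ge_min lexx orbT.
  have := hr1 x 0 hx2 (z0 _ r10) i.
  by rewrite FE // f0 !mxE !subr0.
Qed.

(** * From the cut-off equation back to the original one *)

Lemma supnorm_ub (R : realType) n (u : R -> 'cV[R]_n) (c : R) :
  0 <= c -> (forall x i, `|u x i 0| <= c) -> supnorm u <= c.
Proof.
move=> c0 h; apply: ge_sup; first by exists `|u 0|, 0.
by move=> _ [x _ <-]; apply: mx_norm_le => // i j; rewrite ord1.
Qed.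

Lemma supnorm_ge0 (R : realType) n (u : R -> 'cV[R]_n) (c : R) :
  0 <= c -> (forall x i, `|u x i 0| <= c) -> 0 <= supnorm u.
Proof.
move=> c0 h; apply: (le_trans (normr_ge0 (u 0))); apply: ub_le_sup; last by exists 0.
by exists c => _ [y _ <-]; apply: mx_norm_le => // i j; rewrite ord1.
Qed.

Lemma C0_bounded (R : realType) n (u : R -> 'cV[R]_n) : C0 u ->
  exists2 M : R, 0 <= M & forall x, `|u x| <= M.
Proof.
move=> [_ [M [Mr hM]]]; exists (`|M| + 1); first by rewrite addr_ge0.
move=> x; apply: hM => //; rewrite (le_lt_trans (ler_norm M))// ltrDl//.
Qed.

Lemma supnorm_le (R : realType) n (u : R -> 'cV[R]_n) x i : C0 u -> `|u x i 0| <= supnorm u.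
Proof.
move=> /C0_bounded[M _ hM]; apply: (le_trans (mx_coord_le _ _ _)).
apply: ub_le_sup; last by exists x.
by exists M => _ [y _ <-].
Qed.

Lemma cont_coords (R : realType) n (u : R -> 'cV[R]_n) :
  (forall i, contf (fun x => u x i 0)) -> continuous u.
Proof.
move=> h x; apply/cvgrPdist_le => ep ep0.
have hf : \forall y \near (x : R), forall i : 'I_n, `|u x i 0 - u y i 0| <= ep.
  apply: (@filter_forall _ _ (fun (i : 'I_n) (y : R) => is_true (`|u x i 0 - u y i 0| <= ep))
    (nbhs (x : R)) (@nbhs_filter R x)) => i.
  have hi : (fun y : R => u y i 0) @ (x : R) --> u x i 0 := h i x.
  by move/cvgrPdist_le: hi => /(_ ep ep0).
near=> y; apply: mx_norm_le => [|i j]; first exact: ltW.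
rewrite ord1 !mxE; have hy : forall i : 'I_n, `|u x i 0 - u y i 0| <= ep by near: y.
exact: hy.
Unshelve. all: by end_near.
Qed.

Lemma coords_cont (R : realType) n (u : R -> 'cV[R]_n) i :
  continuous u -> contf (fun x => u x i 0).
Proof.
move=> h x.
have co : {for u x, continuous (fun N : 'cV[R]_n => N i 0)}.
  exact: differentiable_continuous (differentiable_coord _ _ _).
exact: continuous_cvg _ co (h x).
Qed.

Lemma C0_growth (R : realType) n (b : R) (u : R -> 'cV[R]_n) : 0 <= b -> C0 u -> growth b u.
Proof.
move=> b0 hu; have [cu _] := hu; split=> [i|]; first exact: coords_cont.
have [M M0 hM] := C0_bounded hu; exists M => x i.
apply: (le_trans (mx_coord_le _ _ _)); apply: (le_trans (hM x)).
by rewrite ler_peMr// -expR0 ler_expR mulr_ge0.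
Qed.

Lemma bd_C0 (R : realType) n (u : R -> 'cV[R]_n) (c : R) :
  (forall i, contf (fun x => u x i 0)) -> 0 <= c -> (forall x i, `|u x i 0| <= c) -> C0 u.
Proof.
move=> cu c0 h; split; first exact: cont_coords.
exists c; split; first exact: num_real.
by move=> M hM x _; apply: mx_norm_le => [|i j]; [|rewrite ord1; apply: le_trans (h x i) _];
  rewrite ?(le_trans c0) // ltW.
Qed.

Section Bridge.
Variables (R : realType) (n : nat) (k : R -> 'M[R]_n) (A : 'M[R]_n) (eta : R).
Hypothesis hk : forall i j, itg (fun x => k x i j * expR (eta * `|x|)).
Hypothesis ek : {ae @lebesgue_measure R, forall x, k (- x) = k x}.

(** Reflection of the integration variable, and replacement of [k] by its even representative
    under the integral. *)
Lemma conv_convol (b : R) (v : R -> 'cV[R]_n) x : growth b v -> `|b| <= eta ->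
  Defs.conv k v x = convol (evenk k) v x.
Proof.
move=> hv be; have kk := evenk_ekernel hk ek.
apply/matrixP => i j'; rewrite ord1 => {j'}.
rewrite (convolE kk _ _ hv be) /Defs.conv mxE -IntE.
pose g j (y : R) := k y i j * v (x - y) j 0.
have gm j : measurable_fun setT (g j).
  apply: measM; first exact: k_meas hk i j.
  exact: (meas_shiftr x (cont_meas (hv.1 j))).
have gae j : {ae @lebesgue_measure R, forall y, evenk k y i j * v (x - y) j 0 = g j y}.
  by apply: (@filterS _ _ (ae_filter_ringOfSetsType _)) (evenk_ae ek i j) => y; rewrite /g => ->.
have gi j : itg (g j) := ae_itg (gm j) (convol_itg kk x i j hv be) (gae j).
have -> : \sum_j Int (fun y => evenk k y i j * v (x - y) j 0) = \sum_j Int (g j).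
  by apply: eq_bigr => j _; apply: ae_Int (gae j) => //; exact: itg_meas (convol_itg kk x i j hv be).
rewrite -Int_sum; last by move=> j; exact: gi.
rewrite -[RHS](Int_refl x); last by apply: itg_sum => j; exact: gi.
apply: eq_Int => y; rewrite mxE; apply: eq_bigr => j _.
by rewrite /g (_ : x - (x - y) = y) //; ring.
Qed.

Lemma convol_evenkA (u : R -> 'cV[R]_n) x : convol (evenkA k A) u x = convol (evenk k) (fun y => A *m u y) x.
Proof.
by apply/matrixP => i j; rewrite !mxE; apply: eq_Int => y; rewrite /evenkA mulmxA.
Qed.

Lemma growth_mul (b : R) (u : R -> 'cV[R]_n) : growth b u -> growth b (fun x => A *m u x).
Proof.
move=> hu; split=> [i|].
  apply: (contf_eq (f := fun x => \sum_j A i j * u x j 0)); first by move=> x; rewrite mxE.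
  by apply: cont_sum => j; have cj := hu.1 j; cont.
have [C C0' hC] := growth_bd hu.
exists (\sum_i \sum_j `|A i j| * C) => x i; rewrite mxE.
apply: (le_trans (ler_norm_sum _ _ _)).
apply: (@le_trans _ _ (\sum_j `|A i j| * (C * expR (b * `|x|)))).
  by apply: ler_sum => j _; rewrite normrM ler_wpM2l //; exact: hC.
rewrite [X in _ <= X * _](bigD1 i) //= mulrDl.
apply: (@le_trans _ _ ((\sum_j `|A i j| * C) * expR (b * `|x|))).
  by rewrite [leRHS]big_distrl /=; apply: ler_sum => j _; rewrite mulrA.
rewrite lerDl mulr_ge0 ?expR_ge0//; apply: sumr_ge0 => p _; apply: sumr_ge0 => j _.
by rewrite mulr_ge0.
Qed.

Variables (V : set 'cV[R]_n) (f F : 'cV[R]_n -> 'cV[R]_n) (r d : R).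
Hypothesis hF : lipF d F.
Hypothesis d0 : 0 <= d.
Hypothesis F0 : F 0 = 0.
Hypothesis Ff : forall x : 'cV[R]_n, (forall i, `|x i 0| <= r) -> V x /\ F x = f x.

Lemma equation_convol (b : R) (u : R -> 'cV[R]_n) x : 0 <= b -> growth b u -> b <= eta ->
  (forall x i, `|u x i 0| <= r) ->
  - u x + Defs.conv k (fun y => A *m u y + superposition f u y) x =
  linop (evenkA k A) u x + convol (evenk k) (fun y => F (u y)) x.
Proof.
move=> b0 hu be ur; have kk := evenk_ekernel hk ek; rewrite -(ger0_norm b0) in be.
have -> : (fun y => A *m u y + superposition f u y) = (fun y => A *m u y + F (u y)).
  by apply/funext => y; rewrite /superposition (Ff (ur y)).2.
have gF : growth b (fun y => F (u y)) := lip_growth d0 hF F0 b0 hu.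
rewrite (conv_convol _ (growth_add (growth_mul hu) gF) be) (convol_add kk _ (growth_mul hu) gF be).
by rewrite /linop convol_evenkA addrA.
Qed.
End Bridge.

Lemma W11_itg (R : realType) n (k : R -> 'M[R]_n) (eta : R) : W11_eta eta k ->
  forall i j, itg (fun x => k x i j * expR (eta * `|x|)).
Proof.
move=> [_ [k' [_ _ h _]]] i j; have := h i j; rewrite -/(itg _) => hi.
apply: (eq_itg (f := fun x => (expR (eta * `|x|) *: k x) i j)); last by rewrite itgE.
by move=> x; rewrite mxE mulrC.
Qed.

Local Open Scope complex_scope.

(** A kernel vector [e] of the singular matrix [M(w)], and a coordinate form normalised by
    [l e = 1]. *)
Lemma spectral_data (R : realType) n (k : R -> 'M[R]_n) (A : 'M[R]_n) (eta w : R) :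
  0 < eta -> 0 < w -> (forall i j, itg (fun x => k x i j * expR (eta * `|x|))) ->
  {ae @lebesgue_measure R, forall x, k (- x) = k x} ->
  dchar k A (0 +i* w) = 0 -> derive1 (dchar k A) (0 +i* w) != 0 ->
  (forall x : R, `|x| != w -> dchar k A (0 +i* x) != 0) ->
  exists (e : 'cV[R]_n) (l : 'rV[R]_n), [/\ symbol (evenkA k A) w *m e = 0, l *m e = 1%:M
    & forall x, \det (symbol (regkernel w (evenkA k A) e l) x) != 0].
Proof.
move=> eta0 w0 hk ek hd0 hd1 hd2.
have dE := dcharE A eta0 hk ek.
have d0 : \det (symbol (evenkA k A) w) = 0.
  by move: hd0; rewrite dE => /eqP; rewrite fmorph_eq0 => /eqP.
have /det0P[v v0 vM] : \det (symbol (evenkA k A) w)^T == 0 by rewrite det_tr d0.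
have [i vi] : exists i, v 0 i != 0.
  apply/existsP; apply: contraNT v0; rewrite negb_exists => /forallP h.
  by apply/eqP/matrixP => p i; rewrite ord1 mxE; apply/eqP; move: (h i); rewrite negbK.
have Me : symbol (evenkA k A) w *m v^T = 0.
  by apply: trmx_inj; rewrite trmx_mul trmxK vM trmx0.
have le : ((v 0 i)^-1 *: delta_mx 0 i) *m v^T = 1%:M :> 'M[R]_1.
  apply/matrixP => p q; rewrite !ord1 -scalemxAl -rowE !mxE eqxx /=.
  by rewrite mulVf.
exists v^T, ((v 0 i)^-1 *: delta_mx 0 i); split=> //.
apply: (symbol_regkernel_inv eta0 w0 (evenkA_ekernel A hk ek) Me le).
  by move=> x /hd2; rewrite dE fmorph_eq0.
have := dchar_simple eta0 hk ek hd0 hd1.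
exact.
Qed.

Lemma rowdot_coord (R : realType) n (l : 'rV[R]_n) (u : R -> 'cV[R]_n) x (c : R) :
  (forall i, `|u x i 0| <= c) -> `|rowdot l u x| <= rownorm l * c.
Proof.
move=> h; rewrite /rowdot mxE /rownorm big_distrl /=; apply: (le_trans (ler_norm_sum _ _ _)).
by apply: ler_sum => j _; rewrite normrM ler_wpM2l.
Qed.

Theorem theorem8 (R : realType) (n : nat) (A : 'M[R]_n) (k : R -> 'M[R]_n)
  (eta0 : R) (V : set 'cV[R]_n) (f : 'cV[R]_n -> 'cV[R]_n) (omega_star : R)
  (hA : A \in unitmx)
  (heta0 : 0 < eta0)
  (hk : W11_eta eta0 k)
  (hk_even : {ae @lebesgue_measure R, forall x, k (- x) = k x})
  (hV : open V) (hV0 : V 0)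
  (hf : C1_on V f) (hf0 : f 0 = 0) (hf'0 : jac f 0 = 0)
  (homega_star : 0 < omega_star)
  (hd0 : dchar k A (0 +i* omega_star) = 0)
  (hd1 : derive1 (dchar k A) (0 +i* omega_star) != 0)
  (hd2 : forall w : R, `|w| != omega_star -> dchar k A (0 +i* w) != 0) :
  exists (delta : R) (omega : R -> R) (uc : R -> R -> 'cV[R]_n),
    0 < delta /\
    {within `[0, delta[, continuous omega} /\
    omega 0 = omega_star /\
    (forall a : R, a \in `[0, delta[ -> C0 (uc a)) /\
    C0_continuous_on `[0, delta[ uc /\
    (forall a : R, a \in `[0, delta[ -> periodic (uc a) (2 * pi)) /\
    (forall y, uc 0 y = 0) /\
    (forall a : R, a \in `[0, delta[ -> forall tau : R,
       solution V k A f (fun x => uc a (omega a * (x + tau))) /\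
       is_periodic (fun x => uc a (omega a * (x + tau)))) /\
    (exists2 eps : R, 0 < eps &
       forall u : R -> 'cV[R]_n,
         solution V k A f u -> supnorm u < eps ->
         is_periodic u /\
         exists a tau : R, (a \in `[0, delta[) /\
           u = (fun x => uc a (omega a * (x + tau)))).
Proof.
have {}hk := W11_itg hk.
have [e [l [hMe hle hdet]]] := spectral_data heta0 homega_star hk hk_even hd0 hd1 hd2.
have kke := evenk_ekernel hk hk_even; have kK := evenkA_ekernel A hk hk_even.
have [A1 A10 hT] := kernel_tracking heta0 homega_star kke kK hMe hle hdet.
have [a1 a10 hE] := even_solution_exists heta0 homega_star kke kK hMe hle hdet.
have [Aw [Aw0 AwA1 Aweta]] : exists Aw : R, [/\ 0 < Aw, Aw <= A1 & 2 * Aw <= eta0].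
  exists (Num.min A1 (eta0 / 2)); split.
  - by rewrite lt_min A10 divr_gt0.
  - by rewrite ge_min lexx.
  - by rewrite mulrC -ler_pdivlMr // ge_min lexx orbT.
have [d1 [C [d10 C0p hT']]] := hT Aw Aw0 AwA1.
have [a [a0 aa1 aAw]] : exists a : R, [/\ 0 < a, a <= a1 & a < Aw].
  exists (Num.min a1 (Aw / 2)); split.
  - by rewrite lt_min a10 divr_gt0.
  - by rewrite ge_min lexx.
  - by rewrite gt_min; apply/orP; right; rewrite ltr_pdivrMr // ltr_pMr // ltr1n.
have [dl dl0 hE'] := hE a a0 aa1.
have LCE : 0 <= rownorm l * C * window_wt omega_star Aw.
  by rewrite !mulr_ge0 ?expR_ge0 // sumr_ge0.
have [d [d0 dd1 ddl dsmall]] : exists d : R,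
    [/\ 0 < d, d <= d1, d <= dl & rownorm l * C * d * window_wt omega_star Aw <= 1 / 8].
  move: LCE; set M := rownorm l * C * _; move=> M0.
  have M1 : 0 < 8 * (M + 1) by rewrite mulr_gt0 // ltr_wpDl.
  pose d := Num.min (Num.min d1 dl) (8 * (M + 1))^-1.
  have d3 : d <= (8 * (M + 1))^-1 by rewrite ge_min lexx orbT.
  exists d; split.
  - by rewrite !lt_min d10 dl0 invr_gt0.
  - by rewrite !ge_min lexx.
  - by rewrite !ge_min lexx orbT.
  - have -> : rownorm l * C * d * window_wt omega_star Aw = M * d by rewrite /M; ring.
    apply: (le_trans (ler_wpM2l M0 d3)).
    by rewrite ler_pdivrMr // mulrA divfK // mul1r lerDl.
have [r [F [r0 Ff hF F0 Fsmall]]] := cutoff hV hV0 hf hf0 hf'0 d0.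
have {}hT v h d2 : 0 <= d2 -> d2 <= d -> subgrowth Aw v -> subgrowth Aw h ->
    (forall x i, `|h x i 0| <= d2 * l2 (v x)) ->
    (forall x, linop (evenkA k A) v x + convol (evenk k) h x = 0) ->
    forall x i, `|v x i 0 - kerfun omega_star e (cos_coord l v) (sin_coord omega_star l v) x i 0| <=
      C * d2 * (`|cos_coord l v| + `|sin_coord omega_star l v|) * expR (Aw * `|x|).
  by move=> d20 d2d; apply: hT' => //; exact: le_trans dd1.
have {}hE al : exists u, [/\ solves (evenk k) (evenkA k A) F a u, forall x, u (- x) = u x & rowdot l u 0 = al].
  have [u [h1 h2 h3 h4]] := hE' F d (ltW d0) ddl hF F0 al.
  by exists u; split.
have [om [W [[om_c om0 om_p W0] [W_sol W_per W_bd W_c W_cls]]]] :=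
  periodic_family heta0 homega_star kke kK hle a0 aAw Aweta (ltW d0) C0p hF F0
    (fun d2 v h => hT v h d2) hE dsmall Fsmall.
move: W_bd; have B0 : 0 <= ampl omega_star e Aw d C := ampl_ge0 _ _ _ (ltW d0) C0p.
move: (ampl _ _ _ _ _) B0 => ampl B0 W_bd.
have aeta : a <= eta0 by move: (aAw) (Aweta) (Aw0); lra.
have B1 : 0 < ampl + 1 by rewrite ltr_wpDl.
have delta0 : 0 < r / (ampl + 1) by rewrite divr_gt0.
(* Solutions of amplitude below [delta] stay in the box where [F] and [f] agree. *)
pose delta := r / (ampl + 1).
have Wr al y i : al \in `[0, delta[ -> `|W al y i 0| <= r.
  rewrite in_itv /= => /andP[al0 ald]; apply: (le_trans (W_bd _ _ _ al0)).
  have := ler_wpM2l B0 (ltW ald); move=> h; apply: (le_trans h).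
  by rewrite /delta mulrA ler_pdivrMr // mulrC ler_pM2l // lerDl.
have Wcont al i : contf (fun y => W al y i 0).
  have [[h _] _] := W_sol al 0.
  have omn : om al != 0 by rewrite gt_eqF.
  have E : (fun y => W al (om al * (y / om al + 0)) i 0) = (fun y => W al y i 0).
    by apply/funext => y; rewrite addr0 mulrC divfK.
  rewrite -E; have hi := h i.
  by apply: (cont_cmp hi); cont.
have WC0 al : al \in `[0, delta[ -> C0 (W al).
  by move=> al_; apply: (bd_C0 (Wcont al) (ltW r0)) => x i; exact: Wr.
have Wper al t : 0 <= al -> is_periodic (fun x => W al (om al * (x + t))).
  move=> al0; exists (2 * pi / om al); first by rewrite divr_gt0 // mulr_gt0 // pi_gt0.
  move=> x; rewrite -[RHS](W_per al _ al0); congr (W al _).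
  by rewrite !mulrDr [om al * (_ / _)]mulrC divfK ?gt_eqF //; ring.
exists delta, om, W; split=> //; split; first exact: continuous_subspaceT.
split=> //; split=> //; split; last split.
- move=> al al_; have al0 : 0 <= al by move: al_; rewrite /= in_itv => /andP[].
  apply/cvgrPdist_le => ep ep0; have [dl' dl'0 hdl] := W_c al ep al0 ep0.
  rewrite near_withinE; near=> b => b_.
  have b0 : 0 <= b by move: b_; rewrite /= in_itv => /andP[].
  have bal : `|b - al| < dl'.
    rewrite distrC; near: b.
    by apply/nbhs_ballP; exists dl' => // b; rewrite -ball_normE.
  have hb y i : `|(W b y - W al y) i 0| <= ep by rewrite !mxE; exact: hdl.
  by rewrite sub0r normrN ger0_norm ?(supnorm_ge0 (ltW ep0) hb) // (supnorm_ub (ltW ep0) hb).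
- by move=> al; rewrite in_itv => /andP[al0 _] y; exact: W_per.
split=> //; split.
  move=> al al_ t; split; last by apply: Wper; move: al_; rewrite in_itv => /andP[].
  have [gW eW] := W_sol al t.
  have ur x i : `|W al (om al * (x + t)) i 0| <= r by exact: Wr.
  split.
  - by apply: (bd_C0 gW.1 (ltW r0)).
  - by move=> x; exact: (Ff _ (ur x)).1.
  - move=> x; rewrite (equation_convol A hk hk_even hF (ltW d0) F0 Ff _ (ltW a0) gW aeta ur).
    by rewrite eW.
have L0 : 0 <= rownorm l by rewrite sumr_ge0.
have L1 : 0 < rownorm l + 1 by rewrite ltr_wpDl.
(* The amplitude of a solution is [l u(- t)], at most [rownorm l] times its norm. *)
exists (Num.min r (delta / (rownorm l + 1))); first by rewrite lt_min r0 divr_gt0.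
move=> u [uC uV uE]; rewrite lt_min => /andP[sr sd].
have gu := C0_growth (ltW a0) uC.
have ur x i : `|u x i 0| <= r by apply: (le_trans (supnorm_le x i uC)); exact: ltW.
have su : solves (evenk k) (evenkA k A) F a u.
  split=> // x.
  by rewrite -(equation_convol A hk hk_even hF (ltW d0) F0 Ff _ (ltW a0) gu aeta ur) -uE.
have [al [t [al0 ut alE]]] := W_cls u su.
split; first by rewrite ut; exact: Wper.
exists al, t; split=> //; rewrite in_itv /= al0 /=.
have := rowdot_coord l (fun i => supnorm_le (- t) i uC); rewrite -alE (ger0_norm al0) => h.
apply: (le_lt_trans h); apply: (@le_lt_trans _ _ ((rownorm l + 1) * supnorm u)).
  by rewrite ler_wpM2r ?(supnorm_ge0 (ltW r0) ur) // lerDl.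
by rewrite mulrC -ltr_pdivlMr.
Unshelve. all: by end_near.
Qed.
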